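(* Consider the two-sample setting and the subsampled statistic $T_{\rm S}$ described in the context, under the null hypothesis that $X^{(0)}$ and $X^{(1)}$ have the same distribution, with $n_1\to\infty$ and $n_1/n\to0$ ($n=n_0+n_1$). (1) If $\xi_{0,1}>0$ or $\xi_{1,0}>0$, and $\mathrm{E}\{h_{1,0}^4(X_1^{(0)})\}<\infty$, then $$n_1^{1/2}T_{\rm S}\xrightarrow{d}N\big(0,\;m_1^2\xi_{0,1}+m_0^2\xi_{1,0}/s\big).$$ (2) If $\xi_{1,0}=\xi_{0,1}=0$ but $\xi_{0,2}>0$, $\xi_{2,0}>0$, or $\xi_{1,1}>0$, then $n_1T_{\rm S}$ converges in distribution to a nondegenerate distribution with zero mean and variance $$\frac{m_1^2(m_1-1)^2\xi_{0,2}}{2}+\frac{m_1^2m_0^2\xi_{1,1}}{s}+\frac{m_0^2(m_0-1)^2\xi_{2,0}}{2s^2}.$$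
   Context: Observations $X_1^{(0)},\dots,X_{n_0}^{(0)}$ (controls) are i.i.d. in $\mathbb{R}^p$, and $X_1^{(1)},\dots,X_{n_1}^{(1)}$ (cases) are i.i.d. in $\mathbb{R}^p$; the two samples are independent. Fix integers $m_0,m_1\ge1$. Let $h:(\mathbb{R}^p)^{m_0}\times(\mathbb{R}^p)^{m_1}\to\mathbb{R}$ be a measurable kernel symmetric in its first $m_0$ arguments and in its last $m_1$ arguments, with $\mathrm{E}\,h(X_1^{(0)},\dots,X_{m_0}^{(0)};X_1^{(1)},\dots,X_{m_1}^{(1)})=0$ and finite second moment. For $0\le a\le m_0$, $0\le b\le m_1$, $h_{a,b}(x_1,\dots,x_a;y_1,\dots,y_b)$ denotes the conditional expectation of $h(X_1^{(0)},\dots,X_{m_0}^{(0)};X_1^{(1)},\dots,X_{m_1}^{(1)})$ given $X_i^{(0)}=x_i$ ($i\le a$), $X_j^{(1)}=y_j$ ($j\le b$), and $\xi_{a,b}=\operatorname{Var}\{h_{a,b}(X_1^{(0)},\dots,X_a^{(0)};X_1^{(1)},\dots,X_b^{(1)})\}$. Fix an integer $s\ge2$, and let $\delta_1,\dots,\delta_{n_0}$ be i.i.d. $\mathrm{Bernoulli}(sn_1/n_0)$, independent of all observations. The subsampled statistic is $$T_{\rm S}=\binom{sn_1}{m_0}^{-1}\binom{n_1}{m_1}^{-1}\sum\Big(\prod_{k=1}^{m_0}\delta_{i_k}\Big)h\big(X_{i_1}^{(0)},\dots,X_{i_{m_0}}^{(0)};X_{j_1}^{(1)},\dots,X_{j_{m_1}}^{(1)}\big),$$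 summing over all $1\le i_1<\dots<i_{m_0}\le n_0$ and $1\le j_1<\dots<j_{m_1}\le n_1$. *)

(* Defs.v *)
From HB Require Import structures.
From mathcomp Require Import all_boot all_order all_algebra.
From mathcomp Require Import all_classical all_reals all_analysis.
Set Implicit Arguments. Unset Strict Implicit. Unset Printing Implicit Defensive.
Import Order.TTheory GRing.Theory Num.Theory numFieldTopology.Exports.
Local Open Scope classical_set_scope.
Local Open Scope ring_scope.

Section defs.
Context {R : realType} {d : measure_display} {Omega : measurableType d}.
Variable P : probability Omega R.

Definition mutually_independent_classes (I : eqType) (E : I -> set (set Omega)) :=
  forall (J : seq I) (A : I -> set Omega), uniq J ->
    (forall i, i \in J -> E i (A i)) ->
    P (\big[setI/setT]_(i <- J) A i) = (\prod_(i <- J) P (A i))%E.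

Definition events_of {d'} {T : measurableType d'} (X : Omega -> T) : set (set Omega) :=
  [set X @^-1` B | B in [set B : set T | measurable B]].

Definition mutually_independent_rvs (I : eqType) {d'} {T : measurableType d'}
   (X : I -> Omega -> T) := mutually_independent_classes (fun i => events_of (X i)).

Definition cvg_in_distribution (Y : nat -> Omega -> R) (nu : probability (measurableTypeR R) R) :=
  forall f : R -> R, continuous f -> (exists M : R, forall x, `|f x| <= M) ->
    ('E_P[f \o Y k])%E @[k --> \oo] --> (\int[nu]_x (f x)%:E)%E.
End defs.

From mathcomp Require Import perm.

Section ustat.
Context {R : realType} {d : measure_display} {Omega : measurableType d}.
Variable P : probability Omega R.
Variables (p m0 m1 : nat).
Local Notation Pt := (p.-tuple R).
Variable h : m0.-tuple Pt * m1.-tuple Pt -> R.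
Variables (X0 X1 : nat -> Omega -> Pt).

Definition first_tuple m (X : nat -> Omega -> Pt) (w : Omega) : m.-tuple Pt :=
  [tuple X k w | k < m].

(** h_{a,b}(x_1..x_a ; y_1..y_b): integrate out the remaining arguments, i.e.
    the conditional expectation given X_i^(0)=x_i (i<=a), X_j^(1)=y_j (j<=b)
    (only the first a (resp. b) entries of x (resp. y) are used) *)
Definition h_cond (a b : nat) (x : m0.-tuple Pt) (y : m1.-tuple Pt) : R :=
  fine ('E_P[fun w => h ([tuple if (k < a)%N then tnth x k else X0 k w | k < m0],
                        [tuple if (l < b)%N then tnth y l else X1 l w | l < m1])])%E.

Definition xi (a b : nat) : R :=
  fine (variance P (fun w => h_cond a b (first_tuple m0 X0 w) (first_tuple m1 X1 w))).

Definition incr_idx m n (i : {ffun 'I_m -> 'I_n}) : bool :=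
  [forall a : 'I_m, forall b : 'I_m, (a < b)%N ==> (i a < i b)%N].

Definition T_S (s n0 n1 : nat) (delta : nat -> Omega -> R) (w : Omega) : R :=
  ('C(s * n1, m0)%:R)^-1 * ('C(n1, m1)%:R)^-1 *
  \sum_(i : {ffun 'I_m0 -> 'I_n0} | incr_idx i)
   \sum_(j : {ffun 'I_m1 -> 'I_n1} | incr_idx j)
     (\prod_(k < m0) delta (i k) w) *
     h ([tuple X0 (i k) w | k < m0], [tuple X1 (j l) w | l < m1]).
End ustat.

(* Main.v *)
(** Conditionally on the set [D] of selected controls, the statistic is, up to the factor
    ['C(#|D|, m0) / 'C(s * n1, m0)], a two-sample U-statistic on [#|D|] controls and [n1] cases,
    and by exchangeability its law depends on [D] only through [#|D|], which Chebyshev's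
    inequality concentrates at [s * n1].  So it suffices to find the limit law of a two-sample
    U-statistic along any sample sizes [N, n] with [N / n] tending to [s].

    The projections of order [c] (one or two) dominate: writing the U-statistic as an average
    over permutations of averages of decoupled terms, the remainder has second moment
    O(n^-(c+1)).  Under the null hypothesis controls and cases form a single i.i.d. sequence,
    so the dominant part is a weighted i.i.d. sum for [c = 1], handled by Lindeberg's method.

    For [c = 2] it is a degenerate quadratic chaos [W_n].  No spectral decomposition is used:
    replacing every observation of [W_n] by a block of [m] observations with weights
    [m^(-1/2)] turns [W_n] into [W_(n m)], and the Lindeberg cost of the replacement is small
    uniformly in [m].  Hence [E f(W_n)] is Cauchy for smooth [f]; fourth moments of chaos with
    bounded kernels give uniform integrability of the squares, so that the limit law exists,
    is centred and has the limiting variance. *)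
Require Import Defs.
From HB Require Import structures.
From mathcomp Require Import all_boot all_order all_algebra perm.
From mathcomp Require Import all_classical all_reals all_analysis.
From mathcomp Require Import measurable_realfun ring lra.
Set Implicit Arguments. Unset Strict Implicit. Unset Printing Implicit Defensive.
Import Order.TTheory GRing.Theory Num.Theory numFieldTopology.Exports.
Import numFieldNormedType.Exports.
Local Open Scope classical_set_scope.
Local Open Scope ring_scope.

(** * Expectations *)

Section Expectation.
Context {R : realType} {d : measure_display} {T : measurableType d}.
Variable Q : probability T R.
Implicit Types f g : T -> R.

(** The kernel is only square integrable, whereas the cost of a block replacement and the uniform
    integrability bound go through fourth moments of bounded kernels. Kernels are therefore
    truncated, and double centring repairs the degeneracy that truncation destroys. A block can be
    replaced cheaply because the form is made affine in it: pairs inside a block are deleted, and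
    their second moment is of order [1 / n] whatever [m] is. Two sizes [n] and [n'] meet at the
    common refinement [n * n']. No infinite product measure is built: the law of the observed sample
    on a sequence space is the i.i.d. law, and conditional expectation is integration over spliced
    sequences. A limit of [E f(W_n)] for each [f] is only a functional; its measure is recovered
    from a distribution function, with tightness coming from the second moment bound. Limits are
    known along deterministic sizes, while the selected size is random. Taking the least favourable
    size in a shrinking window makes the limit uniform over that window. *)

Definition L1 (f : T -> R) := Q.-integrable setT (EFin \o f).
(** Measurability of [f] is demanded separately because integrability of the square only controls
    the absolute value. *)
Definition L2 (f : T -> R) := measurable_fun setT f /\ L1 (fun x => f x ^+ 2).
(** A total real-valued expectation, worth 0 when the integral is infinite; hence the [L1]
    hypotheses on additivity and comparison. *)
Definition Ex (f : T -> R) : R := \int[Q]_x f x.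

Lemma L1_meas f : L1 f -> measurable_fun setT f.
Proof. by move=> /measurable_int/measurable_EFinP. Qed.

Lemma L1_le f g : measurable_fun setT f -> L1 g -> (forall x, `|f x| <= g x) -> L1 f.
Proof.
move=> mf ig fg; apply: (le_integrable _ _ _ ig) => //.
  exact/measurable_EFinP.
by move=> x _ /=; rewrite lee_fin (le_trans (fg x))// ler_norm.
Qed.

Lemma L1_cst c : L1 (fun=> c).
Proof. exact: finite_measure_integrable_cst. Qed.

Lemma L1_bdd f M : measurable_fun setT f -> (forall x, `|f x| <= M) -> L1 f.
Proof. by move=> mf fM; apply: (L1_le mf (L1_cst M)). Qed.

Lemma L1_eq f g : f =1 g -> L1 f -> L1 g.
Proof. by move=> /funext ->. Qed.

Lemma L1D f g : L1 f -> L1 g -> L1 (fun x => f x + g x).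
Proof. by move=> lf lg; apply: eq_integrable (integrableD _ lf lg). Qed.

Lemma L1Z c f : L1 f -> L1 (fun x => c * f x).
Proof. by move=> lf; apply: eq_integrable (integrableZl _ c lf). Qed.

Lemma L1N f : L1 f -> L1 (fun x => - f x).
Proof. by move=> /(L1Z (-1)); apply: L1_eq => x; rewrite mulN1r. Qed.

Lemma L1B f g : L1 f -> L1 g -> L1 (fun x => f x - g x).
Proof. by move=> lf /L1N lg; exact: L1D. Qed.

Lemma L1_sum (I : Type) (s : seq I) (P : pred I) (F : I -> T -> R) :
  (forall i, P i -> L1 (F i)) -> L1 (fun x => \sum_(i <- s | P i) F i x).
Proof.
move=> lF; elim: s => [|i s ih].
  by apply: L1_eq (L1_cst 0) => x; rewrite big_nil.
have [Pi|Pi] := boolP (P i).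
  by apply: L1_eq (L1D (lF _ Pi) ih) => x; rewrite big_cons Pi.
by apply: L1_eq ih => x; rewrite big_cons (negbTE Pi).
Qed.

Lemma L1_norm f : L1 f -> L1 (fun x => `|f x|).
Proof.
move=> lf; apply: eq_integrable (integrable_abse lf) => //.
Qed.

Lemma measurable_sqr f : measurable_fun setT f -> measurable_fun setT (fun x => f x ^+ 2).
Proof. by move=> mf; apply: measurable_funX. Qed.

Lemma L2_meas f : L2 f -> measurable_fun setT f. Proof. by case. Qed.

Lemma L2_sqr f : L2 f -> L1 (fun x => f x ^+ 2). Proof. by case. Qed.

Lemma L2_eq f g : f =1 g -> L2 f -> L2 g.
Proof. by move=> /funext ->. Qed.

Lemma L2_mul f g : L2 f -> L2 g -> L1 (fun x => f x * g x).
Proof.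
move=> [mf lf] [mg lg]; apply: (L1_le _ (L1D lf lg)).
  exact: measurable_funM.
move=> x; rewrite ler_norml; apply/andP; split; nra.
Qed.

Lemma L2_bdd f M : measurable_fun setT f -> (forall x, `|f x| <= M) -> L2 f.
Proof.
move=> mf fM; split=> //; apply: (@L1_bdd _ (M ^+ 2)); first exact: measurable_sqr.
move=> x; rewrite normrX ler_sqr ?nnegrE//; exact: le_trans (fM x).
Qed.

Lemma L2_cst c : L2 (fun=> c).
Proof. by apply: (@L2_bdd _ `|c|). Qed.

Lemma L2_L1 f : L2 f -> L1 f.
Proof. by move=> lf; apply: L1_eq (L2_mul lf (L2_cst 1)) => x; rewrite mulr1. Qed.

Lemma L2D f g : L2 f -> L2 g -> L2 (fun x => f x + g x).
Proof.
move=> lf lg; split; first by apply: measurable_funD; exact: L2_meas.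
apply: L1_eq (L1D (L1D (L2_sqr lf) (L1Z 2 (L2_mul lf lg))) (L2_sqr lg)) => x.
ring.
Qed.

Lemma L2Z c f : L2 f -> L2 (fun x => c * f x).
Proof.
move=> [mf lf]; split; first by apply: measurable_funM.
by apply: L1_eq (L1Z (c ^+ 2) lf) => x; rewrite exprMn.
Qed.

Lemma L2B f g : L2 f -> L2 g -> L2 (fun x => f x - g x).
Proof. by move=> lf /(L2Z (-1)) lg; apply: L2_eq (L2D lf lg) => x; rewrite mulN1r. Qed.

Lemma L2_sum (I : Type) (s : seq I) (P : pred I) (F : I -> T -> R) :
  (forall i, P i -> L2 (F i)) -> L2 (fun x => \sum_(i <- s | P i) F i x).
Proof.
move=> lF; elim: s => [|i s ih].
  by apply: L2_eq (L2_cst 0) => x; rewrite big_nil.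
have [Pi|Pi] := boolP (P i).
  by apply: L2_eq (L2D (lF _ Pi) ih) => x; rewrite big_cons Pi.
by apply: L2_eq ih => x; rewrite big_cons (negbTE Pi).
Qed.

Lemma ExD f g : L1 f -> L1 g -> Ex (fun x => f x + g x) = Ex f + Ex g.
Proof. by move=> lf lg; rewrite /Ex RintegralD. Qed.

Lemma ExB f g : L1 f -> L1 g -> Ex (fun x => f x - g x) = Ex f - Ex g.
Proof. by move=> lf lg; rewrite /Ex RintegralB. Qed.

Lemma ExZ c f : L1 f -> Ex (fun x => c * f x) = c * Ex f.
Proof. by move=> lf; rewrite /Ex RintegralZl. Qed.

Lemma Ex_eq f g : f =1 g -> Ex f = Ex g.
Proof. by move=> /funext ->. Qed.

Lemma Ex_cst c : Ex (fun=> c) = c.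
Proof. rewrite /Ex /Rintegral integral_cst//.
have -> : (c%:E * Q setT)%E = c%:E by rewrite (probability_setT Q) mule1.
by [].
Qed.

Lemma Ex_sum (I : Type) (s : seq I) (P : pred I) (F : I -> T -> R) :
  (forall i, P i -> L1 (F i)) ->
  Ex (fun x => \sum_(i <- s | P i) F i x) = \sum_(i <- s | P i) Ex (F i).
Proof.
move=> lF; elim: s => [|i s ih].
  rewrite big_nil -[RHS](Ex_cst 0); apply: Ex_eq => x; by rewrite big_nil.
rewrite big_cons; have [Pi|Pi] := boolP (P i).
  rewrite -ih -ExD//; [|exact: lF|exact: L1_sum].
  by apply: Ex_eq => x; rewrite big_cons Pi.
by rewrite -ih; apply: Ex_eq => x; rewrite big_cons (negbTE Pi).
Qed.

Lemma Ex_le f g : L1 f -> L1 g -> (forall x, f x <= g x) -> Ex f <= Ex g.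
Proof. by move=> lf lg fg; apply: le_Rintegral => // x _. Qed.

Lemma Ex_ge0 f : (forall x, 0 <= f x) -> 0 <= Ex f.
Proof. by move=> f0; apply: Rintegral_ge0. Qed.

Lemma Ex_abs f : L1 f -> `|Ex f| <= Ex (fun x => `|f x|).
Proof. by move=> lf; apply: le_normr_Rintegral. Qed.

Lemma Ex_ae f g : measurable_fun setT f -> measurable_fun setT g ->
  {ae Q, forall x, f x = g x} -> Ex f = Ex g.
Proof.
move=> mf mg fg; rewrite /Ex /Rintegral; congr fine; apply: ae_eq_integral => //.
- exact/measurable_EFinP.
- exact/measurable_EFinP.
by apply: filterS fg => x -> _.
Qed.

Lemma Ex_ae0 f : measurable_fun setT f -> {ae Q, forall x, f x = 0} -> Ex f = 0.
Proof. by move=> mf /(Ex_ae mf); rewrite Ex_cst => ->. Qed.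

Lemma Ex_EFin f : L1 f -> (\int[Q]_x (f x)%:E = (Ex f)%:E)%E.
Proof. by move=> lf; rewrite fineK// integrable_fin_num. Qed.

Lemma Ex_le_bdd f M : L1 f -> (forall x, `|f x| <= M) -> `|Ex f| <= M.
Proof.
move=> lf fM; apply: le_trans (Ex_abs lf) _; rewrite -[leRHS]Ex_cst.
by apply: Ex_le => //; [exact: L1_norm|exact: L1_cst].
Qed.

Lemma Ex_sqr_ge0 f : 0 <= Ex (fun x => f x ^+ 2).
Proof. by apply: Ex_ge0 => x; exact: sqr_ge0. Qed.

(** The difference of the two sides is the variance of [f]. *)
Lemma Ex_sqr_jensen f : L2 f -> Ex f ^+ 2 <= Ex (fun x => f x ^+ 2).
Proof.
move=> lf; rewrite -subr_ge0.
suff <- : Ex (fun x => (f x - Ex f) ^+ 2) = Ex (fun x => f x ^+ 2) - Ex f ^+ 2.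
  exact: Ex_sqr_ge0.
have l1 := L2_L1 lf; have l2 := L2_sqr lf.
transitivity (Ex (fun x => f x ^+ 2 - (2 * Ex f * f x - Ex f ^+ 2))).
  by apply: Ex_eq => x; ring.
rewrite ExB//; last by apply: L1B; [exact: L1Z|exact: L1_cst].
rewrite ExB//; [|exact: L1Z|exact: L1_cst].
by rewrite ExZ// Ex_cst; ring.
Qed.

Lemma Ex_norm_le_sqrt f : L2 f -> Ex (fun x => `|f x|) <= Num.sqrt (Ex (fun x => f x ^+ 2)).
Proof.
move=> lf.
have lg : L2 (fun x => `|f x|).
  case: lf => mf lf; split; first exact: measurableT_comp.
  by apply: L1_eq lf => x; rewrite real_normK// num_real.
rewrite -(ler_sqr (x := Ex _)) ?nnegrE ?sqrtr_ge0//; last exact: Ex_ge0.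
rewrite sqr_sqrtr ?Ex_sqr_ge0//; apply: le_trans (Ex_sqr_jensen lg) _.
by rewrite le_eqVlt; apply/orP; left; apply/eqP/Ex_eq => x; rewrite real_normK// num_real.
Qed.

Lemma Ex_mul_le f g : L2 f -> L2 g ->
  `|Ex (fun x => f x * g x)| <= (Ex (fun x => f x ^+ 2) + Ex (fun x => g x ^+ 2)) / 2.
Proof.
move=> lf lg; apply: le_trans (Ex_abs (L2_mul lf lg)) _.
rewrite -ExD; [|exact: L2_sqr..]; rewrite mulrC -ExZ; last by apply: L1D; exact: L2_sqr.
apply: Ex_le; first exact/L1_norm/L2_mul.
  by apply: L1Z; apply: L1D; exact: L2_sqr.
move=> x; have := sqr_ge0 (f x + g x); have := sqr_ge0 (f x - g x).
by rewrite ler_norml => ? ?; apply/andP; split; nra.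
Qed.

Lemma Ex_sqrD_le f g : L2 f -> L2 g -> Ex (fun x => (f x + g x) ^+ 2) <=
  2 * Ex (fun x => f x ^+ 2) + 2 * Ex (fun x => g x ^+ 2).
Proof.
move=> lf lg; rewrite -!ExZ; [|exact: L2_sqr..]; rewrite -ExD; try exact/L1Z/L2_sqr.
apply: Ex_le; first exact/L2_sqr/L2D.
  by apply: L1D; exact/L1Z/L2_sqr.
by move=> x; have := sqr_ge0 (f x - g x); nra.
Qed.

Lemma Ex_sqr0_ae f : L2 f -> Ex (fun x => f x ^+ 2) = 0 -> {ae Q, forall x, f x = 0}.
Proof.
move=> lf f0.
have : (\int[Q]_x `|(f x ^+ 2)%:E| = 0)%E.
  transitivity (\int[Q]_x (f x ^+ 2)%:E)%E.
    by apply: eq_integral => x _; rewrite gee0_abs// lee_fin sqr_ge0.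
  by rewrite Ex_EFin ?f0//; exact: L2_sqr.
have mf2 : measurable_fun setT (fun x => (f x ^+ 2)%:E).
  apply/measurable_EFinP; apply: measurable_sqr; exact: L2_meas.
move=> /(ae_eq_integral_abs Q measurableT mf2); apply: filterS => x /(_ I)/= [] /eqP.
by rewrite sqrf_eq0 => /eqP.
Qed.

(** Pythagoras: expanding the square leaves only the diagonal terms. *)
Lemma Ex_sqr_orth (J : eqType) (s : seq J) (c : J -> R) (F : J -> T -> R) :
  uniq s -> (forall j, j \in s -> L2 (F j)) ->
  (forall i j, i \in s -> j \in s -> i != j -> Ex (fun x => F i x * F j x) = 0) ->
  Ex (fun x => (\sum_(j <- s) c j * F j x) ^+ 2) =
  \sum_(j <- s) c j ^+ 2 * Ex (fun x => F j x ^+ 2).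
Proof.
move=> us lF orth.
transitivity (Ex (fun x => \sum_(i <- s | i \in s) \sum_(j <- s | j \in s)
    c i * c j * (F i x * F j x))).
  apply: Ex_eq => x; rewrite expr2 big_distrlr/= [LHS]big_seq.
  apply: eq_bigr => i si; rewrite [LHS]big_seq; apply: eq_bigr => j sj; ring.
have l1 i j : i \in s -> j \in s -> L1 (fun x => c i * c j * (F i x * F j x)).
  by move=> si sj; apply/L1Z/L2_mul; apply: lF.
rewrite Ex_sum; last by move=> i si; apply: L1_sum => j sj; exact: l1.
rewrite [RHS]big_seq; apply: eq_bigr => i si.
rewrite Ex_sum; last by move=> j sj; exact: l1.
rewrite -big_seq (bigD1_seq i)//= [X in _ + X]big_seq_cond big1 ?addr0.
  rewrite ExZ; last by apply: L2_mul; apply: lF.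
  by rewrite -expr2; congr (_ * _); apply: Ex_eq => x; rewrite expr2.
move=> j /andP[sj ji]; rewrite ExZ; last by apply: L2_mul; apply: lF.
by rewrite orth ?mulr0// eq_sym.
Qed.

End Expectation.

Section AlmostEverywhereLogic.
Context {R : realType} {d : measure_display} {T : measurableType d}.
Variable Q : probability T R.

Lemma ae_imp (A B : T -> Prop) : {ae Q, forall x, A x} -> (forall x, A x -> B x) ->
  {ae Q, forall x, B x}.
Proof. by move=> hA AB; apply: filterS hA. Qed.

Lemma ae_imp2 (A B C : T -> Prop) : {ae Q, forall x, A x} -> {ae Q, forall x, B x} ->
  (forall x, A x -> B x -> C x) -> {ae Q, forall x, C x}.
Proof. by move=> hA hB ABC; move: hA hB; apply: filterS2. Qed.

Lemma ae_all (I : finType) (A : I -> T -> Prop) : (forall i, {ae Q, forall x, A i x}) ->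
  {ae Q, forall x, forall i, A i x}.
Proof.
move=> h; suff : {ae Q, forall x, forall i, i \in enum I -> A i x}.
  by move/ae_imp; apply => x hx i; apply: hx; rewrite mem_enum.
elim: (enum I) => [|i s ih]; first by apply: aeW.
by apply: (ae_imp2 (h i) ih) => x hi hs j; rewrite inE => /predU1P[->//|]; exact: hs.
Qed.

End AlmostEverywhereLogic.

(** * Transport of expectations along measure-preserving maps *)

Section MeasurePreserving.
Context {R : realType} {d d' : measure_display} {T : measurableType d}
  {T' : measurableType d'}.
Variables (Q : probability T R) (Q' : probability T' R) (phi : T -> T').
Implicit Types f : T' -> R.

(** [Q'] is the law of [phi] under [Q]. Every passage between sample spaces, from [Omega] to a
    sequence space or from one index set to another, goes through such a map. *)
Definition mpres := measurable_fun setT phi /\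
  forall A, measurable A -> Q (phi @^-1` A) = Q' A.

Hypothesis mp : mpres.

(** Positive and negative parts are transported separately, which covers every measurable
    extended-real function; integrability itself can then be transported, as in [L1_mp]. *)
Lemma mpres_integral (f : T' -> \bar R) : measurable_fun setT f ->
  (\int[Q']_x f x = \int[Q]_x f (phi x))%E.
Proof.
case: mp => mphi e mf.
have h (g : T' -> \bar R) : measurable_fun setT g -> (forall x, 0 <= g x)%E ->
    (\int[Q']_x g x = \int[Q]_x g (phi x))%E.
  move=> mg g0; rewrite (_ : (\int[Q']_x g x = \int[pushforward Q phi]_x g x)%E).
    by rewrite ge0_integral_pushforward//.
  by apply: eq_measure_integral => A mA _; exact/esym/e.
rewrite integralE [RHS]integralE; congr (_ - _)%E.
  rewrite h; [|exact: measurable_funepos|exact: funepos_ge0].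
  by apply: eq_integral => x _; rewrite [LHS](esym (congr1 (fun g => g x) (funepos_comp f phi))).
rewrite h; [|exact: measurable_funeneg|exact: funeneg_ge0].
by apply: eq_integral => x _; rewrite [LHS](esym (congr1 (fun g => g x) (funeneg_comp f phi))).
Qed.

Lemma Ex_mp f : measurable_fun setT f -> Ex Q' f = Ex Q (fun x => f (phi x)).
Proof. by move=> mf; rewrite /Ex /Rintegral mpres_integral//; exact/measurable_EFinP. Qed.

Lemma meas_mp (f : T' -> R) : measurable_fun setT f -> measurable_fun setT (fun x => f (phi x)).
Proof. by move=> mf; apply: (measurableT_comp mf); case: mp. Qed.

Lemma L1_mp f : L1 Q' f -> L1 Q (fun x => f (phi x)).
Proof.
move=> lf; have mf := L1_meas lf; apply/integrableP; split.
  by apply/measurable_EFinP/meas_mp.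
move/integrableP: lf => [_]; rewrite mpres_integral//.
by do 2 apply: measurableT_comp => //.
Qed.

Lemma L2_mp f : L2 Q' f -> L2 Q (fun x => f (phi x)).
Proof. by move=> [mf lf]; split; [exact: meas_mp|exact: (L1_mp lf)]. Qed.

Lemma ae_mp (A : T' -> Prop) : {ae Q', forall x, A x} -> {ae Q, forall x, A (phi x)}.
Proof.
case: mp => mphi e [N [mN N0 sub]]; exists (phi @^-1` N); split.
- by rewrite -[X in measurable X]setTI; exact: mphi.
- by rewrite -N0; apply: e.
- by move=> x /= nA; apply: sub.
Qed.

End MeasurePreserving.

(** * Fubini's theorem for real-valued expectations *)

Section ProductExpectation.
Context {R : realType} {d1 d2 : measure_display} {T1 : measurableType d1}
  {T2 : measurableType d2}.
Variables (Q1 : probability T1 R) (Q2 : probability T2 R).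
Let QQ : probability (T1 * T2)%type R := (Q1 \x Q2)%E.
Implicit Types f : T1 * T2 -> R.

Lemma L1_ae_section f : L1 QQ f -> {ae Q1, forall x, L1 Q2 (fun y => f (x, y))}.
Proof. by move=> lf; exact: (ae_integrable1 lf). Qed.

Lemma meas_fubini f : L1 QQ f -> measurable_fun setT (fun x => Ex Q2 (fun y => f (x, y))).
Proof.
move=> lf; rewrite /Ex /Rintegral.
by apply: measurableT_comp => //; exact: (measurable_fubini_F lf).
Qed.

(** Only almost every section is integrable. On those the real inner expectation agrees with the
    extended one, and the outer integral ignores the others. *)
Lemma Ex_fubini f : L1 QQ f -> Ex QQ f = Ex Q1 (fun x => Ex Q2 (fun y => f (x, y))).
Proof.
move=> lf; rewrite /Ex {1}/Rintegral -(integral12_prod_meas1 lf) /Rintegral.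
congr fine; apply: ae_eq_integral => //.
- exact: (measurable_fubini_F lf).
- by apply/measurable_EFinP; exact: (meas_fubini lf).
- apply: filterS (L1_ae_section lf) => x lx _; rewrite /fubini_F.
  by rewrite fineK// integrable_fin_num.
Qed.

Lemma L1_fubini f : L1 QQ f -> L1 Q1 (fun x => Ex Q2 (fun y => f (x, y))).
Proof.
move=> lf; have lF := integrable_fubini_F lf.
apply/integrableP; split; first by apply/measurable_EFinP; exact: (meas_fubini lf).
move/integrableP: lF => [mF]; congr (_ < _)%E; apply: ae_eq_integral => //.
- exact: measurableT_comp.
- by apply: measurableT_comp => //; apply/measurable_EFinP; exact: (meas_fubini lf).
- apply: filterS (L1_ae_section lf) => x lx _; rewrite /fubini_F/=.
  by rewrite Ex_EFin.
Qed.

Lemma mpres_fst : mpres QQ Q1 fst.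
Proof.
split=> // A mA; rewrite (_ : fst @^-1` A = A `*` setT); last first.
  by apply/seteqP; split => [x|x []].
rewrite /QQ/= product_measure1E//.
by have -> : (Q1 A * Q2 setT)%E = Q1 A by rewrite (probability_setT Q2) mule1.
Qed.

Lemma mpres_snd : mpres QQ Q2 snd.
Proof.
split=> // A mA; rewrite (_ : snd @^-1` A = setT `*` A); last first.
  by apply/seteqP; split => [x|x []].
rewrite /QQ/= product_measure1E//.
by have -> : (Q1 setT * Q2 A)%E = Q2 A by rewrite (probability_setT Q1) mul1e.
Qed.

End ProductExpectation.

(** * Product laws on sequence spaces *)

Section AlmostEverywhere.
Context {R : realType} {d : measure_display} {T : measurableType d}.
Variable Q : probability T R.
Implicit Types f g : T -> R.

Lemma L1_ae_le f g : measurable_fun setT f -> L1 Q g ->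
  {ae Q, forall x, `|f x| <= g x} -> L1 Q f.
Proof.
move=> mf lg fg; apply/integrableP; split; first exact/measurable_EFinP.
have /integrableP[mg lg'] := lg; apply: le_lt_trans lg'.
apply: ae_ge0_le_integral => //.
- by apply: measurableT_comp => //; exact/measurable_EFinP.
- exact: measurableT_comp.
by apply: filterS fg => x fgx _ /=; rewrite lee_fin (le_trans fgx)// ler_norm.
Qed.

(** Replacing [g] by its pointwise maximum with [f], which equals [g] almost everywhere, reduces the
    claim to a pointwise inequality. *)
Lemma Ex_ae_le f g : L1 Q f -> L1 Q g -> {ae Q, forall x, f x <= g x} -> Ex Q f <= Ex Q g.
Proof.
move=> lf lg fg; have mf := L1_meas lf; have mg := L1_meas lg.
have mm : measurable_fun setT (fun x => Num.max (f x) (g x)) by exact: measurable_maxr.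
have -> : Ex Q g = Ex Q (fun x => Num.max (f x) (g x)).
  apply: Ex_ae => //; apply: filterS fg => x fgx.
  by rewrite max_r.
apply: Ex_le => //.
  apply: (L1_ae_le mm (L1D (L1_norm lf) (L1_norm lg))); apply: aeW => x.
  by rewrite /Num.max; case: ifP => _; rewrite ?lerDl ?lerDr ?normr_ge0.
by move=> x; rewrite le_max lexx.
Qed.

End AlmostEverywhere.

Section SequenceSpace.
Context {d : measure_display} {E : measurableType d}.

Definition box (I : eqType) (J : seq I) (B : I -> set E) : set (I -> E) :=
  [set x | forall i, i \in J -> B i (x i)].

Definition boxes (I : eqType) : set (set (I -> E)) :=
  [set A | exists J B, [/\ uniq J, forall i, measurable (B i) & A = box J B]].

Arguments boxes : clear implicits.

(** Two index sets occur below: [nat + nat], with controls on the left and cases on the right, and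
    [nat] for the pooled sample. *)
Definition seqspace (I : eqType) := g_sigma_algebraType (boxes I).

HB.instance Definition _ (I : eqType) :=
  Measurable.copy (seqspace I) (g_sigma_algebraType (boxes I)).

End SequenceSpace.
Arguments boxes {d} E I.
Arguments seqspace {d} E I.

Section Iid.
Context {R : realType} {d : measure_display} {E : measurableType d}.
Variable mu : probability E R.

(** The product law is characterised by its values on finite-dimensional boxes. Such laws are
    obtained below as the law of the observed sample or of a reindexed part of it. *)
Definition iid_law (I : eqType) (Q : {measure set (seqspace E I) -> \bar R}) :=
  forall J (B : I -> set E), uniq J -> (forall i, measurable (B i)) ->
    Q (box J B) = (\prod_(i <- J) mu (B i))%E.

Lemma boxT (I : eqType) (B : I -> set E) : box [::] B = setT.
Proof. by apply/seteqP; split => // x _ i. Qed.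

Lemma boxes_setI (I : eqType) : setI_closed (boxes E I).
Proof.
move=> _ _ [J [B [uJ mB ->]]] [J' [B' [uJ' mB' ->]]].
exists (undup (J ++ J')), (fun i => (if i \in J then B i else setT) `&`
  (if i \in J' then B' i else setT)); split; first exact: undup_uniq.
  by move=> i; apply: measurableI; case: ifP.
apply/seteqP; split => [x [h h'] i|x h].
  by move=> _; split; case: ifP => // ij; [exact: h|exact: h'].
split=> i iJ.
  have /h[] : i \in undup (J ++ J') by rewrite mem_undup mem_cat iJ.
  by rewrite iJ.
have /h[] : i \in undup (J ++ J') by rewrite mem_undup mem_cat iJ orbT.
by rewrite iJ.
Qed.

(** Boxes are stable under intersection and generate the sigma-algebra, so a pi-lambda argument
    applies; the whole space is the box over no coordinate. *)
Lemma measure_box_unique (I : eqType) (m1 m2 : {measure set (seqspace E I) -> \bar R}) :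
  (m1 setT < +oo)%E ->
  (forall A, boxes E I A -> m1 A = m2 A) -> forall A, measurable A -> m1 A = m2 A.
Proof.
move=> m1T m12 A mA; apply: (@measure_unique _ R (seqspace E I) (boxes E I) (fun=> setT) _ _ _ _ m1 m2) => //.
- exact: boxes_setI.
- by move=> _; exists [::], (fun=> setT); split=> //; rewrite boxT.
- by apply/seteqP; split => // x _; exists 0%N.
Qed.

Lemma measurable_box (I : eqType) (J : seq I) (B : I -> set E) :
  uniq J -> (forall i, measurable (B i)) -> measurable (box J B : set (seqspace E I)).
Proof. by move=> uJ mB; apply: sub_sigma_algebra; exists J, B. Qed.

Lemma measurable_coord (I : eqType) (i : I) :
  measurable_fun setT (fun x : seqspace E I => x i : E).
Proof.
move=> _ B mB; rewrite setTI.
rewrite (_ : _ @^-1` _ = box [:: i] (fun=> B)); first exact: measurable_box.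
apply/seteqP; split => [x /= Bx j|x /= h]; first by rewrite inE => /eqP ->.
by apply: h; rewrite inE.
Qed.

Lemma measurable_seqspace d' (T : measurableType d') (I : eqType) (phi : T -> seqspace E I) :
  (forall i, measurable_fun setT (fun w => phi w i : E)) -> measurable_fun setT phi.
Proof.
move=> mphi; apply: (@measurability _ _ _ _ setT phi (boxes E I) erefl) => // _ [_ [J [B [uJ mB ->]]] <-].
rewrite setTI; elim: J {uJ} => [|i J ih].
  by rewrite (_ : _ @^-1` _ = setT)//; apply/seteqP; split => // w _ i.
rewrite (_ : _ @^-1` _ = ((fun w => phi w i) @^-1` B i) `&` (phi @^-1` box J B)).
  by apply: measurableI => //; rewrite -[X in measurable X]setTI; exact: mphi.
apply/seteqP; split => [w h|w [h h'] j].
  split; first by apply: h; rewrite inE eqxx.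
  by move=> j jJ; apply: h; rewrite inE jJ orbT.
by rewrite inE => /predU1P[->//|jJ]; exact: h'.
Qed.

Lemma mpres_iid d' (T : measurableType d') (Q : probability T R) (I : eqType)
    (Q' : probability (seqspace E I) R) (phi : T -> seqspace E I) :
  (forall i, measurable_fun setT (fun w => phi w i : E)) -> iid_law Q' ->
  (forall J B, uniq J -> (forall i, measurable (B i)) ->
    Q (phi @^-1` box J B) = (\prod_(i <- J) mu (B i))%E) ->
  mpres Q Q' phi.
Proof.
move=> mc iQ' h; have mphi := measurable_seqspace mc; split=> // A mA.
apply: (measure_box_unique (m1 := pushforward Q phi) (m2 := Q')) => //.
  have : (Q setT < +oo)%E by rewrite probability_setT ltry.
  exact.
by move=> _ [J [B [uJ mB ->]]]; rewrite iQ'//; exact: h.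
Qed.

(** An injective selection of coordinates of an i.i.d. sequence is i.i.d.; the left inverse [pi']
    supplies the sides of the corresponding box over [I]. *)
Lemma mpres_reindex (I I' : eqType) (Q : probability (seqspace E I) R)
    (Q' : probability (seqspace E I') R) (pi : I' -> I) (pi' : I -> I') :
  iid_law Q -> iid_law Q' -> cancel pi pi' ->
  mpres Q Q' (fun x : seqspace E I => x \o pi : seqspace E I').
Proof.
move=> iQ iQ' piK; apply: mpres_iid => // [i|J B uJ mB].
  exact: measurable_coord.
rewrite (_ : _ @^-1` _ = box (map pi J) (B \o pi')); last first.
  apply/seteqP; split => [x /= h _ /mapP[i iJ ->]|x /= h i iJ] /=.
    by rewrite piK; exact: h.
  by have := h (pi i); rewrite /= piK; apply; rewrite map_f.
rewrite iQ//; [|by rewrite map_inj_uniq//; exact: can_inj piK|by move=> i; exact: mB].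
by rewrite big_map; apply: eq_bigr => i _; rewrite /= piK.
Qed.

Definition mix (I : Type) (S : pred I) (x y : I -> E) : I -> E :=
  fun i => if S i then x i else y i.

(** A box splits into a box over the coordinates in [S] and one over the others, so splicing two
    independent copies preserves the law. Together with Fubini this makes integration over the
    second copy a conditional expectation. *)
Lemma mpres_mix (I : eqType) (Q : probability (seqspace E I) R) (S : pred I) : iid_law Q ->
  mpres (Q \x Q)%E Q (fun z => mix S z.1 z.2 : seqspace E I).
Proof.
move=> iQ; apply: mpres_iid => // [i|J B uJ mB].
  rewrite /mix; case: (S i).
    exact: (measurableT_comp (measurable_coord i) measurable_fst).
  exact: (measurableT_comp (measurable_coord i) measurable_snd).
rewrite (_ : _ @^-1` _ = box [seq i <- J | S i] B `*` box [seq i <- J | predC S i] B); last first.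
  apply/seteqP; split => [[x y] /= h|[x y] /= [h h'] i iJ].
    split=> i; rewrite mem_filter => /andP[Si iJ]; have := h i iJ; rewrite /mix/=.
      by rewrite Si.
    by rewrite (negbTE Si).
  rewrite /mix/=; case: ifP => Si; first by apply: h; rewrite mem_filter Si.
  by apply: h'; rewrite mem_filter /= Si.
have mb (s : pred I) : measurable (box [seq i <- J | s i] B : set (seqspace E I)).
  by apply: measurable_box => //; exact: filter_uniq.
rewrite /= product_measure1E//.
transitivity ((\prod_(i <- [seq i <- J | S i]) mu (B i)) * (\prod_(i <- [seq i <- J | predC S i]) mu (B i)))%E.
  by congr (_ * _)%E; apply: iQ => //; exact: filter_uniq.
by rewrite !big_filter [RHS](bigID S).
Qed.

End Iid.

(** * Conditional expectation by resampling coordinates *)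

Section ConditionalExpectation.
Context {R : realType} {d : measure_display} {E : measurableType d}.
Variables (mu : probability E R) (I : eqType) (Q : probability (seqspace E I) R).
Hypothesis iQ : iid_law mu Q.
Local Notation T := (seqspace E I).
Implicit Types (S : pred I) (F G : T -> R).

(** A pointwise form of measurability with respect to the coordinates in [S], well suited to
    computations with [mix]. *)
Definition dep (S : pred I) (F : T -> R) :=
  forall x y : T, (forall i, S i -> x i = y i) -> F x = F y.

(* a version of the conditional expectation of [F] given the coordinates in [S] *)
Definition PS (S : pred I) (F : T -> R) (x : T) : R := Ex Q (fun y => F (mix S x y : T)).

Let QQ : probability (T * T)%type R := (Q \x Q)%E.

Lemma measurable_mix S : measurable_fun setT (fun z : T * T => mix S z.1 z.2 : T).
Proof. by case: (mpres_mix S iQ). Qed.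

Lemma measurable_mixr S (x : T) : measurable_fun setT (fun y : T => mix S x y : T).
Proof.
exact: (measurableT_comp (measurable_mix S) (measurable_pair1 x)).
Qed.

Lemma mpres_coord (i : I) : mpres Q mu (fun x : T => x i).
Proof.
split=> [|A mA]; first exact: measurable_coord.
transitivity (Q (box [:: i] (fun=> A))).
  congr (Q _); apply/seteqP; split => [x /= Ax j|x /= h]; first by rewrite inE => /eqP ->.
  by apply: h; rewrite inE.
by rewrite iQ// big_seq1.
Qed.

Lemma L1_mix S F : L1 Q F -> L1 QQ (fun z => F (mix S z.1 z.2)).
Proof. exact: (L1_mp (mpres_mix S iQ)). Qed.

Lemma L1_mixr_ae S F : L1 Q F -> {ae Q, forall x, L1 Q (fun y => F (mix S x y))}.
Proof. by move=> /(L1_mix S)/L1_ae_section. Qed.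

Lemma PS_L1 S F : L1 Q F -> L1 Q (PS S F).
Proof. by move=> /(L1_mix S)/L1_fubini. Qed.

Lemma PS_meas S F : L1 Q F -> measurable_fun setT (PS S F).
Proof. by move=> /(L1_mix S)/meas_fubini. Qed.

Lemma Ex_mix S F : L1 Q F -> Ex Q F = Ex Q (fun x => Ex Q (fun y => F (mix S x y))).
Proof.
move=> lF; rewrite (Ex_mp (mpres_mix S iQ)); last exact: L1_meas lF.
by rewrite (Ex_fubini (L1_mix S lF)).
Qed.

Lemma Ex_PS S F : L1 Q F -> Ex Q (PS S F) = Ex Q F.
Proof. by move=> lF; rewrite -Ex_mix. Qed.

Lemma PS_sqr_ae S F : L2 Q F ->
  {ae Q, forall x, PS S F x ^+ 2 <= PS S (fun y => F y ^+ 2) x}.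
Proof.
move=> lF; apply: (ae_imp (L1_mixr_ae S (L2_sqr lF))) => x lx.
apply: Ex_sqr_jensen; split=> //.
exact: (measurableT_comp (L2_meas lF) (measurable_mixr S x)).
Qed.

Lemma PS_L2 S F : L2 Q F -> L2 Q (PS S F).
Proof.
move=> lF; split; first exact: (PS_meas S (L2_L1 lF)).
apply: (L1_ae_le _ (PS_L1 S (L2_sqr lF))).
  by apply: measurable_sqr; exact: (PS_meas S (L2_L1 lF)).
by apply: (ae_imp (PS_sqr_ae S lF)) => x; rewrite ger0_norm ?sqr_ge0.
Qed.

(** A coordinate survives both resamplings only if it lies in [S] and in [S']. The identity is
    almost sure because [Ex_mix] is applied to a section of [F], which is integrable for almost
    every [x]. *)
Lemma PS_PS S S' F : L1 Q F ->
  {ae Q, forall x, PS S (PS S' F) x = PS (predI S S') F x}.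
Proof.
move=> lF; apply: (ae_imp (L1_mixr_ae (predI S S') lF)) => x lx.
rewrite [RHS]/PS (Ex_mix S' lx); apply: Ex_eq => y; apply: Ex_eq => z.
congr F; apply/funext => i; rewrite /mix/=.
by case: (S' i); case: (S i).
Qed.

Lemma PS_dep S S0 F : dep S0 F -> PS S F =1 PS (predI S S0) F.
Proof.
by move=> dF x; apply: Ex_eq => y; apply: dF => i Si; rewrite /mix/= Si andbT.
Qed.

Lemma dep_PS S F : dep S (PS S F).
Proof.
move=> x y xy; apply: Ex_eq => z; congr F; apply/funext => i; rewrite /mix.
by case: ifP => // /xy.
Qed.

Lemma PS_eqS S S' F : S =1 S' -> PS S F =1 PS S' F.
Proof.
by move=> e x; apply: Ex_eq => y; congr F; apply/funext => i; rewrite /mix e.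
Qed.

Lemma PS0 S F x : (forall i, ~~ S i) -> PS S F x = Ex Q F.
Proof.
by move=> S0; apply: Ex_eq => y; congr F; apply/funext => i; rewrite /mix (negbTE (S0 i)).
Qed.

Lemma mpres_comp (rho rho' : I -> I) : cancel rho rho' ->
  mpres Q Q (fun x : T => x \o rho : T).
Proof. by move=> /(mpres_reindex iQ iQ). Qed.

Lemma PS_comp S F (rho rho' : I -> I) x : cancel rho rho' -> measurable_fun setT F ->
  PS S (fun y => F (y \o rho)) x = PS (S \o rho) F (x \o rho).
Proof.
move=> rhoK mF; rewrite [RHS]/PS (Ex_mp (mpres_comp rhoK)); last first.
  exact: (measurableT_comp mF (measurable_mixr _ _)).
by apply: Ex_eq => y; congr F; apply/funext => i.
Qed.

(** Once the coordinates in [S] are frozen, [G] is a constant factor and the inner expectation is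
    [G] times [PS S F]. *)
Lemma Ex_orth S F G : L2 Q F -> L2 Q G -> dep S G ->
  {ae Q, forall x, PS S F x = 0} -> Ex Q (fun x => F x * G x) = 0.
Proof.
move=> lF lG dG F0; have lFG := L2_mul lF lG.
rewrite (Ex_mix S lFG); apply: Ex_ae0.
  exact: (PS_meas S lFG).
apply: (ae_imp2 F0 (L1_mixr_ae S (L2_L1 lF))) => x {}F0 lx.
transitivity (G x * PS S F x); last by rewrite F0 mulr0.
rewrite -ExZ//; apply: Ex_eq => y; rewrite mulrC; congr (_ * _).
by apply: dG => i Si; rewrite /mix Si.
Qed.

End ConditionalExpectation.

(** * Gaussian laws *)

Section Gaussian.
Context {R : realType}.
Local Notation mu := (@lebesgue_measure R).
Local Notation RT := (measurableTypeR R).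

Lemma measurable_EFin_normal_pdf (m s : R) :
  measurable_fun setT (fun x : RT => (normal_pdf m s x)%:E).
Proof. by apply/measurable_EFinP; exact: measurable_normal_pdf. Qed.

Lemma normal_pdfE0 (m s x : R) : s != 0 -> normal_pdf m s x = normal_peak s * normal_fun m s x.
Proof. by move=> s0; rewrite /normal_pdf (negbTE s0). Qed.

(** Translation invariance of Lebesgue measure, from its uniqueness on half-open intervals. *)
Lemma ge0_integral_shift (c : R) (f : RT -> \bar R) : measurable_fun setT f ->
  (forall x, 0 <= f x)%E -> (\int[mu]_x f (x + c)%R = \int[mu]_x f x)%E.
Proof.
move=> mf f0; have mshift : measurable_fun setT ((fun x : RT => x + c) : RT -> RT).
  exact: measurable_funD.
transitivity (\int[pushforward mu ((fun x : RT => (x + c)%R) : RT -> RT)]_x f x)%E.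
  by rewrite ge0_integral_pushforward.
apply: eq_measure_integral => A mA _.
apply/esym/lebesgue_measure_unique => //= _ [[a b]] _ <-.
rewrite /pushforward (_ : _ @^-1` _ = `]a - c, b - c]%classic); last first.
  by apply/seteqP; split => x /=; rewrite !in_itv/= ltrBlDr lerBrDr.
rewrite !lebesgue_measure_itv/= !lte_fin ltrD2r; case: ifP => // _.
by rewrite -!EFinB; congr EFin; ring.
Qed.

Lemma ge0_integral_opp (f : RT -> \bar R) : measurable_fun setT f ->
  (forall x, 0 <= f x)%E -> (\int[mu]_x f (- x)%R = \int[mu]_x f x)%E.
Proof.
move=> mf f0; have mopp : measurable_fun setT ((fun x => - x) : RT -> RT).
  exact: measurable_funN.
transitivity (\int[pushforward mu ((fun x : RT => (- x)%R) : RT -> RT)]_x f x)%E.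
  by rewrite ge0_integral_pushforward.
by apply: eq_measure_integral => A mA _; exact: lebesgue_measureN.
Qed.

(** The Radon-Nikodym derivative of the normal law agrees almost everywhere with [normal_pdf], both
    having the same integral over every measurable set. *)
Lemma ge0_integral_normal_prob (m s : R) (f : RT -> \bar R) : measurable_fun setT f ->
  (forall x, 0 <= f x)%E ->
  (\int[normal_prob m s]_x f x = \int[mu]_x (f x * (normal_pdf m s x)%:E))%E.
Proof.
move=> mf f0.
rewrite -(Radon_Nikodym_SigmaFinite.change_of_variables (normal_prob_dominates m s))//.
set g := Radon_Nikodym_SigmaFinite.f _ _.
have ig : mu.-integrable setT g by exact: Radon_Nikodym_SigmaFinite.f_integrable (normal_prob_dominates m s).
apply: ae_eq_integral => //.
- by apply: emeasurable_funM => //; exact: measurable_int ig.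
- apply: emeasurable_funM => //; apply/measurable_EFinP; exact: measurable_normal_pdf.
- apply: ae_eqe_mul2l; apply: integral_ae_eq => //.
    exact: measurable_EFin_normal_pdf.
  move=> A _ mA; rewrite -(Radon_Nikodym_SigmaFinite.f_integral (normal_prob_dominates m s))//.
Qed.

(** The parameter is the standard deviation, not the variance. *)
Definition gauss (s : R) : probability RT R := normal_prob 0 s.

Lemma normal_peakE (u : R) : 0 < u -> normal_peak u = (u * Num.sqrt (pi *+ 2))^-1.
Proof.
move=> u0; rewrite /normal_peak; congr (_^-1).
by rewrite -mulrnAr (sqrtrM (pi *+ 2)) ?sqr_ge0// sqrtr_sqr gtr0_norm.
Qed.

Lemma normal_peakM (s t : R) : 0 < s -> 0 < t ->
  normal_peak s * normal_peak t =
  normal_peak (Num.sqrt (s ^+ 2 + t ^+ 2)) * normal_peak (s * t / Num.sqrt (s ^+ 2 + t ^+ 2)).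
Proof.
move=> s0 t0; have r0 : 0 < s ^+ 2 + t ^+ 2 by nra.
rewrite /normal_peak -!invfM; congr (_^-1).
have p0 : 0 < (pi : R) by exact: pi_gt0.
rewrite -!sqrtrM; try by rewrite -mulr_natr !mulr_ge0 ?sqr_ge0// ltW.
congr Num.sqrt; rewrite expr_div_n sqr_sqrtr ?(ltW r0)//; field.
exact: lt0r_neq0.
Qed.

(** Completing the square: the joint density of the first term and the sum factors into the density
    of the sum at [z] and the conditional Gaussian density of the first term given the sum. *)
Lemma normal_pdfM (s t x z : R) : 0 < s -> 0 < t ->
  let r := Num.sqrt (s ^+ 2 + t ^+ 2) in
  normal_pdf 0 s x * normal_pdf 0 t (z - x) =
  normal_pdf 0 r z * normal_pdf (z * s ^+ 2 / r ^+ 2) (s * t / r) x.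
Proof.
move=> s0 t0 r; have r2 : 0 < s ^+ 2 + t ^+ 2 by nra.
have r0 : 0 < r by rewrite sqrtr_gt0.
have q0 : 0 < s * t / r by rewrite divr_gt0// mulr_gt0.
rewrite !normal_pdfE0 ?lt0r_neq0// mulrACA normal_peakM// -/r.
rewrite [RHS]mulrACA; congr (_ * _); rewrite /normal_fun -!expRD; congr expR.
rewrite expr_div_n (_ : r ^+ 2 = s ^+ 2 + t ^+ 2); last by rewrite sqr_sqrtr// ltW.
field.
by rewrite !lt0r_neq0.
Qed.

(* stability of the centred Gaussian family, by completing the square *)
Lemma mpres_gauss_add (s t : R) : 0 < s -> 0 < t ->
  mpres (gauss s \x gauss t)%E (gauss (Num.sqrt (s ^+ 2 + t ^+ 2))) (fun z => z.1 + z.2).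
Proof.
move=> s0 t0; set r := Num.sqrt _.
have r0 : 0 < r by rewrite sqrtr_gt0; nra.
have q0 : 0 < s * t / r by rewrite divr_gt0// mulr_gt0.
have madd : measurable_fun setT (fun z : RT * RT => z.1 + z.2 : RT) by exact: measurable_funD.
split=> // A mA.
have mI : measurable_fun setT (fun x : RT => (\1_A x)%:E : \bar R) by exact/measurable_EFinP/measurable_indic.
have I0 x : (0 <= (\1_A x)%:E :> \bar R)%E by rewrite lee_fin.
have mpdf m u : measurable_fun setT (fun x : RT => (normal_pdf m u x)%:E).
  exact: measurable_EFin_normal_pdf.
have pdf0 m u x : (0 <= (normal_pdf m u x)%:E :> \bar R)%E by rewrite lee_fin normal_pdf_ge0.
pose k := fun z : RT * RT => ((\1_A z.2)%:E * (normal_pdf 0 s z.1 * normal_pdf 0 t (z.2 - z.1))%:E)%E.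
have mk : measurable_fun setT k.
  apply: emeasurable_funM; first exact: (measurableT_comp mI measurable_snd).
  apply/measurable_EFinP/measurable_funM.
    exact: (measurableT_comp (measurable_normal_pdf 0 s) measurable_fst).
  apply: (measurableT_comp (measurable_normal_pdf 0 t)).
  by apply: measurable_funB.
have k0 z : (0 <= k z)%E.
  by rewrite mule_ge0// lee_fin mulr_ge0// normal_pdf_ge0.
transitivity (\int[gauss s]_x \int[gauss t]_y (\1_A (x + y))%:E)%E.
  rewrite /product_measure1/=; apply: eq_integral => x _.
  rewrite /=; set B := xsection _ _; have mB : measurable (B : set RT).
    by apply: measurable_xsection; rewrite -[X in measurable X]setTI; exact: madd.
  transitivity (\int[gauss t]_y (\1_B y)%:E)%E.
    by rewrite integral_indic// setIT.
  by apply: eq_integral => y _; rewrite !indicE /B mem_xsection.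
have mtr m u x : measurable_fun setT (fun z : RT => (normal_pdf m u (z - x))%:E).
  by apply: (measurableT_comp (mpdf m u)); exact: measurable_funB.
have mF x : measurable_fun setT (fun z : RT => (\1_A z)%:E * (normal_pdf 0 t (z - x))%:E : \bar R)%E.
  by apply: emeasurable_funM; [exact: mI|exact: mtr].
have F0 x z : (0 <= (\1_A z)%:E * (normal_pdf 0 t (z - x))%:E :> \bar R)%E.
  by apply: mule_ge0; [exact: I0|exact: pdf0].
have h x : (\int[gauss t]_y (\1_A (x + y))%:E = \int[mu]_z ((\1_A z)%:E * (normal_pdf 0 t (z - x))%:E))%E.
  have m1 : measurable_fun setT (fun y : RT => (\1_A (x + y))%:E : \bar R).
    by apply: (measurableT_comp mI); exact: measurable_funD.
  rewrite (ge0_integral_normal_prob 0 t m1 (fun y => I0 _)).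
  rewrite -(ge0_integral_shift x (mF x) (F0 x)).
  by apply: eq_integral => y _; rewrite addrK addrC.
have mh : measurable_fun setT (fun x : RT => \int[gauss t]_y (\1_A (x + y))%:E : \bar R)%E.
  under eq_fun do rewrite h.
  apply: (measurable_fun_fubini_tonelli_F (fun z : RT * RT => (\1_A z.2)%:E * (normal_pdf 0 t (z.2 - z.1))%:E)%E).
    apply: emeasurable_funM; first exact: (measurableT_comp mI measurable_snd).
    by apply: (measurableT_comp (mpdf 0 t)); exact: measurable_funB.
  by move=> z; exact: F0.
have h0 x : (0 <= \int[gauss t]_y (\1_A (x + y))%:E :> \bar R)%E.
  by apply: integral_ge0 => y _; exact: I0.
transitivity (\int[mu]_x \int[mu]_z k (x, z))%E.
  rewrite (ge0_integral_normal_prob 0 s mh h0).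
  apply: eq_integral => x _; rewrite h -(ge0_integralZr _ measurableT (mF x)).
  - by apply: eq_integral => z _; rewrite /k/= -!EFinM; congr EFin; rewrite -mulrA [in LHS](mulrC (normal_pdf 0 t _)).
  - by move=> z _; exact: F0.
  - exact: pdf0.
(* With the sum [z] outside, the conditional density of the first term integrates to 1. *)
rewrite (fubini_tonelli k mk k0).
transitivity (\int[mu]_z ((\1_A z)%:E * (normal_pdf 0 r z)%:E))%E; last first.
  by rewrite -(ge0_integral_normal_prob 0 r mI I0) integral_indic// setIT.
apply: eq_integral => z _.
transitivity (\int[mu]_x (((\1_A z)%:E * (normal_pdf 0 r z)%:E) * (normal_pdf (z * s ^+ 2 / r ^+ 2) (s * t / r) x)%:E))%E.
  by apply: eq_integral => x _; rewrite /k/= normal_pdfM// EFinM muleA.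
rewrite (ge0_integralZl _ measurableT (mpdf _ _)).
- by rewrite integral_normal_pdf mule1.
- by move=> x _; exact: pdf0.
- by apply: mule_ge0; [exact: I0|exact: pdf0].
Qed.

Lemma mpres_gaussN (s : R) : s != 0 -> mpres (gauss s) (gauss s) (fun x : RT => - x : RT).
Proof.
move=> s0; have mN : measurable_fun setT (fun x : RT => - x : RT) by exact: measurable_funN.
split=> // A mA.
have mI : measurable_fun setT (fun x : RT => (\1_A x)%:E : \bar R) by exact/measurable_EFinP/measurable_indic.
have mpdf : measurable_fun setT (fun x : RT => (normal_pdf 0 s x)%:E).
  exact: measurable_EFin_normal_pdf.
have mk : measurable_fun setT (fun x : RT => (\1_A x)%:E * (normal_pdf 0 s x)%:E : \bar R)%E.
  exact: emeasurable_funM.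
have k0 (x : RT) : (0 <= (\1_A x)%:E * (normal_pdf 0 s x)%:E :> \bar R)%E.
  by apply: mule_ge0; rewrite lee_fin// normal_pdf_ge0.
have mB : measurable (-%R @^-1` A : set RT) by rewrite -[X in measurable X]setTI; exact: mN.
have e (B : set RT) : measurable B ->
    (gauss s B = \int[mu]_x ((\1_B x)%:E * (normal_pdf 0 s x)%:E))%E.
  move=> mB'; rewrite -ge0_integral_normal_prob//; last exact/measurable_EFinP/measurable_indic.
  by rewrite integral_indic// setIT.
rewrite !e//.
rewrite -(ge0_integral_opp mk k0).
by apply: eq_integral => x _; rewrite !normal_pdfE0// /normal_fun !subr0 sqrrN.
Qed.

(* change of Gaussian scale: the density ratio is Gaussian again *)
Lemma Ex_gauss_tilt (s t : R) (f : RT -> R) : 0 < s -> 0 < t -> measurable_fun setT f ->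
  (forall y, 0 <= f y) ->
  (\int[gauss s]_y (f y * expR (- (((2 * t ^+ 2)^-1 - (2 * s ^+ 2)^-1) * y ^+ 2)))%:E =
   (t / s)%:E * \int[gauss t]_y (f y)%:E)%E.
Proof.
move=> s0 t0 mf f0.
have ne0 u : 0 < u -> u != 0 :> R by move=> /lt0r_neq0.
have mg : measurable_fun setT (fun y : RT => f y * expR (- (((2 * t ^+ 2)^-1 - (2 * s ^+ 2)^-1) * y ^+ 2))).
  apply: measurable_funM => //; apply: measurableT_comp => //.
  by apply: measurable_funN; apply: measurable_funM => //; exact: measurable_funX.
rewrite !ge0_integral_normal_prob; last first.
- by move=> y; rewrite lee_fin mulr_ge0// expR_ge0.
- exact/measurable_EFinP.
- by move=> y; rewrite lee_fin.
- exact/measurable_EFinP.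
rewrite -ge0_integralZl//; last first.
- by rewrite lee_fin divr_ge0// ltW.
- by move=> y _; rewrite mule_ge0// lee_fin// normal_pdf_ge0.
- by apply: emeasurable_funM; [exact/measurable_EFinP|exact: measurable_EFin_normal_pdf].
apply: eq_integral => y _; rewrite -!EFinM; congr EFin.
rewrite !normal_pdfE0 ?ne0//.
have -> : normal_peak s = t / s * normal_peak t.
  by rewrite !normal_peakE//; field; rewrite !ne0//= sqrtr_gt0 pmulrn_lgt0// pi_gt0.
set X := expR _; set Y := normal_fun 0 s y; set Z := normal_fun 0 t y.
suff -> : Z = X * Y by ring.
rewrite /X /Y /Z /normal_fun -expRD; congr expR; rewrite !subr0.
by field; rewrite !ne0.
Qed.

Lemma L1_ge0_lty (Q : probability RT R) (f : RT -> R) (M : R) : measurable_fun setT f ->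
  (forall x, 0 <= f x) -> (\int[Q]_x (f x)%:E <= M%:E)%E -> L1 Q f /\ Ex Q f <= M.
Proof.
move=> mf f0 fM; have lf : L1 Q f.
  apply/integrableP; split; first exact/measurable_EFinP.
  apply: le_lt_trans (ltry M); apply: le_trans fM.
  rewrite le_eqVlt; apply/orP; left; apply/eqP; apply: eq_integral => x _ /=.
  by rewrite ger0_norm.
by split => //; rewrite -lee_fin -Ex_EFin.
Qed.

(** With [t^2 = 2 s^2], the density at scale [s] is [sqrt 2] times the density at scale [t] times
    [exp (- y^2 / (4 s^2))]. Since [y^2 exp (- y^2 / (4 s^2)) <= 4 s^2], two powers of [y] are
    traded for a constant; 8 is [4 * sqrt 2] rounded up. *)
Lemma gauss_mono_bound (s : R) (n : nat) (M : R) : 0 < s ->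
  (forall t : R, 0 < t -> t = Num.sqrt 2 * s ->
    (\int[gauss t]_y (y ^+ (2 * n))%:E <= M%:E)%E) ->
  L1 (gauss s) (fun y : RT => y ^+ (2 * n.+1)) /\
  Ex (gauss s) (fun y => y ^+ (2 * n.+1)) <= 8 * s ^+ 2 * M.
Proof.
move=> s0 hM; set t := Num.sqrt 2 * s.
have t0 : 0 < t by rewrite mulr_gt0// sqrtr_gt0.
have t2 : t ^+ 2 = 2 * s ^+ 2 by rewrite exprMn sqr_sqrtr.
have mX k : measurable_fun setT (fun y : RT => y ^+ k) by exact: measurable_funX.
pose f (y : RT) := y ^+ (2 * n.+1) * expR (- (y ^+ 2 / (4 * s ^+ 2))).
have mf : measurable_fun setT f.
  apply: measurable_funM => //; apply: measurableT_comp => //.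
  by apply: measurable_funN; exact: measurable_funM.
have p0 k (y : R) : 0 <= y ^+ (2 * k) by rewrite exprM exprn_ge0// sqr_ge0.
have f0 y : 0 <= f y by rewrite mulr_ge0// ?expR_ge0.
have fle y : f y <= 4 * s ^+ 2 * y ^+ (2 * n).
  rewrite /f mulnS exprD (_ : _ * _ = y ^+ 2 * expR (- (y ^+ 2 / (4 * s ^+ 2))) * y ^+ (2 * n)); last ring.
  apply: ler_wpM2r => //.
  have s4 : 0 < 4 * s ^+ 2 by nra.
  rewrite expRN ler_pdivrMr ?expR_gt0// -ler_pdivrMl// mulrC.
  by apply: le_trans (expR_ge1Dx _); rewrite lerDr.
apply: L1_ge0_lty => //.
have := Ex_gauss_tilt s0 t0 mf f0.
have -> : (\int[gauss s]_y (f y * expR (- (((2 * t ^+ 2)^-1 - (2 * s ^+ 2)^-1) * y ^+ 2)))%:E =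
   \int[gauss s]_y (y ^+ (2 * n.+1))%:E)%E.
  apply: eq_integral => y _; rewrite /f -mulrA -expRD t2 (_ : _ + _ = 0) ?expR0 ?mulr1//.
  by field; rewrite lt0r_neq0.
move=> ->.
have h : (\int[gauss t]_y (f y)%:E <= (4 * s ^+ 2 * M)%:E)%E.
  apply: (@le_trans _ _ (\int[gauss t]_y ((4 * s ^+ 2)%:E * (y ^+ (2 * n))%:E))%E).
    apply: ge0_le_integral => //.
    - by move=> y _; rewrite lee_fin.
    - exact/measurable_EFinP.
    - by apply/measurable_EFinP; exact: measurable_funM.
    - by move=> y _; rewrite -EFinM lee_fin.
  rewrite ge0_integralZl//; last first.
  - by rewrite lee_fin mulr_ge0// sqr_ge0.
  - by move=> y _; rewrite lee_fin.
  - exact/measurable_EFinP.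
  rewrite [leRHS]EFinM; apply: lee_wpmul2l; last exact: hM.
  by rewrite lee_fin mulr_ge0// sqr_ge0.
have M0 : 0 <= M.
  by rewrite -lee_fin; apply: le_trans (hM t t0 erefl); apply: integral_ge0 => y _; rewrite lee_fin.
apply: (@le_trans _ _ ((t / s)%:E * (4 * s ^+ 2 * M)%:E)%E).
  by rewrite lee_wpmul2l// lee_fin divr_ge0// ltW.
rewrite -EFinM lee_fin /t mulfK ?lt0r_neq0//.
have : Num.sqrt 2 <= 2 :> R by rewrite -[leRHS]ger0_norm// -sqrtr_sqr ler_sqrt; lra.
have : 0 <= s ^+ 2 * M by rewrite mulr_ge0// sqr_ge0.
nra.
Qed.

Lemma L1_gauss_sqr (s : R) : 0 < s -> L1 (gauss s) (fun y : RT => y ^+ 2).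
Proof.
move=> s0; have [] := @gauss_mono_bound s 0 1 s0 _; last by [].
move=> t t0 _; under eq_integral do rewrite muln0 expr0.
by rewrite integral_cst// mul1e probability_le1.
Qed.

(** A variational computation of the variance [v]. Tilting from scale [s] to [k * s] shows that
    [exp (- c y^2)] has expectation [k] for [c = (k^-2 - 1) / (2 s^2)]. As [exp (- u) >= 1 - u],
    this gives [1 - c v <= k] for every [k > 0], with equality at [k = 1]; the tangents on both
    sides of 1 must then agree, which forces [v = s^2]. *)
Lemma Ex_gauss_sqr (s : R) : 0 < s -> Ex (gauss s) (fun y : RT => y ^+ 2) = s ^+ 2.
Proof.
move=> s0; set v := Ex _ _; have s2 : 0 < s ^+ 2 by rewrite exprn_gt0.
have key (k : R) : 0 < k -> 1 - (k ^- 2 - 1) / (2 * s ^+ 2) * v <= k.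
  move=> k0; have t0 : 0 < k * s by rewrite mulr_gt0.
  have := @Ex_gauss_tilt s (k * s) (fun=> 1) s0 t0 (@measurable_cst _ _ _ _ _ _) (fun=> ler01).
  rewrite [X in (_ * X)%E](Ex_EFin (L1_cst (gauss (k * s)) 1)) Ex_cst mule1 mulfK ?lt0r_neq0// => e.
  set c := (k ^- 2 - 1) / (2 * s ^+ 2).
  have cE : (2 * (k * s) ^+ 2)^-1 - (2 * s ^+ 2)^-1 = c.
    by rewrite /c; field; rewrite !lt0r_neq0.
  pose g (y : RT) := expR (- (c * y ^+ 2)).
  have mg : measurable_fun setT g.
    by apply: measurableT_comp => //; apply: measurable_funN; apply: measurable_funM => //; exact: measurable_funX.
  have [lg gk] : L1 (gauss s) g /\ Ex (gauss s) g <= k.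
    apply: L1_ge0_lty => //; first by move=> y; exact: expR_ge0.
    rewrite -e le_eqVlt; apply/orP; left; apply/eqP; apply: eq_integral => y _.
    by rewrite /g mul1r cE.
  apply: le_trans gk; have l2 := L1_gauss_sqr s0.
  rewrite -(Ex_cst (gauss s) 1) -[c * v]ExZ// -ExB; [|exact: L1_cst|exact: L1Z].
  apply: Ex_le => //; first by apply: L1B; [exact: L1_cst|exact: L1Z].
  by move=> y; rewrite /g; apply: le_trans (expR_ge1Dx _).
set a := v / (2 * s ^+ 2).
have key' (k : R) : 0 < k -> (1 - k) * k ^+ 2 <= a * (1 - k) * (1 + k).
  move=> k0; have := key k k0.
  rewrite -mulrA [_^-1 * v]mulrC -/a => h.
  have k2 : 0 < k ^+ 2 by rewrite exprn_gt0.
  have : (1 - k) <= (k ^- 2 - 1) * a by lra.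
  rewrite -(ler_pM2r k2) (_ : (k ^- 2 - 1) * a * k ^+ 2 = a * (1 - k) * (1 + k))//.
  by field; rewrite lt0r_neq0.
(* [k = 1 + e] refutes [a > 1/2] and [k = 1 - e] refutes [a < 1/2], where [e] is at most the
   distance from [a] to [1/2]. *)
have : a = 2^-1.
  apply/eqP; rewrite eq_le; apply/andP; split; rewrite leNgt; apply/negP => h.
    pose e := Num.min 1 ((a - 2^-1)); have e0 : 0 < e by rewrite lt_min ltr01 subr_gt0.
    have e1 : e <= 1 by rewrite ge_min lexx.
    have ea : e <= a - 2^-1 by rewrite ge_min lexx orbT.
    have := key' (1 + e) (addr_gt0 ltr01 e0).
    nra.
  pose e := Num.min 2^-1 (2^-1 - a); have e0 : 0 < e by rewrite lt_min invr_gt0 ltr0n/= subr_gt0.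
  have e1 : e <= 2^-1 by rewrite ge_min lexx.
  have ea : e <= 2^-1 - a by rewrite ge_min lexx orbT.
  have ke : 0 < 1 - e by lra.
  have k1 := key' (1 - e) ke.
  have : (1 - e) ^+ 2 <= a * (2 - e) by rewrite -(ler_pM2l e0); lra.
  have : 0 <= (2^-1 - e - a) * (2 - e) by apply: mulr_ge0; lra.
  nra.
rewrite /a => /(congr1 (fun z => z * (2 * s ^+ 2))); rewrite divfK ?lt0r_neq0//; last by rewrite mulr_gt0.
by move=> ->; rewrite mulKf.
Qed.

Lemma gauss_pow4 (s : R) : 0 < s -> L1 (gauss s) (fun y : RT => y ^+ 4) /\
  Ex (gauss s) (fun y => y ^+ 4) <= 16 * s ^+ 4.
Proof.
(* The second moment at scale [sqrt 2 * s] is [2 * s ^+ 2], whence [8 * 2 = 16]. *)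
move=> s0; have [] := @gauss_mono_bound s 1 (2 * s ^+ 2) s0 _.
  move=> t t0 tE; rewrite Ex_EFin; last exact: (L1_gauss_sqr t0).
  by rewrite (Ex_gauss_sqr t0) lee_fin tE exprMn sqr_sqrtr.
by move=> l h; split => //; apply: (le_trans h); rewrite le_eqVlt; apply/orP; left; apply/eqP; ring.
Qed.

Lemma Ex_gauss_id (s : R) : 0 < s -> Ex (gauss s) (fun y : RT => y) = 0.
Proof.
move=> s0; have l2 : L2 (gauss s) (fun y : RT => y).
  by split; [exact: measurable_id|exact: L1_gauss_sqr].
have := Ex_mp (mpres_gaussN (lt0r_neq0 s0)) (L2_meas l2).
have -> : Ex (gauss s) (fun x : RT => - x) = - Ex (gauss s) (fun x : RT => x).
  rewrite -mulN1r -ExZ; last exact: L2_L1.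
  by apply: Ex_eq => x; rewrite mulN1r.
lra.
Qed.

End Gaussian.

(** * Smooth test functions and the central limit theorem *)

Section Taylor.
Context {R : realType}.
Local Notation RT := (measurableTypeR R).

(** Taylor's remainder is cubic for small increments and quadratic for large ones. Keeping the
    minimum allows Lindeberg's method under second moments alone. *)
Definition rho (y : R) : R := Num.min (y ^+ 2) (`|y| ^+ 3).

(* Test functions for the Lindeberg method: [f1], [f2] play the role of the first two
   derivatives of [f], and one remainder bound serves both as second and as third order. *)
Definition TC (M : R) (f f1 f2 : R -> R) :=
  [/\ [/\ measurable_fun setT f, measurable_fun setT f1 & measurable_fun setT f2],
      forall x, [/\ `|f x| <= M, `|f1 x| <= M & `|f2 x| <= M] &
      forall x y, `|f (x + y) - f x - f1 x * y - f2 x * y ^+ 2 / 2| <= M * rho y].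

Lemma rho_ge0 y : 0 <= rho y.
Proof. by rewrite le_min sqr_ge0 exprn_ge0. Qed.

Lemma rho_sqr y : rho y <= y ^+ 2.
Proof. by rewrite ge_min lexx. Qed.

Lemma rho_cube y : rho y <= `|y| ^+ 3.
Proof. by rewrite ge_min lexx orbT. Qed.

(** The arithmetic-geometric inequality between [t y^2] and [y^4 / t]. Second and fourth moments of
    independent sums can be expanded, third absolute moments cannot. *)
Lemma rho_pow4 (t y : R) : 0 < t -> rho y <= t * y ^+ 2 / 2 + y ^+ 4 / t / 2.
Proof.
move=> t0; apply: le_trans (rho_cube y) _.
have -> : y ^+ 2 = `|y| ^+ 2 by rewrite real_normK// num_real.
have -> : y ^+ 4 = `|y| ^+ 4 by rewrite (exprM _ 2 2) (exprM _ 2 2) real_normK// num_real.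
have z0 : 0 <= `|y| by exact: normr_ge0.
move: z0; set z := `|y| => z0.
rewrite -subr_ge0 (_ : _ - _ = z ^+ 2 / t / 2 * (z - t) ^+ 2); last by field; rewrite lt0r_neq0.
by apply: mulr_ge0; [rewrite !divr_ge0 ?sqr_ge0//; exact: ltW|exact: sqr_ge0].
Qed.

Lemma measurable_rho : measurable_fun setT rho.
Proof.
apply: measurable_minr; first exact: measurable_funX.
by apply: measurable_funX; exact: normr_measurable.
Qed.

Lemma TC_ge0 M f f1 f2 : TC M f f1 f2 -> 0 <= M.
Proof. by case=> _ /(_ 0)[+ _ _] _; exact: le_trans. Qed.

(** [f1] is tied to [f] only by the remainder bound, so the Lipschitz property is read off from it
    when [|y| <= 1]; for larger [|y|] boundedness of [f] suffices. *)
Lemma TC_lip M f f1 f2 x y : TC M f f1 f2 -> `|f (x + y) - f x| <= 4 * M * `|y|.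
Proof.
move=> h; have M0 := TC_ge0 h; case: h => _ b r.
have [fx f1x f2x] := b x; have [fy _ _] := b (x + y).
have [y1|y1] := leP `|y| 1; last first.
  have : `|f (x + y) - f x| <= M + M by rewrite (le_trans (ler_normB _ _))// lerD.
  nra.
have -> : f (x + y) - f x = (f (x + y) - f x - f1 x * y - f2 x * y ^+ 2 / 2) +
   (f1 x * y + f2 x * y ^+ 2 / 2) by ring.
apply: (le_trans (ler_normD _ _)); have := r x y; have := rho_sqr y.
have -> : y ^+ 2 = `|y| ^+ 2 by rewrite real_normK// num_real.
move=> rs ry.
have : `|f1 x * y + f2 x * `|y| ^+ 2 / 2| <= M * `|y| + M * `|y| ^+ 2 / 2.
  rewrite (le_trans (ler_normD _ _))// lerD//; first by rewrite normrM ler_wpM2r.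
  rewrite normrM normfV (ger0_norm (ler0n _ 2)) ler_wpM2r ?invr_ge0// normrM normrX normr_id.
  by rewrite ler_wpM2r// exprn_ge0.
have : M * rho y <= M * `|y| ^+ 2 by rewrite ler_wpM2l.
move: ry; have y0 : 0 <= `|y| by exact: normr_ge0.
have : 0 <= M * (`|y| * (1 - `|y|)) by rewrite !mulr_ge0// subr_ge0.
have : 0 <= M * `|y| by rewrite mulr_ge0.
move: (`|y|) y0 y1 => z z0 z1; rewrite !expr2; lra.
Qed.

Section Step.
Context {d : measure_display} {T : measurableType d}.
Variable Q : probability T R.

Lemma L1_rho (u : T -> R) : L2 Q u -> L1 Q (fun x => rho (u x)).
Proof.
move=> lu; apply: (L1_le _ (L2_sqr lu)).
  exact: (measurableT_comp measurable_rho (L2_meas lu)).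
by move=> x; rewrite ger0_norm ?rho_ge0// rho_sqr.
Qed.

Lemma L1_TC M f f1 f2 (a : R) (u : T -> R) : TC M f f1 f2 -> measurable_fun setT u ->
  L1 Q (fun x => f (a + u x)).
Proof.
move=> [[mf _ _] b _] mu; apply: (@L1_bdd _ _ _ _ _ M).
  by apply: (measurableT_comp mf); exact: measurable_funD.
by move=> x; case: (b (a + u x)).
Qed.

(** A centred increment kills the first-order term. In the applications [a] collects everything that
    has been frozen. *)
Lemma taylor_step M f f1 f2 (a : R) (u : T -> R) : TC M f f1 f2 -> L2 Q u -> Ex Q u = 0 ->
  `|Ex Q (fun x => f (a + u x)) - f a - f2 a / 2 * Ex Q (fun x => u x ^+ 2)| <=
  M * Ex Q (fun x => rho (u x)).
Proof.
move=> tc lu u0; have l0 := L1_TC a tc (L2_meas lu).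
have l1 := L1Z (f1 a) (L2_L1 lu); have l2 := L1Z (f2 a / 2) (L2_sqr lu).
have lc := L1_cst Q (f a).
have -> : Ex Q (fun x => f (a + u x)) - f a - f2 a / 2 * Ex Q (fun x => u x ^+ 2) =
    Ex Q (fun x => f (a + u x) - f a - f1 a * u x - f2 a / 2 * u x ^+ 2).
  rewrite (ExB (L1B (L1B l0 lc) l1) l2) (ExB (L1B l0 lc) l1) (ExB l0 lc) Ex_cst.
  by rewrite (ExZ _ (L2_L1 lu)) u0 mulr0 subr0 (ExZ _ (L2_sqr lu)).
apply: (le_trans (Ex_abs (L1B (L1B (L1B l0 lc) l1) l2))).
rewrite -ExZ; last exact: L1_rho.
apply: Ex_le; [exact: (L1_norm (L1B (L1B (L1B l0 lc) l1) l2))|exact/L1Z/L1_rho|].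
move=> x; case: tc => _ _ /(_ a (u x)); congr (`|_ - _| <= _); ring.
Qed.

(** The class is stable under convolution with the same constant, so a replacement argument may
    smooth the test function at every step without loss. *)
Lemma TC_avg M f f1 f2 (v : T -> R) : TC M f f1 f2 -> measurable_fun setT v ->
  TC M (fun a => Ex Q (fun x => f (a + v x))) (fun a => Ex Q (fun x => f1 (a + v x)))
    (fun a => Ex Q (fun x => f2 (a + v x))).
Proof.
move=> [[mf mf1 mf2] b r] mv.
have m (g : R -> R) a : measurable_fun setT g -> measurable_fun setT (fun x => g (a + v x)).
  by move=> mg; apply: (measurableT_comp mg); exact: measurable_funD.
have l (g : R -> R) a : measurable_fun setT g -> (forall x, `|g x| <= M) -> L1 Q (fun x => g (a + v x)).
  by move=> mg gM; apply: (@L1_bdd _ _ _ _ _ M) => //; exact: m.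
have mm (g : R -> R) : measurable_fun setT g -> (forall x, `|g x| <= M) ->
    measurable_fun setT (fun a : RT => Ex Q (fun x => g (a + v x))).
  move=> mg gM.
  (* Any probability on the line would serve: [gauss 1] only makes measurability in [a] an instance
     of Fubini. *)
  apply: (@meas_fubini _ _ _ _ _ (gauss 1) Q (fun z : RT * T => g (z.1 + v z.2))).
  apply: (@L1_bdd _ _ _ _ _ M) => [|z]; last exact: gM.
  apply: (measurableT_comp mg); apply: measurable_funD => //.
  exact: (measurableT_comp mv measurable_snd).
have bf x : `|f x| <= M by case: (b x).
have bf1 x : `|f1 x| <= M by case: (b x).
have bf2 x : `|f2 x| <= M by case: (b x).
split; first by split; exact: mm.
  by move=> a; split; apply: Ex_le_bdd => //; exact: l.
move=> a y.
have l0 := l f (a + y) mf bf; have l0' := l f a mf bf; have l1 := L1Z y (l f1 a mf1 bf1).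
have l2 := L1Z (y ^+ 2 / 2) (l f2 a mf2 bf2).
have -> : Ex Q (fun x => f (a + y + v x)) - Ex Q (fun x => f (a + v x)) -
     Ex Q (fun x => f1 (a + v x)) * y - Ex Q (fun x => f2 (a + v x)) * y ^+ 2 / 2 =
   Ex Q (fun x => f (a + y + v x) - f (a + v x) - y * f1 (a + v x) - y ^+ 2 / 2 * f2 (a + v x)).
  rewrite (ExB (L1B (L1B l0 l0') l1) l2) (ExB (L1B l0 l0') l1) (ExB l0 l0').
  rewrite (ExZ _ (l f1 a mf1 bf1)) (ExZ _ (l f2 a mf2 bf2)); ring.
apply: Ex_le_bdd; first exact: (L1B (L1B (L1B l0 l0') l1) l2).
move=> x; have := r (a + v x) y.
rewrite (_ : a + v x + y = a + y + v x); last ring.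
congr (`|_ - _ - _| <= _); ring.
Qed.

End Step.

(** Gaussian smoothing with standard deviation [s]. The case [s = 0] is set apart to mean no
    smoothing at all. *)
Definition gav (s : R) (f : R -> R) (a : R) : R :=
  if s == 0 then f a else Ex (gauss s) (fun y : RT => f (a + y)).

Lemma gav0 f : gav 0 f = f.
Proof. by apply/funext => a; rewrite /gav eqxx. Qed.

Lemma gavE s f : s != 0 -> gav s f = fun a => Ex (gauss s) (fun y : RT => f (a + y)).
Proof. by move=> s0; apply/funext => a; rewrite /gav (negbTE s0). Qed.

Lemma TC_gav M f f1 f2 s : TC M f f1 f2 -> TC M (gav s f) (gav s f1) (gav s f2).
Proof.
have [->|s0] := eqVneq s 0; first by rewrite !gav0.
rewrite !(gavE _ s0) => tc.
exact: (@TC_avg _ _ (gauss s) M f f1 f2 (fun y : RT => y) tc).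
Qed.

Lemma gavD M f f1 f2 s t a : TC M f f1 f2 -> 0 <= s -> 0 <= t ->
  gav s (gav t f) a = gav (Num.sqrt (s ^+ 2 + t ^+ 2)) f a.
Proof.
move=> tc s0 t0; have [s00|s00] := eqVneq s 0.
  by rewrite s00 gav0 expr0n add0r sqrtr_sqr ger0_norm.
have [t00|t00] := eqVneq t 0.
  by rewrite t00 gav0 expr0n addr0 sqrtr_sqr ger0_norm.
have {}s0 : 0 < s by rewrite lt_neqAle eq_sym s00.
have {}t0 : 0 < t by rewrite lt_neqAle eq_sym t00.
have r0 : 0 < Num.sqrt (s ^+ 2 + t ^+ 2) by rewrite sqrtr_gt0; nra.
rewrite (gavE _ s00) (gavE _ t00) (gavE _ (lt0r_neq0 r0)).
have [[mf _ _] b _] := tc.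
have mfa : measurable_fun setT (fun y : RT => f (a + y)).
  by apply: (measurableT_comp mf); exact: measurable_funD.
rewrite [RHS](Ex_mp (mpres_gauss_add s0 t0) mfa) Ex_fubini; last first.
  apply: (@L1_bdd _ _ _ _ _ M).
    by apply: (measurableT_comp mfa); exact: measurable_funD.
  by move=> z; case: (b (a + (z.1 + z.2))).
by apply: Ex_eq => x; apply: Ex_eq => y; rewrite addrA.
Qed.

(** [rho_pow4] with parameter [s] and the moments [s ^+ 2] and at most [16 * s ^+ 4] give
    [s ^+ 3 / 2 + 8 * s ^+ 3], rounded up to 9. *)
Lemma taylor_gav M f f1 f2 s a : TC M f f1 f2 -> 0 <= s ->
  `|gav s f a - f a - f2 a / 2 * s ^+ 2| <= M * (9 * s ^+ 3).
Proof.
move=> tc s0; have [->|s00] := eqVneq s 0.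
  by rewrite gav0 !expr0n/= !mulr0 subrr subr0 normr0.
have {}s0 : 0 < s by rewrite lt_neqAle eq_sym s00.
rewrite (gavE _ s00); have l2 : L2 (gauss s) (fun y : RT => y) by split; [exact: measurable_id|exact: L1_gauss_sqr].
have := taylor_step a tc l2 (Ex_gauss_id s0); rewrite (Ex_gauss_sqr s0) => h.
apply: (le_trans h); rewrite ler_wpM2l ?(TC_ge0 tc)//.
have [l4 e4] := gauss_pow4 s0; have q2 := L2_sqr l2.
apply: (@le_trans _ _ (Ex (gauss s) (fun y : RT => s / 2 * y ^+ 2 + (s^-1 / 2) * y ^+ 4))).
  apply: Ex_le; [exact: L1_rho|by apply: L1D; exact: L1Z|].
  move=> y; apply: (le_trans (rho_pow4 y s0)).
  by rewrite le_eqVlt; apply/orP; left; apply/eqP; field; rewrite lt0r_neq0.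
rewrite ExD; [|exact: L1Z..]; rewrite !ExZ// (Ex_gauss_sqr s0).
have : s^-1 / 2 * Ex (gauss s) (fun x : RT => x ^+ 4) <= s^-1 / 2 * (16 * s ^+ 4).
  by rewrite ler_wpM2l// divr_ge0// invr_ge0 ltW.
have -> : s^-1 / 2 * (16 * s ^+ 4) = 8 * s ^+ 3 by field; rewrite lt0r_neq0.
have : 0 < s ^+ 3 by rewrite exprn_gt0.
have -> : s / 2 * s ^+ 2 = s ^+ 3 / 2 by ring.
lra.
Qed.

End Taylor.

(** * Lindeberg replacement of independent summands by Gaussians *)

Section Lindeberg.
Context {R : realType} {d : measure_display} {E : measurableType d}.
Variables (mu : probability E R) (Q : probability (seqspace E nat) R).
Hypothesis iQ : iid_law mu Q.
Local Notation T := (seqspace E nat).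

(** Induction on the number of terms. The last summand is replaced by a Gaussian of equal variance,
    which is absorbed at once into the test function as [gav (sig n) f]; no Gaussian variable has to
    live on the sample space. *)
Lemma lindeberg_gauss (w : nat -> E -> R) (sig : nat -> R) :
  (forall i, L2 mu (w i)) -> (forall i, Ex mu (w i) = 0) -> (forall i, 0 <= sig i) ->
  (forall i, Ex mu (fun z => w i z ^+ 2) = sig i ^+ 2) ->
  forall n M f f1 f2, TC M f f1 f2 ->
  `|Ex Q (fun x : T => f (\sum_(i < n) w i (x i))) -
    gav (Num.sqrt (\sum_(i < n) sig i ^+ 2)) f 0| <=
  M * \sum_(i < n) (Ex mu (fun z => rho (w i z)) + 9 * sig i ^+ 3).
Proof.
move=> lw w0 sig0 wsig; have mpc i := mpres_coord iQ i.
pose S n (x : T) := \sum_(i < n) w i (x i).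
have mS n : measurable_fun setT (S n).
  apply: measurable_sum => i.
  exact: (meas_mp (mpc i) (L2_meas (lw i))).
elim=> [|n ih] M f f1 f2 tc.
  rewrite !big_ord0 sqrtr0 mulr0 gav0.
  rewrite (@Ex_eq _ _ _ _ _ (fun=> f 0)) ?Ex_cst ?subrr ?normr0//.
  by move=> x; rewrite big_ord0.
have lwn := L2_mp (mpc n) (lw n).
set r := Ex mu (fun z => rho (w n z)) + 9 * sig n ^+ 3.
have lS : L1 Q (fun x : T => f (S n x + w n (x n))).
  have [[mf _ _] b _] := tc; apply: (@L1_bdd _ _ _ _ _ M).
    by apply: (measurableT_comp mf); apply: measurable_funD => //; exact: L2_meas lwn.
  by move=> x; case: (b (S n x + w n (x n))).
have -> : Ex Q (fun x : T => f (\sum_(i < n.+1) w i (x i))) =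
   Ex Q (fun x : T => Ex Q (fun y : T => f (S n x + w n (y n)))).
  transitivity (Ex Q (fun x : T => f (S n x + w n (x n)))).
    by apply: Ex_eq => x; rewrite big_ord_recr.
  (* Only coordinate [n] is resampled, so the last summand is integrated against a frozen partial
     sum. *)
  rewrite (Ex_mix iQ (fun i => i != n) lS); apply: Ex_eq => x; apply: Ex_eq => y.
  congr (f (_ + _)); last by rewrite /mix eqxx.
  by apply: eq_bigr => i _; rewrite /mix ltn_eqF.
have tcg := TC_gav (sig n) tc.
have step x : `|Ex Q (fun y : T => f (S n x + w n (y n))) - gav (sig n) f (S n x)| <= M * r.
  have h1 := taylor_gav (S n x) tc (sig0 n).
  have z0 : Ex Q (fun y : T => w n (y n)) = 0.
    by rewrite -(Ex_mp (mpc n) (L2_meas (lw n))).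
  have := taylor_step (S n x) tc lwn z0.
  rewrite -(Ex_mp (mpc n) (measurable_sqr (L2_meas (lw n)))) wsig.
  rewrite -(Ex_mp (mpc n) (measurableT_comp measurable_rho (L2_meas (lw n)))).
  rewrite /r; move: h1; rewrite !ler_norml => /andP[h1 h2] /andP[h3 h4].
  by rewrite mulrDr; apply/andP; split; lra.
have lav : L1 Q (fun x : T => Ex Q (fun y : T => f (S n x + w n (y n)))).
  have [[mf _ _] b _] := tc; apply: (@L1_fubini _ _ _ _ _ Q Q (fun z : T * T => f (S n z.1 + w n (z.2 n)))).
  apply: (@L1_bdd _ _ _ _ _ M).
    apply: (measurableT_comp mf); apply: measurable_funD.
      exact: (measurableT_comp (mS n) measurable_fst).
    exact: (measurableT_comp (L2_meas lwn) measurable_snd).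
  by move=> z; case: (b (S n z.1 + w n (z.2 n))).
have lgav : L1 Q (fun x : T => gav (sig n) f (S n x)).
  have := L1_TC Q 0 tcg (mS n); apply: L1_eq => x; by rewrite add0r.
have := ih _ _ _ _ tcg.
rewrite (gavD _ tc) ?sqrtr_ge0//.
rewrite sqr_sqrtr; last by apply: sumr_ge0 => i _; exact: sqr_ge0.
rewrite -(@big_ord_recr _ _ _ n (fun i => sig i ^+ 2)).
rewrite [X in _ -> _ <= M * X]big_ord_recr mulrDr -/r => {}ih.
have : `|Ex Q (fun x : T => Ex Q (fun y : T => f (S n x + w n (y n)))) - Ex Q (fun x : T => gav (sig n) f (S n x))| <= M * r.
  by rewrite -ExB//; apply: Ex_le_bdd => //; exact: L1B.
move: ih; rewrite !ler_norml => /andP[h1 h2] /andP[h3 h4].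
by apply/andP; split; rewrite /S in h1 h2 h3 h4 *; lra.
Qed.

End Lindeberg.

(** * Quadratic forms and replacement of a block *)

Section IndependentSums.
Context {R : realType} {d : measure_display} {E : measurableType d}.
Variables (mu : probability E R) (Q : probability (seqspace E nat) R).
Hypothesis iQ : iid_law mu Q.
Local Notation T := (seqspace E nat).

Lemma Ex_indep (F : T -> R) (g : E -> R) r : L1 Q F -> L1 mu g ->
  L1 Q (fun x => F x * g (x r)) -> dep (fun i => i != r) F ->
  Ex Q (fun x => F x * g (x r)) = Ex Q F * Ex mu g.
Proof.
move=> lF lg lFg dF; have mpr := mpres_coord iQ r.
rewrite (Ex_mix iQ (fun i => i != r) lFg).
rewrite [RHS]mulrC -(ExZ _ lF); apply: Ex_eq => x.
rewrite (Ex_mp mpr (L1_meas lg)) mulrC -(ExZ _ (L1_mp mpr lg)).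
apply: Ex_eq => y; congr (_ * _); last by rewrite /mix eqxx.
by apply: dF => i ir; rewrite /mix ir.
Qed.

Variables (phi : nat -> E -> R) (B : nat -> R).
Hypotheses (mphi : forall q, measurable_fun setT (phi q))
  (Bphi : forall q z, `|phi q z| <= B q) (phi0 : forall q, Ex mu (phi q) = 0).

Let S n (x : T) := \sum_(q < n) phi q (x q).

Let mS n : measurable_fun setT (S n).
Proof.
by apply: measurable_sum => i; exact: (meas_mp (mpres_coord iQ i) (mphi i)).
Qed.

Let Sbdd n x : `|S n x| <= \sum_(q < n) B q.
Proof. by apply: le_trans (ler_norm_sum _ _ _) _; apply: ler_sum. Qed.

Let Sdep n : dep (fun i => i != n) (S n).
Proof. by move=> x y xy; apply: eq_bigr => i _; rewrite xy// ltn_eqF. Qed.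

Lemma bdd_pow (T' : Type) (F : T' -> R) k M x : (forall x, `|F x| <= M) -> `|F x ^+ k| <= M ^+ k.
Proof. by move=> h; rewrite normrX lerXn2r// nnegrE// (le_trans _ (h x)). Qed.

Let lphi q k : L1 mu (fun z => phi q z ^+ k).
Proof.
apply: (@L1_bdd _ _ _ _ _ (B q ^+ k)); first exact: measurable_funX.
by move=> x; apply: bdd_pow.
Qed.

Let lS n k q l : L1 Q (fun x => S n x ^+ k * phi q (x q) ^+ l).
Proof.
apply: (@L1_bdd _ _ _ _ _ ((\sum_(q < n) B q) ^+ k * B q ^+ l)).
  apply: measurable_funM; apply: measurable_funX => //.
  exact: (meas_mp (mpres_coord iQ q) (mphi q)).
by move=> x; rewrite normrM ler_pM// bdd_pow.
Qed.

Let lS1 n k : L1 Q (fun x => S n x ^+ k).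
Proof. by apply: L1_eq (lS n k 0 0) => x; rewrite expr0 mulr1. Qed.

Let Ex_Sphi n k l : Ex Q (fun x => S n x ^+ k * phi n (x n) ^+ l) =
  Ex Q (fun x => S n x ^+ k) * Ex mu (fun z => phi n z ^+ l).
Proof.
apply: (@Ex_indep _ (fun z => phi n z ^+ l)); [exact: lS1|exact: lphi|exact: lS|].
by move=> x y xy; rewrite (Sdep xy).
Qed.

Lemma Ex_sum_sqr n : Ex Q (fun x => (\sum_(q < n) phi q (x q)) ^+ 2) =
  \sum_(q < n) Ex mu (fun z => phi q z ^+ 2).
Proof.
elim: n => [|n ih].
  rewrite big_ord0 -[RHS](Ex_cst Q); apply: Ex_eq => x; by rewrite big_ord0 expr0n.
rewrite big_ord_recr/= -ih.
transitivity (Ex Q (fun x => S n x ^+ 2 + 2 * (S n x ^+ 1 * phi n (x n) ^+ 1) + S n x ^+ 0 * phi n (x n) ^+ 2)).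
  by apply: Ex_eq => x; rewrite big_ord_recr/= -/(S n x); ring.
rewrite (ExD (L1D (lS1 n 2) (L1Z 2 (lS n 1 n 1))) (lS n 0 n 2)).
rewrite (ExD (lS1 n 2) (L1Z 2 (lS n 1 n 1))) (ExZ _ (lS n 1 n 1)) !Ex_Sphi.
by rewrite (_ : Ex mu (fun z => phi n z ^+ 1) = 0) ?mulr0 ?addr0 ?Ex_cst ?mul1r//; exact: phi0.
Qed.

(** In the expansion of [(S + phi)^4] the terms [S^3 phi] and [S phi^3] vanish, since [phi] and [S]
    are independent and centred. The induction closes by [3 s^2 + 6 s t + t^2 <= 3 (s + t)^2]. *)
Lemma Ex_sum_pow4 (D : nat -> R) n : (forall q, 0 <= D q) ->
  (forall q, Ex mu (fun z => phi q z ^+ 4) <= D q ^+ 2) ->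
  Ex Q (fun x => (\sum_(q < n) phi q (x q)) ^+ 4) <= 3 * (\sum_(q < n) D q) ^+ 2.
Proof.
move=> D0 hD.
have h2 q : Ex mu (fun z => phi q z ^+ 2) <= D q.
  rewrite -(ler_sqr (x := Ex _ _)) ?nnegrE ?Ex_sqr_ge0//; apply: le_trans (hD q).
  have l2 : L2 mu (fun z => phi q z ^+ 2).
    split; first exact: measurable_funX.
    by apply: L1_eq (lphi q 4) => z; rewrite -exprM.
  apply: le_trans (Ex_sqr_jensen l2) _.
  by rewrite le_eqVlt; apply/orP; left; apply/eqP/Ex_eq => z; rewrite -exprM.
have e2 n' : Ex Q (fun x => S n' x ^+ 2) <= \sum_(q < n') D q.
  by rewrite Ex_sum_sqr; apply: ler_sum => i _; exact: h2.
elim: n => [|n ih].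
  rewrite big_ord0 expr0n/= mulr0 (_ : Ex _ _ = 0)// -[RHS](Ex_cst Q).
  by apply: Ex_eq => x; rewrite big_ord0 expr0n.
rewrite big_ord_recr/=.
rewrite (_ : Ex _ _ = Ex Q (fun x => S n x ^+ 4) + 6 * (Ex Q (fun x => S n x ^+ 2) *
   Ex mu (fun z => phi n z ^+ 2)) + Ex mu (fun z => phi n z ^+ 4)).
  have := ih; rewrite -/(S n).
  have := e2 n; have := h2 n; have := hD n; have := D0 n.
  have := Ex_sqr_ge0 Q (S n); have := Ex_sqr_ge0 mu (phi n).
  rewrite -/(S n); set a := Ex _ _; set b := Ex _ _; set c := Ex _ _; set e := Ex _ _.
  set s := \sum_(q < n) _; set t := D n => a0 b0 t0 ct at_ bs es.
  have : b * a <= s * t by apply: ler_pM.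
  nra.
transitivity (Ex Q (fun x => S n x ^+ 4 + 4 * (S n x ^+ 3 * phi n (x n) ^+ 1) +
   6 * (S n x ^+ 2 * phi n (x n) ^+ 2) + 4 * (S n x ^+ 1 * phi n (x n) ^+ 3) + S n x ^+ 0 * phi n (x n) ^+ 4)).
  by apply: Ex_eq => x; rewrite big_ord_recr/= -/(S n x); ring.
have l1 := L1D (lS1 n 4) (L1Z 4 (lS n 3 n 1)); have l2 := L1D l1 (L1Z 6 (lS n 2 n 2)).
have l3 := L1D l2 (L1Z 4 (lS n 1 n 3)).
rewrite (ExD l3 (lS n 0 n 4)) (ExD l2 (L1Z 4 (lS n 1 n 3))) (ExD l1 (L1Z 6 (lS n 2 n 2))).
rewrite (ExD (lS1 n 4) (L1Z 4 (lS n 3 n 1))) (ExZ _ (lS n 3 n 1)) (ExZ _ (lS n 2 n 2)) (ExZ _ (lS n 1 n 3)).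
rewrite !Ex_Sphi (_ : Ex mu (fun z => phi n z ^+ 1) = 0); last exact: phi0.
have -> : Ex Q (fun x => S n x ^+ 1) = 0.
  rewrite /S Ex_sum; last first.
    by move=> i _; apply: L1_eq (L1_mp (mpres_coord iQ i) (lphi i 1)) => x.
  apply: big1 => i _; rewrite -(Ex_mp (mpres_coord iQ i)); first exact: phi0.
  by have := mphi i.
by rewrite !mulr0 mul0r mulr0 !addr0 Ex_cst mul1r.
Qed.

End IndependentSums.

(** * Changing the weights inside one block of a quadratic form *)

Section BlockSwap.
Context {R : realType} {d : measure_display} {E : measurableType d}.
Variables (mu : probability E R) (Q : probability (seqspace E nat) R).
Hypothesis iQ : iid_law mu Q.
Local Notation T := (seqspace E nat).
Variables (kap : nat -> nat -> E * E -> R) (b : R) (blk : nat -> nat) (N : nat).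
Hypotheses (mk : forall i j, measurable_fun setT (kap i j))
  (kb : forall i j z, `|kap i j z| <= b)
  (ksym : forall i j y z, kap i j (y, z) = kap j i (z, y))
  (kdiag : forall i z, kap i i z = 0)
  (kdeg : forall i j y, Ex mu (fun z => kap i j (y, z)) = 0).

(** The kernel sees observations only through their values and their blocks, and vanishes for two
    observations of one block; the form is thus affine in the kernel contributions of each single
    block. *)
Definition qform (a : nat -> R) (x : T) : R :=
  \sum_(q < N) \sum_(q' < N) a q * a q' * kap (blk q) (blk q') (x q, x q').

Section Swap.
Variables (j r : nat).
Hypothesis blkr : blk r = j.

Let Lf (a : nat -> R) (x : T) (z : E) : R :=
  \sum_(q < N) (if blk q == j then 0 else a q * kap j (blk q) (z, x q)).

Let Af (a : nat -> R) (x : T) : R :=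
  \sum_(q < N | blk q != j) \sum_(q' < N | blk q' != j)
    a q * a q' * kap (blk q) (blk q') (x q, x q').

(** [Af] does not involve block [j]; by symmetry of the kernel the pairs with exactly one index in
    [j] are counted twice, and pairs with both indices in [j] contribute nothing. *)
Let qform_split a x : qform a x = Af a x +
  2 * \sum_(q < N) (if blk q == j then a q * Lf a x (x q) else 0).
Proof.
rewrite /qform (bigID (fun q : 'I_N => blk q != j))/=.
pose D1 := \sum_(q < N | blk q != j) \sum_(q' < N | blk q' == j)
    a q * a q' * kap (blk q) (blk q') (x q, x q').
pose D2 := \sum_(q < N | ~~ (blk q != j)) \sum_(q' < N)
    a q * a q' * kap (blk q) (blk q') (x q, x q').
have e2 : D2 = \sum_(q < N) (if blk q == j then a q * Lf a x (x q) else 0).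
  rewrite -[RHS]big_mkcond/= /D2; apply: eq_big => [q|q]; first by rewrite negbK.
  rewrite negbK => /eqP qj; rewrite /Lf mulr_sumr; apply: eq_bigr => q' _.
  rewrite qj; case: ifP => [/eqP ->|_]; first by rewrite kdiag !mulr0.
  by rewrite mulrA.
have e1 : D1 = D2.
  rewrite /D1 /D2 exchange_big/=; apply: eq_big => [q|q]; first by rewrite negbK.
  move=> /eqP qj; rewrite [RHS](bigID (fun q' : 'I_N => blk q' != j))/=.
  rewrite [X in _ = _ + X]big1 ?addr0; last first.
    by move=> q'; rewrite negbK => /eqP q'j; rewrite qj q'j kdiag mulr0.
  by apply: eq_bigr => q' _; rewrite ksym [a q' * _]mulrC.
rewrite -/D2 -e2 mulrDl mul1r addrA; congr (_ + _).
rewrite -{1}e1 /Af /D1 -big_split/=; apply: eq_bigr => q _.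
rewrite (bigID (fun q' : 'I_N => blk q' != j))/=; congr (_ + _).
by apply: eq_bigl => q'; rewrite negbK.
Qed.

Let b0 : 0 <= b.
Proof. exact: le_trans (kb 0 0 point). Qed.

Let mkap i i' (u v : T -> E) : measurable_fun setT u -> measurable_fun setT v ->
  measurable_fun setT (fun x => kap i i' (u x, v x)).
Proof. by move=> mu' mv; apply: (measurableT_comp (mk i i')); exact: measurable_fun_pair. Qed.

Let mkz i i' (z : E) : measurable_fun setT (fun y => kap i i' (z, y)).
Proof. by apply: (measurableT_comp (mk i i')); exact: measurable_pair1. Qed.

Let mkz' i i' (z : E) : measurable_fun setT (fun y => kap i i' (y, z)).
Proof. by apply: (measurableT_comp (mk i i')); exact: measurable_pair2. Qed.

Let mLz a x : measurable_fun setT (Lf a x).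
Proof.
apply: measurable_sum => q; case: (blk q == j); first exact: measurable_cst.
by apply: measurable_funM => //; exact: mkz'.
Qed.

Let Lbdd a x z : `|Lf a x z| <= \sum_(q < N) `|a q| * b.
Proof.
apply: le_trans (ler_norm_sum _ _ _) _; apply: ler_sum => q _.
case: ifP => _; first by rewrite normr0 mulr_ge0.
by rewrite normrM ler_wpM2l.
Qed.

Let Ldep a x y z : (forall q, blk q != j -> x q = y q) -> Lf a x z = Lf a y z.
Proof.
by move=> xy; apply: eq_bigr => q _; case: ifPn => // /xy ->.
Qed.

Let Adep a : dep (fun q => blk q != j) (Af a).
Proof.
by move=> x y xy; apply: eq_bigr => q qj; apply: eq_bigr => q' q'j; rewrite !xy.
Qed.

Let L0 a x : Ex mu (Lf a x) = 0.
Proof.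
rewrite /Lf Ex_sum; last first.
  move=> q _; apply: (@L1_bdd _ _ _ _ _ (`|a q| * b)).
    by case: (blk q == j); [exact: measurable_cst|apply: measurable_funM => //; exact: mkz'].
  by move=> z; case: ifP => _; rewrite ?normr0 ?mulr_ge0// normrM ler_wpM2l.
apply: big1 => q _; case: (blk q == j); first exact: Ex_cst.
rewrite ExZ; last by apply: (@L1_bdd _ _ _ _ _ b) => //; exact: mkz'.
by under Ex_eq do rewrite ksym; rewrite kdeg mulr0.
Qed.

Let sig (a : nat -> R) : R := \sum_(q < N) (if blk q == j then 0 else a q ^+ 2).

Let mLx a : measurable_fun setT (fun x : T => Lf a x (x r)).
Proof.
apply: measurable_sum => q; case: (blk q == j); first exact: measurable_cst.
by apply: measurable_funM => //; apply: mkap; exact: measurable_coord.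
Qed.

(** As [Lf] ignores block [j], its argument may be the observation [x r] of that block. Integrating
    the other coordinates first, for a fixed argument, leaves a sum of independent centred terms. *)
Let ExLpow a k : Ex Q (fun x : T => Ex mu (fun z => Lf a x z ^+ k)) =
  Ex Q (fun x : T => Ex Q (fun y : T => Lf a y (x r) ^+ k)).
Proof.
have l : L1 Q (fun x : T => Lf a x (x r) ^+ k).
  apply: (@L1_bdd _ _ _ _ _ ((\sum_(q < N) `|a q| * b) ^+ k)); first exact: measurable_funX.
  by move=> x; rewrite normrX lerXn2r// nnegrE// (le_trans _ (Lbdd a x point)).
transitivity (Ex Q (fun x : T => Lf a x (x r) ^+ k)).
  rewrite [RHS](Ex_mix iQ (fun q => blk q != j) l); apply: Ex_eq => x.
  rewrite (Ex_mp (mpres_coord iQ r)); last exact: measurable_funX.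
  apply: Ex_eq => y; congr (_ ^+ k); rewrite {2}/mix blkr eqxx/=.
  by apply: Ldep => q qj; rewrite /mix qj.
rewrite (Ex_mix iQ (fun q => q == r) l); apply: Ex_eq => x; apply: Ex_eq => y.
congr (_ ^+ k); rewrite {2}/mix eqxx; apply: Ldep => q qj; rewrite /mix.
by case: eqP => // qr; rewrite qr blkr eqxx in qj.
Qed.

Let phi a (z : E) q (y : E) : R := if blk q == j then 0 else a q * kap j (blk q) (z, y).

Let mphi a z q : measurable_fun setT (phi a z q).
Proof.
rewrite /phi; case: (blk q == j); first exact: measurable_cst.
by apply: measurable_funM => //; exact: mkz.
Qed.

Let phib a z q y : `|phi a z q y| <= `|a q| * b.
Proof. by rewrite /phi; case: ifP => _; rewrite ?normr0 ?mulr_ge0// normrM ler_wpM2l. Qed.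

Let phi0 a z q : Ex mu (phi a z q) = 0.
Proof.
rewrite /phi; case: (blk q == j); first exact: Ex_cst.
by rewrite ExZ ?kdeg ?mulr0//; apply: (@L1_bdd _ _ _ _ _ b) => //; exact: mkz.
Qed.

Let phiE2 a z q : Ex mu (fun y => phi a z q y ^+ 2) <= (if blk q == j then 0 else a q ^+ 2) * b ^+ 2.
Proof.
apply: le_trans (ler_norm _) _; apply: Ex_le_bdd => [|y].
  by apply: (@L1_bdd _ _ _ _ _ ((`|a q| * b) ^+ 2)) => [|y]; [exact: measurable_funX|exact: bdd_pow].
rewrite /phi; case: (blk q == j); first by rewrite expr0n normr0 mul0r.
rewrite normrX normrM exprMn real_normK ?num_real// ler_wpM2l ?sqr_ge0//.
by rewrite lerXn2r ?nnegrE.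
Qed.

Let phiE4 a z q : Ex mu (fun y => phi a z q y ^+ 4) <=
  ((if blk q == j then 0 else a q ^+ 2) * b ^+ 2) ^+ 2.
Proof.
apply: le_trans (ler_norm _) _; apply: Ex_le_bdd => [|y].
  by apply: (@L1_bdd _ _ _ _ _ ((`|a q| * b) ^+ 4)) => [|y]; [exact: measurable_funX|exact: bdd_pow].
rewrite /phi; case: (blk q == j); first by rewrite !mul0r !expr0n normr0.
have -> : (a q ^+ 2 * b ^+ 2) ^+ 2 = (`|a q| * b) ^+ 4.
  by rewrite -[a q ^+ 2](real_normK (num_real (a q))); ring.
by rewrite normrX lerXn2r ?nnegrE ?mulr_ge0// normrM ler_wpM2l.
Qed.

Let lLpow a k : L1 Q (fun x : T => Ex mu (fun z => Lf a x z ^+ k)).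
Proof.
apply: (@L1_fubini _ _ _ _ _ Q mu (fun p : T * E => Lf a p.1 p.2 ^+ k)).
apply: (@L1_bdd _ _ _ _ _ ((\sum_(q < N) `|a q| * b) ^+ k)) => [|p]; last first.
  by rewrite normrX lerXn2r// nnegrE// (le_trans _ (Lbdd a p.1 p.2)).
apply: measurable_funX; apply: measurable_sum => q; case: (blk q == j); first exact: measurable_cst.
apply: measurable_funM => //; apply: (measurableT_comp (mk _ _)); apply: measurable_fun_pair => //.
exact: (measurableT_comp (measurable_coord _) measurable_fst).
Qed.

Let Lpow_bdd a k C : (forall z, Ex Q (fun y : T => Lf a y z ^+ k) <= C) ->
  (forall x : T, 0 <= Ex Q (fun y : T => Lf a y (x r) ^+ k)) ->
  Ex Q (fun x : T => Ex mu (fun z => Lf a x z ^+ k)) <= C.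
Proof.
move=> hC h0; rewrite ExLpow; apply: le_trans (ler_norm _) _; apply: Ex_le_bdd => [|x].
  have l : L1 Q (fun x : T => Lf a x (x r) ^+ k).
    apply: (@L1_bdd _ _ _ _ _ ((\sum_(q < N) `|a q| * b) ^+ k)); first exact: measurable_funX.
    by move=> x; rewrite normrX lerXn2r// nnegrE// (le_trans _ (Lbdd a x point)).
  apply: L1_eq (PS_L1 iQ (fun q => q == r) l) => x; apply: Ex_eq => y.
  congr (_ ^+ k); rewrite {2}/mix eqxx; apply: Ldep => q qj; rewrite /mix.
  by case: eqP => // qr; rewrite qr blkr eqxx in qj.
by rewrite ger0_norm.
Qed.

Let ExL2 a : Ex Q (fun x : T => Ex mu (fun z => Lf a x z ^+ 2)) <= b ^+ 2 * sig a.
Proof.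
apply: Lpow_bdd => [z|x]; last exact: Ex_sqr_ge0.
rewrite (Ex_sum_sqr iQ (mphi a z) (phib a z) (phi0 a z)).
by rewrite /sig mulrC mulr_suml; apply: ler_sum => q _; exact: phiE2.
Qed.

Let ExL4 a : Ex Q (fun x : T => Ex mu (fun z => Lf a x z ^+ 4)) <= 3 * (b ^+ 2 * sig a) ^+ 2.
Proof.
apply: Lpow_bdd => [z|x]; last by apply: Ex_ge0 => y; rewrite (exprM _ 2 2) sqr_ge0.
apply: le_trans (Ex_sum_pow4 iQ (mphi a z) (phib a z) (phi0 a z) N _ (phiE4 a z)) _.
  by move=> q; rewrite mulr_ge0 ?sqr_ge0//; case: ifP; rewrite ?sqr_ge0.
by rewrite /sig -mulr_suml mulrC [b ^+ 2 * _]mulrC mulrC.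
Qed.

Let tau (a : nat -> R) : R := \sum_(q < N) (if blk q == j then a q ^+ 2 else 0).

Let psi (c : R) a (x : T) q (z : E) : R := if blk q == j then 2 * c * a q * Lf a x z else 0.

Let mpsi c a x q : measurable_fun setT (psi c a x q).
Proof.
by rewrite /psi; case: (blk q == j); [exact: measurable_funM|exact: measurable_cst].
Qed.

Let psib c a x q z : `|psi c a x q z| <= `|2 * c * a q| * \sum_(q < N) `|a q| * b.
Proof.
rewrite /psi; case: ifP => _; first by rewrite normrM ler_wpM2l.
by rewrite normr0 mulr_ge0// sumr_ge0// => i _; rewrite mulr_ge0.
Qed.

Let lLz a x k : L1 mu (fun z => Lf a x z ^+ k).
Proof.
apply: (@L1_bdd _ _ _ _ _ ((\sum_(q < N) `|a q| * b) ^+ k)) => [|z]; first exact: measurable_funX.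
by apply: bdd_pow => {}z; exact: Lbdd.
Qed.

Let psi0 c a x q : Ex mu (psi c a x q) = 0.
Proof.
rewrite /psi; case: (blk q == j); last exact: Ex_cst.
by rewrite ExZ ?L0 ?mulr0//; apply: L1_eq (lLz a x 1) => z.
Qed.

Let psi2 c a x : \sum_(q < N) Ex mu (fun z => psi c a x q z ^+ 2) =
  4 * c ^+ 2 * tau a * Ex mu (fun z => Lf a x z ^+ 2).
Proof.
rewrite /tau mulr_sumr mulr_suml; apply: eq_bigr => q _; rewrite /psi; case: (blk q == j).
  rewrite -ExZ//; apply: Ex_eq => z; ring.
by rewrite mulr0 mul0r -[RHS](Ex_cst mu); apply: Ex_eq => z; rewrite expr0n.
Qed.

Let psi4 c a x q : Ex mu (fun z => psi c a x q z ^+ 4) <=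
  (4 * c ^+ 2 * (if blk q == j then a q ^+ 2 else 0) * Num.sqrt (Ex mu (fun z => Lf a x z ^+ 4))) ^+ 2.
Proof.
have e0 : 0 <= Ex mu (fun z => Lf a x z ^+ 4).
  by apply: Ex_ge0 => z; rewrite (exprM _ 2 2) sqr_ge0.
rewrite exprMn sqr_sqrtr// /psi; case: (blk q == j).
  rewrite -ExZ// le_eqVlt; apply/orP; left; apply/eqP; apply: Ex_eq => z; ring.
rewrite mulr0 !expr0n /= mul0r (_ : Ex _ _ = 0)// -[RHS](Ex_cst mu); by apply: Ex_eq => z.
Qed.

(** Given the other blocks, block [j] contributes a sum of independent centred variables whose
    variance depends on the weights only through [tau a]. The second-order expansion is therefore
    insensitive to how the weight is spread, and only the remainder matters. *)
Let swap_one M f f1 f2 (c th : R) a x : TC M f f1 f2 -> 0 < th ->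
  `|Ex Q (fun y : T => f (c * Af a x + \sum_(q < N) psi c a x q (y q))) - f (c * Af a x) -
    f2 (c * Af a x) / 2 * (4 * c ^+ 2 * tau a * Ex mu (fun z => Lf a x z ^+ 2))| <=
  M * (2 * th * c ^+ 2 * tau a * Ex mu (fun z => Lf a x z ^+ 2) +
       24 / th * (c ^+ 2 * tau a) ^+ 2 * Ex mu (fun z => Lf a x z ^+ 4)).
Proof.
move=> tc th0.
pose U (y : T) := \sum_(q < N) psi c a x q (y q).
have mU : measurable_fun setT U.
  by apply: measurable_sum => q; exact: (meas_mp (mpres_coord iQ q) (mpsi c a x q)).
have Ub y : `|U y| <= \sum_(q < N) `|2 * c * a q| * \sum_(q < N) `|a q| * b.
  by apply: le_trans (ler_norm_sum _ _ _) _; apply: ler_sum => q _; exact: psib.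
have lU : L2 Q U by exact: (L2_bdd Q mU Ub).
have U0 : Ex Q U = 0.
  rewrite /U Ex_sum; last first.
    move=> q _; apply: (L1_mp (mpres_coord iQ q)).
    by apply: (L1_bdd mu (mpsi c a x q)) => z; exact: psib.
  by apply: big1 => q _; rewrite -(Ex_mp (mpres_coord iQ q)).
have := taylor_step (c * Af a x) tc lU U0.
rewrite /U (Ex_sum_sqr iQ (mpsi c a x) (psib c a x) (psi0 c a x)) psi2 => h.
apply: le_trans h _; rewrite ler_wpM2l ?(TC_ge0 tc)//.
have l4 : L1 Q (fun y => U y ^+ 4).
  apply: (@L1_bdd _ _ _ _ _ ((\sum_(q < N) `|2 * c * a q| * \sum_(q < N) `|a q| * b) ^+ 4)).
    exact: measurable_funX.
  by move=> y; apply: bdd_pow.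
(* The constants of the statement arise as [th / 2 * 4 = 2 * th] and
   [1 / (2 th) * 3 * 4^2 = 24 / th]. *)
apply: (@le_trans _ _ (Ex Q (fun y => th / 2 * U y ^+ 2 + (th^-1 / 2) * U y ^+ 4))).
  apply: Ex_le; [exact: L1_rho|by apply: L1D; apply: L1Z => //; exact: L2_sqr|].
  move=> y; apply: (le_trans (rho_pow4 _ th0)).
  by rewrite le_eqVlt; apply/orP; left; apply/eqP; rewrite -/(U y); field; rewrite lt0r_neq0.
rewrite ExD; [|apply: L1Z => //; exact: L2_sqr|exact: L1Z].
rewrite !ExZ//; last exact: L2_sqr.
rewrite /U (Ex_sum_sqr iQ (mpsi c a x) (psib c a x) (psi0 c a x)) psi2.
apply: lerD; first by rewrite le_eqVlt; apply/orP; left; apply/eqP; field.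
have D0 q : 0 <= 4 * c ^+ 2 * (if blk q == j then a q ^+ 2 else 0) * Num.sqrt (Ex mu (fun z => Lf a x z ^+ 4)).
  apply: mulr_ge0; last exact: sqrtr_ge0.
  apply: mulr_ge0; first by apply: mulr_ge0 => //; exact: sqr_ge0.
  by case: (blk q == j); rewrite ?sqr_ge0.
have := Ex_sum_pow4 iQ (mpsi c a x) (psib c a x) (psi0 c a x) N D0 (psi4 c a x).
rewrite -mulr_suml -mulr_sumr -/(tau a) => h4.
have e0 : 0 <= Ex mu (fun z => Lf a x z ^+ 4).
  by apply: Ex_ge0 => z; rewrite (exprM _ 2 2) sqr_ge0.
rewrite exprMn sqr_sqrtr// in h4.
apply: (@le_trans _ _ (th^-1 / 2 * (3 * ((4 * c ^+ 2 * tau a) ^+ 2 * Ex mu (fun z => Lf a x z ^+ 4))))).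
  by rewrite ler_wpM2l// divr_ge0// invr_ge0 ltW.
by rewrite le_eqVlt; apply/orP; left; apply/eqP; field; rewrite lt0r_neq0.
Qed.

Let measurable_qform a : measurable_fun setT (qform a).
Proof.
apply: measurable_sum => q; apply: measurable_sum => q'; apply: measurable_funM => //.
by apply: mkap; exact: measurable_coord.
Qed.

Let qform_mix M f f1 f2 (c : R) a : TC M f f1 f2 -> Ex Q (fun x : T => f (c * qform a x)) =
  Ex Q (fun x : T => Ex Q (fun y : T => f (c * Af a x + \sum_(q < N) psi c a x q (y q)))).
Proof.
move=> tc; have l : L1 Q (fun x : T => f (c * qform a x)).
  have := L1_TC Q 0 tc (measurable_funM (@measurable_cst _ _ _ _ _ c) (measurable_qform a)).
  by apply: L1_eq => x; rewrite add0r.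
rewrite (Ex_mix iQ (fun q => blk q != j) l); apply: Ex_eq => x; apply: Ex_eq => y.
congr f; rewrite qform_split mulrDr; congr (_ + _).
  by congr (_ * _); apply: Adep => q qj; rewrite /mix qj.
rewrite !mulr_sumr; apply: eq_bigr => q _; rewrite /psi /mix.
case: eqP => [qj|_]; last by rewrite !mulr0.
rewrite mulrA [c * 2]mulrC -!mulrA; congr (_ * (_ * (_ * _))).
by apply: Ldep => q' /negbTE; case: eqP.
Qed.

(* replacing the weights inside one block, at equal sum of squares *)
Lemma block_swap M f f1 f2 (c th : R) (a a' : nat -> R) : TC M f f1 f2 -> 0 < th ->
  (forall q, blk q != j -> a q = a' q) ->
  \sum_(q < N | blk q == j) a q ^+ 2 = \sum_(q < N | blk q == j) a' q ^+ 2 ->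
  `|Ex Q (fun x : T => f (c * qform a x)) - Ex Q (fun x : T => f (c * qform a' x))| <=
  2 * M * (2 * th * (c ^+ 2 * (\sum_(q < N | blk q == j) a q ^+ 2)) * (b ^+ 2 * \sum_(q < N) a q ^+ 2) +
       72 / th * (c ^+ 2 * (\sum_(q < N | blk q == j) a q ^+ 2)) ^+ 2 * (b ^+ 2 * \sum_(q < N) a q ^+ 2) ^+ 2).
Proof.
move=> tc th0 aa' tt'; have M0 := TC_ge0 tc.
have tE a0 : tau a0 = \sum_(q < N | blk q == j) a0 q ^+ 2 by rewrite /tau -big_mkcond.
rewrite -tE; have t0 : 0 <= tau a by rewrite tE sumr_ge0// => i _; exact: sqr_ge0.
have tau' : tau a' = tau a by rewrite !tE.
have LE : Lf a' = Lf a.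
  apply/funext => x; apply/funext => z; apply: eq_bigr => q _.
  by case: ifPn => // /aa' ->.
have AE : Af a' = Af a.
  apply/funext => x; apply: eq_bigr => q qj; apply: eq_bigr => q' q'j.
  by rewrite !aa'.
rewrite !(qform_mix _ _ tc).
set F := fun x : T => Ex Q (fun y : T => f (c * Af a x + \sum_(q < N) psi c a x q (y q))).
set F' := fun x : T => Ex Q (fun y : T => f (c * Af a' x + \sum_(q < N) psi c a' x q (y q))).
pose V := 2 * th * (c ^+ 2 * tau a); pose W := 24 / th * (c ^+ 2 * tau a) ^+ 2.
have FF' x : `|F x - F' x| <= 2 * M * (V * Ex mu (fun z => Lf a x z ^+ 2) + W * Ex mu (fun z => Lf a x z ^+ 4)).
  have := swap_one c a x tc th0; have := swap_one c a' x tc th0.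
  rewrite -/(F x) -/(F' x) LE AE tau' /V /W.
  by rewrite !ler_norml => /andP[h1 h2] /andP[h3 h4]; apply/andP; split; lra.
have lF a0 : L1 Q (fun x : T => Ex Q (fun y : T => f (c * Af a0 x + \sum_(q < N) psi c a0 x q (y q)))).
  have l : L1 Q (fun x : T => f (c * qform a0 x)).
    have := L1_TC Q 0 tc (measurable_funM (@measurable_cst _ _ _ _ _ c) (measurable_qform a0)).
    by apply: L1_eq => x; rewrite add0r.
  apply: L1_eq (PS_L1 iQ (fun q => blk q != j) l) => x; apply: Ex_eq => y.
  congr f; rewrite qform_split mulrDr; congr (_ + _).
    by congr (_ * _); apply: Adep => q qj; rewrite /mix qj.
  rewrite !mulr_sumr; apply: eq_bigr => q _; rewrite /psi /mix.
  case: eqP => [qj|_]; last by rewrite !mulr0.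
  rewrite mulrA [c * 2]mulrC -!mulrA; congr (_ * (_ * (_ * _))).
  by apply: Ldep => q' /negbTE; case: eqP.
rewrite -ExB; [|exact: lF..].
apply: le_trans (Ex_abs (L1B (lF a) (lF a'))) _.
apply: (@le_trans _ _ (Ex Q (fun x : T => 2 * M * (V * Ex mu (fun z => Lf a x z ^+ 2) + W * Ex mu (fun z => Lf a x z ^+ 4))))).
  apply: Ex_le => //; first exact: (L1_norm (L1B (lF a) (lF a'))).
  by apply: L1Z; apply: L1D; apply: L1Z; exact: lLpow.
rewrite ExZ; last by apply: L1D; apply: L1Z; exact: lLpow.
rewrite ExD; [|apply: L1Z; exact: lLpow..]; rewrite !ExZ; [|exact: lLpow..].
have V0 : 0 <= V by rewrite /V; apply: mulr_ge0; [apply: mulr_ge0 => //; exact: ltW|apply: mulr_ge0 => //; exact: sqr_ge0].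
have W0 : 0 <= W by rewrite /W; apply: mulr_ge0; [apply: divr_ge0 => //; exact: ltW|exact: sqr_ge0].
have sle : sig a <= \sum_(q < N) a q ^+ 2.
  by apply: ler_sum => q _; case: ifP; rewrite ?sqr_ge0.
have s0 : 0 <= sig a by apply: sumr_ge0 => q _; case: ifP; rewrite ?sqr_ge0.
have bs : b ^+ 2 * sig a <= b ^+ 2 * \sum_(q < N) a q ^+ 2 by rewrite ler_wpM2l ?sqr_ge0.
rewrite ler_wpM2l ?mulr_ge0//; apply: lerD.
  by rewrite -/V ler_wpM2l// (le_trans (ExL2 a)).
(* [72 = 24 * 3], the 3 being the fourth moment constant of [Lf]. *)
rewrite (_ : 72 / th * _ * _ = W * (3 * (b ^+ 2 * \sum_(q < N) a q ^+ 2) ^+ 2)); last first.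
  by rewrite /W; field; rewrite lt0r_neq0.
rewrite ler_wpM2l// (le_trans (ExL4 a))// ler_wpM2l// lerXn2r ?nnegrE ?mulr_ge0 ?sqr_ge0//.
by rewrite sumr_ge0// => i _; exact: sqr_ge0.
Qed.

End Swap.
End BlockSwap.

(** * Degenerate chaos of order two *)

Lemma big_blocks (V : nmodType) (K m : nat) (F : nat -> V) :
  \sum_(q < K * m) F q = \sum_(i < K) \sum_(u < m) F (i * m + u)%N.
Proof.
elim: K => [|K ih]; first by rewrite mul0n !big_ord0.
rewrite big_ord_recr/= -ih mulSn addnC -(big_mkord xpredT F) (big_cat_nat _ (n := (K * m)%N))//=.
  rewrite big_mkord; congr (_ + _).
  rewrite -{1}[(K * m)%N]add0n big_addn addnC addnK big_mkord.
  by apply: eq_bigr => u _; rewrite addnC.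
by rewrite leq_addr.
Qed.

Lemma sum_sym_pairs (V : zmodType) (N : nat) (F : nat -> nat -> V) :
  (forall q q', F q q' = F q' q) -> (forall q, F q q = 0) ->
  \sum_(q < N) \sum_(q' < N) F q q' = (\sum_(q' < N) \sum_(q < q') F q q') *+ 2.
Proof.
move=> Fs F0; elim: N => [|N ih]; first by rewrite !big_ord0 mul0rn.
rewrite big_ord_recr/= [in RHS]big_ord_recr/= mulrnDl -ih.
have -> : \sum_(i < N) \sum_(q' < N.+1) F i q' =
   \sum_(i < N) \sum_(q' < N) F i q' + \sum_(i < N) F i N.
  by rewrite -big_split; apply: eq_bigr => i _; rewrite big_ord_recr.
rewrite big_ord_recr/= F0 addr0 -addrA; congr (_ + _).
by rewrite mulr2n; congr (_ + _); apply: eq_bigr => i _.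
Qed.

Section PairLaw.
Context {R : realType} {d : measure_display} {E : measurableType d}.
Variables (mu : probability E R) (I : eqType) (Q : probability (seqspace E I) R).
Hypothesis iQ : iid_law mu Q.
Local Notation T := (seqspace E I).
Let MM : probability (E * E)%type R := (mu \x mu)%E.

Lemma mpres_pair q q' : q != q' -> mpres Q MM (fun x : T => (x q, x q')).
Proof.
move=> qq'; have mp : measurable_fun setT (fun x : T => (x q, x q')).
  by apply: measurable_fun_pair; exact: measurable_coord.
split=> // A mA; apply/esym.
apply: (@product_measure_unique _ _ _ _ _ mu mu (pushforward Q (fun x : T => (x q, x q')))) => // A1 A2 mA1 mA2.
transitivity (Q (box [:: q; q'] (fun i => if i == q then A1 else A2))).
  rewrite /pushforward; congr (Q _); apply/seteqP; split => [x /= [h1 h2] i|x /= h].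
    by rewrite !inE => /orP[/eqP ->|/eqP ->]; rewrite ?eqxx// eq_sym (negbTE qq').
  split; first by have := h q; rewrite inE eqxx; apply.
  by have := h q'; rewrite !inE eqxx orbT eq_sym (negbTE qq'); apply.
rewrite iQ//.
- by rewrite !big_cons big_nil eqxx eq_sym (negbTE qq') mule1.
- by rewrite /= inE qq'.
- by move=> i; case: ifP.
Qed.

End PairLaw.

(** * Moments of sums over pairs with degenerate kernels *)

Section PairForms.
Context {R : realType} {d : measure_display} {E : measurableType d}.
Variables (mu : probability E R) (Q : probability (seqspace E nat) R).
Hypothesis iQ : iid_law mu Q.
Local Notation T := (seqspace E nat).
Let MM : probability (E * E)%type R := (mu \x mu)%E.

(** Degeneracy in each argument up to null sets, since kernels obtained as conditional expectations
    satisfy it only almost everywhere. *)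
Definition degen (k : E * E -> R) :=
  {ae mu, forall z, Ex mu (fun z' => k (z, z')) = 0} /\
  {ae mu, forall z', Ex mu (fun z => k (z, z')) = 0}.

Let PSr (k : E * E -> R) q q' : measurable_fun setT k -> q != q' -> degen k ->
  {ae Q, forall x, PS Q (fun i => i != q') (fun x : T => k (x q, x q')) x = 0}.
Proof.
move=> mk qq' [dk _]; apply: (ae_imp (ae_mp (mpres_coord iQ q) dk)) => x /= <-.
rewrite (Ex_mp (mpres_coord iQ q')).
  by apply: Ex_eq => y; rewrite /mix eqxx qq'.
by apply: (measurableT_comp mk); exact: measurable_pair1.
Qed.

Let PSl (k : E * E -> R) q q' : measurable_fun setT k -> q != q' -> degen k ->
  {ae Q, forall x, PS Q (fun i => i != q) (fun x : T => k (x q, x q')) x = 0}.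
Proof.
move=> mk qq' [_ dk]; apply: (ae_imp (ae_mp (mpres_coord iQ q') dk)) => x /= <-.
rewrite (Ex_mp (mpres_coord iQ q)).
  by apply: Ex_eq => y; rewrite /mix eqxx eq_sym qq'.
by apply: (measurableT_comp mk); exact: measurable_pair2.
Qed.

Section Form.
Variable kap : nat -> nat -> E * E -> R.

(** Grouping the pairs by their larger index makes the increments in [N] martingale differences. *)
Definition pform N (x : T) : R := \sum_(q' < N) \sum_(q < q') kap q q' (x q, x q').
Let Lf N (x : T) : R := \sum_(q < N) kap q N (x q, x N).

Let pformS N x : pform N.+1 x = pform N x + Lf N x.
Proof. by rewrite /pform big_ord_recr. Qed.

Hypotheses (lk : forall q q', L2 MM (kap q q')) (dk : forall q q', degen (kap q q')).

Let lk2 q q' : q != q' -> L2 Q (fun x : T => kap q q' (x q, x q')).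
Proof. by move=> qq'; exact: (L2_mp (mpres_pair iQ qq') (lk q q')). Qed.

Let lL N : L2 Q (Lf N).
Proof. by apply: L2_sum => q _; apply: lk2; rewrite ltn_eqF. Qed.

Lemma L2_pform N : L2 Q (pform N).
Proof. by apply: L2_sum => q' _; exact: lL. Qed.

Let pform_dep N : dep (fun i => i != N) (pform N).
Proof.
move=> x y xy; apply: eq_bigr => q' _; apply: eq_bigr => q _; rewrite !xy//.
  by rewrite ltn_eqF.
by rewrite ltn_eqF// (ltn_trans (ltn_ord q)).
Qed.

Let orthL N (G : T -> R) : L2 Q G -> dep (fun i => i != N) G ->
  Ex Q (fun x => Lf N x * G x) = 0.
Proof.
move=> lG dG; transitivity (Ex Q (fun x => \sum_(q < N) kap q N (x q, x N) * G x)).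
  by apply: Ex_eq => x; rewrite mulr_suml.
rewrite Ex_sum; last by move=> q _; apply: L2_mul => //; apply: lk2; rewrite ltn_eqF.
apply: big1 => q _; apply: (Ex_orth iQ _ lG dG).
  by apply: lk2; rewrite ltn_eqF.
by apply: PSr; rewrite ?ltn_eqF//; exact: L2_meas (lk q N).
Qed.

(** Distinct pairs are orthogonal: with different larger indices by the martingale property, with
    the same larger index by integrating out a smaller one. *)
Lemma Ex_pform_sqr N : Ex Q (fun x => pform N x ^+ 2) =
  \sum_(q' < N) \sum_(q < q') Ex MM (fun z => kap q q' z ^+ 2).
Proof.
elim: N => [|N ih].
  by rewrite big_ord0 -[RHS](Ex_cst Q); apply: Ex_eq => x; rewrite /pform big_ord0 expr0n.
rewrite big_ord_recr/= -ih.
transitivity (Ex Q (fun x => pform N x ^+ 2 + 2 * (Lf N x * pform N x) + Lf N x ^+ 2)).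
  by apply: Ex_eq => x; rewrite pformS; ring.
have l1 := L2_sqr (L2_pform N); have l2 := L2_mul (lL N) (L2_pform N); have l3 := L2_sqr (lL N).
rewrite (ExD (L1D l1 (L1Z 2 l2)) l3) (ExD l1 (L1Z 2 l2)) (ExZ _ l2) orthL//; last exact: L2_pform.
rewrite mulr0 addr0; congr (_ + _).
transitivity (Ex Q (fun x => (\sum_(q <- index_enum 'I_N) 1 * kap q N (x q, x N)) ^+ 2)).
  by apply: Ex_eq => x; congr (_ ^+ 2); apply: eq_bigr => q _; rewrite mul1r.
rewrite (@Ex_sqr_orth _ _ _ Q _ (index_enum 'I_N) (fun=> 1)
  (fun (q : 'I_N) (x : T) => kap q N (x q, x N))).
- apply: eq_bigr => q _; rewrite expr1n mul1r; apply/esym.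
  apply: (Ex_mp (mpres_pair iQ _)); first by rewrite ltn_eqF.
  by apply: measurable_sqr; exact: L2_meas (lk q N).
- exact: index_enum_uniq.
- by move=> q _; apply: lk2; rewrite ltn_eqF.
- move=> i j _ _ ij; apply: (@Ex_orth _ _ _ _ _ Q iQ (fun l => l != val i)).
  + by apply: lk2; rewrite ltn_eqF.
  + by apply: lk2; rewrite ltn_eqF.
  + move=> x y xy; have e1 : N != val i by rewrite neq_ltn ltn_ord orbT.
    have e2 : val j != val i by rewrite eq_sym.
    by rewrite (xy _ e1) (xy _ e2).
  + by apply: (PSl (L2_meas (lk i N)) _ (dk i N)); rewrite neq_ltn ltn_ord.
Qed.

Lemma Ex_pform N : Ex Q (pform N) = 0.
Proof.
elim: N => [|N ih].
  by rewrite -[RHS](Ex_cst Q); apply: Ex_eq => x; rewrite /pform big_ord0.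
transitivity (Ex Q (fun x => pform N x + Lf N x * 1)).
  by apply: Ex_eq => x; rewrite pformS mulr1.
rewrite ExD; [|exact/L2_L1/L2_pform|by apply: L2_mul => //; exact: L2_cst].
by rewrite ih orthL ?addr0//; exact: L2_cst.
Qed.

(* the cross terms of odd degree in the last variable vanish *)
Lemma Ex_pform_pow4 (b : R) N : (forall q q' z, `|kap q q' z| <= b) ->
  (forall q q' z', Ex mu (fun z => kap q q' (z, z')) = 0) ->
  Ex Q (fun x => pform N x ^+ 4) <= 19 * b ^+ 4 * N%:R ^+ 4.
Proof.
move=> kb kdeg; have b0 : 0 <= b by exact: le_trans (kb 0 0 point).
have mkap q q' : measurable_fun setT (fun x : T => kap q q' (x q, x q')).
  apply: (measurableT_comp (L2_meas (lk q q'))).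
  by apply: measurable_fun_pair; exact: measurable_coord.
have mL n : measurable_fun setT (Lf n) by apply: measurable_sum => q.
have mP n : measurable_fun setT (pform n).
  by apply: measurable_sum => q'; exact: mL.
have Lb n x : `|Lf n x| <= n%:R * b.
  apply: le_trans (ler_norm_sum _ _ _) _.
  apply: (@le_trans _ _ (\sum_(q < n) b)); first by apply: ler_sum => q _; exact: kb.
  by rewrite sumr_const card_ord mulr_natl.
pose Pb n : R := \sum_(q < n) q%:R * b.
have Pbd n x : `|pform n x| <= Pb n.
  by apply: le_trans (ler_norm_sum _ _ _) _; apply: ler_sum => q _; exact: Lb.
have l n i j : L1 Q (fun x => pform n x ^+ i * Lf n x ^+ j).
  apply: (@L1_bdd _ _ _ _ _ (Pb n ^+ i * (n%:R * b) ^+ j)).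
    by apply: measurable_funM; exact: measurable_funX.
  by move=> x; rewrite normrM ler_pM ?bdd_pow.
have l' n i : L1 Q (fun x => pform n x ^+ i) by apply: L1_eq (l n i 0%N) => x; rewrite expr0 mulr1.
have l'' n i : L1 Q (fun x => Lf n x ^+ i) by apply: L1_eq (l n 0%N i) => x; rewrite expr0 mul1r.
have L4 n : Ex Q (fun x => Lf n x ^+ 4) <= 3 * b ^+ 4 * n%:R ^+ 2.
  rewrite (Ex_mix iQ (fun i => i == n) (l'' n 4%N)).
  apply: le_trans (ler_norm _) _; apply: Ex_le_bdd; first exact: (PS_L1 iQ (fun i => i == n) (l'' n 4%N)).
  move=> x; rewrite ger0_norm; last by apply: Ex_ge0 => y; rewrite (exprM _ 2 2) sqr_ge0.
  pose phi q z := kap q n (z, x n).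
  have mphi q : measurable_fun setT (phi q).
    by apply: (measurableT_comp (L2_meas (lk q n))); exact: measurable_pair2.
  have pb q z : `|phi q z| <= b by exact: kb.
  have p4 q : Ex mu (fun z => phi q z ^+ 4) <= (b ^+ 2) ^+ 2.
    apply: le_trans (ler_norm _) _; apply: Ex_le_bdd => [|z].
      by apply: (@L1_bdd _ _ _ _ _ (b ^+ 4)) => [|z]; [exact: measurable_funX|exact: bdd_pow].
    by rewrite -exprM; exact: bdd_pow.
  have h := Ex_sum_pow4 iQ mphi pb (fun q => kdeg q n (x n)) n (fun=> sqr_ge0 b) p4.
  apply: (@le_trans _ _ (3 * (\sum_(q < n) b ^+ 2) ^+ 2)); last first.
    by rewrite sumr_const card_ord -mulr_natl le_eqVlt; apply/orP; left; apply/eqP; ring.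
  apply: le_trans h; rewrite le_eqVlt; apply/orP; left; apply/eqP; apply: Ex_eq => y.
  congr (_ ^+ 4); apply: eq_bigr => q _; rewrite /phi /mix eqxx ifF//.
  by rewrite ltn_eqF.
elim: N => [|n ih].
  rewrite expr0n/= mulr0 (_ : Ex _ _ = 0)// -[RHS](Ex_cst Q).
  by apply: Ex_eq => x; rewrite /pform big_ord0 expr0n.
(* [pform] over one observation is an empty sum; setting it apart ensures [N >= 1], so that [N^-1]
   can serve as a weight. *)
case: n ih => [_|n ih].
  rewrite (_ : Ex _ _ = 0); first by rewrite !mulr_ge0 ?exprn_ge0.
  rewrite -[RHS](Ex_cst Q); apply: Ex_eq => x.
  by rewrite /pform big_ord1 big_ord0 expr0n.
set N := n.+1 in ih *; have N0 : 0 < N%:R :> R by rewrite ltr0n.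
have N1 : 1 <= N%:R :> R by rewrite ler1n.
have odd : Ex Q (fun x => Lf N x * pform N x ^+ 3) = 0.
  apply: orthL.
    apply: (@L2_bdd _ _ _ _ _ (Pb N ^+ 3)); first exact: measurable_funX.
    by move=> x; exact: bdd_pow.
  by move=> x y xy; rewrite (pform_dep xy).
have l31 : L1 Q (fun x => Lf N x * pform N x ^+ 3).
  by apply: L1_eq (l N 3%N 1%N) => x; rewrite expr1 mulrC.
have lsum := L1D (L1D (L1Z (1 + N%:R^-1) (l' N 4%N)) (L1Z 4 l31)) (L1Z (16 * N%:R + 3) (l'' N 4%N)).
(* The term [P^3 L] has expectation 0. The terms [6 P^2 L^2] and [4 P L^3] are split by Young's
   inequality so that [P^4] grows only by the factor [1 + 1 / N], which a bound of order [N^4]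
   absorbs. *)
have h : Ex Q (fun x => pform N.+1 x ^+ 4) <=
    (1 + N%:R^-1) * Ex Q (fun x => pform N x ^+ 4) + (16 * N%:R + 3) * Ex Q (fun x => Lf N x ^+ 4).
  apply: (@le_trans _ _ (Ex Q (fun x => (1 + N%:R^-1) * pform N x ^+ 4 + 4 * (Lf N x * pform N x ^+ 3) +
      (16 * N%:R + 3) * Lf N x ^+ 4))).
    apply: Ex_le; [exact: l'|exact: lsum|move=> x].
    rewrite pformS; set P := pform N x; set L := Lf N x.
    rewrite -subr_ge0.
    have -> : (1 + N%:R^-1) * P ^+ 4 + 4 * (L * P ^+ 3) + (16 * N%:R + 3) * L ^+ 4 - (P + L) ^+ 4 =
       N%:R^-1 * (P ^+ 2 - 4 * N%:R * L ^+ 2) ^+ 2 + 2 * L ^+ 2 * (P - L) ^+ 2.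
      by field; rewrite lt0r_neq0.
    apply: addr_ge0; first by apply: mulr_ge0; [rewrite invr_ge0 ltW|exact: sqr_ge0].
    by apply: mulr_ge0; [apply: mulr_ge0 => //; exact: sqr_ge0|exact: sqr_ge0].
  rewrite (ExD (L1D (L1Z (1 + N%:R^-1) (l' N 4%N)) (L1Z 4 l31)) (L1Z (16 * N%:R + 3) (l'' N 4%N))).
  rewrite (ExD (L1Z (1 + N%:R^-1) (l' N 4%N)) (L1Z 4 l31)).
  by rewrite (ExZ _ (l' N 4%N)) (ExZ _ l31) (ExZ _ (l'' N 4%N)) odd mulr0 addr0.
apply: (le_trans h).
have i0 : 0 <= N%:R^-1 :> R by rewrite invr_ge0 ltW.
apply: (@le_trans _ _ ((1 + N%:R^-1) * (19 * b ^+ 4 * N%:R ^+ 4) + (16 * N%:R + 3) * (3 * b ^+ 4 * N%:R ^+ 2))).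
  by apply: lerD; rewrite ler_wpM2l// addr_ge0// mulr_ge0.
rewrite -(natr1 N); move: (N%:R) N0 N1 {i0 h lsum ih odd l31} => v v0 v1.
have -> : (1 + v^-1) * (19 * b ^+ 4 * v ^+ 4) = b ^+ 4 * (19 * v ^+ 4 + 19 * v ^+ 3).
  by field; rewrite lt0r_neq0.
have b4 : 0 <= b ^+ 4 by rewrite exprn_ge0.
(* The constant 19 leaves room: the coefficient of [v ^+ 3] is [19 + 48] on one side and [4 * 19] on
   the other. *)
rewrite -subr_ge0 (_ : _ - _ = b ^+ 4 * (9 * v ^+ 2 * (v - 1) + 114 * v ^+ 2 - 0 * v + 76 * v + 19)); last by ring.
apply: mulr_ge0 => //; have : 0 <= v ^+ 2 by exact: sqr_ge0.
have : 0 <= v ^+ 2 * (v - 1) by rewrite mulr_ge0 ?sqr_ge0 ?subr_ge0.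
lra.
Qed.

End Form.
End PairForms.

(** * Chaos with bounded kernels: moments and comparison of sizes *)

Section BoundedChaos.
Context {R : realType} {d : measure_display} {E : measurableType d}.
Variables (mu : probability E R) (Q : probability (seqspace E nat) R).
Hypothesis iQ : iid_law mu Q.
Local Notation T := (seqspace E nat).
Let MM : probability (E * E)%type R := (mu \x mu)%E.
Variable s : nat.

(* coordinates [q < n] stand for the cases (type [true]), the next [s * n] for the selected controls *)
Definition chaos (w : bool -> bool -> E * E -> R) (n : nat) (x : T) : R :=
  n%:R^-1 * pform (fun q q' => w (q < n)%N (q' < n)%N) (s.+1 * n) x.

Variables (w : bool -> bool -> E * E -> R) (b : R).
Hypotheses (mw : forall t t', measurable_fun setT (w t t'))
  (wb : forall t t' z, `|w t t' z| <= b)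
  (wsym : forall t t' y z, w t t' (y, z) = w t' t (z, y))
  (wdeg : forall t t' y, Ex mu (fun z => w t t' (y, z)) = 0).

Let b0 : 0 <= b. Proof. exact: le_trans (wb true true point). Qed.

Let wdeg' t t' z : Ex mu (fun y => w t t' (y, z)) = 0.
Proof. by under Ex_eq do rewrite wsym; exact: wdeg. Qed.

Let wdegen t t' : degen mu (w t t').
Proof. by split; apply: aeW => z; [exact: wdeg|exact: wdeg']. Qed.

Let lw t t' : L2 MM (w t t'). Proof. exact: (L2_bdd _ (mw t t') (wb t t')). Qed.

Lemma Ex_chaos_pow4 n : (0 < n)%N -> Ex Q (fun x => chaos w n x ^+ 4) <= 19 * b ^+ 4 * s.+1%:R ^+ 4.
Proof.
move=> n0; have v0 : 0 < n%:R :> R by rewrite ltr0n.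
have h := Ex_pform_pow4 iQ (fun q q' => lw (q < n)%N (q' < n)%N) (fun q q' => wdegen _ _)
  (s.+1 * n) (fun q q' => wb _ _) (fun q q' => wdeg' _ _).
have l := @L2_pform _ _ _ _ _ iQ _ (fun q q' => lw (q < n)%N (q' < n)%N) (s.+1 * n).
rewrite (_ : Ex _ _ = n%:R^-1 ^+ 4 * Ex Q (fun x => pform (fun q q' => w (q < n)%N (q' < n)%N) (s.+1 * n) x ^+ 4)).
  rewrite exprVn ler_pdivrMl ?exprn_gt0//; apply: le_trans h _.
  by rewrite natrM exprMn le_eqVlt; apply/orP; left; apply/eqP; ring.
rewrite -ExZ; first by apply: Ex_eq => x; rewrite exprMn.
set P := pform _ _ in h l *.
pose Pb : R := \sum_(q' < s.+1 * n) \sum_(q < q') b.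
apply: (@L1_bdd _ _ _ _ _ (Pb ^+ 4)); first by apply: measurable_funX; exact: L2_meas l.
move=> x; apply: bdd_pow => {}x; apply: le_trans (ler_norm_sum _ _ _) _.
by apply: ler_sum => q' _; apply: le_trans (ler_norm_sum _ _ _) _; apply: ler_sum.
Qed.

Section Compare.
Variables (n m : nat).
Hypotheses (n0 : (0 < n)%N) (m0 : (0 < m)%N).
Let K := (s.+1 * n)%N.
Let blk q := (q %/ m)%N.
(** Pairs inside a block are deleted so that [block_swap] applies; [Ex_within] measures what is lost
    at the last stage. *)
Let kap i j (z : E * E) : R := if i == j then 0 else w (i < n)%N (j < n)%N z.

Let mk i j : measurable_fun setT (kap i j).
Proof. by rewrite /kap; case: (i == j); [exact: measurable_cst|exact: mw]. Qed.
Let kb i j z : `|kap i j z| <= b.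
Proof. by rewrite /kap; case: ifP; rewrite ?normr0. Qed.
Let ksym i j y z : kap i j (y, z) = kap j i (z, y).
Proof. by rewrite /kap eq_sym wsym. Qed.
Let kdiag i z : kap i i z = 0. Proof. by rewrite /kap eqxx. Qed.
Let kdeg i j y : Ex mu (fun z => kap i j (y, z)) = 0.
Proof. by rewrite /kap; case: (i == j); [exact: Ex_cst|exact: wdeg]. Qed.

(** Hybrid weights: blocks before [j] are spread evenly over their [m] observations, the others sit
    on their first index alone. In both cases the squares over a block add up to 1. *)
Let aa (j q : nat) : R := if (q %/ m < j)%N then (Num.sqrt m%:R)^-1 else (m %| q)%:R.

Let blkE i (u : 'I_m) : blk (i * m + u) = i.
Proof. by rewrite /blk divnMDl// divn_small// addn0. Qed.

Let blk_sum j i : \sum_(u < m) aa j (i * m + u) ^+ 2 = 1.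
Proof.
rewrite /aa; under eq_bigr => u _ do rewrite -/(blk _) blkE.
case: ltnP => _.
  by rewrite sumr_const card_ord exprVn sqr_sqrtr// -[_ *+ m]mulr_natl divff// pnatr_eq0 -lt0n.
rewrite -(prednK m0) big_ord_recl big1 ?addr0/=.
  by rewrite prednK// addn0 dvdn_mull// expr1n.
move=> u _; rewrite /bump leq0n add1n dvdn_addr ?dvdn_mull// gtnNdvd ?expr0n//.
by rewrite ltnS.
Qed.

Let sum_all j : \sum_(q < K * m) aa j q ^+ 2 = K%:R.
Proof.
rewrite (big_blocks K m (fun q => aa j q ^+ 2)).
by under eq_bigr do rewrite blk_sum; rewrite sumr_const card_ord.
Qed.

Let sum_blk j i : (i < K)%N -> \sum_(q < K * m | blk q == i) aa j q ^+ 2 = 1.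
Proof.
move=> iK; rewrite big_mkcond (big_blocks K m (fun q => if blk q == i then aa j q ^+ 2 else 0)).
rewrite (bigD1 (Ordinal iK))//= -[RHS](blk_sum j i) [X in _ + X]big1 ?addr0.
  by apply: eq_bigr => u _; rewrite blkE eqxx.
move=> i' /eqP ne; apply: big1 => u _; rewrite blkE ifF//.
by apply/eqP => e; apply: ne; apply: val_inj.
Qed.

(** The factor 2 compensates for [qform] counting each pair twice. *)
Let c : R := (2 * n%:R)^-1.
Let t : R := (Num.sqrt n%:R)^-1.
Let CC (M : R) : R := 2 * M * (s.+1%:R * b ^+ 2 / 2 + 9 / 2 * (s.+1%:R * b ^+ 2) ^+ 2).

Let n0' : 0 < n%:R :> R. Proof. by rewrite ltr0n. Qed.
Let c2 : c * 2 = n%:R^-1.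
Proof. by rewrite /c; field; rewrite lt0r_neq0. Qed.
Let t0 : 0 < t. Proof. by rewrite invr_gt0 sqrtr_gt0. Qed.
Let t2 : t ^+ 2 = n%:R^-1. Proof. by rewrite exprVn sqr_sqrtr// ltW. Qed.

(** With threshold [t = n^(-1/2)], [c^2] of order [n^-2] and total squared weight [(s + 1) n], both
    error terms of [block_swap] are of order [n^(-3/2)], free of [m]. The factor [9 / 2] is
    [72 / 16]. *)
Let swap1 M f f1 f2 j : TC M f f1 f2 -> (j < K)%N ->
  `|Ex Q (fun x => f (c * qform kap blk (K * m) (aa j) x)) -
    Ex Q (fun x => f (c * qform kap blk (K * m) (aa j.+1) x))| <= CC M * t ^+ 3.
Proof.
move=> tc jK.
have bj : blk (j * m) = j by rewrite /blk mulnK.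
have aaj q : blk q != j -> aa j q = aa j.+1 q.
  by rewrite /aa /blk => /negbTE e; rewrite [in RHS]ltnS [in RHS]leq_eqVlt e.
have e : \sum_(q < K * m | blk q == j) aa j q ^+ 2 = \sum_(q < K * m | blk q == j) aa j.+1 q ^+ 2.
  by rewrite !sum_blk.
have := block_swap iQ mk kb ksym kdiag kdeg bj c tc t0 aaj e.
rewrite sum_blk// sum_all => h; apply: (le_trans h).
rewrite !mulr1 /c /K natrM invfM exprMn -t2 (_ : n%:R = (t ^+ 2)^-1); last by rewrite t2 invrK.
rewrite le_eqVlt; apply/orP; left; apply/eqP; rewrite /CC; field.
by rewrite lt0r_neq0.
Qed.

Let swaps M f f1 f2 j : TC M f f1 f2 -> (j <= K)%N ->
  `|Ex Q (fun x => f (c * qform kap blk (K * m) (aa 0) x)) -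
    Ex Q (fun x => f (c * qform kap blk (K * m) (aa j) x))| <= j%:R * (CC M * t ^+ 3).
Proof.
move=> tc; elim: j => [_|j ih jK]; first by rewrite subrr normr0 mul0r.
have := swap1 tc jK; have := ih (ltnW jK).
rewrite -natr1 mulrDl mul1r !ler_norml => /andP[h1 h2] /andP[h3 h4].
by apply/andP; split; lra.
Qed.

(* stage 0 is a rescaled copy of chaos w n, sitting on the multiples of m *)
Let stage0 M f f1 f2 : TC M f f1 f2 ->
  Ex Q (fun x => f (c * qform kap blk (K * m) (aa 0) x)) = Ex Q (fun x => f (chaos w n x)).
Proof.
move=> tc; have mp : mpres Q Q (fun x : T => x \o (muln^~ m) : T).
  by apply: (mpres_reindex (pi' := fun q => q %/ m)%N iQ iQ) => q; rewrite mulnK.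
have mch : measurable_fun setT (chaos w n).
  apply: measurable_funM => //.
  exact: L2_meas (L2_pform iQ (fun q q' => lw (q < n)%N (q' < n)%N) _).
rewrite [RHS](Ex_mp mp); last by case: tc => -[mf _ _] _ _; exact: (measurableT_comp mf).
apply: Ex_eq => x; congr f; rewrite /chaos /qform.
pose F q q' : R := aa 0 q * aa 0 q' * kap (blk q) (blk q') (x q, x q').
rewrite (big_blocks K m (fun q => \sum_(q' < K * m) F q q')).
have aa0 i : aa 0 (i * m) = 1 by rewrite /aa ltn0 dvdn_mull.
have aau i (u : 'I_m) : val u != 0%N -> aa 0 (i * m + u) = 0.
  move=> u0; rewrite /aa ltn0 dvdn_addr ?dvdn_mull// gtnNdvd// lt0n//.
have sum0 (G : nat -> R) i : (forall u : 'I_m, val u != 0%N -> G (i * m + u)%N = 0) ->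
    \sum_(u < m) G (i * m + u)%N = G (i * m)%N.
  move=> G0; rewrite (bigD1 (Ordinal m0))//= addn0 big1 ?addr0// => u /eqP ne.
transitivity (c * \sum_(i < K) \sum_(i' < K) kap i i' (x (i * m)%N, x (i' * m)%N)).
  congr (_ * _); apply: eq_bigr => i _.
  rewrite (sum0 (fun q => \sum_(q' < K * m) F q q')); last first.
    by move=> u u0; apply: big1 => q' _; rewrite /F aau// !mul0r.
  rewrite (big_blocks K m (F (i * m)%N)); apply: eq_bigr => i' _.
  rewrite (sum0 (F (i * m)%N)); last by move=> u u0; rewrite /F aau// mulr0 mul0r.
  by rewrite /F !aa0 !mul1r /blk !mulnK.
rewrite (sum_sym_pairs K (F := fun i i' => kap i i' (x (i * m)%N, x (i' * m)%N))) => [|i i'|i].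
- rewrite -[X in c * X]mulr_natl mulrA c2; congr (_ * _).
  by apply: eq_bigr => q' _; apply: eq_bigr => q _; rewrite /kap ltn_eqF.
- exact: ksym.
- exact: kdiag.
Qed.

Let within (q q' : nat) (z : E * E) : R :=
  if (q %/ m == q' %/ m)%N then w (q < n * m)%N (q' < n * m)%N z else 0.

(** When every block is spread, a pair has weight [m^-1], which turns [n^-1] into the normalisation
    at size [n * m]. An index is below [n * m] exactly when its block is below [n], so the types
    agree. *)
Let stageK x : c * qform kap blk (K * m) (aa K) x =
  chaos w (n * m) x - (n * m)%:R^-1 * pform within (K * m) x.
Proof.
have KE : (s.+1 * (n * m) = K * m)%N by rewrite /K mulnA.
rewrite /chaos -mulrBr KE /pform -sumrB.
rewrite /qform (sum_sym_pairs (K * m) (F := fun q q' => aa K q * aa K q' * kap (blk q) (blk q') (x q, x q'))); last 2 first.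
- by move=> q q'; rewrite ksym [aa K q * _]mulrC.
- by move=> q; rewrite kdiag mulr0.
rewrite -[X in c * X]mulr_natl mulrA c2.
rewrite natrM invfM -mulrA; congr (_ * _); rewrite mulr_sumr; apply: eq_bigr => q' _.
rewrite -sumrB mulr_sumr; apply: eq_bigr => q _.
have aK (r : nat) : (r < K * m)%N -> aa K r = (Num.sqrt m%:R)^-1.
  by move=> rK; rewrite /aa ltn_divLR// rK.
have qK : (q < K * m)%N := ltn_trans (ltn_ord q) (ltn_ord q').
rewrite (aK _ qK) (aK _ (ltn_ord q')) -expr2 exprVn sqr_sqrtr//; congr (_ * _).
rewrite /kap /within /blk !ltn_divLR//; case: ifP => _; first by rewrite subrr.
by rewrite subr0.
Qed.

Let lwithin q q' : L2 MM (within q q').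
Proof. by rewrite /within; case: eqP => _; [exact: lw|exact: L2_cst]. Qed.

Let dwithin q q' : degen mu (within q q').
Proof.
rewrite /within; case: eqP => _; first exact: wdegen.
by split; apply: aeW => z; exact: Ex_cst.
Qed.

(** Each of the [K * m] observations has at most [m] partners in its block; dividing by [(n m)^2]
    leaves a bound in [1 / n] only. *)
Let Ex_within : Ex Q (fun x => ((n * m)%:R^-1 * pform within (K * m) x) ^+ 2) <= s.+1%:R * b ^+ 2 * t ^+ 2.
Proof.
have lp := L2_pform iQ lwithin (K * m).
rewrite (_ : Ex _ _ = (n * m)%:R^-1 ^+ 2 * Ex Q (fun x => pform within (K * m) x ^+ 2)); last first.
  rewrite -ExZ; last exact: L2_sqr.
  by apply: Ex_eq => x; rewrite exprMn.
rewrite (Ex_pform_sqr iQ lwithin dwithin).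
have nm0 : 0 < (n * m)%:R :> R by rewrite ltr0n muln_gt0 n0.
have m0' : 0 < m%:R :> R by rewrite ltr0n.
have h : \sum_(q' < K * m) \sum_(q < q') Ex MM (fun z => within q q' z ^+ 2) <= (K * m)%:R * (m%:R * b ^+ 2).
  rewrite mulr_natl -[X in _ *+ X]card_ord -sumr_const; apply: ler_sum => q' _.
  apply: (@le_trans _ _ (\sum_(q < q') (if blk q == blk q' then b ^+ 2 else 0))).
    apply: ler_sum => q _; rewrite /within -/(blk _) -/(blk _); case: eqP => _.
      apply: le_trans (ler_norm _) _; apply: Ex_le_bdd; first exact: L2_sqr.
      by move=> z; apply: bdd_pow.
    rewrite (_ : Ex _ _ = 0)// -[RHS](Ex_cst MM); apply: Ex_eq => z; by rewrite expr0n.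
  apply: (@le_trans _ _ (\sum_(q < K * m) (if blk q == blk q' then b ^+ 2 else 0))).
    rewrite (big_ord_widen (K * m) (fun q => if blk q == blk q' then b ^+ 2 else 0) (ltnW (ltn_ord q'))).
    rewrite big_mkcond; apply: ler_sum => q _; case: ifP => // _; case: ifP => // _; exact: sqr_ge0.
  rewrite (big_blocks K m (fun q => if blk q == blk q' then b ^+ 2 else 0)).
  have bq' : (blk q' < K)%N by rewrite /blk ltn_divLR.
  rewrite (bigD1 (Ordinal bq'))//= [X in _ + X]big1 ?addr0.
    under eq_bigr do rewrite blkE eqxx.
    by rewrite sumr_const card_ord mulr_natl.
  move=> i /eqP ne; apply: big1 => u _; rewrite blkE ifF//.
  by apply/eqP => e; apply: ne; apply: val_inj.
apply: (@le_trans _ _ ((n * m)%:R^-1 ^+ 2 * ((K * m)%:R * (m%:R * b ^+ 2)))).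
  by rewrite ler_wpM2l// sqr_ge0.
rewrite t2 /K !natrM le_eqVlt; apply/orP; left; apply/eqP; field.
by rewrite !lt0r_neq0.
Qed.

(** The [(s + 1) n] swaps cost [n^(-3/2)] each, and the deleted pairs cost [n^(-1/2)] through the
    Lipschitz constant of [f]. *)
Lemma chaos_compare M f f1 f2 : TC M f f1 f2 ->
  `|Ex Q (fun x => f (chaos w n x)) - Ex Q (fun x => f (chaos w (n * m) x))| <=
  (2 * M * (s.+1%:R * b ^+ 2 / 2 + 9 / 2 * (s.+1%:R * b ^+ 2) ^+ 2) * s.+1%:R +
   4 * M * Num.sqrt (s.+1%:R * b ^+ 2)) / Num.sqrt n%:R.
Proof.
move=> tc; have M0 := TC_ge0 tc.
have h1 := swaps tc (leqnn K); rewrite (stage0 tc) in h1.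
have lp := L2Z (n * m)%:R^-1 (L2_pform iQ lwithin (K * m)).
have mch : measurable_fun setT (chaos w (n * m)).
  apply: measurable_funM => //.
  exact: L2_meas (L2_pform iQ (fun q q' => lw (q < n * m)%N (q' < n * m)%N) _).
have l1 : L1 Q (fun x => f (chaos w (n * m) x)).
  by apply: L1_eq (L1_TC Q 0 tc mch) => x; rewrite add0r.
have l2 : L1 Q (fun x => f (c * qform kap blk (K * m) (aa K) x)).
  have := L1_TC Q 0 tc (measurable_funB mch (L2_meas lp)); apply: L1_eq => x.
  by rewrite add0r /= -stageK.
have h2 : `|Ex Q (fun x => f (c * qform kap blk (K * m) (aa K) x)) - Ex Q (fun x => f (chaos w (n * m) x))| <=
    4 * M * Num.sqrt (s.+1%:R * b ^+ 2) * t.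
  rewrite -ExB//; apply: le_trans (Ex_abs (L1B l2 l1)) _.
  apply: (@le_trans _ _ (Ex Q (fun x => 4 * M * `|(n * m)%:R^-1 * pform within (K * m) x|))).
    apply: Ex_le; [exact: (L1_norm (L1B l2 l1))|exact/L1Z/L1_norm/L2_L1|].
    move=> x; rewrite stageK; have := TC_lip (chaos w (n * m) x) (- ((n * m)%:R^-1 * pform within (K * m) x)) tc.
    by rewrite normrN.
  rewrite ExZ; last exact/L1_norm/L2_L1.
  rewrite -[leRHS]mulrA; apply: ler_wpM2l; first by rewrite mulr_ge0.
  apply: le_trans (Ex_norm_le_sqrt lp) _.
  apply: (@le_trans _ _ (Num.sqrt (s.+1%:R * b ^+ 2 * t ^+ 2))).
    by rewrite ler_sqrt// mulr_ge0 ?sqr_ge0// mulr_ge0// sqr_ge0.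
  by rewrite sqrtrM ?mulr_ge0 ?sqr_ge0// sqrtr_sqr gtr0_norm.
have -> : 2 * M * (s.+1%:R * b ^+ 2 / 2 + 9 / 2 * (s.+1%:R * b ^+ 2) ^+ 2) = CC M by [].
have e : K%:R * (CC M * t ^+ 3) = CC M * s.+1%:R * t.
  rewrite /K natrM (_ : n%:R = (t ^+ 2)^-1); last by rewrite t2 invrK.
  by field; rewrite lt0r_neq0.
rewrite e in h1; rewrite -/t mulrDl.
by move: h1 h2; rewrite !ler_norml => /andP[? ?] /andP[? ?]; apply/andP; split; lra.
Qed.

End Compare.
End BoundedChaos.

(** * Truncation and its use in Lindeberg's condition *)

Section Truncation.
Context {R : realType} {d : measure_display} {T : measurableType d}.
Variable Q : probability T R.

Definition trunc (B v : R) : R := Num.max (- B) (Num.min v B).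

Lemma trunc_bdd B v : 0 <= B -> `|trunc B v| <= B.
Proof.
move=> B0; rewrite ler_norml /trunc le_max lexx ge_max ge_min lexx orbT andbT.
by rewrite (le_trans _ B0)// oppr_le0.
Qed.

Lemma trunc_id B v : `|v| <= B -> trunc B v = v.
Proof. by rewrite ler_norml /trunc => /andP[h1 h2]; rewrite min_l// max_r. Qed.

Lemma trunc_dist B v : 0 <= B -> `|v - trunc B v| = Num.max 0 (`|v| - B).
Proof.
move=> B0; rewrite /trunc; have [v0|v0] := leP 0 v.
  rewrite (ger0_norm v0); have [vB|vB] := leP v B.
    by rewrite max_r ?subrr ?normr0 ?max_l ?subr_le0// (le_trans _ v0)// oppr_le0.
  rewrite max_r; last by rewrite (le_trans _ B0)// oppr_le0.
  by rewrite ger0_norm ?max_r// subr_ge0 ltW.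
rewrite (ltr0_norm v0) min_l; last by rewrite (le_trans (ltW v0)).
have [vB|vB] := leP (- B) v; first by rewrite subrr normr0 max_l// subr_le0 lerNl.
rewrite max_r; last by rewrite subr_ge0 lerNr ltW.
by rewrite ltr0_norm ?subr_lt0//; ring.
Qed.

Lemma measurable_trunc B : measurable_fun setT (trunc B : R -> R).
Proof. by apply: measurable_maxr => //; exact: measurable_minr. Qed.

Lemma L2_trunc f B : L2 Q f -> 0 <= B -> L2 Q (fun x => f x - trunc B (f x)).
Proof.
move=> lf B0; apply: L2B => //; apply: (@L2_bdd _ _ _ _ _ B).
  exact: (measurableT_comp (measurable_trunc B) (L2_meas lf)).
by move=> x; exact: trunc_bdd.
Qed.

(** Dominated convergence: the squared error is at most [f ^+ 2] and is eventually 0 at each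
    point. *)
Lemma trunc_L2_cvg f (e : R) : L2 Q f -> 0 < e ->
  exists2 B, 0 < B & Ex Q (fun x => (f x - trunc B (f x)) ^+ 2) <= e.
Proof.
move=> lf e0; have mf := L2_meas lf.
pose g (n : nat) (x : T) := (f x - trunc n%:R (f x)) ^+ 2.
have mg n : measurable_fun setT (g n).
  by apply: measurable_sqr; exact: L2_meas (L2_trunc lf (ler0n R n)).
have gf n x : g n x <= f x ^+ 2.
  rewrite /g -(real_normK (num_real (f x - _))) -(real_normK (num_real (f x))).
  rewrite lerXn2r ?nnegrE// trunc_dist// ge_max normr_ge0/= gerBl//.
have : ((\int[Q]_x (g n x)%:E)%E @[n --> \oo] --> (\int[Q]_x (cst 0%E x))%E).
  apply: (@dominated_cvg _ _ _ _ _ measurableT _ _ (EFin \o (fun x => f x ^+ 2))).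
  - by move=> n; apply/measurable_EFinP.
  - move=> x _; apply: cvg_near_cst; near=> n.
    rewrite /g trunc_id ?subrr ?expr0n//.
    near: n; exact: nbhs_infty_ger.
  - by [].
  - exact: L2_sqr lf.
  - move=> n x _ /=; rewrite lee_fin ger0_norm ?gf//; exact: sqr_ge0.
rewrite integral0 => /fine_cvgP[_] /cvgrPdist_le/(_ e e0)[N _ h].
exists N.+1%:R; first by rewrite ltr0n.
have := h N.+1 (leqnSn N); rewrite /= sub0r normrN; apply: le_trans.
exact: ler_norm.
Unshelve. all: by end_near. Qed.

(** For [|f| <= B] the cubic side of [rho] gives the first term. For [|f| > B] one has
    [|f| <= 2 (|f| - B / 2)], and the quadratic side is controlled by the truncation error at level
    [B / 2]. *)
Lemma rho_scale (f : R) (B v : R) : 0 < B -> 0 < v -> v ^+ 2 * rho (f / v) <=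
  B * v^-1 * f ^+ 2 + 4 * (f - trunc (B / 2) f) ^+ 2.
Proof.
move=> B0 v0; have [fB|fB] := leP `|f| B.
  apply: (@le_trans _ _ (B * v^-1 * f ^+ 2)); last first.
    by rewrite lerDl mulr_ge0// sqr_ge0.
  apply: (@le_trans _ _ (v ^+ 2 * `|f / v| ^+ 3)).
    by rewrite ler_wpM2l ?sqr_ge0// rho_cube.
  rewrite normrM normfV (gtr0_norm v0) -[f ^+ 2](real_normK (num_real f)).
  have -> : v ^+ 2 * (`|f| / v) ^+ 3 = `|f| * (v^-1 * `|f| ^+ 2) by field; rewrite lt0r_neq0.
  by rewrite -mulrA ler_wpM2r// mulr_ge0 ?invr_ge0 ?(ltW v0)// exprn_ge0.
apply: (@le_trans _ _ (4 * (f - trunc (B / 2) f) ^+ 2)); last first.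
  by rewrite lerDr; apply: mulr_ge0; [apply: mulr_ge0; rewrite ?invr_ge0 ltW|exact: sqr_ge0].
apply: (@le_trans _ _ (v ^+ 2 * (f / v) ^+ 2)).
  by rewrite ler_wpM2l ?sqr_ge0// rho_sqr.
have -> : v ^+ 2 * (f / v) ^+ 2 = `|f| ^+ 2 by rewrite real_normK ?num_real//; field; rewrite lt0r_neq0.
have B2 : 0 <= B / 2 by rewrite divr_ge0// ltW.
rewrite -(real_normK (num_real (f - _))) trunc_dist// max_r; last by rewrite subr_ge0; lra.
nra.
Qed.

End Truncation.

Section Swap.
Context {R : realType} {d : measure_display} {E : measurableType d}.
Variable mu : probability E R.
Let MM : probability (E * E)%type R := (mu \x mu)%E.

Lemma mpres_swap : mpres MM MM (fun z => (z.2, z.1)).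
Proof.
have ms : measurable_fun setT (fun z : E * E => (z.2, z.1)) by exact: measurable_fun_pair.
split=> // A mA; apply/esym.
apply: (@product_measure_unique _ _ _ _ _ mu mu (pushforward MM (fun z => (z.2, z.1)))) => // A1 A2 mA1 mA2.
transitivity (MM (A2 `*` A1)).
  rewrite /pushforward; congr (MM _); apply/seteqP; split => [[x y] /= [] //|[x y] /= []//].
by rewrite /MM/= product_measure1E// muleC.
Qed.

End Swap.

(** * Chaos with square-integrable kernels *)

Section L2Chaos.
Context {R : realType} {d : measure_display} {E : measurableType d}.
Variables (mu : probability E R) (Q : probability (seqspace E nat) R).
Hypothesis iQ : iid_law mu Q.
Local Notation T := (seqspace E nat).
Let MM : probability (E * E)%type R := (mu \x mu)%E.
Variable s : nat.

Section Center.
Variables (k : E * E -> R) (B : R).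
Hypotheses (mk : measurable_fun setT k) (kB : forall z, `|k z| <= B).

(** Hoeffding's projection onto doubly degenerate kernels: both marginals are removed, and the mean,
    thereby subtracted twice, is restored once. *)
Definition dcenter (z : E * E) : R := k z - Ex mu (fun z' => k (z.1, z')) -
  Ex mu (fun y => k (y, z.2)) + Ex MM k.

Let mkr y : measurable_fun setT (fun z => k (y, z)).
Proof. by apply: (measurableT_comp mk); exact: measurable_pair1. Qed.
Let mkl y : measurable_fun setT (fun z => k (z, y)).
Proof. by apply: (measurableT_comp mk); exact: measurable_pair2. Qed.
Let lkr y : L1 mu (fun z => k (y, z)). Proof. exact: L1_bdd. Qed.
Let lkl y : L1 mu (fun z => k (z, y)). Proof. exact: L1_bdd. Qed.
Let lk : L1 MM k. Proof. exact: L1_bdd. Qed.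
Let lks : L1 MM (fun z => k (z.2, z.1)). Proof. exact: (L1_mp (mpres_swap mu) lk). Qed.

Let g1 y := Ex mu (fun z => k (y, z)).
Let g2 z := Ex mu (fun y => k (y, z)).
Let mg1 : measurable_fun setT g1. Proof. exact: (meas_fubini lk). Qed.
Let mg2 : measurable_fun setT g2. Proof. exact: (meas_fubini lks). Qed.
Let bg1 y : `|g1 y| <= B. Proof. exact: Ex_le_bdd. Qed.
Let bg2 y : `|g2 y| <= B. Proof. exact: Ex_le_bdd. Qed.
Let Eg1 : Ex mu g1 = Ex MM k. Proof. by rewrite (Ex_fubini lk). Qed.
Let Eg2 : Ex mu g2 = Ex MM k.
Proof. by rewrite (Ex_mp (mpres_swap mu) mk) (Ex_fubini lks). Qed.

Lemma measurable_dcenter : measurable_fun setT dcenter.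
Proof.
apply: measurable_funD => //; apply: measurable_funB.
  by apply: measurable_funB => //; exact: (measurableT_comp mg1 measurable_fst).
exact: (measurableT_comp mg2 measurable_snd).
Qed.

Lemma dcenter_bdd z : `|dcenter z| <= 4 * B.
Proof.
have h1 := kB z; have h2 := bg1 z.1; have h3 := bg2 z.2; have h4 : `|Ex MM k| <= B by exact: Ex_le_bdd.
rewrite /dcenter -/(g1 z.1) -/(g2 z.2).
by move: h1 h2 h3 h4; rewrite !ler_norml => /andP[? ?] /andP[? ?] /andP[? ?] /andP[? ?];
  apply/andP; split; lra.
Qed.

Lemma dcenter_degr y : Ex mu (fun z => dcenter (y, z)) = 0.
Proof.
rewrite /dcenter/= -/(g1 y).
have l1 := L1B (lkr y) (L1_cst mu (g1 y)); have l2 := L1_bdd mu mg2 bg2.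
rewrite (ExD (L1B l1 l2) (L1_cst mu _)) (ExB l1 l2) (ExB (lkr y) (L1_cst mu _)) !Ex_cst.
by rewrite -/(g1 y) Eg2; ring.
Qed.

(** As [w] is degenerate, the marginals of [k] are, up to sign, those of [w - k]. By Jensen each
    correction term has second moment at most that of [w - k]; four terms and [(a + b + c + d)^2 <=
    4 (a^2 + b^2 + c^2 + d^2)] give 16. *)
Lemma dcenter_dist w : L2 MM w -> degen mu w ->
  Ex MM (fun z => (w z - dcenter z) ^+ 2) <= 16 * Ex MM (fun z => (w z - k z) ^+ 2).
Proof.
move=> lw [dw1 dw2]; have lD : L2 MM (fun z => w z - k z) by apply: L2B => //; exact: (L2_bdd _ mk kB).
have lDs : L2 MM (fun z => w (z.2, z.1) - k (z.2, z.1)) by exact: (L2_mp (mpres_swap mu) lD).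
set D2 := Ex MM (fun z => (w z - k z) ^+ 2).
have mw := L2_meas lw.
have mwr y : measurable_fun setT (fun z => w (y, z)).
  by apply: (measurableT_comp mw); exact: measurable_pair1.
have mwl y : measurable_fun setT (fun z => w (z, y)).
  by apply: (measurableT_comp mw); exact: measurable_pair2.
have lws : L2 MM (fun z => w (z.2, z.1)) by exact: (L2_mp (mpres_swap mu) lw).
have lg1 : L2 mu g1 by exact: (L2_bdd _ mg1 bg1).
have lg2 : L2 mu g2 by exact: (L2_bdd _ mg2 bg2).
have hg1 : Ex mu (fun y => g1 y ^+ 2) <= D2.
  rewrite /D2 (Ex_fubini (L2_sqr lD)); apply: Ex_ae_le; [exact: L2_sqr|exact: (L1_fubini (L2_sqr lD))|].
  have ae3 := L1_ae_section (L2_sqr lD); have ae1 := L1_ae_section (L2_L1 lw).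
  apply: (ae_imp2 dw1 (ae_imp2 ae1 ae3 (fun x a b => conj a b))) => y wy [l1 l2].
  have -> : g1 y = - Ex mu (fun z => w (y, z) - k (y, z)) by rewrite (ExB l1 (lkr y)) wy /g1; ring.
  rewrite sqrrN; apply: Ex_sqr_jensen; split => //.
  by apply: measurable_funB.
have hg2 : Ex mu (fun y => g2 y ^+ 2) <= D2.
  have e : D2 = Ex MM (fun z => (w (z.2, z.1) - k (z.2, z.1)) ^+ 2).
    exact: (Ex_mp (mpres_swap mu) (measurable_sqr (L2_meas lD))).
  rewrite e (Ex_fubini (L2_sqr lDs)); apply: Ex_ae_le; [exact: L2_sqr|exact: (L1_fubini (L2_sqr lDs))|].
  have ae3 := L1_ae_section (L2_sqr lDs); have ae1 := L1_ae_section (L2_L1 lws).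
  apply: (ae_imp2 dw2 (ae_imp2 ae1 ae3 (fun x a b => conj a b))) => y wy [l1 l2].
  have -> : g2 y = - Ex mu (fun z => w (z, y) - k (z, y)) by rewrite (ExB l1 (lkl y)) wy /g2; ring.
  rewrite sqrrN; apply: Ex_sqr_jensen; split => //.
  by apply: measurable_funB.
have hc : Ex MM k ^+ 2 <= D2.
  by rewrite -Eg1; apply: le_trans hg1; exact: Ex_sqr_jensen.
have lg1' : L2 MM (fun z => g1 z.1) by exact: (L2_mp (mpres_fst mu mu) lg1).
have lg2' : L2 MM (fun z => g2 z.2) by exact: (L2_mp (mpres_snd mu mu) lg2).
have l1 := L1D (L1D (L2_sqr lD) (L2_sqr lg1')) (L2_sqr lg2').
have l2 := L1D l1 (L1_cst MM (Ex MM k ^+ 2)).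
apply: (@le_trans _ _ (Ex MM (fun z => 4 * ((w z - k z) ^+ 2 + g1 z.1 ^+ 2 + g2 z.2 ^+ 2 + Ex MM k ^+ 2)))).
  apply: Ex_le; [|exact: L1Z|move=> z].
    by apply: L2_sqr; apply: L2B => //; exact: (L2_bdd _ measurable_dcenter dcenter_bdd).
  rewrite /dcenter -/(g1 z.1) -/(g2 z.2).
  move: (w z) (k z) (g1 z.1) (g2 z.2) (Ex MM k) => a b c e f.
  rewrite -subr_ge0 (_ : _ - _ = ((a - b) - c) ^+ 2 + ((a - b) - e) ^+ 2 + ((a - b) + f) ^+ 2 +
    (c - e) ^+ 2 + (c + f) ^+ 2 + (e + f) ^+ 2); last ring.
  by rewrite !addr_ge0 ?sqr_ge0.
rewrite (ExZ _ l2) (ExD l1 (L1_cst MM _)) (ExD (L1D (L2_sqr lD) (L2_sqr lg1')) (L2_sqr lg2')).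
rewrite (ExD (L2_sqr lD) (L2_sqr lg1')) Ex_cst -/D2.
rewrite -(Ex_mp (mpres_fst mu mu) (measurable_sqr mg1)) -(Ex_mp (mpres_snd mu mu) (measurable_sqr mg2)).
lra.
Qed.

End Center.

Section Kernel.
Variable w : bool -> bool -> E * E -> R.
Hypotheses (lw : forall t t', L2 MM (w t t'))
  (wdeg : forall t t', degen mu (w t t')).

Lemma L2_chaos n : L2 Q (chaos s w n).
Proof. exact/L2Z/(L2_pform iQ (fun q q' => lw _ _)). Qed.

Lemma Ex_chaos n : Ex Q (chaos s w n) = 0.
Proof.
rewrite ExZ; last exact/L2_L1/(L2_pform iQ (fun q q' => lw _ _)).
by rewrite (Ex_pform iQ (fun q q' => lw _ _) (fun q q' => wdeg _ _)) mulr0.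
Qed.

Lemma Ex_chaos_sqr_le n (e : R) : (0 < n)%N -> (forall t t', Ex MM (fun z => w t t' z ^+ 2) <= e) ->
  Ex Q (fun x => chaos s w n x ^+ 2) <= s.+1%:R ^+ 2 * e.
Proof.
move=> n0 we; have e0 : 0 <= e by apply: le_trans (we true true); exact: Ex_sqr_ge0.
rewrite (_ : Ex _ _ = n%:R^-1 ^+ 2 * Ex Q (fun x => pform (fun q q' => w (q < n)%N (q' < n)%N) (s.+1 * n) x ^+ 2)); last first.
  rewrite -ExZ; last exact: (L2_sqr (L2_pform iQ (fun q q' => lw _ _) _)).
  by apply: Ex_eq => x; rewrite exprMn.
rewrite (Ex_pform_sqr iQ (fun q q' => lw _ _) (fun q q' => wdeg _ _)).
have n0' : 0 < n%:R :> R by rewrite ltr0n.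
rewrite exprVn ler_pdivrMl ?exprn_gt0//.
apply: (@le_trans _ _ (\sum_(q' < s.+1 * n) \sum_(q < s.+1 * n) e)).
  apply: ler_sum => q' _; apply: (@le_trans _ _ (\sum_(q < q') e)).
    by apply: ler_sum => q _; exact: we.
  by rewrite !sumr_const !card_ord -!(mulr_natl e) ler_wpM2r// ler_nat ltnW.
rewrite !sumr_const !card_ord -mulrnA -(mulr_natl e) !natrM.
by move: (s.+1%:R : R) (n%:R : R) => a c; rewrite le_eqVlt; apply/orP; left; apply/eqP; ring.
Qed.

End Kernel.

Lemma degenB (f g : E * E -> R) : L2 MM f -> L2 MM g -> degen mu f -> degen mu g ->
  degen mu (fun z => f z - g z).
Proof.
move=> lf lg [f1 f2] [g1 g2].
have lfs := L2_mp (mpres_swap mu) lf; have lgs := L2_mp (mpres_swap mu) lg.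
split.
  have l := ae_imp2 (L1_ae_section (L2_L1 lf)) (L1_ae_section (L2_L1 lg)) (fun x a b => conj a b).
  apply: (ae_imp2 l (ae_imp2 f1 g1 (fun x a b => conj a b))) => z [h1 h2] [e1 e2].
  by rewrite (ExB h1 h2) e1 e2 subr0.
have l := ae_imp2 (L1_ae_section (L2_L1 lfs)) (L1_ae_section (L2_L1 lgs)) (fun x a b => conj a b).
apply: (ae_imp2 l (ae_imp2 f2 g2 (fun x a b => conj a b))) => z [h1 h2] [e1 e2].
by rewrite (ExB h1 h2) e1 e2 subr0.
Qed.

Lemma chaosB (w w' : bool -> bool -> E * E -> R) n x :
  chaos s w n x - chaos s w' n x = chaos s (fun t t' z => w t t' z - w' t t' z) n x.
Proof.
rewrite /chaos -mulrBr /pform -sumrB; congr (_ * _); apply: eq_bigr => q' _.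
by rewrite -sumrB.
Qed.

Section Approximation.
Variable w : bool -> bool -> E * E -> R.
Hypotheses (lw : forall t t', L2 MM (w t t'))
  (wsym : forall t t' y z, w t t' (y, z) = w t' t (z, y))
  (wdeg : forall t t', degen mu (w t t')).

Lemma trunc_mono (B B' v : R) : 0 <= B -> B <= B' -> (v - trunc B' v) ^+ 2 <= (v - trunc B v) ^+ 2.
Proof.
move=> B0 BB'; rewrite -(real_normK (num_real (v - trunc B' v))) -(real_normK (num_real (v - trunc B v))).
rewrite lerXn2r ?nnegrE// !trunc_dist ?(le_trans B0)// ge_max !le_max lexx/=.
by apply/orP; right; rewrite lerD2l lerN2.
Qed.

(* truncate, then restore degeneracy by double centring *)
Lemma chaos_approx (e : R) : 0 < e -> exists (w' : bool -> bool -> E * E -> R) (b : R),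
  [/\ forall t t', measurable_fun setT (w' t t'), forall t t' z, `|w' t t' z| <= b,
      forall t t' y z, w' t t' (y, z) = w' t' t (z, y),
      forall t t' y, Ex mu (fun z => w' t t' (y, z)) = 0 &
      forall n, (0 < n)%N -> Ex Q (fun x => (chaos s w n x - chaos s w' n x) ^+ 2) <= e].
Proof.
(* 16 is the loss in [dcenter_dist], and [s.+1%:R ^+ 2] the loss in [Ex_chaos_sqr_le]. *)
move=> e0; pose e' := e / (16 * s.+1%:R ^+ 2).
have s0 : 0 < s.+1%:R :> R by rewrite ltr0n.
have e'0 : 0 < e' by rewrite divr_gt0// mulr_gt0// exprn_gt0.
have /choice[Bf hB] : forall p : bool * bool, exists B, 0 < B /\
    Ex MM (fun z => (w p.1 p.2 z - trunc B (w p.1 p.2 z)) ^+ 2) <= e'.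
  by move=> p; have [B B0 h] := trunc_L2_cvg (lw p.1 p.2) e'0; exists B.
(* One common truncation level keeps the symmetry between [w t t'] and [w t' t]. *)
pose B := \sum_p Bf p.
have Bp p : Bf p <= B.
  rewrite /B (bigD1 p)//= lerDl sumr_ge0// => i _; exact: ltW (hB i).1.
have B0 : 0 < B by apply: lt_le_trans (Bp (true, true)); exact: (hB _).1.
pose k t t' z := trunc B (w t t' z).
have mk t t' : measurable_fun setT (k t t').
  exact: (measurableT_comp (measurable_trunc B) (L2_meas (lw t t'))).
have kB t t' z : `|k t t' z| <= B by apply: trunc_bdd; exact: ltW.
have ksym t t' y z : k t t' (y, z) = k t' t (z, y) by rewrite /k wsym.
have wk t t' : Ex MM (fun z => (w t t' z - k t t' z) ^+ 2) <= e'.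
  apply: le_trans (hB (t, t')).2; apply: Ex_le.
  - exact: (L2_sqr (L2_trunc (lw t t') (ltW B0))).
  - exact: (L2_sqr (L2_trunc (lw t t') (ltW (hB (t, t')).1))).
  by move=> z; apply: trunc_mono; [exact: ltW (hB (t, t')).1|exact: Bp].
exists (fun t t' => dcenter (k t t')), (4 * B); split.
- by move=> t t'; exact: (measurable_dcenter (mk t t') (kB t t')).
- by move=> t t' z; exact: (dcenter_bdd (mk t t') (kB t t')).
- move=> t t' y z; rewrite /dcenter/= ksym.
  have -> : Ex MM (k t t') = Ex MM (k t' t).
    rewrite (Ex_mp (mpres_swap mu) (mk t t')); apply: Ex_eq => -[a b]/=; exact: ksym.
  congr (_ + _); rewrite -!addrA; congr (_ + _); rewrite addrC; congr (- _ - _).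
    by apply: Ex_eq => a; rewrite ksym.
  by apply: Ex_eq => a; rewrite ksym.
- by move=> t t' y; exact: (dcenter_degr (mk t t') (kB t t')).
move=> n n0; pose w2 t t' z := w t t' z - dcenter (k t t') z.
have ld t t' : L2 MM (dcenter (k t t')).
  exact: (L2_bdd _ (measurable_dcenter (mk t t') (kB t t')) (dcenter_bdd (mk t t') (kB t t'))).
have h t t' : Ex MM (fun z => w2 t t' z ^+ 2) <= 16 * e'.
  apply: le_trans (dcenter_dist (mk t t') (kB t t') (lw t t') (wdeg t t')) _.
  by rewrite ler_wpM2l.
have dd t t' : degen mu (dcenter (k t t')).
  split; apply: aeW => z; first exact: (dcenter_degr (mk t t') (kB t t')).
  have e1 y : dcenter (k t t') (y, z) = dcenter (k t' t) (z, y).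
    rewrite /dcenter/= ksym.
    have -> : Ex MM (k t t') = Ex MM (k t' t).
      rewrite (Ex_mp (mpres_swap mu) (mk t t')); apply: Ex_eq => -[a b]/=; exact: ksym.
    congr (_ + _); rewrite -!addrA; congr (_ + _); rewrite addrC; congr (- _ - _).
      by apply: Ex_eq => a; rewrite ksym.
    by apply: Ex_eq => a; rewrite ksym.
  by under Ex_eq do rewrite e1; exact: (dcenter_degr (mk t' t) (kB t' t)).
have l2 t t' : L2 MM (w2 t t') by apply: L2B.
have d2 t t' : degen mu (w2 t t') by exact: degenB.
have := Ex_chaos_sqr_le l2 d2 n0 h.
rewrite (_ : s.+1%:R ^+ 2 * (16 * e') = e); last by rewrite /e'; field; rewrite lt0r_neq0.
apply: le_trans; rewrite le_eqVlt; apply/orP; left; apply/eqP; apply: Ex_eq => x.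
by rewrite chaosB.
Qed.

(** Sizes [n] and [n'] are both compared with [n * n']. Since [chaos_compare] is uniform in the
    refinement, only [n] and [n'] have to be large. *)
Lemma chaos_cauchy M f f1 f2 (e : R) : TC M f f1 f2 -> 0 < e ->
  exists n0, forall n n', (n0 <= n)%N -> (n0 <= n')%N -> (0 < n)%N -> (0 < n')%N ->
  `|Ex Q (fun x => f (chaos s w n x)) - Ex Q (fun x => f (chaos s w n' x))| <= e.
Proof.
move=> tc e0; have M0 := TC_ge0 tc.
have M1 : 0 < M + 1 by rewrite ltr_wpDl.
(* Chosen so that the Lipschitz constant [4 * M] times the square root of [e1] is at most
   [e / 8]. *)
pose e1 := (e / (32 * (M + 1))) ^+ 2.
have e10 : 0 < e1 by rewrite exprn_gt0// divr_gt0// mulr_gt0.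
have [w' [b [mw' bw' sw' dw' aw']]] := chaos_approx e10.
have lw' t t' : L2 MM (w' t t') := L2_bdd _ (mw' t t') (bw' t t').
pose C := (2 * M * (s.+1%:R * b ^+ 2 / 2 + 9 / 2 * (s.+1%:R * b ^+ 2) ^+ 2) * s.+1%:R +
   4 * M * Num.sqrt (s.+1%:R * b ^+ 2)).
have C0 : 0 <= C.
  have ? : 0 <= s.+1%:R * b ^+ 2 by rewrite mulr_ge0// sqr_ge0.
  have ? : 0 <= (s.+1%:R * b ^+ 2) ^+ 2 by exact: sqr_ge0.
  rewrite /C addr_ge0//; last by rewrite !mulr_ge0// sqrtr_ge0.
  by apply: mulr_ge0 => //; apply: mulr_ge0; [exact: mulr_ge0|lra].
have lf (Y : T -> R) : L2 Q Y -> L1 Q (fun x => f (Y x)).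
  by move=> lY; apply: L1_eq (L1_TC Q 0 tc (L2_meas lY)) => x; rewrite add0r.
have step n : (0 < n)%N -> `|Ex Q (fun x => f (chaos s w n x)) - Ex Q (fun x => f (chaos s w' n x))| <= e / 8.
  move=> n0; have la := L2_chaos lw n; have lb := L2_chaos lw' n.
  rewrite -ExB; [|exact: lf..].
  apply: le_trans (Ex_abs (L1B (lf _ la) (lf _ lb))) _.
  apply: (@le_trans _ _ (Ex Q (fun x => 4 * M * `|chaos s w n x - chaos s w' n x|))).
    apply: Ex_le; [exact: (L1_norm (L1B (lf _ la) (lf _ lb)))|exact/L1Z/L1_norm/L2_L1/L2B|].
    move=> x; have := TC_lip (chaos s w' n x) (chaos s w n x - chaos s w' n x) tc.
    by rewrite addrCA subrr addr0.
  rewrite ExZ; last exact/L1_norm/L2_L1/L2B.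
  apply: (@le_trans _ _ (4 * M * (e / (32 * (M + 1))))).
    rewrite ler_wpM2l ?mulr_ge0//; apply: le_trans (Ex_norm_le_sqrt (L2B la lb)) _.
    rewrite -[leRHS]ger0_norm ?divr_ge0 ?(ltW e0) ?mulr_ge0 ?(ltW M1)// -sqrtr_sqr ler_sqrt ?sqr_ge0//.
    exact: aw'.
  have -> : 4 * M * (e / (32 * (M + 1))) = e / 8 * (M / (M + 1)) by field; rewrite lt0r_neq0.
  rewrite ler_piMr ?divr_ge0 ?(ltW e0)// ler_pdivrMr// mul1r; lra.
pose n0 := (Num.bound ((8 * C / e) ^+ 2)).+1.
have Cn n : (n0 <= n)%N -> C / Num.sqrt n%:R <= e / 8.
  move=> nn; have n0' : 0 < n%:R :> R by rewrite ltr0n (leq_trans _ nn).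
  rewrite ler_pdivrMr ?sqrtr_gt0// mulrC -ler_pdivrMr ?divr_gt0//.
  rewrite (_ : C / (e / 8) = 8 * C / e); last by field; rewrite lt0r_neq0.
  have c0 : 0 <= 8 * C / e by rewrite divr_ge0 ?mulr_ge0// ltW.
  rewrite -[leLHS]ger0_norm// -sqrtr_sqr ler_sqrt ?ler0n//.
  have := archi_boundP (sqr_ge0 (8 * C / e)) => /ltW h; apply: (le_trans h).
  by rewrite ler_nat; exact: leq_trans (leqnSn _) nn.
exists n0 => n n' hn hn' n_0 n'_0.
have c1 := chaos_compare iQ s mw' bw' sw' dw' n_0 n'_0 tc.
have c2 := chaos_compare iQ s mw' bw' sw' dw' n'_0 n_0 tc.
rewrite -/C mulnC in c2; rewrite -/C in c1.
have := step n n_0; have := step n' n'_0; have := Cn n hn; have := Cn n' hn'.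
move: c1 c2; rewrite !ler_norml => /andP[? ?] /andP[? ?] ? ? /andP[? ?] /andP[? ?].
by apply/andP; split; lra.
Qed.

(** Uniform integrability as smallness of the excess over a level [A]. If [y'] is the value with
    bounded kernels, then [y^2 - A <= 2 y'^2 - A + 2 (y - y')^2 <= y'^4 / A + 2 (y - y')^2], and the
    fourth moment of [y'] is bounded uniformly in [n]. *)
Lemma chaos_ui (e : R) : 0 < e -> exists2 A, 0 < A & forall n, (0 < n)%N ->
  Ex Q (fun x => chaos s w n x ^+ 2 - Num.min (chaos s w n x ^+ 2) A) <= e.
Proof.
move=> e0; have e4 : 0 < e / 4 by rewrite divr_gt0.
have [w' [b [mw' bw' sw' dw' aw']]] := chaos_approx e4.
have lw' t t' : L2 MM (w' t t') := L2_bdd _ (mw' t t') (bw' t t').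
pose C := 19 * b ^+ 4 * s.+1%:R ^+ 4.
have b0 : 0 <= b by exact: le_trans (bw' true true point).
have C0 : 0 <= C by rewrite mulr_ge0 ?mulr_ge0 ?exprn_ge0.
pose A := 2 * C / e + 1.
have A0 : 0 < A by rewrite ltr_wpDl// divr_ge0 ?mulr_ge0// ltW.
exists A => // n n0; have la := L2_chaos lw n; have lb := L2_chaos lw' n.
have lmin : L1 Q (fun x => Num.min (chaos s w n x ^+ 2) A).
  apply: (@L1_bdd _ _ _ _ _ A).
    by apply: measurable_minr => //; exact: measurable_sqr (L2_meas la).
  by move=> x; rewrite ger0_norm ?ge_min ?lexx ?orbT// le_min sqr_ge0 ltW.
have Pb : exists Pb, forall x, `|chaos s w' n x| <= Pb.
  exists (n%:R^-1 * \sum_(q' < s.+1 * n) \sum_(q < q') b) => x.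
  rewrite normrM ger0_norm ?invr_ge0// ler_wpM2l ?invr_ge0//.
  apply: le_trans (ler_norm_sum _ _ _) _; apply: ler_sum => q' _.
  by apply: le_trans (ler_norm_sum _ _ _) _; apply: ler_sum.
have [Pb' hPb] := Pb.
have l4 : L1 Q (fun x => chaos s w' n x ^+ 4).
  apply: (@L1_bdd _ _ _ _ _ (Pb' ^+ 4)); first by apply: measurable_funX; exact: L2_meas lb.
  by move=> x; exact: bdd_pow.
have ld := L2_sqr (L2B la lb).
apply: (@le_trans _ _ (Ex Q (fun x => A^-1 * chaos s w' n x ^+ 4 + 2 * (chaos s w n x - chaos s w' n x) ^+ 2))).
  apply: Ex_le; [exact: (L1B (L2_sqr la) lmin)|by apply: L1D; exact: L1Z|move=> x].
  move: (chaos s w n x) (chaos s w' n x) => y y'.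
  have h0 : 0 <= A^-1 * y' ^+ 4 + 2 * (y - y') ^+ 2.
    by apply: addr_ge0; apply: mulr_ge0; rewrite ?sqr_ge0 ?invr_ge0 ?(ltW A0) ?exprn_even_ge0.
  have [h|h] := leP (y ^+ 2) A; first by rewrite subrr.
  have : 0 <= A^-1 * (y' ^+ 2 - A) ^+ 2 by rewrite mulr_ge0 ?sqr_ge0 ?invr_ge0 ?(ltW A0).
  have -> : A^-1 * (y' ^+ 2 - A) ^+ 2 = A^-1 * y' ^+ 4 - 2 * y' ^+ 2 + A by field; rewrite lt0r_neq0.
  have : 0 <= (y - 2 * y') ^+ 2 by exact: sqr_ge0.
  lra.
rewrite (ExD (L1Z _ l4) (L1Z 2 ld)) (ExZ _ l4) (ExZ _ ld).
have h4 := Ex_chaos_pow4 iQ s mw' bw' sw' dw' n0.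
have h2 := aw' n n0.
have : A^-1 * Ex Q (fun x => chaos s w' n x ^+ 4) <= e / 2.
  rewrite ler_pdivrMl//; apply: (le_trans h4); rewrite -/C /A.
  have -> : (2 * C / e + 1) * (e / 2) = C + e / 2 by field; rewrite lt0r_neq0.
  by rewrite lerDl divr_ge0// ltW.
lra.
Qed.

(** Pair counts divided by [n^2]: [n (n - 1) / 2] among cases, [n * s n] mixed, [s n (s n - 1) / 2]
    among controls. *)
Lemma Ex_chaos_sqr n : (0 < n)%N -> Ex Q (fun x => chaos s w n x ^+ 2) =
  (1 - n%:R^-1) / 2 * Ex MM (fun z => w true true z ^+ 2) +
  s%:R * Ex MM (fun z => w true false z ^+ 2) +
  s%:R * (s%:R - n%:R^-1) / 2 * Ex MM (fun z => w false false z ^+ 2).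
Proof.
move=> n0; have n0' : n%:R != 0 :> R by rewrite pnatr_eq0 -lt0n.
rewrite (_ : Ex _ _ = n%:R^-1 ^+ 2 * Ex Q (fun x => pform (fun q q' => w (q < n)%N (q' < n)%N) (s.+1 * n) x ^+ 2)); last first.
  rewrite -ExZ; last exact: (L2_sqr (L2_pform iQ (fun q q' => lw _ _) _)).
  by apply: Ex_eq => x; rewrite exprMn.
rewrite (Ex_pform_sqr iQ (fun q q' => lw _ _) (fun q q' => wdeg _ _)).
set v11 := Ex MM (fun z => w true true z ^+ 2); set v10 := Ex MM (fun z => w true false z ^+ 2).
set v00 := Ex MM (fun z => w false false z ^+ 2).
have sumid m : \sum_(q < m) (q%:R : R) = m%:R * (m%:R - 1) / 2.
  elim: m => [|m ih]; first by rewrite big_ord0 !mul0r.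
  by rewrite big_ord_recr/= ih -natr1; field.
have -> : (s.+1 * n = n + s * n)%N by rewrite mulSn.
rewrite big_split_ord/=.
have -> : \sum_(i < n) \sum_(q < i) Ex MM (fun z => w (q < n)%N (i < n)%N z ^+ 2) = n%:R * (n%:R - 1) / 2 * v11.
  rewrite -sumid mulr_suml; apply: eq_bigr => i _.
  rewrite mulr_natl -[X in _ = _ *+ X]card_ord -sumr_const; apply: eq_bigr => q _.
  by rewrite ltn_ord (ltn_trans (ltn_ord q)).
have -> : \sum_(i < s * n) \sum_(q < n + i) Ex MM (fun z => w (q < n)%N (n + i < n)%N z ^+ 2) =
    (s * n)%:R * (n%:R * v10) + (s * n)%:R * ((s * n)%:R - 1) / 2 * v00.
  rewrite -sumid mulr_suml mulr_natl -[X in _ *+ X]card_ord -sumr_const -big_split/=.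
  apply: eq_bigr => i _; rewrite big_split_ord/=; congr (_ + _).
    rewrite mulr_natl -[X in _ = _ *+ X]card_ord -sumr_const; apply: eq_bigr => q _.
    by rewrite ltn_ord ltnNge leq_addr.
  rewrite mulr_natl -[X in _ = _ *+ X]card_ord -sumr_const; apply: eq_bigr => q _.
  by rewrite !ltnNge !leq_addr.
by rewrite natrM; field.
Qed.

End Approximation.
End L2Chaos.

(** * Weak limits *)

Section TCstable.
Context {R : realType}.

(** Where [y^2] is the smaller side of [rho], either [y = 0] or [|y| >= 1]; in the latter case
    boundedness of the three functions suffices, by [2 + |y| + y^2 / 2 <= 4 y^2]. *)
Lemma TC_of_cube (K : R) (f f1 f2 : R -> R) :
  measurable_fun setT f -> measurable_fun setT f1 -> measurable_fun setT f2 ->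
  (forall x, [/\ `|f x| <= K, `|f1 x| <= K & `|f2 x| <= K]) ->
  (forall x y, `|f (x + y) - f x - f1 x * y - f2 x * y ^+ 2 / 2| <= K * `|y| ^+ 3) ->
  TC (4 * K) f f1 f2.
Proof.
move=> mf mf1 mf2 b r; have K0 : 0 <= K by case: (b 0) => + _ _; exact: le_trans.
split=> //.
  by move=> x; have [h1 h2 h3] := b x; split; lra.
move=> x y; have y0 : 0 <= `|y| by [].
rewrite /rho; have [h|h] := leP (y ^+ 2) (`|y| ^+ 3); last first.
  apply: le_trans (r x y) _; apply: ler_wpM2r; [exact: exprn_ge0|lra].
have [y1|y1] := leP `|y| 1.
  apply: le_trans (r x y) _; rewrite -(real_normK (num_real y)).
  have : `|y| ^+ 3 <= `|y| ^+ 2 by rewrite exprS ler_piMl// exprn_ge0.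
  have : 0 <= `|y| ^+ 2 by exact: exprn_ge0.
  move: (`|y| ^+ 3) (`|y| ^+ 2) => a c c0 ac; nra.
have [fx f1x f2x] := b x; have [fy _ _] := b (x + y).
have h1 : `|f1 x * y| <= K * `|y| by rewrite normrM ler_wpM2r.
have h2 : `|f2 x * y ^+ 2 / 2| <= K * `|y| ^+ 2 / 2.
  rewrite -mulrA normrM -mulrA; apply: ler_pM => //.
  by rewrite real_normK ?num_real// ger0_norm// divr_ge0// sqr_ge0.
apply: (@le_trans _ _ (K + K + K * `|y| + K * `|y| ^+ 2 / 2)).
  apply: le_trans (ler_normB _ _) _; apply: lerD => //.
  apply: le_trans (ler_normB _ _) _; apply: lerD => //.
  by apply: le_trans (ler_normB _ _) _; apply: lerD.
rewrite -(real_normK (num_real y)); set z := `|y| in y0 y1 *.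
have -> : 4 * K * z ^+ 2 = K * (4 * z ^+ 2) by ring.
have -> : K + K + K * z + K * z ^+ 2 / 2 = K * (2 + z + z ^+ 2 / 2) by field.
apply: ler_wpM2l => //; nra.
Qed.

Lemma TC_cst (c : R) : TC `|c| (fun=> c) (fun=> 0) (fun=> 0).
Proof.
split; [by split|by move=> x; rewrite normr0 lexx normr_ge0|move=> x y].
by rewrite !mul0r !subr0 subrr normr0; apply: mulr_ge0 => //; exact: rho_ge0.
Qed.

Lemma TC_add M M' (f f1 f2 g g1 g2 : R -> R) : TC M f f1 f2 -> TC M' g g1 g2 ->
  TC (M + M') (fun x => f x + g x) (fun x => f1 x + g1 x) (fun x => f2 x + g2 x).
Proof.
move=> [[mf mf1 mf2] bf rf] [[mg mg1 mg2] bg rg]; split.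
- by split; exact: measurable_funD.
- move=> x; have [? ? ?] := bf x; have [? ? ?] := bg x.
  by split; apply: le_trans (ler_normD _ _) _; exact: lerD.
- move=> x y; rewrite [leRHS]mulrDl.
  have -> : f (x + y) + g (x + y) - (f x + g x) - (f1 x + g1 x) * y - (f2 x + g2 x) * y ^+ 2 / 2 =
    (f (x + y) - f x - f1 x * y - f2 x * y ^+ 2 / 2) + (g (x + y) - g x - g1 x * y - g2 x * y ^+ 2 / 2).
    by field.
  exact: le_trans (ler_normD _ _) (lerD (rf x y) (rg x y)).
Qed.

Lemma rho_scale_le (a y : R) : rho (a * y) <= (1 + `|a|) ^+ 3 * rho y.
Proof.
have a0 : 0 <= `|a| by [].
have r0 := rho_ge0 y.
rewrite {2}/rho; have [h|h] := leP (y ^+ 2) (`|y| ^+ 3).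
  apply: le_trans (rho_sqr _) _; rewrite exprMn ler_wpM2r ?sqr_ge0// -(real_normK (num_real a)).
  set z := `|a| in a0 *; have : 0 <= z ^+ 2 by exact: sqr_ge0.
  have : 0 <= z ^+ 3 by exact: exprn_ge0.
  have -> : (1 + z) ^+ 3 = 1 + 3 * z + 3 * z ^+ 2 + z ^+ 3 by ring.
  lra.
apply: le_trans (rho_cube _) _; rewrite normrM exprMn ler_wpM2r ?exprn_ge0//.
by rewrite lerXn2r ?nnegrE// ?addr_ge0// lerDr.
Qed.

(** [(1 + |a|)^3] dominates [1], [|a|], [|a|^2] and [|a|^3] at once, hence all three functions and
    the rescaled remainder. *)
Lemma TC_affine M (c a b : R) (f f1 f2 : R -> R) : TC M f f1 f2 ->
  TC (`|c| * (1 + `|a|) ^+ 3 * M) (fun x => c * f (a * x + b))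
   (fun x => c * a * f1 (a * x + b)) (fun x => c * a ^+ 2 * f2 (a * x + b)).
Proof.
move=> tc; have M0 := TC_ge0 tc; move: tc => [[mf mf1 mf2] bf rf].
have ml : measurable_fun setT (fun x : R => a * x + b).
  by apply: measurable_funD => //; exact: measurable_funM.
have a0 : 0 <= `|a| by []; have c0 : 0 <= `|c| by [].
have a3 : (1 + `|a|) ^+ 3 = 1 + 3 * `|a| + 3 * `|a| ^+ 2 + `|a| ^+ 3 by ring.
have a20 : 0 <= `|a| ^+ 2 by exact: exprn_ge0.
have a30 : 0 <= `|a| ^+ 3 by exact: exprn_ge0.
split.
- by split; apply: measurable_funM => //; exact: measurableT_comp.
- move=> x; have [h1 h2 h3] := bf (a * x + b).
  have e2 : `|a ^+ 2| = `|a| ^+ 2 by exact: normrX.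
  have g k : k <= (1 + `|a|) ^+ 3 -> forall u v, 0 <= k -> `|u| = `|c| * k -> `|v| <= M ->
    `|u * v| <= `|c| * (1 + `|a|) ^+ 3 * M.
    move=> ka u v k0 uk vM; rewrite normrM uk -2!mulrA; apply: ler_wpM2l => //.
    by apply: ler_pM.
  split.
  + by apply: (g 1) => //; [rewrite a3; lra|rewrite mulr1].
  + by apply: (g `|a|) => //; [rewrite a3; lra|exact: normrM].
  + by apply: (g (`|a| ^+ 2)) => //; [rewrite a3; lra|rewrite normrM e2].
- move=> x y.
  have -> : a * (x + y) + b = (a * x + b) + a * y by ring.
  have -> : c * f (a * x + b + a * y) - c * f (a * x + b) - c * a * f1 (a * x + b) * y -
    c * a ^+ 2 * f2 (a * x + b) * y ^+ 2 / 2 = c * (f (a * x + b + a * y) - f (a * x + b) -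
    f1 (a * x + b) * (a * y) - f2 (a * x + b) * (a * y) ^+ 2 / 2) by field.
  rewrite [leLHS]normrM -[leRHS]mulrA -[leRHS]mulrA; apply: ler_wpM2l => //; apply: le_trans (rf _ _) _.
  by rewrite mulrCA; apply: ler_wpM2l => //; exact: rho_scale_le.
Qed.

End TCstable.

(** * A smooth step function *)

Section SmoothStep.
Context {R : realType}.
Let ps (x : R) := Num.max x 0.

Let mps a : measurable_fun setT (fun x : R => ps (x - a)).
Proof. by apply: measurable_maxr => //; exact: measurable_funB. Qed.

Let psE x : (0 <= x /\ ps x = x) \/ (x < 0 /\ ps x = 0).
Proof. by rewrite /ps; have [h|h] := leP 0 x; [left|right]. Qed.

(** The cube of the positive part expands like a cubic on either side of its kink; the four sign
    patterns of [x + y] and [x] give remainder constant 1. *)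
Let cub x y : `|ps (x + y) ^+ 3 - ps x ^+ 3 - 3 * ps x ^+ 2 * y - 3 * ps x * y ^+ 2| <= `|y| ^+ 3.
Proof.
have e0 (a b : R) : a - 0 ^+ 3 - 3 * 0 ^+ 2 * b - 3 * 0 * b ^+ 2 = a by rewrite !expr0n/=; ring.
case: (psE (x + y)) => -[h1 ->]; case: (psE x) => -[h2 ->].
- by rewrite (_ : _ - _ = y ^+ 3); [rewrite normrX|ring].
- rewrite e0 normrX lerXn2r ?nnegrE// ger0_norm// ger0_norm; lra.
- rewrite expr0n/= (_ : _ - _ = (- (x + y)) ^+ 3 - (- y) ^+ 3); last ring.
  have -> : `|y| = - y by rewrite ltr0_norm//; lra.
  have u0 : 0 <= (- (x + y)) ^+ 3 by rewrite exprn_ge0//; lra.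
  have uy : (- (x + y)) ^+ 3 <= (- y) ^+ 3 by rewrite lerXn2r ?nnegrE//; lra.
  by rewrite ler_norml; apply/andP; split; lra.
- by rewrite e0 expr0n/= normr0 exprn_ge0.
Qed.

(** The third difference of [t_+^3 / 6], that is, the distribution function of the sum of three
    independent uniform variables on [[0, 1]]; [S1] and [S2] are its first two derivatives. *)
Let S0 (t : R) := 6^-1 * (ps (t - 0) ^+ 3 - 3 * ps (t - 1) ^+ 3 + 3 * ps (t - 2) ^+ 3 - ps (t - 3) ^+ 3).
Let S1 (t : R) := 2^-1 * (ps (t - 0) ^+ 2 - 3 * ps (t - 1) ^+ 2 + 3 * ps (t - 2) ^+ 2 - ps (t - 3) ^+ 2).
Let S2 (t : R) := ps (t - 0) - 3 * ps (t - 1) + 3 * ps (t - 2) - ps (t - 3).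

Let ps_ge t : 0 <= t -> ps t = t. Proof. by move=> t0; rewrite /ps max_l. Qed.
Let ps_le t : t <= 0 -> ps t = 0. Proof. by move=> t0; rewrite /ps max_r. Qed.

Let S_ge t : 3 <= t -> [/\ S0 t = 1, S1 t = 0 & S2 t = 0].
Proof.
move=> t3; rewrite /S0 /S1 /S2 !ps_ge; try lra; split; field; by [].
Qed.

Let ps3 t a : t <= 3 -> 0 <= a -> 0 <= ps (t - a) <= 3.
Proof. by move=> t3 a0; case: (psE (t - a)) => -[h ->]; lra. Qed.

Let S_bdd t : [/\ `|S0 t| <= 36, `|S1 t| <= 36 & `|S2 t| <= 36].
Proof.
have [t3|t3] := leP 3 t.
  by have [-> -> ->] := S_ge t3; rewrite normr1 normr0; split; lra.
have b a : 0 <= a -> [/\ 0 <= ps (t - a) <= 3, 0 <= ps (t - a) ^+ 2 <= 9 & 0 <= ps (t - a) ^+ 3 <= 27].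
  move=> a0; have /andP[h1 h2] := ps3 (ltW t3) a0; rewrite !exprn_ge0// h1 h2/=.
  rewrite (_ : 9 = 3 ^+ 2); last ring.
  rewrite (_ : 27 = 3 ^+ 3); last ring.
  by rewrite !lerXn2r ?nnegrE.
have [/andP[? ?] /andP[? ?] /andP[? ?]] := b 0 (lexx _).
have [/andP[? ?] /andP[? ?] /andP[? ?]] := b 1 ler01.
have [/andP[? ?] /andP[? ?] /andP[? ?]] := b 2 (ler0n _ _).
have [/andP[? ?] /andP[? ?] /andP[? ?]] := b 3 (ler0n _ _).
rewrite /S0 /S1 /S2; split; rewrite ler_norml; apply/andP; split; lra.
Qed.

Let S_TC : TC (4 * 36) S0 S1 S2.
Proof.
have mX k a : measurable_fun setT (fun x : R => ps (x - a) ^+ k) by apply: measurable_funX; exact: mps.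
apply: TC_of_cube.
- by repeat first [apply: measurable_funB|apply: measurable_funD|apply: measurable_funM].
- by repeat first [apply: measurable_funB|apply: measurable_funD|apply: measurable_funM].
- by repeat first [apply: measurable_funB|apply: measurable_funD|apply: measurable_funM].
- exact: S_bdd.
move=> x y; have c a := cub (x - a) y.
have e a : x + y - a = x - a + y by ring.
rewrite /S0 /S1 /S2 !e; move: (c 0) (c 1) (c 2) (c 3).
have y0 : 0 <= `|y| ^+ 3 by exact: exprn_ge0.
move: (ps (x - 0 + y)) (ps (x - 0)) (ps (x - 1 + y)) (ps (x - 1)) (ps (x - 2 + y)) (ps (x - 2))
  (ps (x - 3 + y)) (ps (x - 3)) (`|y| ^+ 3) y0 => a a' b b' e1 e1' f f' z z0.
rewrite !ler_norml => /andP[? ?] /andP[? ?] /andP[? ?] /andP[? ?]; apply/andP; split; lra.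
Qed.

Lemma smooth_step : exists (s s1 s2 : R -> R) (M : R),
  [/\ TC M s s1 s2, forall x, x <= 0 -> s x = 0 & forall x, 1 <= x -> s x = 1].
Proof.
exists (fun x => 1 * S0 (3 * x + 0)).
exists (fun x => 1 * 3 * S1 (3 * x + 0)), (fun x => 1 * 3 ^+ 2 * S2 (3 * x + 0)), (`|1| * (1 + `|3|) ^+ 3 * (4 * 36)).
split; first exact: TC_affine.
  move=> x x0; rewrite /S0 !ps_le; try lra; rewrite !expr0n/=; ring.
move=> x x1; have [|-> _ _] := @S_ge (3 * x + 0); [lra|exact: mulr1].
Qed.

End SmoothStep.

(** * Approximation of bounded continuous functions by superposed steps *)

Section StepApprox.
Context {R : realType}.
Variables (s : R -> R) (K : R).
Hypotheses (s0 : forall x, x <= 0 -> s x = 0) (s1 : forall x, 1 <= x -> s x = 1)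
  (sK : forall x, `|s x| <= K).

(** Completed steps telescope, so for [t] between [i] and [i + 1] the sum moves from [a i] to
    [a i.+1], up to the constant [a 0]. *)
Let ssum (a : nat -> R) N t := \sum_(j < N) (a j.+1 - a j) * s (t - j%:R).

Let ssum_hi a N t : N%:R <= t -> ssum a N t = a N - a 0.
Proof.
elim: N => [|N ih] Nt; first by rewrite /ssum big_ord0 subrr.
have Nt' : N%:R <= t by apply: le_trans Nt; rewrite ler_nat.
rewrite /ssum big_ord_recr/= -/(ssum a N t) ih// s1; first by ring.
by rewrite lerBrDl natr1.
Qed.

Let ssum_lo a N t : t <= 0 -> ssum a N t = 0.
Proof.
move=> t0; rewrite /ssum big1// => j _; rewrite s0 ?mulr0// subr_le0.
exact: le_trans t0 (ler0n _ _).
Qed.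

Let ssum_mid a N t : 0 <= t -> t <= N%:R -> (0 < N)%N -> exists i, [/\ (i < N)%N, i%:R <= t, t <= i.+1%:R &
  ssum a N t = a i - a 0 + (a i.+1 - a i) * s (t - i%:R)].
Proof.
move=> t0; elim: N => [//|N ih] tN _.
have [tN'|tN'] := leP t N%:R; last first.
  exists N; split => //; first exact: ltW.
  by rewrite /ssum big_ord_recr/= -/(ssum a N t) ssum_hi// ltW.
have [N0|N0] := posnP N.
  subst N; exists 0%N; split => //.
  by rewrite /ssum big_ord_recr big_ord0/=; ring.
have [i [iN it ti e]] := ih tN' N0; exists i; split => //; first exact: ltnW.
by rewrite /ssum big_ord_recr/= -/(ssum a N t) e (s0 (x := t - N%:R)) ?mulr0 ?addr0// subr_le0.
Qed.

Lemma unif_cont_itv (f : R -> R) L e : continuous f -> 0 < e ->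
  exists2 D, 0 < D & forall x y, `|x| <= L -> `|x - y| <= D -> `|f x - f y| <= e.
Proof.
move=> cf e0.
have /compact_near_coveringP := @segment_compact R (- L) L.
move=> /(_ R (nbhs (0:R)^'+) (fun D x => forall y, `|x - y| <= D -> `|f x - f y| <= e) _).
case.
  move=> x _; have e2 : 0 < e / 2 by rewrite divr_gt0.
  have /cvgrPdist_le/(_ _ e2)/nbhs_ballP[r /= r0 hr] := cf x.
  have r2 : 0 < r / 2 by rewrite divr_gt0.
  exists (ball x (r / 2), [set D | D < r / 2]); first split=> //=.
  - exact: nbhsx_ballx.
  - exact: nbhs_right_lt.
  move=> [x' D] /= [xx' Dr] y x'y.
  have h1 : `|f x - f x'| <= e / 2.
    apply: hr; rewrite /ball/= (lt_trans xx')//; lra.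
  have h2 : `|f x - f y| <= e / 2.
    apply: hr; rewrite /ball/=; move: xx'; rewrite /ball/= => xx'.
    rewrite (_ : x - y = (x - x') + (x' - y)); last ring.
    by apply: le_lt_trans (ler_normD _ _) _; lra.
  rewrite (_ : f x' - f y = (f x - f y) - (f x - f x')); last ring.
  by apply: le_trans (ler_normB _ _) _; lra.
move=> D /= D0 hD; exists (D / 2); first by rewrite divr_gt0.
move=> x y xL xy; apply: (hD (D / 2)) => //=.
- by rewrite sub0r normrN ger0_norm ?divr_ge0 ?ltW//; lra.
- by rewrite divr_gt0.
- by rewrite in_itv/= -ler_norml.
Qed.

(** At each point one step at most is in transition, so the approximant combines the values of [f]
    at two neighbouring grid points. The profile [s] is abstract because two are used: the smooth
    step for [TC_dense], and a linear ramp to identify the limit law. *)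
Lemma step_approx (f : R -> R) (B L e : R) : continuous f -> (forall x, `|f x| <= B) ->
  0 < L -> 0 < e -> exists (N : nat) (c0 : R) (c : nat -> R) (a : R), 
  [/\ 0 < a, forall x, `|x| <= L -> `|f x - (c0 + \sum_(j < N) c j * s (a * x + (a * L - j%:R)))| <= e &
  forall x, `|f x - (c0 + \sum_(j < N) c j * s (a * x + (a * L - j%:R)))| <= 2 * B + 2 * B * K].
Proof.
move=> cf fB L0 e0; have K0 : 0 <= K by apply: le_trans (sK 0).
have B0 : 0 <= B by apply: le_trans (fB 0).
(* The weights [1 - u] and [u] of the two grid values are at most [1 + K] in absolute value. *)
pose e' := e / (2 * (1 + K)).
have K1 : 0 < 1 + K by rewrite ltr_pwDl.
have e'0 : 0 < e' by rewrite divr_gt0// mulr_gt0.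
have [D D0 hD] := unif_cont_itv L cf e'0.
pose N := (Num.bound (2 * L / D)).+1.
have N0 : 0 < N%:R :> R by rewrite ltr0n.
pose h := 2 * L / N%:R.
have h0 : 0 < h by rewrite divr_gt0// mulr_gt0.
have hD' : h <= D.
  rewrite /h ler_pdivrMr// -ler_pdivrMl// mulrC.
  have LD : 0 <= 2 * L / D by rewrite divr_ge0 ?mulr_ge0// ltW.
  have := archi_boundP LD => /ltW/le_trans; apply.
  by rewrite ler_nat.
pose g (j : nat) := f (- L + j%:R * h).
exists N, (g 0), (fun j => g j.+1 - g j), h^-1.
have tE x (j : nat) : h^-1 * x + (h^-1 * L - j%:R) = (x + L) / h - j%:R by field; rewrite lt0r_neq0.
have E x : \sum_(j < N) (g j.+1 - g j) * s (h^-1 * x + (h^-1 * L - j%:R)) = ssum g N ((x + L) / h).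
  by apply: eq_bigr => j _; rewrite tE.
split; first by rewrite invr_gt0.
  move=> x xL; rewrite E; have := xL; rewrite ler_norml => /andP[x1 x2].
  have t0 : 0 <= (x + L) / h by rewrite divr_ge0 ?(ltW h0)//; lra.
  have tN : (x + L) / h <= N%:R.
    rewrite ler_pdivrMr// /h mulrCA divff ?lt0r_neq0// mulr1; lra.
  have [i [iN it ti ->]] := ssum_mid g t0 tN (ltn0Sn _).
  rewrite ler_pdivlMr// in it; rewrite ler_pdivrMr// in ti.
  have d1 : `|x - (- L + i%:R * h)| <= h.
    rewrite -natr1 in ti; rewrite ler_norml; apply/andP; split; lra.
  have d2 : `|x - (- L + i.+1%:R * h)| <= h.
    rewrite -natr1 in ti *; rewrite ler_norml; apply/andP; split; lra.
  have f1 := hD _ _ xL (le_trans d1 hD'); have f2 := hD _ _ xL (le_trans d2 hD').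
  rewrite -/(g i) in f1; rewrite -/(g i.+1) in f2.
  set u := s _; have uK : `|u| <= K by exact: sK.
  rewrite (_ : f x - _ = (f x - g i) * (1 - u) + (f x - g i.+1) * u); last by ring.
  have -> : e = e' * (1 + K) + e' * (1 + K) by rewrite /e'; field; rewrite lt0r_neq0.
  apply: le_trans (ler_normD _ _) _; rewrite !normrM; apply: lerD; apply: ler_pM => //; last lra.
  by apply: le_trans (ler_normB _ _) _; rewrite normr1 lerD2l.
move=> x; rewrite E; have BK : 0 <= B * K by exact: mulr_ge0.
have gB j : `|g j| <= B by exact: fB.
have fx := fB x.
have [t0|t0] := leP ((x + L) / h) 0.
  rewrite ssum_lo// addr0; apply: le_trans (ler_normB _ _) _; have := gB 0%N; lra.
have [tN|tN] := leP N%:R ((x + L) / h).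
  rewrite ssum_hi// addrCA subrr addr0; apply: le_trans (ler_normB _ _) _; have := gB N; lra.
have [i [iN it ti ->]] := ssum_mid g (ltW t0) (ltW tN) (ltn0Sn _).
set u := s _; have uK : `|u| <= K by exact: sK.
rewrite (_ : f x - _ = f x - g i + g i * u - g i.+1 * u); last by ring.
have u1 j : `|g j * u| <= B * K by rewrite normrM ler_pM.
apply: le_trans (ler_normB _ _) _; apply: le_trans (lerD (ler_normD _ _) (lexx _)) _.
have := ler_normB (f x) (g i); have := gB i; have := u1 i; have := u1 i.+1; lra.
Qed.
End StepApprox.

Section Dense.
Context {R : realType}.

Definition cb (f : R -> R) := continuous f /\ exists B : R, forall x, `|f x| <= B.

Lemma cb_meas f : cb f -> measurable_fun setT f.
Proof. by case=> cf _; exact: continuous_measurable_fun. Qed.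

Lemma cb_L1 d (T : measurableType d) (Q : probability T R) (Y : T -> R) f :
  cb f -> measurable_fun setT Y -> L1 Q (fun w => f (Y w)).
Proof.
move=> cf mY; have mf := cb_meas cf; case: cf => _ [B fB].
apply: (@L1_bdd _ _ _ _ _ B); first exact: (measurableT_comp mf mY).
by move=> w; exact: fB.
Qed.

(** Outside [[-L, L]] the crude bound [B] is paid for by [Y ^+ 2 / L ^+ 2 >= 1], as in Chebyshev's
    inequality. *)
Lemma Ex_near d (T : measurableType d) (Q : probability T R) (Y : T -> R) (f g : R -> R) (e B L C : R) :
  L2 Q Y -> Ex Q (fun w => Y w ^+ 2) <= C -> L1 Q (fun w => f (Y w)) -> L1 Q (fun w => g (Y w)) ->
  0 <= e -> 0 <= B -> 0 < L -> (forall x, `|x| <= L -> `|f x - g x| <= e) -> (forall x, `|f x - g x| <= B) ->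
  `|Ex Q (fun w => f (Y w)) - Ex Q (fun w => g (Y w))| <= e + B * C / L ^+ 2.
Proof.
move=> lY YC lf lg e0 B0 L0 fge fgB; rewrite -ExB//; apply: le_trans (Ex_abs (L1B lf lg)) _.
have L20 : 0 < L ^+ 2 by exact: exprn_gt0.
apply: (@le_trans _ _ (Ex Q (fun w => e + B / L ^+ 2 * Y w ^+ 2))); last first.
  rewrite (ExD (L1_cst Q e) (L1Z (B / L ^+ 2) (L2_sqr lY))) Ex_cst ExZ; last exact: L2_sqr.
  rewrite lerD2l -mulrA -[leRHS]mulrA; apply: ler_wpM2l => //; rewrite mulrC.
  by apply: ler_wpM2r => //; rewrite invr_ge0 ltW.
apply: Ex_le; [exact: L1_norm (L1B lf lg)|by apply: L1D; [exact: L1_cst|exact: L1Z (L2_sqr lY)]|move=> w].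
have h2 : 0 <= B / L ^+ 2 * Y w ^+ 2.
  by apply: mulr_ge0; [rewrite divr_ge0// ltW|exact: sqr_ge0].
have [YL|YL] := leP `|Y w| L; first by apply: le_trans (fge _ YL) _; rewrite lerDl.
apply: le_trans (fgB _) _; apply: (@le_trans _ _ (B / L ^+ 2 * Y w ^+ 2)); last by rewrite lerDr.
rewrite -mulrA ler_peMr// mulrC ler_pdivlMr// mul1r -[leRHS](real_normK (num_real _)).
by rewrite lerXn2r ?nnegrE// ltW.
Qed.

Lemma TC_sum_affine (s s1 s2 : R -> R) M (c : nat -> R) (a : R) (b : nat -> R) c0 N : TC M s s1 s2 ->
  exists g1 g2 M', TC M' (fun x => c0 + \sum_(j < N) c j * s (a * x + b j)) g1 g2.
Proof.
move=> tc; elim: N => [|N [g1 [g2 [M' ih]]]].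
  exists (fun=> 0), (fun=> 0), `|c0|; rewrite (_ : (fun _ => _) = (fun=> c0)); first exact: TC_cst.
  by apply/funext => x; rewrite big_ord0 addr0.
have h := TC_add ih (TC_affine (c N) a (b N) tc).
exists (fun x => g1 x + c N * a * s1 (a * x + b N)), (fun x => g2 x + c N * a ^+ 2 * s2 (a * x + b N)).
exists (M' + `|c N| * (1 + `|a|) ^+ 3 * M).
rewrite (_ : (fun _ => _) = (fun x => (c0 + \sum_(j < N) c j * s (a * x + b j)) + c N * s (a * x + b N))) //.
by apply/funext => x; rewrite big_ord_recr/= addrA.
Qed.

(** The approximant depends on [f], [C] and [e] only: the second moment bound makes the tails small
    uniformly over all variables and all probability spaces. *)
Lemma TC_dense (f : R -> R) (C e : R) : cb f -> 0 <= C -> 0 < e ->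
  exists g g1 g2 M, TC M g g1 g2 /\
  forall d (T : measurableType d) (Q : probability T R) (Y : T -> R), L2 Q Y ->
    Ex Q (fun w => Y w ^+ 2) <= C ->
   `|Ex Q (fun w => f (Y w)) - Ex Q (fun w => g (Y w))| <= e.
Proof.
move=> cf C0 e0; have [contf [B fB]] := cf.
have [s [s1 [s2 [M [tc sl sh]]]]] := @smooth_step R.
have sM x : `|s x| <= M by case: tc => _ /(_ x)[].
have M0 := TC_ge0 tc.
have B0 : 0 <= B by exact: le_trans (fB 0).
pose B' := 2 * B + 2 * B * M.
have B'0 : 0 <= B' by rewrite addr_ge0 ?mulr_ge0.
pose L := 1 + 2 * B' * C / e.
have Lge1 : 1 <= L by rewrite lerDl divr_ge0 ?mulr_ge0 ?(ltW e0).
have L0 : 0 < L by exact: lt_le_trans Lge1.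
have e2 : 0 < e / 2 by rewrite divr_gt0.
have [N [c0 [c [a [a0 h1 h2]]]]] := step_approx sl sh sM contf fB L0 e2.
have [g1 [g2 [M' tcg]]] := TC_sum_affine c a (fun j => a * L - j%:R) c0 N tc.
eexists; exists g1, g2, M'; split; first exact: tcg.
move=> d T Q Y lY YC.
have lg : L1 Q (fun w => c0 + \sum_(j < N) c j * s (a * Y w + (a * L - j%:R))).
  by apply: L1_eq (L1_TC Q 0 tcg (L2_meas lY)) => x; rewrite add0r.
have := Ex_near lY YC (cb_L1 Q cf (L2_meas lY)) lg (ltW e2) B'0 L0 h1 h2.
move=> h; apply: (le_trans h).
suff : B' * C / L ^+ 2 <= e / 2 by lra.
rewrite ler_pdivrMr ?exprn_gt0//; apply: (@le_trans _ _ (e / 2 * L)).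
  rewrite /L mulrDr (_ : e / 2 * (2 * B' * C / e) = B' * C); last by field; rewrite lt0r_neq0.
  by rewrite lerDr mulr1 ltW.
by rewrite ler_pM2l// expr2 ler_peMl// ltW.
Qed.

End Dense.

Lemma sum_telescope (V : zmodType) (u : nat -> V) K : \sum_(i < K) (u i - u i.+1) = u 0%N - u K.
Proof.
elim: K => [|N ih]; first by rewrite big_ord0 subrr.
by rewrite big_ord_recr/= ih addrA subrK.
Qed.

(** * Existence of the limit law *)

Section WeakLimit.
Context {R : realType} {d : measure_display} {T : measurableType d}.
Variables (Q : probability T R) (Y : nat -> T -> R) (C : R).
Hypotheses (lY : forall k, L2 Q (Y k)) (YC : forall k, Ex Q (fun w => Y k w ^+ 2) <= C).
Hypothesis cauchyY : forall M f f1 f2 (e : R), TC M f f1 f2 -> 0 < e ->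
  exists n0, forall n n', (n0 <= n)%N -> (n0 <= n')%N ->
  `|Ex Q (fun w => f (Y n w)) - Ex Q (fun w => f (Y n' w))| <= e.

Let C0 : 0 <= C. Proof. exact: le_trans (Ex_sqr_ge0 Q (Y 0)) (YC 0). Qed.

Let Ef f k := Ex Q (fun w => f (Y k w)).
(** On [cb] this is a positive linear functional by [LimP]; a measure representing it remains to be
    found. *)
Let Lim f : R := limn (Ef f).

Let LimP f : cb f -> Ef f k @[k --> \oo] --> Lim f.
Proof.
move=> cf; suff : cauchy (Ef f k @[k --> \oo]) by move=> /cauchy_cvg.
apply: (@cauchy_exP R) => e /= e0.
have e3 : 0 < e / 4 by rewrite divr_gt0.
have [g [g1 [g2 [M [tc hg]]]]] := TC_dense cf C0 e3.
have [n0 hn] := cauchyY tc e3.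
exists (Ef f n0); exists n0 => // k /= n0k; rewrite /ball/=.
have := hg _ _ Q (Y n0) (lY n0) (YC n0); have := hg _ _ Q (Y k) (lY k) (YC k).
have := hn n0 k (leqnn n0) n0k.
rewrite -/(Ef f n0) -/(Ef f k) => h1 h2 h3.
rewrite (_ : Ef f n0 - Ef f k = (Ef f n0 - Ef g n0) + (Ef g n0 - Ef g k) - (Ef f k - Ef g k)); last by ring.
apply: le_lt_trans (ler_normB _ _) _; apply: le_lt_trans (lerD (ler_normD _ _) (lexx _)) _.
move: h1 h2 h3; rewrite -/(Ef g n0) -/(Ef g k); lra.
Qed.

Let LimE f l : Ef f k @[k --> \oo] --> l -> Lim f = l.
Proof. by move=> /cvg_lim; apply. Qed.

Let cb_lf f k : cb f -> L1 Q (fun w => f (Y k w)).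
Proof. by move=> cf; apply: cb_L1 => //; exact: L2_meas. Qed.

Let Lim_le f g : cb f -> cb g -> (forall x, f x <= g x) -> Lim f <= Lim g.
Proof.
move=> cf cg fg; apply: ler_cvg_to (LimP cf) (LimP cg) _; near=> k.
by apply: Ex_le; [exact: cb_lf..|].
Unshelve. all: by end_near. Qed.

Let Lim_ub f c : cb f -> (forall x, f x <= c * x ^+ 2) -> 0 <= c -> Lim f <= c * C.
Proof.
move=> cf fc c0; apply: ler_cvg_to (LimP cf) (cvg_cst (c * C)) _; near=> k.
apply: (@le_trans _ _ (Ex Q (fun w => c * Y k w ^+ 2))).
  by apply: Ex_le; [exact: cb_lf|exact: L1Z (L2_sqr (lY k))|move=> w].
by rewrite ExZ; [exact: ler_wpM2l|exact: L2_sqr].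
Unshelve. all: by end_near. Qed.

Let Lim_cst c : Lim (fun=> c) = c.
Proof. by apply: LimE; rewrite /Ef; under eq_fun do rewrite Ex_cst; exact: cvg_cst. Qed.

Let cb_cst c : cb (fun _ : R => c).
Proof. by split; [move=> x; exact: cvg_cst|exists `|c|]. Qed.

Let cbD (f g : R -> R) : cb f -> cb g -> cb (fun x => f x + g x).
Proof.
move=> [cf [B fB]] [cg [D gD]]; split; first by move=> x; apply: cvgD; [exact: cf|exact: cg].
by exists (B + D) => x; apply: le_trans (ler_normD _ _) _; exact: lerD.
Qed.

Let cbZ c (f : R -> R) : cb f -> cb (fun x => c * f x).
Proof.
move=> [cf [B fB]]; split; first by move=> x; apply: cvgM; [exact: cvg_cst|exact: cf].
by exists (`|c| * B) => x; rewrite normrM ler_wpM2l.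
Qed.

Let LimD f g : cb f -> cb g -> Lim (fun x => f x + g x) = Lim f + Lim g.
Proof.
move=> cf cg; apply: LimE; rewrite (_ : Ef _ = fun k => Ef f k + Ef g k).
  by apply: cvgD; exact: LimP.
by apply/funext => k; rewrite /Ef -ExD//; exact: cb_lf.
Qed.

Let LimZ c f : cb f -> Lim (fun x => c * f x) = c * Lim f.
Proof.
move=> cf; apply: LimE; rewrite (_ : Ef _ = fun k => c * Ef f k).
  by apply: cvgM; [exact: cvg_cst|exact: LimP].
by apply/funext => k; rewrite /Ef -ExZ//; exact: cb_lf.
Qed.

Let lst (t : R) := Num.max 0 (Num.min t 1).

Let lst_cases t : [\/ t <= 0 /\ lst t = 0, 0 <= t <= 1 /\ lst t = t | 1 <= t /\ lst t = 1].
Proof.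
rewrite /lst; have [t1|t1] := leP t 1; last first.
  by rewrite max_r//; constructor 3; rewrite ltW.
have [t0|t0] := leP 0 t; last by constructor 1; rewrite ltW.
by constructor 2.
Qed.

Let cont_lst : continuous lst.
Proof.
have : continuous ((fun _ : R => 0 : R) \max ((@idfun R) \min (fun=> 1))).
  move=> t; apply: continuous_max; first exact: cvg_cst.
  by apply: continuous_min; [exact: cvg_id|exact: cvg_cst].
by [].
Qed.

(** A decreasing ramp in [y], equal to 1 up to [x] and to 0 from [x + a^-1] on: a continuous upper
    approximation of the indicator of [y <= x]. *)
Let G a x y := lst (a * (x - y) + 1).

Let G_bdd a x y : 0 <= G a x y <= 1.
Proof. by rewrite /G; case: (lst_cases (a * (x - y) + 1)) => -[h ->]; lra. Qed.

Let cb_lst a b : cb (fun y => lst (a * y + b)).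
Proof.
split.
  move=> y; apply: (@continuous_comp _ _ _ (fun y => a * y + b) lst); last exact: cont_lst.
  by apply: cvgD; [apply: cvgM; [exact: cvg_cst|exact: cvg_id]|exact: cvg_cst].
exists 1 => y; case: (lst_cases (a * y + b)) => -[h ->]; rewrite ler_norml; apply/andP; split; lra.
Qed.

Let cbG a x : cb (G a x).
Proof.
rewrite (_ : G a x = (fun y => lst ((- a) * y + (a * x + 1)))); first exact: cb_lst.
by apply/funext => y; rewrite /G; congr lst; ring.
Qed.

Let lst_mono t u : t <= u -> lst t <= lst u.
Proof.
by move=> tu; case: (lst_cases t) => -[? ->]; case: (lst_cases u) => -[? ->]; lra.
Qed.

Let lst_lip t u : t <= u -> lst u <= lst t + (u - t).
Proof.
by move=> tu; case: (lst_cases t) => -[? ->]; case: (lst_cases u) => -[? ->]; lra.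
Qed.

Let lst1 t : 1 <= t -> lst t = 1. Proof. by move=> ?; case: (lst_cases t) => -[? ->]; lra. Qed.
Let lst0 t : t <= 0 -> lst t = 0. Proof. by move=> ?; case: (lst_cases t) => -[? ->]; lra. Qed.

(** The distribution function of the limit law. Taking the infimum of upper approximations is what
    makes it right-continuous. *)
Let F x := inf [set Lim (G a x) | a in [set a | 0 < a]].

Let Fs_lb x : has_lbound [set Lim (G a x) | a in [set a | 0 < a]].
Proof.
exists 0 => _ [a _ <-]; rewrite -(Lim_cst 0); apply: Lim_le; [exact: cb_cst|exact: cbG|move=> y].
by have /andP[] := G_bdd a x y.
Qed.

Let Fs0 x : [set Lim (G a x) | a in [set a | 0 < a]] !=set0.
Proof. by exists (Lim (G 1 x)); exists (1 : R) => //; exact: ltr01. Qed.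

Let FG a x : 0 < a -> F x <= Lim (G a x).
Proof. by move=> a0; apply: ge_inf; [exact: Fs_lb|exists a]. Qed.

Let F_ge c x : (forall a, 0 < a -> c <= Lim (G a x)) -> c <= F x.
Proof. by move=> h; apply: lb_le_inf; [exact: Fs0|move=> _ [a a0 <-]; exact: h]. Qed.

Let F_ge0 x : 0 <= F x.
Proof.
apply: F_ge => a a0; rewrite -(Lim_cst 0); apply: Lim_le; [exact: cb_cst|exact: cbG|move=> y].
by have /andP[] := G_bdd a x y.
Qed.

Let F_le1 x : F x <= 1.
Proof.
apply: le_trans (FG x (ltr01)) _; rewrite -[leRHS]Lim_cst; apply: Lim_le; [exact: cbG|exact: cb_cst|move=> y].
by have /andP[] := G_bdd 1 x y.
Qed.

Let GF a x : 0 < a -> Lim (G a x) <= F (x + a^-1).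
Proof.
move=> a0; apply: F_ge => b b0; apply: Lim_le; [exact: cbG|exact: cbG|move=> y].
have [h|h] := leP (a * (x - y) + 1) 0.
  by rewrite {1}/G lst0//; have /andP[] := G_bdd b (x + a^-1) y.
rewrite {2}/G lst1; first by have /andP[] := G_bdd a x y.
rewrite lerDr mulr_ge0 ?(ltW b0)//.
rewrite (_ : x + a^-1 - y = a^-1 * (a * (x - y) + 1)); last by field; rewrite lt0r_neq0.
by rewrite mulr_ge0 ?invr_ge0 ?ltW.
Qed.

Let F_mono : {homo F : x y / x <= y}.
Proof.
move=> x y xy; apply: F_ge => a a0; apply: le_trans (FG x a0) _.
apply: Lim_le; [exact: cbG|exact: cbG|move=> z]; apply: lst_mono.
by rewrite lerD2r ler_wpM2l ?(ltW a0)// lerD2r.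
Qed.

Let F_rc x e : 0 < e -> exists2 D, 0 < D & forall y, x <= y -> y <= x + D -> F y <= F x + e.
Proof.
move=> e0; have e2 : 0 < e / 2 by rewrite divr_gt0.
have [_ [a a0 <-] ha] := @inf_adherent _ _ _ e2 (conj (Fs0 x) (Fs_lb x)).
rewrite -/(F x) in ha.
exists (e / 2 / a); first by rewrite divr_gt0.
move=> y xy yx; apply: le_trans (FG y a0) _.
apply: (@le_trans _ _ (Lim (G a x) + e / 2)); last by lra.
rewrite -[e / 2 as X in _ + X]Lim_cst -LimD; [|exact: cbG|exact: cb_cst].
apply: Lim_le; [exact: cbG|exact: cbD (cbG _ _) (cb_cst _)|move=> z].
have h : a * (x - z) + 1 <= a * (y - z) + 1 by rewrite lerD2r ler_wpM2l ?(ltW a0)// lerD2r.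
apply: le_trans (lst_lip h) _; rewrite lerD2l.
rewrite (_ : a * (y - z) + 1 - _ = (y - x) * a); last by ring.
by rewrite -ler_pdivlMr//; lra.
Qed.

(** Where [G 1 x y] is positive, [y < x + 1 <= -1], so [y ^+ 2 >= - x - 1]. This weakened Chebyshev
    bound is enough for the limit at minus infinity. *)
Let F_lo x : x <= -2 -> F x <= C / (- x - 1).
Proof.
move=> x2; apply: le_trans (FG x ltr01) _; rewrite mulrC; apply: Lim_ub; first exact: cbG.
  move=> y; have := G_bdd 1 x y; rewrite /G; case: (lst_cases (1 * (x - y) + 1)) => -[h ->] hh.
  - by apply: mulr_ge0; [rewrite invr_ge0; lra|exact: sqr_ge0].
  - rewrite ler_pdivlMl; [nra|lra].
  - rewrite ler_pdivlMl; [nra|lra].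
by rewrite invr_ge0; lra.
Qed.

Let F_hi x : 1 <= x -> 1 - F x <= C / x.
Proof.
move=> x1; rewrite lerBlDl -lerBlDr; apply: F_ge => a a0.
rewrite lerBlDl -lerBlDr -[X in X - _]Lim_cst -mulN1r -LimZ; last exact: cbG.
rewrite -LimD; [|exact: cb_cst|exact: cbZ (cbG _ _)].
rewrite mulrC; apply: Lim_ub; [exact: cbD (cb_cst _) (cbZ _ (cbG _ _))| |rewrite invr_ge0; lra].
move=> y; have /andP[g0 g1] := G_bdd a x y; have [yx|yx] := leP y x.
  rewrite {1}/G lst1; last by rewrite lerDr mulr_ge0 ?(ltW a0)// subr_ge0.
  rewrite mulN1r subrr; apply: mulr_ge0; [rewrite invr_ge0; lra|exact: sqr_ge0].
rewrite ler_pdivlMl; [nra|lra].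
Qed.

Let F_cumulative : exists nu : probability (measurableTypeR R) R, forall x, nu [set y | y <= x] = (F x)%:E.
Proof.
have rc : right_continuous F.
  move=> x; apply/cvgrPdist_le => e e0; have [D D0 hD] := F_rc x e0.
  near=> y; have xy : x <= y by near: y; exact: nbhs_right_ge.
  have yx : y <= x + D by near: y; apply: nbhs_right_le; rewrite ltrDl.
  rewrite distrC ger0_norm; last by rewrite subr_ge0; exact: F_mono.
  by rewrite lerBlDl; exact: hD.
have FN : F @ -oo --> 0.
  apply/cvgrPdist_le => e e0; near=> x; rewrite sub0r normrN ger0_norm//.
  have x1 : x <= -2 by near: x; exact: nbhs_ninfty_le (num_real _).
  have x2 : x <= -1 - C / e by near: x; exact: nbhs_ninfty_le (num_real _).
  apply: le_trans (F_lo x1) _; rewrite ler_pdivrMr; last lra.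
  by rewrite -ler_pdivrMl// mulrC; lra.
have FP : F x @[x --> +oo%R] --> (1 : R).
  apply/cvgrPdist_le => e e0; near=> x; rewrite ger0_norm ?subr_ge0//.
  have x1 : 1 <= x by near: x; exact: nbhs_pinfty_ge (num_real _).
  have x2 : C / e <= x by near: x; exact: nbhs_pinfty_ge (num_real _).
  apply: le_trans (F_hi x1) _; rewrite ler_pdivrMr; last lra.
  by rewrite -ler_pdivrMl// mulrC.
pose f1 := isCumulative.Build R _ R F F_mono rc.
pose f2 := isCumulativeBounded.Build R 0 1 F FN FP.
pose f : cumulativeBounded 0 1 := HB.pack F f1 f2.
exists (lebesgue_stieltjes_measure f) => x.
have := cdf_lebesgue_stieltjes_id f x; rewrite /cdf /distribution /pushforward /= => <-.
by congr (lebesgue_stieltjes_measure f _); apply/seteqP; split => y; rewrite /= in_itv/=.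
Unshelve. all: by end_near. Qed.

Let lst_sum K t : (0 < K)%N -> \sum_(i < K) lst (t - i%:R) = K%:R * lst (t / K%:R).
Proof.
move=> K0; have K0' : 0 < K%:R :> R by rewrite ltr0n.
have h N : \sum_(i < N) lst (t - i%:R) = Num.max 0 (Num.min t N%:R).
  elim: N => [|N ih].
    by rewrite big_ord0; apply/esym; have [h|h] := leP t 0; rewrite ?max_l.
  have N0 : 0 <= N%:R :> R by [].
  rewrite big_ord_recr/= ih -natr1; case: (lst_cases (t - N%:R)) => -[h ->].
  - by rewrite addr0 !min_l//; lra.
  - by rewrite [in LHS]min_r ?[in RHS]min_l ?max_r; lra.
  - by rewrite !min_r ?max_r; lra.
rewrite h; case: (lst_cases (t / K%:R)) => -[c ->].
- have t0 : t <= 0 by move: c; rewrite ler_pdivrMr// mul0r.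
  by rewrite mulr0 max_l// ge_min t0.
- have /andP[c1 c2] := c; rewrite ler_pdivrMr// mul1r in c2; rewrite ler_pdivlMr// mul0r in c1.
  by rewrite min_l// max_r// mulrC divfK// lt0r_neq0.
- rewrite ler_pdivlMr// mul1r in c.
  by rewrite min_r// max_r ?ltW// mulr1.
Qed.

Section Limit.
Variable nu : probability (measurableTypeR R) R.
Hypothesis nuF : forall x, nu [set y | y <= x] = (F x)%:E.

Let mid : measurable_fun setT (fun y : measurableTypeR R => y). Proof. by []. Qed.

Let hs (x y : R) : R := (y <= x)%R%:R.

Let Exi x : L1 nu (hs x) /\ Ex nu (hs x) = F x.
Proof.
have mA : measurable [set y : measurableTypeR R | y <= x].
  rewrite (_ : [set _ | _] = `]-oo, x]%classic); last by apply/seteqP; split => y; rewrite /= in_itv.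
  exact: measurable_itv.
have e : hs x = \1_[set y | y <= x].
  by apply/funext => y; rewrite /hs indicE; congr (_%:R); rewrite [in RHS](_ : (y \in _) = (y <= x)%R)//; apply/idP/idP; rewrite inE.
rewrite e; split.
  by apply: (@L1_bdd _ _ _ _ _ 1) => // y; rewrite indicE; case: (_ \in _); rewrite ?normr1 ?normr0.
rewrite /Ex /Rintegral integral_indic// setIT.
by have /(congr1 (@fine R)) := nuF x.
Qed.

Let lG a x : L1 nu (G a x).
Proof. exact: (cb_L1 nu (cbG a x) mid). Qed.

Let nuG a x : 0 < a -> F x <= Ex nu (G a x) <= F (x + a^-1).
Proof.
move=> a0; have [l1 <-] := Exi x; have [l2 <-] := Exi (x + a^-1); apply/andP; split.
  apply: Ex_le => // y; rewrite /hs; have [h|h] := leP y x; last by have /andP[] := G_bdd a x y.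
  by rewrite /G lst1// lerDr mulr_ge0 ?(ltW a0)// subr_ge0.
apply: Ex_le => // y; rewrite /hs; have [h|h] := leP y (x + a^-1); first by have /andP[] := G_bdd a x y.
rewrite /G lst0//; rewrite (_ : a * (x - y) + 1 = a * (x + a^-1 - y)); last by field; rewrite lt0r_neq0.
by rewrite pmulr_rle0// subr_le0 ltW.
Qed.

Let LG a x : 0 < a -> F x <= Lim (G a x) <= F (x + a^-1).
Proof. by move=> a0; rewrite FG// GF. Qed.

Let LimS N (c : nat -> R) (f : nat -> R -> R) : (forall j, cb (f j)) ->
  cb (fun x => \sum_(j < N) c j * f j x) /\
  Lim (fun x => \sum_(j < N) c j * f j x) = \sum_(j < N) c j * Lim (f j).
Proof.
move=> cf; elim: N => [|N [ih1 ih2]].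
  rewrite big_ord0 (_ : (fun _ => _) = (fun=> 0)); last by apply/funext => x; rewrite big_ord0.
  by split; [exact: cb_cst|exact: Lim_cst].
rewrite (_ : (fun _ => _) = (fun x => \sum_(j < N) c j * f j x + c N * f N x)); last first.
  by apply/funext => x; rewrite big_ord_recr.
split; first exact: cbD ih1 (cbZ _ (cf N)).
by rewrite LimD//; [rewrite ih2 LimZ// big_ord_recr|exact: cbZ].
Qed.

Let eq_eps (u v : R) : (forall e, 0 < e -> `|u - v| <= e) -> u = v.
Proof.
move=> h; apply/eqP; rewrite -subr_eq0 -normr_le0; apply/ler_addgt0Pr => e e0.
by rewrite add0r; exact: h.
Qed.

(** A ramp of slope [a] is the average of [K] ramps of slope [K * a]. For each of these, both [nu]
    and [Lim] lie between the values of [F] at two consecutive points; the gaps telescope to at most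
    1, so the averages differ by at most [K^-1]. *)
Let eqG a x : 0 < a -> Ex nu (G a x) = Lim (G a x).
Proof.
move=> a0; apply: eq_eps => e e0; pose K := (Num.bound (e^-1)).+1.
have K0 : 0 < K%:R :> R by rewrite ltr0n.
have Ke : K%:R^-1 <= e.
  rewrite -[leRHS]invrK lef_pV2 ?posrE ?invr_gt0//.
  have e0' : 0 <= e^-1 by rewrite invr_ge0 ltW.
  apply: le_trans (ltW (archi_boundP e0')) _; by rewrite ler_nat.
pose xx (i : nat) := x + (K%:R - 1 - i%:R) / (K%:R * a).
have Ka : 0 < K%:R * a by exact: mulr_gt0.
have GE y : G a x y = \sum_(i < K) K%:R^-1 * G (K%:R * a) (xx i) y.
  rewrite -mulr_sumr; have := @lst_sum K (K%:R * (a * (x - y) + 1)) (ltn0Sn _).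
  rewrite (_ : K%:R * _ / K%:R = a * (x - y) + 1); last by field; rewrite lt0r_neq0.
  rewrite -/(G a x y) => e1; rewrite (_ : \sum_(i < K) G _ _ _ = K%:R * G a x y).
    by rewrite mulrA mulVf ?mul1r// lt0r_neq0.
  rewrite -e1; apply: eq_bigr => i _; congr lst; rewrite /xx.
  by field; rewrite !lt0r_neq0.
have -> : G a x = (fun y => \sum_(i < K) K%:R^-1 * G (K%:R * a) (xx i) y) by exact/funext.
rewrite (LimS K (fun=> K%:R^-1) (fun i => cbG (K%:R * a) (xx i))).2.
rewrite Ex_sum; last by move=> i _; exact: L1Z (lG _ _).
under eq_bigr do rewrite ExZ ?(lG _ _)//.
rewrite -sumrB; apply: le_trans (ler_norm_sum _ _ _) _.
pose u (i : nat) := F (x + (K%:R - i%:R) / (K%:R * a)).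
have ui i : F (xx i + (K%:R * a)^-1) = u i.
  by rewrite /u /xx; congr F; field; rewrite !lt0r_neq0.
have ui1 i : F (xx i) = u i.+1.
  by rewrite /u /xx -natr1; congr F; field; rewrite !lt0r_neq0.
apply: (@le_trans _ _ (\sum_(i < K) K%:R^-1 * (u i - u i.+1))).
  apply: ler_sum => i _; rewrite -mulrBr normrM ger0_norm ?invr_ge0 ?(ltW K0)//.
  apply: ler_wpM2l; first by rewrite invr_ge0 ltW.
  have /andP[h1 h2] := nuG (xx i) Ka; have /andP[h3 h4] := LG (xx i) Ka.
  rewrite ui1 in h1 h3; rewrite ui in h2 h4.
  move: h1 h2 h3 h4; move: (Ex nu _) (Lim _) (u i) (u i.+1) => z1 z2 z3 z4 h1 h2 h3 h4.
  by rewrite ler_norml; apply/andP; split; lra.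
rewrite -mulr_sumr sum_telescope.
apply: le_trans Ke; rewrite ler_piMr ?invr_ge0 ?(ltW K0)//.
by have := F_le1 (x + (K%:R - 0) / (K%:R * a)); have := F_ge0 (x + (K%:R - K%:R) / (K%:R * a)); rewrite /u; move: (F _) (F _) => z1 z2 h1 h2; lra.
Qed.

(** On a large interval [f] is approximated by sums of ramps, on which [nu] and [Lim] agree by
    [eqG]. The tails of both are controlled by one cutoff made of ramps. *)
Let Exnu_f f : cb f -> Ex nu f = Lim f.
Proof.
move=> cf; have [contf [B fB]] := cf; have B0 : 0 <= B by exact: le_trans (fB 0).
pose B' := 2 * B + 2 * B * 1.
have B'0 : 0 <= B' by rewrite addr_ge0 ?mulr_ge0.
apply: eq_eps => e e0; have e4 : 0 < e / 4 by rewrite divr_gt0.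
pose m := 1 + B' * C / (e / 4).
have m1 : 1 <= m by rewrite lerDl; apply: divr_ge0; [exact: mulr_ge0|exact: ltW].
have m0 : 0 < m by exact: lt_le_trans m1.
(* A cutoff that vanishes on [[-m, m]] and equals 1 outside [[-(m + 1), m + 1]]. *)
pose h y := G 1 (- (m + 1)) y + (1 + -1 * G 1 m y).
have cG1 : cb (fun y => 1 + -1 * G 1 m y) by exact: cbD (cb_cst _) (cbZ _ (cbG _ _)).
have ch : cb h by exact: cbD (cbG _ _) cG1.
have hlo y : `|y| <= m -> h y = 0.
  rewrite ler_norml /h /G => /andP[y1 y2]; rewrite lst0 ?lst1; lra.
have hhi y : m + 1 < `|y| -> h y = 1.
  rewrite /h /G; have [y0|y0] := leP 0 y; first by rewrite ger0_norm// => y1; rewrite !lst0; lra.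
  by rewrite ltr0_norm// => y1; rewrite !lst1; lra.
have h0 y : 0 <= h y <= 1.
  rewrite /h; have /andP[g1 g2] := G_bdd 1 (- (m + 1)) y; have /andP[g3 g4] := G_bdd 1 m y.
  have [y0|y0] := leP y 0.
    have -> : G 1 m y = 1 by rewrite /G lst1//; lra.
    by lra.
  have -> : G 1 (- (m + 1)) y = 0 by rewrite /G lst0//; lra.
  by lra.
have Lh : Lim h <= (m ^+ 2)^-1 * C.
  apply: Lim_ub => //; last by rewrite invr_ge0 sqr_ge0.
  move=> y; have [ym|ym] := leP `|y| m.
    by rewrite hlo// mulr_ge0 ?invr_ge0 ?sqr_ge0.
  rewrite ler_pdivlMl ?exprn_gt0// -[leRHS](real_normK (num_real y)).
  apply: (@le_trans _ _ (m ^+ 2)); first by rewrite ler_piMr ?sqr_ge0//; case/andP: (h0 y).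
  by rewrite lerXn2r ?nnegrE ?(ltW m0)// ltW.
have cfL1 g : cb g -> L1 nu g by move=> cg; exact: (cb_L1 nu cg mid).
have Eh : Ex nu h = Lim h.
  rewrite /h (LimD (cbG _ _) cG1) (ExD (lG _ _) (cfL1 _ cG1)) eqG//.
  rewrite (LimD (cb_cst 1) (cbZ (-1) (cbG 1 m))) (ExD (L1_cst nu 1) (L1Z (-1) (lG 1 m))).
  by rewrite Ex_cst Lim_cst ExZ; [rewrite LimZ; [rewrite eqG|exact: cbG]|exact: lG].
have lstK x : `|lst x| <= 1 by case: (lst_cases x) => -[? ->]; rewrite ler_norml; apply/andP; split; lra.
have Bh : B' * Lim h <= e / 4.
  apply: (@le_trans _ _ (B' * ((m ^+ 2)^-1 * C))); first exact: ler_wpM2l.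
  rewrite mulrCA ler_pdivrMl ?exprn_gt0//; apply: (@le_trans _ _ (m * (e / 4))).
    have -> : m * (e / 4) = B' * C + e / 4 by rewrite /m; field; rewrite lt0r_neq0.
    by rewrite lerDl ltW.
  by rewrite ler_pM2r// expr2 ler_peMl// ltW.
have L0 : 0 < m + 1 by lra.
have [N [c0 [c [a [a0 hf1 hf2]]]]] := step_approx lst0 lst1 lstK contf fB L0 e4.
rewrite -/B' in hf2.
pose b (j : nat) := a * (m + 1) - j%:R.
pose g x := c0 + \sum_(j < N) c j * lst (a * x + b j).
have cl j : cb (fun y => lst (a * y + b j)) by exact: cb_lst.
have [cs Ls] := LimS N c cl.
have cg : cb g by exact: cbD (cb_cst _) cs.
have El j : Ex nu (fun y => lst (a * y + b j)) = Lim (fun y => lst (a * y + b j)).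
  (* Increasing ramps are complements of decreasing ones because [lst t = 1 - lst (1 - t)]. *)
  have -> : (fun y => lst (a * y + b j)) = (fun y => 1 + -1 * G a (- b j / a) y).
    apply/funext => y; rewrite /G (_ : a * (- b j / a - y) + 1 = 1 - (a * y + b j)); last by field; rewrite lt0r_neq0.
    case: (lst_cases (a * y + b j)) => -[z ->].
    - by rewrite lst1; lra.
    - by case: (lst_cases (1 - (a * y + b j))) => -[z' ->]; lra.
    - by rewrite lst0; lra.
  rewrite (LimD (cb_cst 1) (cbZ (-1) (cbG a (- b j / a)))) (ExD (L1_cst nu 1) (L1Z (-1) (lG a (- b j / a)))).
  by rewrite Ex_cst Lim_cst ExZ; [rewrite LimZ; [rewrite eqG|exact: cbG]|exact: lG].
have Eg : Ex nu g = Lim g.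
  rewrite /g (LimD (cb_cst c0) cs) (ExD (L1_cst nu c0) (cfL1 _ cs)).
  rewrite Ex_cst Lim_cst Ls Ex_sum; last by move=> j _; exact/L1Z/cfL1.
  by congr (_ + _); apply: eq_bigr => j _; rewrite ExZ; [rewrite El|exact: cfL1].
have fg y : `|f y - g y| <= e / 4 + B' * h y.
  have [ym|ym] := leP `|y| (m + 1); last by rewrite hhi// mulr1; apply: le_trans (hf2 y) _; rewrite lerDr ltW.
  by apply: le_trans (hf1 _ ym) _; rewrite lerDl mulr_ge0//; case/andP: (h0 y).
have ceh : cb (fun y => e / 4 + B' * h y) by exact: cbD (cb_cst _) (cbZ _ ch).
have cgn : cb (fun y => -1 * g y) by exact: cbZ.
have cfg : cb (fun y => f y + -1 * g y) by exact: cbD.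
have cneh : cb (fun y => -1 * (e / 4 + B' * h y)) by exact: cbZ.
have Leh : Lim (fun y => e / 4 + B' * h y) <= e / 2.
  by rewrite LimD; [rewrite Lim_cst LimZ//; lra|exact: cb_cst|exact: cbZ].
have h1 : Lim f + -1 * Lim g <= e / 2.
  rewrite -LimZ// -LimD//; apply: le_trans Leh; apply: Lim_le => // y.
  by have := fg y; rewrite ler_norml mulN1r => /andP[].
have h2 : - (e / 2) <= Lim f + -1 * Lim g.
  rewrite -LimZ// -LimD//; apply: (@le_trans _ _ (Lim (fun y => -1 * (e / 4 + B' * h y)))).
    by rewrite LimZ// mulN1r lerN2.
  by apply: Lim_le => // y; have := fg y; rewrite ler_norml !mulN1r => /andP[].
have h3 : `|Ex nu f - Ex nu g| <= e / 2.
  rewrite -ExB; [|exact: cfL1..]; apply: le_trans (Ex_abs (L1B (cfL1 _ cf) (cfL1 _ cg))) _.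
  apply: (@le_trans _ _ (Ex nu (fun y => e / 4 + B' * h y))).
    by apply: Ex_le => //; [exact: (L1_norm (L1B (cfL1 _ cf) (cfL1 _ cg)))|exact: cfL1].
  rewrite ExD; [|exact: L1_cst|exact/L1Z/cfL1].
  rewrite Ex_cst ExZ; last exact: cfL1.
  by rewrite Eh; lra.
move: h3; rewrite Eg !ler_norml => /andP[h3 h4].
move: h1 h2 h3 h4; move: (Lim f) (Lim g) (Ex nu f) => z1 z2 z3 h1 h2 h3 h4.
by apply/andP; split; lra.
Qed.

Lemma weak_limit_cvg f : cb f -> Ex Q (fun w => f (Y k w)) @[k --> \oo] --> Ex nu f.
Proof. by move=> cf; rewrite Exnu_f//; exact: LimP. Qed.

End Limit.

Lemma weak_limit_exists : exists nu : probability (measurableTypeR R) R,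
  forall f, cb f -> Ex Q (fun w => f (Y k w)) @[k --> \oo] --> Ex nu f.
Proof. by have [nu nuF] := F_cumulative; exists nu => f cf; exact: weak_limit_cvg. Qed.

End WeakLimit.

(** * Mean and variance of the limit law *)

Section WeakMoments.
Context {R : realType} {d : measure_display} {T : measurableType d}.
Variables (Q : probability T R) (Y : nat -> T -> R) (V : R).
Hypotheses (lY : forall k, L2 Q (Y k)) (Y0 : forall k, Ex Q (Y k) = 0)
  (YV : Ex Q (fun w => Y k w ^+ 2) @[k --> \oo] --> V)
  (Yui : forall e : R, 0 < e -> exists2 A, 0 < A & forall k,
     Ex Q (fun w => Y k w ^+ 2 - Num.min (Y k w ^+ 2) A) <= e).
Variable nu : probability (measurableTypeR R) R.
Hypothesis Ynu : forall f, cb f -> Ex Q (fun w => f (Y k w)) @[k --> \oo] --> Ex nu f.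

Let msq (A x : R) := Num.min (x ^+ 2) A.

Let cb_msq A : 0 <= A -> cb (msq A).
Proof.
move=> A0; split; last first.
  by exists A => x; rewrite ger0_norm /msq ?ge_min ?lexx ?orbT// le_min sqr_ge0.
have : continuous ((fun x : R => x ^+ 2) \min (fun _ : R => A)); last by [].
by move=> t; apply: continuous_min; [exact: exprn_continuous|exact: cvg_cst].
Qed.

Let cb_trunc (A : R) : 0 <= A -> cb (trunc A).
Proof.
move=> A0; split; last by exists A => x; exact: trunc_bdd.
have : continuous ((fun _ : R => - A) \max ((@idfun R) \min (fun=> A))); last by [].
move=> t; apply: continuous_max; first exact: cvg_cst.
by apply: continuous_min; [exact: cvg_id|exact: cvg_cst].
Qed.

Let lfY f k : cb f -> L1 Q (fun w => f (Y k w)).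
Proof. by move=> cf; apply: cb_L1 => //; exact: L2_meas. Qed.

Let msq_le A : 0 <= A -> Ex nu (msq A) <= V.
Proof.
move=> A0; apply: ler_cvg_to (Ynu (cb_msq A0)) YV _; near=> k.
apply: Ex_le; [exact: lfY (cb_msq A0)|exact: L2_sqr (lY k)|move=> w].
by rewrite /msq ge_min lexx.
Unshelve. all: by end_near. Qed.

(** Uniform integrability bounds the excess over the level uniformly in [k], so the limit in [k] can
    be taken before the limit in the level, and no variance escapes. *)
Let msq_cvg : Ex nu (msq k%:R) @[k --> \oo] --> V.
Proof.
apply/cvgrPdist_le => e e0; have [A A0 hA] := Yui e0; near=> n.
have An : A <= n%:R by near: n; exact: nbhs_infty_ger.
rewrite ger0_norm ?subr_ge0 ?msq_le//.
have h : forall k, Ex Q (fun w => Y k w ^+ 2) - Ex Q (fun w => msq n%:R (Y k w)) <= e.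
  move=> k; have lm := lfY k (cb_msq (ler0n R n)).
  rewrite -ExB; [|exact: L2_sqr|exact: lm].
  apply: le_trans (hA k); apply: Ex_le.
  - exact: (L1B (L2_sqr (lY k)) lm).
  - exact: (L1B (L2_sqr (lY k)) (lfY k (cb_msq (ltW A0)))).
  by move=> w; rewrite lerB// /msq le_min ge_min lexx/= ge_min An orbT.
apply: ler_cvg_to (cvgB YV (Ynu (cb_msq (ler0n R n)))) (cvg_cst e) _.
by near=> k; exact: h.
Unshelve. all: by end_near. Qed.

Let int_sqr : (\int[nu]_x (x ^+ 2)%:E = V%:E)%E.
Proof.
have mg n : measurable_fun setT (fun x : measurableTypeR R => (msq n%:R x)%:E).
  by apply/measurable_EFinP; exact: (cb_meas (cb_msq (ler0n R n))).
have g0 n (x : measurableTypeR R) : setT x -> (0 <= (msq n%:R x)%:E)%E.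
  by move=> _; rewrite lee_fin le_min sqr_ge0 ler0n.
have gi (x : measurableTypeR R) : setT x -> {homo (fun n => (msq n%:R x)%:E) : n m / (n <= m)%N >-> (n <= m)%E}.
  move=> _ n m nm; rewrite lee_fin /msq le_min ge_min lexx/= ge_min ler_nat nm orbT//.
have := cvg_monotone_convergence measurableT mg g0 gi.
have -> : (fun x : measurableTypeR R => limn (fun n => (msq n%:R x)%:E)) = (fun x => (x ^+ 2)%:E).
  apply/funext => x; apply: cvg_lim => //; apply: cvg_near_cst; near=> n.
  by rewrite /msq min_l//; near: n; exact: nbhs_infty_ger.
move=> h.
have h2 : (\int[nu]_x (msq n%:R x)%:E)%E @[n --> \oo] --> V%:E.
  have -> : (fun n : nat => (\int[nu]_x (msq n%:R x)%:E)%E) = (fun n => (Ex nu (msq n%:R))%:E).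
    apply/funext => n; apply: Ex_EFin; apply: (cb_L1 nu (cb_msq (ler0n R n)) (Y := fun y : measurableTypeR R => y)).
    exact: measurable_id.
  by apply: cvg_EFin; [near=> n|exact: msq_cvg].
exact: (cvg_unique _ (h nu) h2).
Unshelve. all: by end_near. Qed.

Lemma weak_limit_L2 : L2 nu (fun x => x).
Proof.
split; first exact: measurable_id.
apply/integrableP; split; first by apply/measurable_EFinP; apply: measurable_funX; exact: measurable_id.
rewrite (_ : (\int[_]_x _)%E = V%:E) ?ltry// -int_sqr; apply: eq_integral => x _.
by rewrite /= ger0_norm// sqr_ge0.
Qed.

Lemma weak_limit_sqr : Ex nu (fun x => x ^+ 2) = V.
Proof. by have := int_sqr; rewrite (Ex_EFin (L2_sqr weak_limit_L2)) => -[]. Qed.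

(** Truncation at [A] changes a mean by at most [A^-1] times the second moment, for [Y k] as for
    [nu]. Since the means of [Y k] are 0, that of [nu] is at most [2 * A^-1 * V] for every [A]. *)
Lemma weak_limit_mean : Ex nu (fun x => x) = 0.
Proof.
have tA (A x : R) : 0 < A -> `|x - trunc A x| <= A^-1 * x ^+ 2.
  move=> A0; rewrite trunc_dist; last exact: ltW.
  rewrite ge_max; apply/andP; split.
    by rewrite mulr_ge0 ?sqr_ge0// invr_ge0 ltW.
  rewrite ler_pdivlMl// -(real_normK (num_real x)); nra.
have V0 : 0 <= V by rewrite -weak_limit_sqr; exact: Ex_sqr_ge0.
have tr d' (T' : measurableType d') (Q' : probability T' R) (Z : T' -> R) A : 0 < A -> L2 Q' Z ->
    `|Ex Q' Z - Ex Q' (fun w => trunc A (Z w))| <= A^-1 * Ex Q' (fun w => Z w ^+ 2).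
  move=> A0 lZ; have lt : L1 Q' (fun w => trunc A (Z w)) by apply: cb_L1 (cb_trunc (ltW A0)) (L2_meas lZ).
  rewrite -ExB//; last exact: L2_L1.
  apply: le_trans (Ex_abs (L1B (L2_L1 lZ) lt)) _; rewrite -ExZ; last exact: L2_sqr.
  apply: Ex_le; [exact: (L1_norm (L1B (L2_L1 lZ) lt))|exact/L1Z/L2_sqr|by move=> w; exact: tA].
have bd (A : R) : 0 < A -> `|Ex nu (fun x => x)| <= 2 * A^-1 * V.
  move=> A0; have h1 := tr _ _ nu (fun x => x) A A0 weak_limit_L2; rewrite weak_limit_sqr in h1.
  have h2 : `|Ex nu (trunc A)| <= A^-1 * V.
    apply: ler_cvg_to (cvg_norm (Ynu (cb_trunc (ltW A0)))) (cvgM (cvg_cst A^-1) YV) _; near=> k.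
    by have := tr _ _ Q (Y k) A A0 (lY k); rewrite Y0 sub0r normrN.
  rewrite (_ : Ex nu _ = (Ex nu (fun x => x) - Ex nu (trunc A)) + Ex nu (trunc A)); last by rewrite subrK.
  apply: le_trans (ler_normD _ _) _; rewrite -mulrA (_ : 2 * _ = A^-1 * V + A^-1 * V); last by ring.
  exact: lerD.
apply/eqP; rewrite -normr_le0; apply/ler_addgt0Pr => e e0; rewrite add0r.
have A0 : 0 < 2 * V / e + 1 by rewrite ltr_wpDl// divr_ge0 ?mulr_ge0// ltW.
apply: le_trans (bd _ A0) _; rewrite mulrAC ler_pdivrMr// mulrDr mulr1.
rewrite (_ : e * (2 * V / e) = 2 * V); last by field; rewrite lt0r_neq0.
by rewrite lerDl ltW.
Unshelve. all: by end_near. Qed.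

(* a point mass has mean zero only at the origin, and then the variance vanishes *)
Lemma weak_limit_nondeg : V != 0 -> forall c : R, (nu [set c] < 1)%E.
Proof.
move=> V0 c; rewrite lt_neqAle probability_le1 ?andbT; last exact: measurable_set1.
apply/eqP => nc.
have ac : {ae nu, forall x, x = c}.
  exists (~` [set c]); split; first by apply: measurableC; exact: measurable_set1.
    by rewrite probability_setC ?nc ?subee//; exact: measurable_set1.
  by move=> x.
have c0 : c = 0.
  by rewrite -weak_limit_mean (@Ex_ae _ _ _ _ _ (fun=> c)) ?Ex_cst//; exact: measurable_id.
move/eqP: V0; apply; rewrite -weak_limit_sqr; apply: Ex_ae0.
  by apply: measurable_funX; exact: measurable_id.
apply: (@ae_imp _ _ _ nu (fun x => x = c) (fun x => x ^+ 2 = 0) ac) => x ->.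
by rewrite c0 expr0n.
Qed.

End WeakMoments.

(** * Symmetrised sums over increasing index families *)

Section Permutations.
Local Open Scope set_scope.

(** Values are corrected one at a time: a transposition sends the current image of [g k0] to [f k0]
    without disturbing the earlier ones. *)
Lemma perm_extends (m : nat) (T : finType) (f g : 'I_m -> T) : injective f -> injective g ->
  exists sg : {perm T}, forall k, sg (g k) = f k.
Proof.
move=> fI gI; have h0 j : (j <= m)%N -> exists sg : {perm T}, forall k : 'I_m, (k < j)%N -> sg (g k) = f k.
  elim: j => [|j ih] jm; first by exists 1%g.
  have [sg h] := ih (ltnW jm); pose k0 := Ordinal jm.
  exists (sg * tperm (sg (g k0)) (f k0))%g => k; rewrite ltnS leq_eqVlt => /orP[/eqP kj|kj].
    have -> : k = k0 by apply: val_inj.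
    by rewrite permM tpermL.
  have kk0 : k0 != k by rewrite eq_sym -val_eqE/= (ltn_eqF kj).
  rewrite permM (h _ kj) tpermD//; last by rewrite (inj_eq fI).
  by rewrite -(h _ kj) (inj_eq perm_inj) (inj_eq gI).
by have [sg h] := h0 m (leqnn m); exists sg => k; exact: h.
Qed.

(** A permutation carrying [g] to [f] acts on the symmetric group by translation, so the sum forgets
    the injection it starts from. *)
Lemma sum_perm_inj (V : nmodType) (m : nat) (T : finType) (F : {ffun 'I_m -> T} -> V) (f g : 'I_m -> T) :
  injective f -> injective g ->
  \sum_(sg : {perm T}) F [ffun k => sg (f k)] = \sum_(sg : {perm T}) F [ffun k => sg (g k)].
Proof.
move=> fI gI; have [s0 h] := perm_extends fI gI.
rewrite [RHS](reindex_inj (mulgI s0)); apply: eq_bigr => sg _; congr F.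
by apply/ffunP => k; rewrite !ffunE permM h.
Qed.

Lemma same_image_perm (m : nat) (T : finType) (f g : {ffun 'I_m -> T}) : injective f ->
  f @: 'I_m = g @: 'I_m -> exists p : 'S_m, f = [ffun k => g (p k)].
Proof.
move=> fI fg.
have ex k : exists l, f k == g l.
  have : f k \in g @: 'I_m by rewrite -fg; apply: imset_f.
  by case/imsetP => l _ ->; exists l.
pose p k := xchoose (ex k).
have pE k : f k = g (p k) by exact/eqP/(xchooseP (ex k)).
have pI : injective p by move=> k l kl; apply: fI; rewrite !pE kl.
by exists (perm pI); apply/ffunP => k; rewrite ffunE permE.
Qed.

End Permutations.

Section Increasing.
Local Open Scope set_scope.
Variables (m N : nat).

Lemma incr_inj (i : {ffun 'I_m -> 'I_N}) : incr_idx i -> injective i.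
Proof.
move=> /forallP h k l kl; apply/eqP/negPn/negP => nkl.
have [lt|lt|/val_inj e] := ltngtP k l; last by rewrite e eqxx in nkl.
  by have /forallP/(_ l)/implyP/(_ lt) := h k; rewrite kl ltnn.
by have /forallP/(_ k)/implyP/(_ lt) := h l; rewrite kl ltnn.
Qed.

Variable i0 : 'I_m -> 'I_N.
Hypothesis i0I : injective i0.

Let en (A : {set 'I_N}) : {ffun 'I_m -> 'I_N} := [ffun k => nth (i0 k) (enum A) k].

Let sorted_en (A : {set 'I_N}) : sorted ltn (map val (enum A)).
Proof.
rewrite -[enum _](eq_filter (mem_enum _)) -(eq_filter (mem_map val_inj _)) -filter_map.
by rewrite (sorted_filter ltn_trans) // unlock val_ord_enum iota_ltn_sorted.
Qed.

Let incr_en (A : {set 'I_N}) : #|A| = m -> incr_idx (en A).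
Proof.
move=> Am; apply/forallP => k; apply/forallP => l; apply/implyP => kl; rewrite !ffunE.
have sz : size (enum A) = m by rewrite -cardE.
have := sorted_ltn_nth ltn_trans 0%N (sorted_en A) k l.
rewrite !inE size_map sz => /(_ (ltn_ord k) (ltn_ord l) kl).
by rewrite (nth_map (i0 k)) ?sz// (nth_map (i0 l)) ?sz.
Qed.

Let im_en (A : {set 'I_N}) : #|A| = m -> en A @: 'I_m = A.
Proof.
move=> Am; have sz : size (enum A) = m by rewrite -cardE.
apply/eqP.
rewrite eqEcard; apply/andP; split.
  apply/fintype.subsetP => _ /imsetP[k _ ->]; rewrite ffunE -mem_enum mem_nth// sz//.
by rewrite card_imset ?card_ord ?Am//; exact/incr_inj/incr_en.
Qed.

Let en_im (i : {ffun 'I_m -> 'I_N}) : incr_idx i -> en (i @: 'I_m) = i.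
Proof.
move=> hi; have iI := incr_inj hi.
have cim : #|i @: 'I_m| = m by rewrite card_imset ?card_ord.
have e : map val (enum (i @: 'I_m)) = map (fun k => val (i k)) (enum 'I_m).
  apply: (irr_sorted_eq ltn_trans ltnn); [exact: sorted_en| |].
    rewrite sorted_map; apply: (@sub_sorted _ (fun k l : 'I_m => (k < l)%N)).
      by move=> k l kl; have /forallP/(_ k)/forallP/(_ l)/implyP := hi; apply.
    by have := iota_ltn_sorted 0 m; rewrite -val_enum_ord sorted_map.
  move=> y; apply/mapP/mapP => -[x].
    by rewrite mem_enum => /imsetP[k _ ->] ->; exists k => //; rewrite mem_enum.
  by move=> _ ->; exists (i x) => //; rewrite mem_enum; apply: imset_f.
apply/ffunP => k; apply: val_inj; rewrite ffunE.
have : nth 0%N (map val (enum (i @: 'I_m))) k = nth 0%N (map (fun k => val (i k)) (enum 'I_m)) k by rewrite e.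
rewrite (nth_map (i0 k)); last by rewrite -cardE cim.
by rewrite (nth_map k) ?size_enum_ord// nth_ord_enum.
Qed.

(** Relabelling permutes the [m]-element subsets and so preserves the sum of a symmetric [F] over
    increasing families. After summing over all relabellings and exchanging the sums, every
    increasing family contributes the same permutation sum, and there are ['C(N, m)] families. *)
Lemma sum_incr_perm (V : pzRingType) (F : {ffun 'I_m -> 'I_N} -> V) :
  (forall (p : 'S_m) (i : {ffun 'I_m -> 'I_N}), F [ffun k => i (p k)] = F i) ->
  N`!%:R * \sum_(i : {ffun 'I_m -> 'I_N} | incr_idx i) F i =
  'C(N, m)%:R * \sum_(sg : 'S_N) F [ffun k => sg (i0 k)].
Proof.
move=> Fsym.
have sets (G : {ffun 'I_m -> 'I_N} -> V) : \sum_(i : {ffun 'I_m -> 'I_N} | incr_idx i) G i =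
    \sum_(A : {set 'I_N} | #|A| == m) G (en A).
  rewrite (reindex_onto en (fun i : {ffun 'I_m -> 'I_N} => i @: 'I_m)) => [|i]; last exact: en_im.
  apply: eq_bigl => A; apply/idP/idP => [/andP[h1 /eqP h3]|/eqP Am].
    by rewrite -{1}h3 card_imset ?card_ord ?eqxx//; exact: incr_inj.
  by rewrite incr_en//= im_en.
have sgE (sg : 'S_N) : \sum_(i : {ffun 'I_m -> 'I_N} | incr_idx i) F [ffun k => sg (i k)] =
    \sum_(i : {ffun 'I_m -> 'I_N} | incr_idx i) F i.
  rewrite (sets F) (sets (fun i : {ffun 'I_m -> 'I_N} => F [ffun k => sg (i k)])).
  rewrite [RHS](reindex_inj (imset_inj (@perm_inj _ sg))).
  apply: eq_big => A; first by rewrite card_imset//; exact: perm_inj.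
  move=> /eqP Am; have Bm : #|sg @: A| = m by rewrite card_imset//; exact: perm_inj.
  have [||p ->] := @same_image_perm m _ [ffun k => sg (en A k)] (en (sg @: A)).
  - move=> k l kl; apply: (incr_inj (incr_en Am)); apply: (@perm_inj _ sg); move: kl.
    by rewrite (ffunE (fun k => sg (en A k)) k) (ffunE (fun k => sg (en A k)) l).
  - rewrite im_en// -[in RHS](im_en Am) -imset_comp; apply: eq_imset => k.
    exact: ffunE.
  by rewrite Fsym.
transitivity (\sum_(sg : 'S_N) \sum_(i : {ffun 'I_m -> 'I_N} | incr_idx i) F [ffun k => sg (i k)]).
  by rewrite [RHS](eq_bigr _ (fun sg _ => sgE sg)) sumr_const card_Sn -[RHS]mulr_natl.
rewrite exchange_big/= (sets (fun i : {ffun 'I_m -> 'I_N} => \sum_(sg : 'S_N) F [ffun k => sg (i k)])).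
rewrite (eq_bigr (fun=> \sum_(sg : 'S_N) F [ffun k => sg (i0 k)])).
  rewrite [LHS]sumr_const -[LHS]mulr_natl; congr (_%:R * _).
  by rewrite -[N in RHS]card_ord -card_draws; apply: eq_card => A; rewrite !inE.
by move=> A /eqP Am; apply: sum_perm_inj => //; exact/incr_inj/incr_en.
Qed.

End Increasing.

Section Restriction.
Local Open Scope set_scope.

(** [sg] maps the first [N] indices increasingly onto [D], so increasing families inside [D]
    correspond to increasing families of initial indices. It is chosen before [F], so one
    relabelling serves every sample point. *)
Lemma sum_incr_subset (m n N : nat) (D : {set 'I_n}) (Nn : (N <= n)%N) : (0 < m)%N -> #|D| = N ->
  exists sg : 'S_n, forall (V : nmodType) (F : {ffun 'I_m -> 'I_n} -> V),
  \sum_(i : {ffun 'I_m -> 'I_n} | incr_idx i && [forall k, i k \in D]) F i =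
  \sum_(i : {ffun 'I_m -> 'I_N} | incr_idx i) F [ffun k => sg (widen_ord Nn (i k))].
Proof.
move=> m0; case: N Nn => [|N] Nn DN.
  exists 1%g => V F; have k0 := Ordinal m0.
  rewrite !big_pred0// => [i|i].
    by have := ltn_ord (i k0).
  apply/negP => /andP[_ /forallP/(_ k0)]; rewrite (cards0_eq DN) inE//.
have szD : size (enum D) = N.+1 by rewrite -cardE.
have x0 : 'I_n := Ordinal (leq_trans (ltn0Sn N) Nn).
pose f (a : 'I_N.+1) := nth x0 (enum D) a.
have fI : injective f.
  by move=> a b /eqP; rewrite nth_uniq ?szD ?enum_uniq// => /eqP/val_inj.
have wI : injective (widen_ord Nn) by move=> a b /(congr1 val)/= ab; exact: val_inj.
have [sg hsg] := perm_extends fI wI; exists sg => V F.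
have fmono (a b : 'I_N.+1) : (a < b)%N -> (f a < f b)%N.
  move=> ab; have st : sorted ltn (map val (enum D)).
    rewrite -[enum _](eq_filter (mem_enum _)) -(eq_filter (mem_map val_inj _)) -filter_map.
    by rewrite (sorted_filter ltn_trans) // unlock val_ord_enum iota_ltn_sorted.
  have := sorted_ltn_nth ltn_trans 0%N st a b; rewrite !inE size_map szD !(nth_map x0) ?szD//; exact.
have fD a : f a \in D by rewrite -mem_enum mem_nth// szD.
rewrite (reindex_onto (fun i : {ffun 'I_m -> 'I_N.+1} => [ffun k => sg (widen_ord Nn (i k))])
   (fun i : {ffun 'I_m -> 'I_n} => [ffun k => inord (index (i k) (enum D))])).
  apply: eq_bigl => i; rewrite (_ : [ffun k => inord _] = i) ?eqxx ?andbT; last first.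
    apply/ffunP => k; rewrite !ffunE hsg; apply: val_inj.
    by rewrite /f/= index_uniq ?szD ?enum_uniq// inordK.
  have -> : [forall k, [ffun k => sg (widen_ord Nn (i k))] k \in D] = true.
    by apply/forallP => k; rewrite ffunE hsg fD.
  rewrite andbT; apply/forallP/forallP => h k; apply/forallP => l; apply/implyP => kl.
    have /forallP/(_ l)/implyP/(_ kl) := h k; rewrite !ffunE !hsg => lt.
    rewrite ltnNge leq_eqVlt; apply/negP => /orP[/eqP/val_inj e|/fmono]; first by rewrite e ltnn in lt.
    by rewrite ltnNge ltnW.
  have /forallP/(_ l)/implyP/(_ kl) := h k; rewrite !ffunE !hsg; exact: fmono.
move=> i /andP[_ /forallP iD]; apply/ffunP => k; rewrite !ffunE hsg /f inordK ?nth_index ?mem_enum//.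
by rewrite -szD index_mem mem_enum.
Qed.

End Restriction.

(** * Hoeffding decomposition *)

Section SumSqr.
Context {R : realType}.

(** Cauchy-Schwarz by Lagrange's identity: the double sum of [(f i - f j) ^+ 2] is nonnegative. *)
Lemma sqr_sum_le (I : finType) (f : I -> R) : (\sum_i f i) ^+ 2 <= #|I|%:R * \sum_i f i ^+ 2.
Proof.
have : 0 <= \sum_i \sum_j (f i - f j) ^+ 2.
  by apply: sumr_ge0 => i _; apply: sumr_ge0 => j _; exact: sqr_ge0.
rewrite (_ : \sum_i _ = (#|I|%:R * \sum_i f i ^+ 2 - (\sum_i f i) ^+ 2) *+ 2).
  by rewrite pmulrn_lge0// subr_ge0.
have e1 : \sum_i \sum_(j : I) f i ^+ 2 = #|I|%:R * \sum_i f i ^+ 2.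
  by under eq_bigr do rewrite sumr_const -mulr_natl; rewrite -mulr_sumr.
have e2 : \sum_(i : I) \sum_j f j ^+ 2 = #|I|%:R * \sum_i f i ^+ 2.
  by rewrite sumr_const mulr_natl.
rewrite mulr2n; transitivity (\sum_i \sum_(j : I) f i ^+ 2 + \sum_(i : I) \sum_j f j ^+ 2 - 2 * (\sum_i f i) ^+ 2); last first.
  by rewrite e1 e2; ring.
rewrite expr2 mulr_suml mulr_sumr -big_split -sumrB; apply: eq_bigr => i _.
rewrite /= mulr_sumr mulr_sumr -big_split -sumrB; apply: eq_bigr => j _ /=; ring.
Qed.

End SumSqr.

Section PermExtension.

(* a permutation of the first N indices, extended by the identity *)
Definition pext N (sg : 'S_N) (i : nat) : nat := if insub i is Some k then val (sg k) else i.

Lemma pext_ord N (sg : 'S_N) (k : 'I_N) : pext sg k = sg k.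
Proof. by rewrite /pext valK. Qed.

Lemma pextM N (sg ta : 'S_N) i : pext (sg * ta)%g i = pext ta (pext sg i).
Proof. by rewrite {1 3}/pext; case: insubP => [k _ _|h]; rewrite ?permM ?pext_ord// /pext insubN. Qed.

Lemma pext1 N i : pext (1%g : 'S_N) i = i.
Proof. by rewrite /pext; case: insubP => // k _ <-; rewrite perm1. Qed.

Lemma pextK N (sg : 'S_N) : cancel (pext sg) (pext sg^-1%g).
Proof. by move=> i; rewrite -pextM mulgV pext1. Qed.

Definition rp N n (a : 'S_N * 'S_n) (i : nat + nat) : nat + nat :=
  match i with inl k => inl (pext a.1 k) | inr l => inr (pext a.2 l) end.

Lemma rpK N n (a : 'S_N * 'S_n) : cancel (rp a) (rp (a.1^-1, a.2^-1)%g).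
Proof. by case=> k /=; rewrite pextK. Qed.

Lemma rpM N n (a b : 'S_N * 'S_n) i : rp b (rp a i) = rp ((a.1 * b.1)%g, (a.2 * b.2)%g) i.
Proof. by case: i => k /=; rewrite pextM. Qed.

End PermExtension.

(** * U-statistics as averages over permutations *)

Section UStatistic.
Context {R : realType} {d : measure_display} {E : measurableType d}.
Variables (mu : probability E R) (Q : probability (seqspace E (nat + nat)%type) R).
Hypothesis iQ : iid_law mu Q.
Local Notation T := (seqspace E (nat + nat)%type).

Let mpc N n (a : 'S_N * 'S_n) : mpres Q Q (fun x : T => x \o rp a : T).
Proof. exact: (mpres_comp iQ (rpK a)). Qed.

(* The U-statistic on [N] controls and [n] cases, as an average over all permutations of the samples. *)
Definition Uavg N n (F : T -> R) (x : T) : R :=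
  #|{: 'S_N * 'S_n}|%:R^-1 * \sum_(a : 'S_N * 'S_n) F (x \o rp a).

Lemma Uavg_eq N n F G : F =1 G -> Uavg N n F =1 Uavg N n G.
Proof. by move=> FG x; congr (_ * _); apply: eq_bigr => a _; rewrite FG. Qed.

Lemma Uavg_inv N n (b : 'S_N * 'S_n) F x : Uavg N n (fun y => F (y \o rp b)) x = Uavg N n F x.
Proof.
congr (_ * _); have bI : injective (fun a : 'S_N * 'S_n => (b.1 * a.1, b.2 * a.2)%g).
  by move=> [a a'] [c c'] /= [/mulgI -> /mulgI ->].
rewrite [RHS](reindex_inj bI); apply: eq_bigr => a _; congr F.
by apply/funext => i; rewrite /= rpM.
Qed.

Lemma UavgD N n F G x : Uavg N n (fun y => F y + G y) x = Uavg N n F x + Uavg N n G x.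
Proof. by rewrite /Uavg big_split mulrDr. Qed.

Lemma UavgZ N n c F x : Uavg N n (fun y => c * F y) x = c * Uavg N n F x.
Proof. by rewrite /Uavg -mulr_sumr mulrCA. Qed.

Lemma Uavg_sum N n (J : Type) (s : seq J) (P : pred J) (F : J -> T -> R) x :
  Uavg N n (fun y => \sum_(j <- s | P j) F j y) x = \sum_(j <- s | P j) Uavg N n (F j) x.
Proof. by rewrite /Uavg exchange_big/= -mulr_sumr. Qed.

Lemma L2_Uavg N n F : L2 Q F -> L2 Q (Uavg N n F).
Proof. by move=> lF; apply: L2Z; apply: L2_sum => a _; exact: (L2_mp (mpc a) lF). Qed.

(** Convexity of the square and invariance of the law under relabelling. *)
Lemma Uavg_sqr_le N n F : L2 Q F -> Ex Q (fun x => Uavg N n F x ^+ 2) <= Ex Q (fun x => F x ^+ 2).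
Proof.
move=> lF; set K := #|{: 'S_N * 'S_n}|.
have K0 : 0 < K%:R :> R by rewrite ltr0n; apply/card_gt0P; exists (1%g, 1%g).
have l a : L1 Q (fun x : T => F (x \o rp a) ^+ 2) := L2_sqr (L2_mp (@mpc N n a) lF).
apply: (@le_trans _ _ (Ex Q (fun x => K%:R^-1 * \sum_(a : 'S_N * 'S_n) F (x \o rp a) ^+ 2))).
  apply: Ex_le; [exact: L2_sqr (L2_Uavg N n lF)|by apply: L1Z; apply: L1_sum => a _; exact: l|move=> x].
  rewrite /Uavg -/K exprMn exprVn ler_pdivrMl ?exprn_gt0//.
  rewrite expr2 -mulrA mulVKf ?lt0r_neq0//; exact: sqr_sum_le.
rewrite ExZ; last by apply: L1_sum => a _; exact: l.
rewrite Ex_sum; last by move=> a _; exact: l.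
rewrite (eq_bigr (fun=> Ex Q (fun x => F x ^+ 2))).
  by rewrite sumr_const -[X in _ * X]mulr_natl mulKf// lt0r_neq0.
by move=> a _; rewrite [RHS](Ex_mp (mpc a))//; exact: measurable_sqr (L2_meas lF).
Qed.

Variables (m0 m1 : nat).
Definition pos : finType := ('I_m0 + 'I_m1)%type.
Definition cpos (p : pos) : nat + nat := match p with inl k => inl (val k) | inr l => inr (val l) end.

Lemma cpos_inj : injective cpos.
Proof. by move=> [k|k] [l|l] //= [] /val_inj ->. Qed.

Definition S0 : pred (nat + nat) := fun i => [exists p, cpos p == i].

Definition cs (B : {set pos}) : pred (nat + nat) := fun i => [exists p, (p \in B) && (cpos p == i)].

Lemma cs_cpos B p : cs B (cpos p) = (p \in B).
Proof.
apply/existsP/idP => [[p' /andP[pB /eqP/cpos_inj <-]]//|pB].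
by exists p; rewrite pB eqxx.
Qed.

Lemma S0_cpos p : S0 (cpos p).
Proof. by apply/existsP; exists p. Qed.

(** A set of coordinates matters to the kernel only through the argument positions it covers;
    degeneracy is measured by their number. *)
Definition trace (S : pred (nat + nat)) : {set pos} := [set p | S (cpos p)]%SET.

Section Decoupling.
Variables (q N n : nat).
Hypotheses (q0 : (0 < q)%N) (qN : (q * m0 <= N)%N) (qn : (q * m1 <= n)%N).

(** Argument [k] owns the [q] indices from [k * q] on, and [t] picks one of them. Disjointness of
    these blocks makes the choice injective, hence extendable to a permutation. *)
Let block (m M : nat) : (q * m <= M)%N -> forall t : 'I_m -> 'I_q, exists sg : 'S_M,
  forall k : 'I_m, pext sg k = (k * q + t k)%N.
Proof.
move=> qM t; have lt (k : 'I_m) : (k * q + t k < M)%N.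
  apply: leq_trans qM; apply: (@leq_trans (k.+1 * q)); last by rewrite mulnC leq_mul.
  by rewrite mulSn addnC ltn_add2r.
have wM : (m <= M)%N by apply: leq_trans qM; rewrite leq_pmull.
have fI : injective (fun k => Ordinal (lt k)).
  move=> k l /(congr1 val)/= e; apply: val_inj.
  have := congr1 (divn^~ q) e; rewrite !divnMDl// !divn_small// ?addn0//.
have wI : injective (widen_ord wM) by move=> a b /(congr1 val)/= ab; exact: val_inj.
have [sg h] := perm_extends fI wI; exists sg => k.
by have := congr1 val (h k) => /= <-; rewrite -pext_ord.
Qed.

Let rho_ex (t : {ffun pos -> 'I_q}) : exists a : 'S_N * 'S_n,
  forall p, rp a (cpos p) = match p with
   | inl k => inl (k * q + t (inl k))%N | inr l => inr (l * q + t (inr l))%N end.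
Proof.
have [sg hs] := block qN (fun k => t (inl k)); have [ta ht] := block qn (fun l => t (inr l)).
by exists (sg, ta) => -[k|l] /=; rewrite ?hs ?ht.
Qed.

Let agree (t t' : {ffun pos -> 'I_q}) : {set pos} := [set p | t p == t' p]%SET.

(** Union bound over the sets of [c] positions at which [t] and [t'] agree; each set forces
    agreement for a fraction [q^-c] of the choices. *)
Let count_agree c : \sum_(t : {ffun pos -> 'I_q}) \sum_(t' : {ffun pos -> 'I_q})
    ((c <= #|agree t t'|)%N%:R : R) <= 'C(m0 + m1, c)%:R * (q%:R ^+ (m0 + m1)) ^+ 2 / q%:R ^+ c.
Proof.
have q0' : 0 < q%:R :> R by rewrite ltr0n.
have cp : #|pos| = (m0 + m1)%N by rewrite card_sum !card_ord.
pose g (B : {set pos}) (t : {ffun pos -> 'I_q}) (p : pos) (v : 'I_q) : R := ((p \in B) ==> (t p == v))%:R.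
have h1 t t' : ((c <= #|agree t t'|)%N%:R : R) <= \sum_(B : {set pos} | #|B| == c) \prod_p g B t p (t' p).
  have e : \sum_(B : {set pos} | #|B| == c) \prod_p g B t p (t' p) = 'C(#|agree t t'|, c)%:R.
    rewrite -cards_draws -sum1_card natr_sum [RHS](eq_bigl (fun B : {set pos} => (#|B| == c) && (B \subset agree t t'))); last first.
      by move=> B; rewrite inE andbC.
    rewrite big_mkcondr; apply: eq_bigr => B _; case: ifPn => BA.
      rewrite big1// => p _; rewrite /g; case: (boolP (p \in B)) => //= pB.
      by have := fintype.subsetP BA p pB; rewrite inE => ->.
    have /subsetPn[p pB pA] := BA; rewrite (bigD1 p)//= /g pB/=.
    by rewrite inE in pA; rewrite (negbTE pA) mul0r.
  rewrite e ler_nat; case: (leqP c _) => // h; by rewrite bin_gt0.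
apply: (@le_trans _ _ (\sum_(t : {ffun pos -> 'I_q}) \sum_(t' : {ffun pos -> 'I_q})
   \sum_(B : {set pos} | #|B| == c) \prod_p g B t p (t' p))).
  by apply: ler_sum => t _; apply: ler_sum => t' _; exact: h1.
have h2 t (B : {set pos}) : #|B| == c -> \sum_(t' : {ffun pos -> 'I_q}) \prod_p g B t p (t' p) = q%:R ^+ (m0 + m1) / q%:R ^+ c.
  move=> /eqP Bc; rewrite -(bigA_distr_bigA (fun p v => g B t p v)).
  have e p : \sum_v g B t p v = if p \in B then 1 else q%:R.
    rewrite /g; case: (p \in B) => /=; last by rewrite sumr_const card_ord.
    by rewrite (bigD1 (t p))//= eqxx big1 ?addr0// => v /negbTE; rewrite eq_sym => ->.
  rewrite (eq_bigr _ (fun p _ => e p)).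
  have -> : q%:R ^+ (m0 + m1) = \prod_(p : pos) (if p \in B then q%:R else q%:R : R).
    by rewrite -cp -prodr_const; apply: eq_bigr => p _; case: ifP.
  rewrite -Bc -prodr_const [X in _ / X]big_mkcond -prodf_div; apply: eq_bigr => p _.
  by case: (p \in B); rewrite ?divff ?divr1// lt0r_neq0.
rewrite le_eqVlt; apply/orP; left; apply/eqP.
under eq_bigr do rewrite exchange_big/=.
rewrite (eq_bigr (fun=> 'C(m0 + m1, c)%:R * (q%:R ^+ (m0 + m1) / q%:R ^+ c))).
  rewrite sumr_const card_ffun card_ord cp -(mulr_natl _ (q ^ _)) natrX.
  by rewrite expr2 mulrCA !mulrA.
move=> t _; rewrite (eq_bigr _ (h2 t)) sumr_const -[LHS]mulr_natl; congr (_%:R * _).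
by rewrite -cp -card_draws; apply: eq_card => B; rewrite !inE.
Qed.

(** Invariance under relabelling lets [F] be replaced by its average over the [q ^ (m0 + m1)]
    choices of one observation per block. Two of these copies sharing at most [c] observations are
    orthogonal, and the remaining pairs form a fraction of at most ['C(m0 + m1, c.+1) / q^(c+1)]. *)
Lemma Uavg_degen_bound (c : nat) (F : T -> R) : L2 Q F -> dep S0 F ->
  (forall S, (#|trace S| <= c)%N -> {ae Q, forall x, PS Q S F x = 0}) ->
  Ex Q (fun x => Uavg N n F x ^+ 2) <= 'C(m0 + m1, c.+1)%:R / q%:R ^+ c.+1 * Ex Q (fun x => F x ^+ 2).
Proof.
move=> lF dF F0; have /choice[rh hrh] := rho_ex.
pose Ft t (x : T) := F (x \o rp (rh t)).
have lFt t : L2 Q (Ft t) by exact: (L2_mp (mpc (rh t)) lF).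
pose Kq : R := #|{: {ffun pos -> 'I_q}}|%:R.
have KqE : Kq = q%:R ^+ (m0 + m1) by rewrite /Kq card_ffun card_sum !card_ord natrX.
have Kq0 : 0 < Kq by rewrite KqE exprn_gt0// ltr0n.
pose V (x : T) := Kq^-1 * \sum_t Ft t x.
have lV : L2 Q V by apply: L2Z; apply: L2_sum => t _; exact: lFt.
have UV x : Uavg N n F x = Uavg N n V x.
  rewrite /V UavgZ Uavg_sum (eq_bigr (fun=> Uavg N n F x)); last by move=> t _; exact: Uavg_inv.
  by rewrite sumr_const -(mulr_natl _ #|_|) mulKf// lt0r_neq0.
have -> : (fun x => Uavg N n F x ^+ 2) = (fun x => Uavg N n V x ^+ 2) by apply/funext => x; rewrite UV.
apply: le_trans (Uavg_sqr_le N n lV) _.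
have dFt t : dep (fun i => [exists p, rp (rh t) (cpos p) == i]) (Ft t).
  move=> x y xy; apply: dF => i /existsP[p /eqP <-]; apply: xy; apply/existsP; by exists p.
have orth t t' : (#|agree t t'| <= c)%N -> Ex Q (fun x => Ft t x * Ft t' x) = 0.
  move=> tt'; apply: (Ex_orth iQ (lFt t) (lFt t') (dFt t')).
  pose S (i : nat + nat) := [exists p, rp (rh t') (cpos p) == i]; rewrite -/S.
  (* An observation read by both copies lies in a single block, hence belongs to one argument
     position, at which [t] and [t'] agree. *)
  have tr : (#|trace (S \o rp (rh t))| <= c)%N.
    apply: leq_trans tt'; apply: subset_leq_card; apply/fintype.subsetP => p.
    rewrite !inE /= /S => /existsP[p' /eqP]; rewrite !hrh.
    case: p' p => [k|k] [l|l] //= [] e.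
      have kl : k = l.
        by apply: val_inj; have := congr1 (divn^~ q) e; rewrite !divnMDl// !divn_small// ?addn0//.
      by subst l; move/eqP: e; rewrite eqn_add2l val_eqE eq_sym.
    have kl : k = l.
      by apply: val_inj; have := congr1 (divn^~ q) e; rewrite !divnMDl// !divn_small// ?addn0//.
    by subst l; move/eqP: e; rewrite eqn_add2l val_eqE eq_sym.
  apply: (ae_imp (ae_mp (mpc (rh t)) (F0 _ tr))) => x h.
  by rewrite /Ft (PS_comp iQ S x (rpK (rh t)) (L2_meas lF)).
have lFF t t' : L1 Q (fun x => Ft t x * Ft t' x) := L2_mul (lFt t) (lFt t').
have EFt t : Ex Q (fun x => Ft t x ^+ 2) = Ex Q (fun x => F x ^+ 2).
  by rewrite [RHS](Ex_mp (mpc (rh t)))//; exact: measurable_sqr (L2_meas lF).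
have EF0 : 0 <= Ex Q (fun x => F x ^+ 2) by exact: Ex_sqr_ge0.
have -> : Ex Q (fun x => V x ^+ 2) = Kq^-1 ^+ 2 * \sum_t \sum_t' Ex Q (fun x => Ft t x * Ft t' x).
  rewrite (_ : Ex Q _ = Ex Q (fun x => Kq^-1 ^+ 2 * \sum_t \sum_t' Ft t x * Ft t' x)); last first.
    apply: Ex_eq => x; rewrite /V exprMn; congr (_ * _); rewrite expr2 mulr_suml.
    by apply: eq_bigr => t _; rewrite mulr_sumr.
  have lS t : L1 Q (fun x => \sum_t' Ft t x * Ft t' x) by apply: L1_sum => t' _; exact: lFF.
  rewrite ExZ; last by apply: L1_sum => t _; exact: lS.
  rewrite Ex_sum; last by move=> t _; exact: lS.
  by congr (_ * _); apply: eq_bigr => t _; rewrite Ex_sum.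
apply: (@le_trans _ _ (Kq^-1 ^+ 2 * (('C(m0 + m1, c.+1)%:R * (q%:R ^+ (m0 + m1)) ^+ 2 / q%:R ^+ c.+1) * Ex Q (fun x => F x ^+ 2)))).
  rewrite ler_wpM2l ?sqr_ge0//; apply: (@le_trans _ _ ((\sum_t \sum_t' ((c.+1 <= #|agree t t'|)%N%:R : R)) * Ex Q (fun x => F x ^+ 2))); last first.
    by apply: ler_wpM2r => //; exact: count_agree.
  rewrite mulr_suml; apply: ler_sum => t _; rewrite mulr_suml; apply: ler_sum => t' _.
  have [h|h] := leqP #|agree t t'| c; first by rewrite orth// mul0r.
  rewrite mul1r; apply: le_trans (ler_norm _) _.
  apply: le_trans (Ex_mul_le (lFt t) (lFt t')) _; rewrite !EFt; lra.
have qc : q%:R ^+ c.+1 != 0 :> R by rewrite expf_neq0// pnatr_eq0 -lt0n.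
rewrite -KqE le_eqVlt; apply/orP; left; apply/eqP.
by move: Kq0 qc; move: (q%:R ^+ c.+1 : R) ('C(_, _)%:R : R) (Ex Q _) => u v w K0 u0; field; rewrite u0 lt0r_neq0.
Qed.

End Decoupling.

Section Remainder.
Variables (c : nat) (H : T -> R).
Hypotheses (lH : L2 Q H) (dH : dep S0 H)
  (H0 : forall S, (#|trace S| < c)%N -> {ae Q, forall x, PS Q S H x = 0}).

(* When the terms of order below [c] vanish, inclusion-exclusion is void and the order-[c] Hoeffding term is a plain sum of projections. *)
Definition lead (x : T) : R := \sum_(B : {set pos} | #|B| == c) PS Q (cs B) H x.

Lemma L2_lead : L2 Q lead.
Proof. by apply: L2_sum => B _; exact: (PS_L2 iQ _ lH). Qed.

Lemma L2_remainder : L2 Q (fun x => H x - lead x).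
Proof. exact: L2B lH L2_lead. Qed.

Lemma dep_remainder : dep S0 (fun x => H x - lead x).
Proof.
move=> x y xy; rewrite (dH xy); congr (_ - _); apply: eq_bigr => B _.
apply: dep_PS => i /existsP[p /andP[_ pi]].
by apply: xy; apply/existsP; exists p.
Qed.

(** Conditioning on [S] kills the term of every [B] other than [trace S], since fewer than [c]
    positions survive. If [trace S] has [c] elements, its own term cancels the projection of [H]; if
    it has fewer, that projection vanishes as well. *)
Lemma degen_remainder S : (#|trace S| <= c)%N ->
  {ae Q, forall x, PS Q S (fun y => H y - lead y) x = 0}.
Proof.
move=> Sc.
have hB : {ae Q, forall x, forall B : {set pos}, PS Q S (PS Q (cs B) H) x = PS Q (predI S (cs B)) H x}.
  by apply: ae_all => B; exact: (PS_PS iQ S (cs B) (L2_L1 lH)).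
have hL : {ae Q, forall x, forall B : {set pos}, L1 Q (fun y => PS Q (cs B) H (mix S x y : T))}.
  by apply: ae_all => B; exact: (L1_mixr_ae iQ S (PS_L1 iQ (cs B) (L2_L1 lH))).
have hz : {ae Q, forall x, forall B : {set pos}, (#|B| == c) && (B != trace S) -> PS Q (predI S (cs B)) H x = 0}.
  apply: ae_all => B; have [/andP[/eqP Bc BS]|_] := boolP ((#|B| == c) && (B != trace S)); last exact: aeW.
  apply: (@ae_imp _ _ _ _ (fun x => PS Q (predI S (cs B)) H x = 0)) => //; apply: H0.
  have -> : trace (predI S (cs B)) = (trace S :&: B)%SET by apply/setP => p; rewrite !inE /= cs_cpos.
  rewrite ltn_neqAle (leq_trans _ Sc) ?andbT; last by apply: subset_leq_card; exact: finset.subsetIl.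
  apply/eqP => e; move/negP: BS; apply.
  have BI : (trace S :&: B)%SET = B.
    by apply/eqP; rewrite eqEcard finset.subsetIr e Bc leqnn.
  by rewrite eqEcard -{1}BI finset.subsetIl Bc Sc.
have hH : {ae Q, forall x, (#|trace S| < c)%N -> PS Q S H x = 0}.
  have [h|h] := boolP (#|trace S| < c)%N; last exact: aeW.
  by apply: (ae_imp (H0 h)).
have lHm := L1_mixr_ae iQ S (L2_L1 lH).
apply: (ae_imp2 lHm (ae_imp2 hH (ae_imp2 hz (ae_imp2 hB hL (fun x a b => conj a b)) (fun x a b => conj a b)) (fun x a b => conj a b))).
move=> x l1 [xH [xz [xB xL]]].
have -> : PS Q S (fun y => H y - lead y) x = PS Q S H x - \sum_(B : {set pos} | #|B| == c) PS Q S (PS Q (cs B) H) x.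
  rewrite /PS ExB//; last by apply: L1_sum => B _; exact: xL.
  by congr (_ - _); rewrite Ex_sum// => B _; exact: xL.
rewrite (eq_bigr (fun B => PS Q (predI S (cs B)) H x)) => [|B _]; last exact: xB.
have [h|h] := ltnP #|trace S| c.
  rewrite xH// big1 ?subrr// => B Bc; apply: xz; rewrite Bc/=; apply/eqP => BS.
  by rewrite -BS (eqP Bc) ltnn in h.
have Ac : #|trace S| == c by rewrite eqn_leq Sc h.
rewrite (bigD1 (trace S))//= big1 => [|B BS]; last exact: xz.
rewrite addr0 (PS_dep Q S dH) (@PS_eqS _ _ _ _ _ _ (predI S (cs (trace S)))) ?subrr// => i.
rewrite /=; case Si: (S i) => //=; apply/existsP/existsP => -[p].
  by move=> /eqP pi; exists p; rewrite pi eqxx andbT inE pi.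
by move=> /andP[_ pi]; exists p.
Qed.

End Remainder.
End UStatistic.

Section MeasurePreservingConverse.
Context {R : realType} d d' (T : measurableType d) (T' : measurableType d').
Variables (Q : probability T R) (Q' : probability T' R) (phi : T -> T').
Hypothesis mp : mpres Q Q' phi.

Lemma mp_L1 g : measurable_fun setT g -> L1 Q (fun x => g (phi x)) -> L1 Q' g.
Proof.
move=> mg /integrableP[_ lg]; apply/integrableP; split; first exact/measurable_EFinP.
rewrite (mpres_integral mp)//.
by do 2 apply: measurableT_comp => //.
Qed.

Lemma mp_L2 g : measurable_fun setT g -> L2 Q (fun x => g (phi x)) -> L2 Q' g.
Proof. by move=> mg [_ lg]; split=> //; apply: mp_L1 => //; exact: measurable_sqr. Qed.

Lemma mp_ae0 (g : T' -> R) : measurable_fun setT g -> {ae Q, forall x, g (phi x) = 0} ->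
  {ae Q', forall x, g x = 0}.
Proof.
move=> mg g0; pose A := g @^-1` [set~ 0].
have mA : measurable A.
  by rewrite -[A]setTI; apply: mg => //; apply: measurableC; exact: measurable_set1.
exists A; split => //.
case: mp => mphi <- //; case: g0 => N [mN N0 sub].
apply/eqP; rewrite eq_le measure_ge0 andbT -N0; apply: le_measure; rewrite ?inE//.
by rewrite -[X in measurable X]setTI; exact: mphi.
Qed.

End MeasurePreservingConverse.

(** * Averages over permutations and sums over sets of one or two elements *)

Section PermutationAverages.
Context {R : realType}.

Lemma card_perm_neq0 N : #|{: 'S_N}|%:R != 0 :> R.
Proof. by rewrite pnatr_eq0 -lt0n; apply/card_gt0P; exists 1%g. Qed.

Lemma perm_avg1 N (F : 'I_N -> R) (k : 'I_N) :
  #|{: 'S_N}|%:R^-1 * \sum_(sg : 'S_N) F (sg k) = N%:R^-1 * \sum_i F i.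
Proof.
have N0 : N%:R != 0 :> R by rewrite pnatr_eq0; case: N k {F} => // -[].
have c0 := card_perm_neq0 N.
have e k' : \sum_(sg : 'S_N) F (sg k') = \sum_(sg : 'S_N) F (sg k).
  have cI (a : 'I_N) : injective (fun _ : 'I_1 => a) by move=> i j _; rewrite !ord1.
  have := @sum_perm_inj R 1 _ (fun f : {ffun 'I_1 -> 'I_N} => F (f ord0)) _ _ (cI k') (cI k).
  by under eq_bigr do rewrite ffunE; under [in RHS]eq_bigr do rewrite ffunE.
have : N%:R * \sum_(sg : 'S_N) F (sg k) = #|{: 'S_N}|%:R * \sum_i F i.
  transitivity (\sum_k' \sum_(sg : 'S_N) F (sg k')).
    by rewrite (eq_bigr _ (fun k' _ => e k')) sumr_const card_ord -[RHS]mulr_natl.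
  rewrite exchange_big/= (eq_bigr (fun=> \sum_i F i)).
    by rewrite sumr_const -[LHS]mulr_natl.
  by move=> sg _; rewrite [RHS](reindex_inj (@perm_inj _ sg)).
by move=> h; apply: (mulfI N0); rewrite mulrCA h mulKf// mulrA divff// mul1r.
Qed.

(** The permutation sum is the same for all pairs of distinct positions. Summed over the [N (N - 1)]
    pairs, each permutation contributes the full off-diagonal sum. *)
Lemma perm_avg2 N (F : 'I_N -> 'I_N -> R) (k l : 'I_N) : k != l ->
  #|{: 'S_N}|%:R^-1 * \sum_(sg : 'S_N) F (sg k) (sg l) =
  (N%:R * (N%:R - 1))^-1 * \sum_i \sum_(j | j != i) F i j.
Proof.
move=> kl.
have N2 : (2 <= N)%N.
  move: kl; rewrite -val_eqE neq_ltn /= => /orP[h|h].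
    by apply: leq_ltn_trans (ltn_ord l); exact: leq_ltn_trans h.
  by apply: leq_ltn_trans (ltn_ord k); exact: leq_ltn_trans h.
have N0 : N%:R * (N%:R - 1) != 0 :> R.
  rewrite mulf_neq0 ?pnatr_eq0 -?lt0n ?(ltnW N2)//.
  by rewrite subr_eq0 eq_sym (_ : 1 = 1%:R)// eqr_nat ltn_eqF.
have c0 := card_perm_neq0 N.
have e k' l' : l' != k' -> \sum_(sg : 'S_N) F (sg k') (sg l') = \sum_(sg : 'S_N) F (sg k) (sg l).
  move=> kl'.
  have cI (a b : 'I_N) : a != b -> injective (fun i : 'I_2 => if i == ord0 then a else b).
    move=> ab i j; case: (eqVneq i ord0) => [->|i0]; case: (eqVneq j ord0) => [->|j0] //.
    - by move=> e; rewrite e eqxx in ab.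
    - by move=> e; rewrite e eqxx in ab.
    by move=> _; apply: val_inj; move: i0 j0; case: i => -[|[|?]]//= ?; case: j => -[|[|?]].
  have := @sum_perm_inj R 2 _ (fun f : {ffun 'I_2 -> 'I_N} => F (f ord0) (f ord_max)) _ _ (cI k' l' _) (cI k l kl).
  rewrite eq_sym => /(_ kl').
  by under eq_bigr do rewrite !ffunE/=; under [in RHS]eq_bigr do rewrite !ffunE/=.
have : (N%:R * (N%:R - 1)) * \sum_(sg : 'S_N) F (sg k) (sg l) = #|{: 'S_N}|%:R * \sum_i \sum_(j | j != i) F i j.
  transitivity (\sum_k' \sum_(l' | l' != k') \sum_(sg : 'S_N) F (sg k') (sg l')).
    rewrite [RHS](eq_bigr (fun=> (N%:R - 1) * \sum_(sg : 'S_N) F (sg k) (sg l))).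
      by rewrite sumr_const card_ord -[RHS]mulr_natl mulrA.
    move=> k' _; rewrite (eq_bigr _ (fun l' kl' => e k' l' kl')) sumr_const -[LHS]mulr_natl; congr (_ * _).
    have -> : N%:R - 1 = (N.-1)%:R :> R by rewrite -subn1 natrB ?(ltnW N2).
    congr (_%:R).
    by have := cardC1 k'; rewrite card_ord => <-; apply: eq_card.
  rewrite (eq_bigr (fun k' => \sum_(sg : 'S_N) \sum_(l' | l' != k') F (sg k') (sg l'))); last first.
    by move=> k' _; rewrite exchange_big.
  rewrite exchange_big/= (eq_bigr (fun=> \sum_i \sum_(j | j != i) F i j)).
    by rewrite sumr_const -[LHS]mulr_natl.
  move=> sg _; rewrite [RHS](reindex_inj (@perm_inj _ sg)); apply: eq_bigr => i _.
  rewrite [RHS](reindex_inj (@perm_inj _ sg)); apply: eq_bigl => j.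
  by rewrite (inj_eq perm_inj).
by move=> h; apply: (mulfI N0); rewrite mulrCA h mulKf// mulrA divff// mul1r.
Qed.

Lemma sum_pair_sets (T : finType) (f : {set T} -> R) :
  \sum_(p : T) \sum_(p' | p' != p) f [set p; p']%SET = 2 * \sum_(B : {set T} | #|B| == 2) f B.
Proof.
rewrite pair_big_dep/= (partition_big (fun pp : T * T => [set pp.1; pp.2]%SET) (fun B => #|B| == 2)) /=; last first.
  by move=> [p p'] /= pp; rewrite cards2 (eq_sym p) pp.
rewrite mulr_sumr; apply: eq_bigr => B /eqP B2.
have [a [b ab BE]] : exists a, exists2 b, a != b & B = [set a; b]%SET.
  by have /eqP/cards2P[a [b [ab ->]]] := B2; exists a, b.
rewrite (eq_bigr (fun=> f B)) => [|pp /andP[_ /eqP ->]//].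
rewrite sumr_const -[LHS]mulr_natl; congr (_ * _).
rewrite (_ : #|_| = #|[set (a, b); (b, a)]%SET|).
  by rewrite cards2 xpair_eqE negb_and ab.
apply: eq_card => -[p p']; rewrite !inE /= !xpair_eqE; apply/idP/idP; last first.
  move=> /orP[/andP[/eqP -> /eqP ->]|/andP[/eqP -> /eqP ->]]; rewrite unfold_in/= BE.
    by rewrite (eq_sym b) ab eqxx.
  by rewrite ab finset.setUC eqxx.
rewrite unfold_in/= => /andP[pp' /eqP e].
have : p \in B by rewrite -e !inE eqxx.
have : p' \in B by rewrite -e !inE eqxx orbT.
rewrite BE !inE => /orP[] /eqP h1 /orP[] /eqP h2; rewrite h1 h2 ?eqxx ?orbT//.
  by rewrite h1 h2 eqxx in pp'.
by rewrite h1 h2 eqxx in pp'.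
Qed.

Lemma sum_singleton_sets (T : finType) (f : {set T} -> R) :
  \sum_(B : {set T} | #|B| == 1) f B = \sum_(p : T) f [set p]%SET.
Proof.
rewrite [RHS](partition_big (fun p : T => [set p]%SET) (fun B => #|B| == 1)) /=; last first.
  by move=> p _; rewrite cards1.
apply: eq_bigr => B /cards1P[a ->]; rewrite (big_pred1 a)// => p /=.
by rewrite (inj_eq finset.set1_inj).
Qed.

End PermutationAverages.

(** * Projections of order one and two as kernels *)

Section Kernels.
Context {R : realType} {d : measure_display} {E : measurableType d}.
Variables (mu : probability E R) (Q : probability (seqspace E (nat + nat)%type) R).
Hypothesis iQ : iid_law mu Q.
Local Notation T := (seqspace E (nat + nat)%type).
Let MM : probability (E * E)%type R := (mu \x mu)%E.
Variables (m0 m1 : nat) (H : T -> R).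
Hypotheses (m00 : (0 < m0)%N) (m10 : (0 < m1)%N) (lH : L2 Q H) (dH : dep (S0 m0 m1) H)
  (symH : forall (a : 'S_m0 * 'S_m1) (x : T), H (x \o rp a : T) = H x).

Definition sel1 (a : nat + nat) : pred (nat + nat) := fun i => i == a.
Definition sel2 (a b : nat + nat) : pred (nat + nat) := fun i => (i == a) || (i == b).
(** A projection depends on one or two coordinates of a sequence. Evaluating it at a sequence
    carrying the given values there turns it into a function on [E] or on [E * E]; the filling
    elsewhere is immaterial. *)
Definition put1 (z : E) : T := fun=> z.
Definition put2 (a : nat + nat) (z : E * E) : T := fun i => if i == a then z.1 else z.2.

Definition G1 a (z : E) : R := PS Q (sel1 a) H (put1 z).
Definition G2 a b (z : E * E) : R := PS Q (sel2 a b) H (put2 a z).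

Lemma PS_one a x : PS Q (sel1 a) H x = G1 a (x a).
Proof. by apply: dep_PS => i /eqP ->. Qed.

Lemma PS_two a b x : PS Q (sel2 a b) H x = G2 a b (x a, x b).
Proof.
apply: dep_PS => i; rewrite /put2; case: (eqVneq i a) => [->//|ia].
by rewrite /sel2 (negbTE ia) => /eqP ->.
Qed.

Let measurable_put1 : measurable_fun setT put1.
Proof. by apply: measurable_seqspace => i; exact: measurable_id. Qed.

Let measurable_put2 a : measurable_fun setT (put2 a).
Proof.
apply: measurable_seqspace => i; rewrite /put2; case: (i == a); [exact: measurable_fst|exact: measurable_snd].
Qed.

Lemma L2_G1 a : L2 mu (G1 a).
Proof.
apply: (mp_L2 (mpres_coord iQ a)).
  exact: (measurableT_comp (PS_meas iQ (sel1 a) (L2_L1 lH)) measurable_put1).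
by apply: L2_eq (PS_L2 iQ (sel1 a) lH) => x; exact: PS_one.
Qed.

Lemma L2_G2 a b : a != b -> L2 MM (G2 a b).
Proof.
move=> ab; apply: (mp_L2 (mpres_pair iQ ab)).
  exact: (measurableT_comp (PS_meas iQ (sel2 a b) (L2_L1 lH)) (measurable_put2 a)).
by apply: L2_eq (PS_L2 iQ (sel2 a b) lH) => x; exact: PS_two.
Qed.

Lemma Ex_G1_sqr a : Ex mu (fun z => G1 a z ^+ 2) = Ex Q (fun x => PS Q (sel1 a) H x ^+ 2).
Proof.
rewrite (Ex_mp (mpres_coord iQ a)); last exact: measurable_sqr (L2_meas (L2_G1 a)).
by apply: Ex_eq => x; rewrite PS_one.
Qed.

Lemma Ex_G2_sqr a b : a != b -> Ex MM (fun z => G2 a b z ^+ 2) = Ex Q (fun x => PS Q (sel2 a b) H x ^+ 2).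
Proof.
move=> ab; rewrite (Ex_mp (mpres_pair iQ ab)); last exact: measurable_sqr (L2_meas (L2_G2 ab)).
by apply: Ex_eq => x; rewrite PS_two.
Qed.

Lemma Ex_G1 a : Ex mu (G1 a) = Ex Q H.
Proof.
rewrite (Ex_mp (mpres_coord iQ a)); last exact: L2_meas (L2_G1 a).
by rewrite -[RHS](Ex_PS iQ (sel1 a) (L2_L1 lH)); apply: Ex_eq => x; rewrite PS_one.
Qed.

Lemma PS_rp S (a : 'S_m0 * 'S_m1) x : PS Q S H x = PS Q (S \o rp a) H (x \o rp a : T).
Proof.
rewrite -(PS_comp iQ S x (rpK a) (L2_meas lH)).
by apply: Ex_eq => y; rewrite symH.
Qed.

Lemma PS_one_rp (a : 'S_m0 * 'S_m1) i x : PS Q (sel1 (rp a i)) H x = G1 i (x (rp a i)).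
Proof.
rewrite (PS_rp _ a) -(PS_one i (x \o rp a)); apply: PS_eqS => j.
by rewrite /sel1/= (inj_eq (can_inj (rpK a))).
Qed.

Lemma PS_two_rp (a : 'S_m0 * 'S_m1) i j x :
  PS Q (sel2 (rp a i) (rp a j)) H x = G2 i j (x (rp a i), x (rp a j)).
Proof.
rewrite (PS_rp _ a) -(PS_two i j (x \o rp a)); apply: PS_eqS => k.
by rewrite /sel2/= !(inj_eq (can_inj (rpK a))).
Qed.

Lemma PS_two_sym a b x : PS Q (sel2 a b) H x = PS Q (sel2 b a) H x.
Proof. by apply: PS_eqS => i; rewrite /sel2 orbC. Qed.

Let move1 m (k : 'I_m) : exists sg : 'S_m, pext sg 0 = k.
Proof.
have m_0 : (0 < m)%N by apply: leq_ltn_trans (ltn_ord k).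
by exists (tperm (Ordinal m_0) k); rewrite (pext_ord _ (Ordinal m_0)) tpermL.
Qed.

Let move2 m (k l : 'I_m) : k != l -> exists sg : 'S_m, pext sg 0 = k /\ pext sg 1 = l.
Proof.
move=> kl; have m2 : (2 <= m)%N.
  move: kl; rewrite -val_eqE neq_ltn /= => /orP[h|h].
    by apply: leq_ltn_trans (ltn_ord l); exact: leq_ltn_trans h.
  by apply: leq_ltn_trans (ltn_ord k); exact: leq_ltn_trans h.
have fI : injective (fun i : 'I_2 => if i == ord0 then k else l).
  move=> i j; case: (eqVneq i ord0) => [->|i0]; case: (eqVneq j ord0) => [->|j0] //.
  - by move=> e; rewrite e eqxx in kl.
  - by move=> e; rewrite e eqxx in kl.
  by move=> _; apply: val_inj; move: i0 j0; case: i => -[|[|?]]//= ?; case: j => -[|[|?]].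
have wI : injective (widen_ord m2) by move=> a b /(congr1 val)/= ab; exact: val_inj.
have [sg h] := perm_extends fI wI; exists sg; split.
  by have := pext_ord sg (widen_ord m2 ord0); rewrite h.
by have := pext_ord sg (widen_ord m2 ord_max); rewrite h.
Qed.

(** Symmetry of the kernel moves argument [k] to argument 0, so a single function serves for all
    control arguments. *)
Lemma PS_l (k : 'I_m0) x : PS Q (sel1 (inl (val k))) H x = G1 (inl 0%N) (x (inl (val k))).
Proof.
have [sg h] := move1 k; have -> : inl (val k) = rp (sg, 1%g : 'S_m1) (inl 0%N) :> nat + nat.
  by rewrite /= h.
exact: PS_one_rp.
Qed.

Lemma PS_r (l : 'I_m1) x : PS Q (sel1 (inr (val l))) H x = G1 (inr 0%N) (x (inr (val l))).
Proof.
have [sg h] := move1 l; have -> : inr (val l) = rp (1%g : 'S_m0, sg) (inr 0%N) :> nat + nat.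
  by rewrite /= h.
exact: PS_one_rp.
Qed.

Lemma PS_ll (k l : 'I_m0) x : k != l -> PS Q (sel2 (inl (val k)) (inl (val l))) H x =
  G2 (inl 0%N) (inl 1%N) (x (inl (val k)), x (inl (val l))).
Proof.
move=> kl; have [sg [h0 h1]] := move2 kl; pose a := (sg, 1%g : 'S_m1).
have -> : inl (val k) = rp a (inl 0%N) :> nat + nat by rewrite /= h0.
have -> : inl (val l) = rp a (inl 1%N) :> nat + nat by rewrite /= h1.
exact: PS_two_rp.
Qed.

Lemma PS_rr (k l : 'I_m1) x : k != l -> PS Q (sel2 (inr (val k)) (inr (val l))) H x =
  G2 (inr 0%N) (inr 1%N) (x (inr (val k)), x (inr (val l))).
Proof.
move=> kl; have [sg [h0 h1]] := move2 kl; pose a := (1%g : 'S_m0, sg).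
have -> : inr (val k) = rp a (inr 0%N) :> nat + nat by rewrite /= h0.
have -> : inr (val l) = rp a (inr 1%N) :> nat + nat by rewrite /= h1.
exact: PS_two_rp.
Qed.

Lemma PS_rl (l : 'I_m1) (k : 'I_m0) x : PS Q (sel2 (inr (val l)) (inl (val k))) H x =
  G2 (inr 0%N) (inl 0%N) (x (inr (val l)), x (inl (val k))).
Proof.
have [sg h0] := move1 k; have [ta h1] := move1 l; pose a := (sg, ta).
have -> : inl (val k) = rp a (inl 0%N) :> nat + nat by rewrite /= h0.
have -> : inr (val l) = rp a (inr 0%N) :> nat + nat by rewrite /= h1.
exact: PS_two_rp.
Qed.

(** Both sides are one conditional expectation at one sequence, read with its two arguments in
    either order; the symmetry therefore holds at every point, given two genuine control
    arguments. *)
Lemma G2_sym_l y z : (1 < m0)%N -> G2 (inl 0%N) (inl 1%N) (y, z) = G2 (inl 0%N) (inl 1%N) (z, y).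
Proof.
move=> h; pose k0 : 'I_m0 := Ordinal m00; pose k1 : 'I_m0 := Ordinal h.
pose x : T := fun i => if i == inl 0%N then y else z.
have e1 := @PS_ll k0 k1 x isT; have e2 := @PS_ll k1 k0 x isT.
by rewrite -[LHS]e1 -[RHS]e2 PS_two_sym.
Qed.

Lemma G2_sym_r y z : (1 < m1)%N -> G2 (inr 0%N) (inr 1%N) (y, z) = G2 (inr 0%N) (inr 1%N) (z, y).
Proof.
move=> h; pose k0 : 'I_m1 := Ordinal m10; pose k1 : 'I_m1 := Ordinal h.
pose x : T := fun i => if i == inr 0%N then y else z.
have e1 := @PS_rr k0 k1 x isT; have e2 := @PS_rr k1 k0 x isT.
by rewrite -[LHS]e1 -[RHS]e2 PS_two_sym.
Qed.

Section Averages.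
Variables (N n : nat).

Let UavgE (F : T -> R) (x : T) : Uavg N n F x = (#|{: 'S_N}|%:R : R)^-1 * \sum_(sg : 'S_N)
  ((#|{: 'S_n}|%:R : R)^-1 * \sum_(ta : 'S_n) F (x \o rp (sg, ta) : T)).
Proof.
rewrite /Uavg card_prod natrM invfM -mulr_sumr mulrA; congr (_ * _).
by rewrite pair_bigA; apply: eq_bigr => -[].
Qed.

Let avg_cst n' (c : R) : #|{: 'S_n'}|%:R^-1 * \sum_(ta : 'S_n') c = c.
Proof. by rewrite sumr_const -[X in _ * X]mulr_natl mulKf// card_perm_neq0. Qed.

Lemma Uavg_l (g : E -> R) (k : 'I_N) (x : T) : Uavg N n (fun y : T => g (y (inl (val k)))) x = N%:R^-1 * \sum_(i < N) g (x (inl (val i))).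
Proof.
rewrite UavgE -(perm_avg1 (fun i : 'I_N => g (x (inl (val i)))) k); congr (_ * _); apply: eq_bigr => sg _.
by rewrite -[RHS](avg_cst n); congr (_ * _); apply: eq_bigr => ta _; rewrite /= pext_ord.
Qed.

Lemma Uavg_r (g : E -> R) (k : 'I_n) (x : T) : Uavg N n (fun y : T => g (y (inr (val k)))) x = n%:R^-1 * \sum_(i < n) g (x (inr (val i))).
Proof.
rewrite UavgE -[RHS](avg_cst N); congr (_ * _); apply: eq_bigr => sg _.
rewrite -(perm_avg1 (fun i : 'I_n => g (x (inr (val i)))) k); congr (_ * _); apply: eq_bigr => ta _.
by rewrite /= pext_ord.
Qed.

Lemma Uavg_ll (g : E * E -> R) (k l : 'I_N) (x : T) : k != l -> Uavg N n (fun y : T => g (y (inl (val k)), y (inl (val l)))) x =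
  (N%:R * (N%:R - 1))^-1 * \sum_(i < N) \sum_(j < N | j != i) g (x (inl (val i)), x (inl (val j))).
Proof.
move=> kl; rewrite UavgE -(perm_avg2 (fun i j : 'I_N => g (x (inl (val i)), x (inl (val j)))) kl).
congr (_ * _); apply: eq_bigr => sg _.
by rewrite -[RHS](avg_cst n); congr (_ * _); apply: eq_bigr => ta _; rewrite /= !pext_ord.
Qed.

Lemma Uavg_rr (g : E * E -> R) (k l : 'I_n) (x : T) : k != l -> Uavg N n (fun y : T => g (y (inr (val k)), y (inr (val l)))) x =
  (n%:R * (n%:R - 1))^-1 * \sum_(i < n) \sum_(j < n | j != i) g (x (inr (val i)), x (inr (val j))).
Proof.
move=> kl; rewrite UavgE -[RHS](avg_cst N); congr (_ * _); apply: eq_bigr => sg _.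
rewrite -(perm_avg2 (fun i j : 'I_n => g (x (inr (val i)), x (inr (val j)))) kl); congr (_ * _); apply: eq_bigr => ta _.
by rewrite /= !pext_ord.
Qed.

Lemma Uavg_rl (g : E * E -> R) (l : 'I_n) (k : 'I_N) (x : T) : Uavg N n (fun y : T => g (y (inr (val l)), y (inl (val k)))) x =
  (N%:R * n%:R)^-1 * \sum_(i < N) \sum_(j < n) g (x (inr (val j)), x (inl (val i))).
Proof.
rewrite UavgE invfM -[RHS]mulrA [in RHS]mulr_sumr.
rewrite -(perm_avg1 (fun i : 'I_N => n%:R^-1 * \sum_(j < n) g (x (inr (val j)), x (inl (val i)))) k).
congr (_ * _); apply: eq_bigr => sg _.
rewrite -(perm_avg1 (fun j : 'I_n => g (x (inr (val j)), x (inl (val (sg k))))) l).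
by congr (_ * _); apply: eq_bigr => ta _; rewrite /= !pext_ord.
Qed.

Hypotheses (mN : (m0 <= N)%N) (mn : (m1 <= n)%N).

Lemma Uavg_lead1 x : Uavg N n (@lead _ _ _ Q m0 m1 1 H) x =
  m0%:R / N%:R * \sum_(i < N) G1 (inl 0%N) (x (inl (val i))) +
  m1%:R / n%:R * \sum_(i < n) G1 (inr 0%N) (x (inr (val i))).
Proof.
have csE (p : pos m0 m1) y : PS Q (cs [set p]%SET) H y = PS Q (sel1 (cpos p)) H y.
  apply: PS_eqS => i; apply/existsP/eqP => [[p' /andP[]]|->]; last by exists p; rewrite !inE !eqxx.
  by rewrite inE => /eqP -> /eqP ->.
have leadE y : @lead _ _ _ Q m0 m1 1 H y =
    \sum_(k < m0) G1 (inl 0%N) (y (inl (val k))) + \sum_(l < m1) G1 (inr 0%N) (y (inr (val l))).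
  rewrite /lead sum_singleton_sets big_sumType/=; congr (_ + _); apply: eq_bigr => k _.
    by rewrite csE PS_l.
  by rewrite csE PS_r.
rewrite (Uavg_eq N n leadE) UavgD !Uavg_sum; congr (_ + _).
  rewrite (eq_bigr (fun=> N%:R^-1 * \sum_(i < N) G1 (inl 0%N) (x (inl (val i))))).
    by rewrite sumr_const card_ord -[LHS]mulr_natl mulrA.
  by move=> k _; exact: (Uavg_l (G1 (inl 0%N)) (widen_ord mN k)).
rewrite (eq_bigr (fun=> n%:R^-1 * \sum_(i < n) G1 (inr 0%N) (x (inr (val i))))).
  by rewrite sumr_const card_ord -[LHS]mulr_natl mulrA.
by move=> k _; exact: (Uavg_r (G1 (inr 0%N)) (widen_ord mn k)).
Qed.

(** The coefficients count pairs of argument positions by type, and each pair averages to the mean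
    of its kernel over pairs of distinct observations. *)
Lemma Uavg_lead2 x : Uavg N n (@lead _ _ _ Q m0 m1 2 H) x =
  m0%:R * (m0%:R - 1) / 2 * ((N%:R * (N%:R - 1))^-1 *
     \sum_(i < N) \sum_(j < N | j != i) G2 (inl 0%N) (inl 1%N) (x (inl (val i)), x (inl (val j)))) +
  m0%:R * m1%:R * ((N%:R * n%:R)^-1 *
     \sum_(i < N) \sum_(j < n) G2 (inr 0%N) (inl 0%N) (x (inr (val j)), x (inl (val i)))) +
  m1%:R * (m1%:R - 1) / 2 * ((n%:R * (n%:R - 1))^-1 *
     \sum_(i < n) \sum_(j < n | j != i) G2 (inr 0%N) (inr 1%N) (x (inr (val i)), x (inr (val j)))).
Proof.
have csE (p p' : pos m0 m1) y : PS Q (cs [set p; p']%SET) H y = PS Q (sel2 (cpos p) (cpos p')) H y.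
  apply: PS_eqS => i; apply/existsP/orP => [[q /andP[]]|[/eqP ->|/eqP ->]].
  - by rewrite !inE => /orP[/eqP -> /eqP ->|/eqP -> /eqP ->]; [left|right].
  - by exists p; rewrite !inE !eqxx.
  - by exists p'; rewrite !inE !eqxx orbT.
have leadE y : @lead _ _ _ Q m0 m1 2 H y = 2^-1 *
    ((\sum_(k < m0) \sum_(l < m0 | l != k) G2 (inl 0%N) (inl 1%N) (y (inl (val k)), y (inl (val l))) +
      \sum_(k < m0) \sum_(l < m1) G2 (inr 0%N) (inl 0%N) (y (inr (val l)), y (inl (val k)))) +
     (\sum_(l < m1) \sum_(k < m0) G2 (inr 0%N) (inl 0%N) (y (inr (val l)), y (inl (val k))) +
      \sum_(k < m1) \sum_(l < m1 | l != k) G2 (inr 0%N) (inr 1%N) (y (inr (val k)), y (inr (val l))))).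
  have := sum_pair_sets (fun B : {set pos m0 m1} => PS Q (cs B) H y); rewrite -/(@lead _ _ _ Q m0 m1 2 H y) => e.
  rewrite -[LHS](mulKf (_ : 2 != 0 :> R))// -e; congr (_ * _).
  rewrite big_sumType/=; congr (_ + _); rewrite -big_split; apply: eq_bigr => k _ /=.
    rewrite big_sumType/=; congr (_ + _); first by apply: eq_bigr => l lk; rewrite csE PS_ll// eq_sym.
    by apply: eq_bigr => l _; rewrite csE PS_two_sym PS_rl.
  rewrite big_sumType/=; congr (_ + _); first by apply: eq_bigr => l _; rewrite csE PS_rl.
  by apply: eq_bigr => l lk; rewrite csE PS_rr// eq_sym.
rewrite (Uavg_eq N n leadE) UavgZ !UavgD !Uavg_sum.
have cardne m (k : 'I_m) (c : R) : \sum_(l < m | l != k) c = (m%:R - 1) * c.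
  rewrite sumr_const -[LHS]mulr_natl; congr (_ * _).
  have -> : m%:R - 1 = (m.-1)%:R :> R by rewrite -subn1 natrB// (leq_ltn_trans _ (ltn_ord k)).
  by congr (_%:R); have := cardC1 k; rewrite card_ord => <-; apply: eq_card.
set ll := (N%:R * (N%:R - 1))^-1 * _; set rl := (N%:R * n%:R)^-1 * _; set rr := (n%:R * (n%:R - 1))^-1 * _.
rewrite (eq_bigr (fun=> (m0%:R - 1) * ll)); last first.
  move=> k _; rewrite Uavg_sum -(cardne m0 k); apply: eq_bigr => l lk.
  by apply: (@Uavg_ll (G2 (inl 0%N) (inl 1%N)) (widen_ord mN k) (widen_ord mN l)); rewrite eq_sym.
rewrite [X in _ + X + _](eq_bigr (fun=> m1%:R * rl)); last first.
  move=> k _; rewrite Uavg_sum (eq_bigr (fun=> rl)); first by rewrite sumr_const card_ord -[LHS]mulr_natl.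
  by move=> l _; exact: (@Uavg_rl (G2 (inr 0%N) (inl 0%N)) (widen_ord mn l) (widen_ord mN k)).
rewrite [X in _ + (X + _)](eq_bigr (fun=> m0%:R * rl)); last first.
  move=> l _; rewrite Uavg_sum (eq_bigr (fun=> rl)); first by rewrite sumr_const card_ord -[LHS]mulr_natl.
  by move=> k _; exact: (@Uavg_rl (G2 (inr 0%N) (inl 0%N)) (widen_ord mn l) (widen_ord mN k)).
rewrite [X in _ + (_ + X)](eq_bigr (fun=> (m1%:R - 1) * rr)); last first.
  move=> k _; rewrite Uavg_sum -(cardne m1 k); apply: eq_bigr => l lk.
  by apply: (@Uavg_rr (G2 (inr 0%N) (inr 1%N)) (widen_ord mn k) (widen_ord mn l)); rewrite eq_sym.
rewrite !sumr_const !card_ord -!(mulr_natl (_ * _)); field; by [].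
Qed.

End Averages.
End Kernels.

(* the pooled sequence: the n cases first, then the controls *)
Definition pin (n i : nat) : nat + nat := if (i < n)%N then inr i else inl (i - n)%N.

Lemma pinK n : cancel (pin n) (fun a => match a with inr l => l | inl k => (n + k)%N end).
Proof. by move=> i; rewrite /pin; case: ltnP => // ni; rewrite subnKC. Qed.

Lemma pin_lt n i : (i < n)%N -> pin n i = inr i. Proof. by rewrite /pin => ->. Qed.

Lemma pin_add n i : pin n (n + i) = inl i.
Proof. by rewrite /pin ltnNge leq_addr/= addKn. Qed.

Section Sums.
Context {R : realType}.

Lemma offdiag_sum N (G : nat -> nat -> R) : (forall i j, G i j = G j i) ->
  \sum_(i < N) \sum_(j < N | j != i) G i j = 2 * \sum_(q' < N) \sum_(q < q') G q q'.
Proof.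
move=> Gs; pose F i j := if i == j then 0 else G i j.
have -> : \sum_(i < N) \sum_(j < N | j != i) G i j = \sum_(i < N) \sum_(j < N) F i j.
  apply: eq_bigr => i _; rewrite big_mkcond; apply: eq_bigr => j _ /=.
  by rewrite /F eq_sym val_eqE; case: (i == j).
rewrite sum_sym_pairs.
- rewrite -[LHS]mulr_natl; congr (_ * _); apply: eq_bigr => i _; apply: eq_bigr => j _.
  by rewrite /F ltn_eqF.
- by move=> i j; rewrite /F eq_sym Gs.
- by move=> i; rewrite /F eqxx.
Qed.

Lemma sum_widen M N (F : nat -> R) : (N <= M)%N -> \sum_(i < M) (i < N)%N%:R * F i = \sum_(i < N) F i.
Proof.
move=> NM; rewrite (big_ord_widen M _ NM) [RHS]big_mkcond; apply: eq_bigr => i _.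
by case: (i < N)%N; rewrite ?mul1r ?mul0r.
Qed.

Lemma sum_between M N N' : (N <= M)%N -> (N' <= M)%N ->
  \sum_(i < M) `|(i < N)%N%:R - (i < N')%N%:R| = `|N%:R - N'%:R| :> R.
Proof.
wlog h : N N' / (N <= N')%N.
  move=> hw NM NM'; have [h|/ltnW h] := leqP N N'; first exact: hw.
  by rewrite distrC -hw//; apply: eq_bigr => i _; rewrite distrC.
move=> NM NM'; rewrite distrC ger0_norm; last by rewrite subr_ge0 ler_nat.
have e K : (K <= M)%N -> \sum_(i < M) ((i < K)%N%:R : R) = K%:R.
  move=> KM; have := sum_widen (fun=> 1) KM; under eq_bigr do rewrite mulr1; move=> ->.
  by rewrite sumr_const card_ord.
rewrite -(e _ NM) -(e _ NM') -sumrB; apply: eq_bigr => i _.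
rewrite distrC ger0_norm// subr_ge0 ler_nat; case: (ltnP i N) => // iN.
by rewrite (leq_trans iN h).
Qed.

(** [b] and [b'] tell whether a coordinate enters the exact and the limiting form, and [al] is the
    exact normalisation; the two sources of discrepancy are separated. *)
Lemma indicator_gap (b b' : bool) (al : R) : (al * b%:R - b'%:R) ^+ 2 <= 2 * (al - 1) ^+ 2 + 2 * `|b%:R - b'%:R|.
Proof.
have h : 0 <= (al - 1) ^+ 2 by exact: sqr_ge0.
case: b; case: b' => /=; rewrite ?mulr1 ?mulr0 ?subrr ?subr0 ?sub0r ?normr0 ?normrN ?normr1 ?sqrrN ?expr1n//; try lra.
- rewrite -subr_ge0 (_ : _ - _ = (al - 2) ^+ 2); last by ring.
  exact: sqr_ge0.
Qed.

End Sums.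

(** * The leading term against its limiting form *)

Section Comparison.
Context {R : realType} {d : measure_display} {E : measurableType d}.
Variables (mu : probability E R) (Q : probability (seqspace E (nat + nat)%type) R).
Variable (Q1 : probability (seqspace E nat) R).
Hypotheses (iQ : iid_law mu Q) (iQ1 : iid_law mu Q1).
Local Notation T := (seqspace E (nat + nat)%type).
Local Notation T1 := (seqspace E nat).
Let MM : probability (E * E)%type R := (mu \x mu)%E.
Variables (m0 m1 : nat) (H : T -> R).
Hypotheses (m00 : (0 < m0)%N) (m10 : (0 < m1)%N) (lH : L2 Q H) (dH : dep (S0 m0 m1) H)
  (symH : forall (a : 'S_m0 * 'S_m1) (x : T), H (x \o rp a : T) = H x).
Variable s : nat.
Hypothesis s0 : (0 < s)%N.

Lemma mpres_pin n : mpres Q Q1 (fun x : T => x \o pin n : T1).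
Proof. exact: (mpres_reindex iQ iQ1 (@pinK n)). Qed.

Local Notation G2 := (G2 Q H).
Local Notation G1 := (G1 Q H).

(* [wl] and [wq] carry the factors [1 / s] coming from the sample-size ratio [N / n], which tends to [s] *)
Definition wl (t : bool) (z : E) : R :=
  if t then m1%:R * G1 (inr 0%N) z else m0%:R / s%:R * G1 (inl 0%N) z.

Definition wq (t t' : bool) (z : E * E) : R :=
  if t then
    if t' then m1%:R * (m1%:R - 1) * G2 (inr 0%N) (inr 1%N) z
    else m0%:R * m1%:R / s%:R * G2 (inr 0%N) (inl 0%N) z
  else
    if t' then m0%:R * m1%:R / s%:R * G2 (inr 0%N) (inl 0%N) (z.2, z.1)
    else m0%:R * (m0%:R - 1) / s%:R ^+ 2 * G2 (inl 0%N) (inl 1%N) z.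

Lemma L2_wl t : L2 mu (wl t).
Proof. by case: t; apply: L2Z; exact: (L2_G1 iQ lH). Qed.

Lemma L2_wq t t' : L2 MM (wq t t').
Proof.
case: t; case: t'; apply: L2Z; [exact: (L2_G2 iQ lH)|exact: (L2_G2 iQ lH)| |exact: (L2_G2 iQ lH)].
by apply: (L2_mp (mpres_swap mu) (f := G2 (inr 0%N) (inl 0%N))); exact: (L2_G2 iQ lH).
Qed.

Let mm1 m : (0 < m)%N -> (m <= 1)%N -> m%:R * (m%:R - 1) = 0 :> R.
Proof. by case: m => [|[|]]// _ _; rewrite subrr mulr0. Qed.

Lemma wq_sym t t' y z : wq t t' (y, z) = wq t' t (z, y).
Proof.
case: t; case: t' => //=.
- have [h|h] := ltnP 1 m1; first by rewrite (G2_sym_r iQ m10 lH symH).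
  by rewrite mm1// !mul0r.
- have [h|h] := ltnP 1 m0; first by rewrite (G2_sym_l iQ m00 lH symH).
  by rewrite mm1// !mul0r.
Qed.

(** The ratio of the exact normalisation at sizes [N] and [n] to the limiting one built into [wq];
    it tends to 1 in the regime considered. *)
Definition al2 (N n : nat) (t t' : bool) : R :=
  if t then if t' then n%:R ^+ 2 * (n%:R * (n%:R - 1))^-1 else s%:R * n%:R / N%:R
  else if t' then s%:R * n%:R / N%:R else s%:R ^+ 2 * n%:R ^+ 2 * (N%:R * (N%:R - 1))^-1.

Definition al1 (N n : nat) (t : bool) : R := if t then 1 else s%:R * n%:R / N%:R.

Lemma Uavg_lead2_pform N n x : (m0 <= N)%N -> (m1 <= n)%N ->
  n%:R * Uavg N n (@lead _ _ _ Q m0 m1 2 H) x =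
  n%:R^-1 * pform (fun q q' z => al2 N n (q < n)%N (q' < n)%N * wq (q < n)%N (q' < n)%N z) (n + N) (x \o pin n).
Proof.
move=> mN mn; have n0 : n%:R != 0 :> R by rewrite pnatr_eq0 -lt0n (leq_trans m10).
have s0' : s%:R != 0 :> R by rewrite pnatr_eq0 -lt0n.
rewrite (Uavg_lead2 iQ lH symH)// /pform big_split_ord/=.
have -> : \sum_(i < n) \sum_(q < i) al2 N n (q < n)%N (i < n)%N * wq (q < n)%N (i < n)%N (x (pin n q), x (pin n i)) =
    al2 N n true true * (m1%:R * (m1%:R - 1) * \sum_(i < n) \sum_(q < i) G2 (inr 0%N) (inr 1%N) (x (inr (val q)), x (inr (val i)))).
  rewrite !mulr_sumr; apply: eq_bigr => i _; rewrite !mulr_sumr; apply: eq_bigr => q _.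
  have qn := ltn_trans (ltn_ord q) (ltn_ord i).
  by rewrite !pin_lt// qn ltn_ord/=.
have -> : \sum_(i < N) \sum_(q < n + i) al2 N n (q < n)%N (n + i < n)%N * wq (q < n)%N (n + i < n)%N (x (pin n q), x (pin n (n + i))) =
    al2 N n true false * (m0%:R * m1%:R / s%:R * \sum_(i < N) \sum_(j < n) G2 (inr 0%N) (inl 0%N) (x (inr (val j)), x (inl (val i)))) +
    al2 N n false false * (m0%:R * (m0%:R - 1) / s%:R ^+ 2 * \sum_(i < N) \sum_(q < i) G2 (inl 0%N) (inl 1%N) (x (inl (val q)), x (inl (val i)))).
  rewrite !mulr_sumr -big_split; apply: eq_bigr => i _; rewrite big_split_ord/= !mulr_sumr.
  have ni : (n + i < n)%N = false by rewrite ltnNge leq_addr.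
  congr (_ + _); apply: eq_bigr => q _.
    by rewrite ni pin_add pin_lt// ltn_ord.
  have nq : (n + q < n)%N = false by rewrite ltnNge leq_addr.
  by rewrite ni nq !pin_add.
have hl : m0%:R * (m0%:R - 1) * \sum_(i < N) \sum_(j < N | j != i) G2 (inl 0%N) (inl 1%N) (x (inl (val i)), x (inl (val j))) =
    m0%:R * (m0%:R - 1) * (2 * \sum_(i < N) \sum_(q < i) G2 (inl 0%N) (inl 1%N) (x (inl (val q)), x (inl (val i)))).
  (* For [m0 = 1] there is no symmetry to invoke, but the coefficient [m0 * (m0 - 1)] vanishes. *)
  have [h|h] := ltnP 1 m0; last first.
    by rewrite mm1// !mul0r.
  congr (_ * _); apply: (offdiag_sum N (G := fun i j => G2 (inl 0%N) (inl 1%N) (x (inl i), x (inl j)))).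
  by move=> i j; rewrite (G2_sym_l iQ m00 lH symH).
have hr : m1%:R * (m1%:R - 1) * \sum_(i < n) \sum_(j < n | j != i) G2 (inr 0%N) (inr 1%N) (x (inr (val i)), x (inr (val j))) =
    m1%:R * (m1%:R - 1) * (2 * \sum_(i < n) \sum_(q < i) G2 (inr 0%N) (inr 1%N) (x (inr (val q)), x (inr (val i)))).
  have [h|h] := ltnP 1 m1; last first.
    by rewrite mm1// !mul0r.
  congr (_ * _); apply: (offdiag_sum n (G := fun i j => G2 (inr 0%N) (inr 1%N) (x (inr i), x (inr j)))).
  by move=> i j; rewrite (G2_sym_r iQ m10 lH symH).
move: hl hr; rewrite /al2 !invfM.
set sl := \sum_(i < N) \sum_(j < N | j != i) _; set sr := \sum_(i < n) \sum_(j < n | j != i) _.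
set tl := \sum_(i < N) \sum_(q < i) _; set tr := \sum_(i < n) \sum_(q < i) _; set tm := \sum_(i < N) \sum_(j < n) _.
move: (N%:R^-1 : R) ((N%:R - 1)^-1 : R) ((n%:R - 1)^-1 : R) => u v w hl hr.
have -> : m0%:R * (m0%:R - 1) / 2 * (u * v * sl) = (u * v) / 2 * (m0%:R * (m0%:R - 1) * sl) by field.
have -> : m1%:R * (m1%:R - 1) / 2 * (n%:R^-1 * w * sr) = (n%:R^-1 * w) / 2 * (m1%:R * (m1%:R - 1) * sr) by field.
rewrite hl hr; field; rewrite s0' n0//.
Qed.

Lemma Uavg_lead1_sum N n x : (m0 <= N)%N -> (m1 <= n)%N ->
  Num.sqrt n%:R * Uavg N n (@lead _ _ _ Q m0 m1 1 H) x =
  (Num.sqrt n%:R)^-1 * \sum_(q < n + N) al1 N n (q < n)%N * wl (q < n)%N (x (pin n q)).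
Proof.
move=> mN mn; have n0 : 0 < n%:R :> R by rewrite ltr0n (leq_trans m10).
have s0' : s%:R != 0 :> R by rewrite pnatr_eq0 -lt0n.
have r0 : Num.sqrt n%:R != 0 :> R by rewrite sqrtr_eq0 -ltNge.
rewrite (Uavg_lead1 iQ lH symH)// big_split_ord/=.
have -> : \sum_(i < n) al1 N n (i < n)%N * wl (i < n)%N (x (pin n i)) = m1%:R * \sum_(i < n) G1 (inr 0%N) (x (inr (val i))).
  by rewrite mulr_sumr; apply: eq_bigr => i _; rewrite ltn_ord/= pin_lt// mul1r.
have -> : \sum_(i < N) al1 N n (n + i < n)%N * wl (n + i < n)%N (x (pin n (n + i))) =
    s%:R * n%:R / N%:R * (m0%:R / s%:R) * \sum_(i < N) G1 (inl 0%N) (x (inl (val i))).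
  rewrite mulr_sumr; apply: eq_bigr => i _; rewrite ltnNge leq_addr/= pin_add; ring.
have e : Num.sqrt n%:R / n%:R = (Num.sqrt n%:R)^-1 :> R.
  by rewrite -{2}(sqr_sqrtr (ltW n0)) expr2 invfM mulrA divff ?mul1r.
rewrite mulrDr -mulrA mulrDr addrC; congr (_ + _).
  by rewrite !mulrA (mulrAC _ m1%:R) e.
rewrite !mulrA; congr (_ * _); rewrite -e.
by move: (N%:R^-1 : R) => u; field; rewrite s0' lt0r_neq0.
Qed.

Section Degenerate.
Hypothesis H0 : forall a, {ae Q, forall x, PS Q (sel1 a) H x = 0}.

Lemma degenZ (c : R) (k : E * E -> R) : L2 MM k -> degen mu k -> degen mu (fun z => c * k z).
Proof.
move=> lk [k1 k2]; have lks := L2_mp (mpres_swap mu) lk; split.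
  apply: (ae_imp2 (L1_ae_section (L2_L1 lk)) k1) => z lz e.
  by rewrite (ExZ _ lz) e mulr0.
apply: (ae_imp2 (L1_ae_section (L2_L1 lks)) k2) => z lz e.
by rewrite (ExZ _ lz) e mulr0.
Qed.

(** Conditioning the order-two projection on one of its coordinates gives the order-one projection,
    which vanishes. *)
Lemma degen_G2 a b : a != b -> degen mu (G2 a b).
Proof.
move=> ab; have lk := L2_G2 iQ lH ab; have lks := L2_mp (mpres_swap mu) lk.
have mk := L2_meas lk.
have h c : {ae Q, forall x, PS Q (sel1 c) (PS Q (sel2 a b) H) x = PS Q (predI (sel1 c) (sel2 a b)) H x}.
  exact: (PS_PS iQ _ _ (L2_L1 lH)).
split.
  apply: (mp_ae0 (mpres_coord iQ a) (meas_fubini (L2_L1 lk))).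
  apply: (ae_imp2 (h a) (H0 a)) => x e1 e2.
  rewrite -e2 -[RHS](_ : PS Q (predI (sel1 a) (sel2 a b)) H x = _); last first.
    by apply: PS_eqS => i; rewrite /sel1 /sel2/=; case: (i == a).
  rewrite -e1 /PS (Ex_mp (mpres_coord iQ b)); last by apply: (measurableT_comp mk); exact: measurable_pair1.
  apply: Ex_eq => y; rewrite -[RHS]/(PS Q (sel2 a b) H (mix (sel1 a) x y)) PS_two.
  by rewrite /mix /sel1 eqxx eq_sym (negbTE ab).
apply: (mp_ae0 (mpres_coord iQ b) (meas_fubini (L2_L1 lks))).
apply: (ae_imp2 (h b) (H0 b)) => x e1 e2.
rewrite -e2 -[RHS](_ : PS Q (predI (sel1 b) (sel2 a b)) H x = _); last first.
  by apply: PS_eqS => i; rewrite /sel1 /sel2/=; case: (i == b); rewrite ?orbT.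
rewrite -e1 /PS (Ex_mp (mpres_coord iQ a)); last by apply: (measurableT_comp mk); exact: measurable_pair2.
apply: Ex_eq => y; rewrite -[RHS]/(PS Q (sel2 a b) H (mix (sel1 b) x y)) PS_two.
by rewrite /mix /sel1 eqxx (negbTE ab).
Qed.

Lemma degen_wq t t' : degen mu (wq t t').
Proof.
case: t; case: t'; rewrite /wq.
- by apply: degenZ; [exact: (L2_G2 iQ lH)|exact: degen_G2].
- by apply: degenZ; [exact: (L2_G2 iQ lH)|exact: degen_G2].
- have l : L2 MM (fun z => G2 (inr 0%N) (inl 0%N) (z.2, z.1)).
    by apply: (L2_mp (mpres_swap mu) (f := G2 (inr 0%N) (inl 0%N))); exact: (L2_G2 iQ lH).
  apply: (degenZ _ l).
  by have [h1 h2] := @degen_G2 (inr 0%N) (inl 0%N) isT; exact: (conj h2 h1).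
- by apply: degenZ; [exact: (L2_G2 iQ lH)|exact: degen_G2].
Qed.

(** Exact and limiting forms are written over a common range of [M] coordinates. As [q < q'], the
    larger index decides whether a pair is present, so the difference is one degenerate form with
    coefficients [be], whose pairs are orthogonal. *)
Lemma lead2_chaos_dist N n W : (m0 <= N)%N -> (m1 <= n)%N -> (forall t t', Ex MM (fun z => wq t t' z ^+ 2) <= W) ->
  Ex Q (fun x => (n%:R * Uavg N n (@lead _ _ _ Q m0 m1 2 H) x - chaos s wq n (x \o pin n)) ^+ 2) <=
  W * ((n + N + s.+1 * n)%:R / n%:R) *
    (2 * (\sum_t \sum_t' (al2 N n t t' - 1) ^+ 2) * ((n + N + s.+1 * n)%:R / n%:R) + 2 * `|N%:R / n%:R - s%:R|).
Proof.
move=> mN mn wW; have n0 : 0 < n%:R :> R by rewrite ltr0n (leq_trans m10).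
have W0 : 0 <= W by exact: le_trans (Ex_sqr_ge0 _ _) (wW true true).
set M := (n + N + s.+1 * n)%N; set A := \sum_t _.
pose be q q' : R := al2 N n (q < n)%N (q' < n)%N * (q' < n + N)%N%:R - (q' < s.+1 * n)%N%:R.
pose kd q q' z := be q q' * wq (q < n)%N (q' < n)%N z.
have ld q q' : L2 MM (kd q q') by apply: L2Z; exact: L2_wq.
have dd q q' : degen mu (kd q q') by apply: degenZ; [exact: L2_wq|exact: degen_wq].
have M1 : (n + N <= M)%N by exact: leq_addr.
have M2 : (s.+1 * n <= M)%N by exact: leq_addl.
have -> : Ex Q (fun x => (n%:R * Uavg N n (@lead _ _ _ Q m0 m1 2 H) x - chaos s wq n (x \o pin n)) ^+ 2) =
    n%:R^-1 ^+ 2 * Ex Q1 (fun y => pform kd M y ^+ 2).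
  have lp := L2_pform iQ1 ld M.
  rewrite -ExZ; last exact: L2_sqr.
  rewrite [RHS](Ex_mp (mpres_pin n)); last exact: (L1_meas (L1Z _ (L2_sqr lp))).
  apply: Ex_eq => x; rewrite Uavg_lead2_pform// /chaos -mulrBr exprMn; congr (_ * _ ^+ 2).
  rewrite /pform.
  rewrite -(sum_widen (fun q' => \sum_(q < q') al2 N n (q < n)%N (q' < n)%N * wq (q < n)%N (q' < n)%N (x (pin n q), x (pin n q'))) M1).
  rewrite -(sum_widen (fun q' => \sum_(q < q') wq (q < n)%N (q' < n)%N (x (pin n q), x (pin n q'))) M2).
  rewrite -sumrB; apply: eq_bigr => q' _; rewrite !mulr_sumr -sumrB; apply: eq_bigr => q _.
  by rewrite /kd /be /=; ring.
rewrite (Ex_pform_sqr iQ1 ld dd).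
have A0 : 0 <= A by apply: sumr_ge0 => t _; apply: sumr_ge0 => t' _; exact: sqr_ge0.
have aA t t' : (al2 N n t t' - 1) ^+ 2 <= A.
  rewrite /A (bigD1 t)//= (bigD1 t')//= -addrA lerDl addr_ge0//.
    by apply: sumr_ge0 => i _; exact: sqr_ge0.
  by apply: sumr_ge0 => i _; apply: sumr_ge0 => i' _; exact: sqr_ge0.
pose gap q' : R := `|(q' < n + N)%N%:R - (q' < s.+1 * n)%N%:R|.
have bnd q q' : Ex MM (fun z => kd q q' z ^+ 2) <= W * (2 * A + 2 * gap q').
  rewrite (_ : Ex MM _ = be q q' ^+ 2 * Ex MM (fun z => wq (q < n)%N (q' < n)%N z ^+ 2)); last first.
    rewrite -ExZ; last exact: L2_sqr (L2_wq _ _).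
    by apply: Ex_eq => z; rewrite exprMn.
  rewrite mulrC; apply: ler_pM => //; [exact: Ex_sqr_ge0|exact: sqr_ge0|].
  apply: le_trans (indicator_gap _ _ _) _ => //.
  by rewrite lerD2r; apply: ler_wpM2l => //; exact: aA.
apply: (@le_trans _ _ (n%:R^-1 ^+ 2 * (\sum_(q' < M) M%:R * (W * (2 * A + 2 * gap q'))))).
  rewrite ler_wpM2l ?sqr_ge0//; apply: ler_sum => q' _.
  have g0 : 0 <= W * (2 * A + 2 * gap q') by apply: mulr_ge0 => //; apply: addr_ge0; apply: mulr_ge0 => //; exact: normr_ge0.
  apply: (@le_trans _ _ (\sum_(q < q') W * (2 * A + 2 * gap q'))); first by apply: ler_sum => q _; exact: bnd.
  by rewrite sumr_const card_ord -[leLHS]mulr_natl ler_wpM2r// ler_nat ltnW.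
rewrite -mulr_sumr -mulr_sumr big_split/= -!mulr_sumr sum_between// sumr_const card_ord.
have -> : `|(n + N)%:R - (s.+1 * n)%:R| = n%:R * `|N%:R / n%:R - s%:R| :> R.
  rewrite -[X in X * `| _ |](ger0_norm (ltW n0)) -normrM; congr `| _ |.
  by rewrite mulSn natrD natrD natrM; field; rewrite lt0r_neq0.
rewrite -(mulr_natr A M) le_eqVlt; apply/orP; left; apply/eqP.
by move: (`|_|) (M%:R : R) => u v; field; rewrite lt0r_neq0.
Qed.

End Degenerate.

Section Linear.
Hypothesis EH : Ex Q H = 0.

Lemma Ex_wl t : Ex mu (wl t) = 0.
Proof.
by case: t; rewrite ExZ ?(Ex_G1 iQ lH) ?EH ?mulr0//; exact: L2_L1 (L2_G1 iQ lH _).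
Qed.

Definition linf n (y : T1) : R := (Num.sqrt n%:R)^-1 * \sum_(q < s.+1 * n) wl (q < n)%N (y q).

Lemma Ex_linear_sqr (c : nat -> R) (v : nat -> E -> R) M : (forall q, L2 mu (v q)) -> (forall q, Ex mu (v q) = 0) ->
  Ex Q1 (fun y => (\sum_(q < M) c q * v q (y q)) ^+ 2) = \sum_(q < M) c q ^+ 2 * Ex mu (fun z => v q z ^+ 2).
Proof.
move=> lv v0; pose F (q : nat) (y : T1) := v q (y q).
have lF q : L2 Q1 (F q) by exact: (L2_mp (mpres_coord iQ1 q) (lv q)).
have orth i j : i != j -> Ex Q1 (fun y => F i y * F j y) = 0.
  move=> ij; rewrite (Ex_indep iQ1 (g := v j) (r := j)) ?v0 ?mulr0//.
  - exact: L2_L1.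
  - exact: L2_L1.
  - exact: (L2_mul (lF i) (lF j)).
  - by move=> x y xy; rewrite /F xy.
have h := @Ex_sqr_orth _ _ _ Q1 nat (iota 0 M) c F (iota_uniq 0 M) (fun j _ => lF j) (fun i j _ _ => orth i j).
have e (V : nmodType) (G : nat -> V) : \sum_(q < M) G q = \sum_(q <- iota 0 M) G q.
  by rewrite -(big_mkord xpredT G) /index_iota subn0.
rewrite (e _ (fun q => c q ^+ 2 * Ex mu (fun z => v q z ^+ 2))); transitivity (\sum_(q <- iota 0 M) c q ^+ 2 * Ex Q1 (fun x => F q x ^+ 2)).
  by rewrite -h; apply: Ex_eq => y; rewrite (e _ (fun q => c q * v q (y q))).
apply: eq_bigr => q _; congr (_ * _); rewrite (Ex_mp (mpres_coord iQ1 q))//.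
exact: measurable_sqr (L2_meas (lv q)).
Qed.

Lemma lead1_linf_dist N n W : (m0 <= N)%N -> (m1 <= n)%N -> (forall t, Ex mu (fun z => wl t z ^+ 2) <= W) ->
  Ex Q (fun x => (Num.sqrt n%:R * Uavg N n (@lead _ _ _ Q m0 m1 1 H) x - linf n (x \o pin n)) ^+ 2) <=
  W * (2 * (\sum_t (al1 N n t - 1) ^+ 2) * ((n + N + s.+1 * n)%:R / n%:R) + 2 * `|N%:R / n%:R - s%:R|).
Proof.
move=> mN mn wW; have n0 : 0 < n%:R :> R by rewrite ltr0n (leq_trans m10).
have W0 : 0 <= W by exact: le_trans (Ex_sqr_ge0 _ _) (wW true).
set M := (n + N + s.+1 * n)%N; set A := \sum_t _.
pose be q : R := al1 N n (q < n)%N * (q < n + N)%N%:R - (q < s.+1 * n)%N%:R.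
have M1 : (n + N <= M)%N by exact: leq_addr.
have M2 : (s.+1 * n <= M)%N by exact: leq_addl.
have lv (q : nat) : L2 mu (wl (q < n)%N) by exact: L2_wl.
have -> : Ex Q (fun x => (Num.sqrt n%:R * Uavg N n (@lead _ _ _ Q m0 m1 1 H) x - linf n (x \o pin n)) ^+ 2) =
    n%:R^-1 * Ex Q1 (fun y => (\sum_(q < M) be q * wl (q < n)%N (y q)) ^+ 2).
  have lp : L2 Q1 (fun y : T1 => \sum_(q < M) be q * wl (q < n)%N (y q)).
    by apply: L2_sum => q _; apply: L2Z; exact: (L2_mp (mpres_coord iQ1 q) (lv q)).
  rewrite -ExZ; last exact: L2_sqr.
  rewrite [RHS](Ex_mp (mpres_pin n)); last exact: (L1_meas (L1Z _ (L2_sqr lp))).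
  apply: Ex_eq => x; rewrite Uavg_lead1_sum// /linf -mulrBr exprMn exprVn sqr_sqrtr ?(ltW n0)//; congr (_ * _ ^+ 2).
  rewrite -(sum_widen (fun q => al1 N n (q < n)%N * wl (q < n)%N (x (pin n q))) M1).
  rewrite -(sum_widen (fun q => wl (q < n)%N (x (pin n q))) M2).
  by rewrite -sumrB; apply: eq_bigr => q _; rewrite /be /=; ring.
rewrite (Ex_linear_sqr be M lv (fun q => Ex_wl _)).
have A0 : 0 <= A by apply: sumr_ge0 => t _; exact: sqr_ge0.
have aA t : (al1 N n t - 1) ^+ 2 <= A.
  by rewrite /A (bigD1 t)//= lerDl; apply: sumr_ge0 => i _; exact: sqr_ge0.
pose gap q' : R := `|(q' < n + N)%N%:R - (q' < s.+1 * n)%N%:R|.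
apply: (@le_trans _ _ (n%:R^-1 * (\sum_(q < M) W * (2 * A + 2 * gap q)))).
  rewrite ler_wpM2l ?invr_ge0//; apply: ler_sum => q _.
  rewrite mulrC; apply: ler_pM => //; [exact: Ex_sqr_ge0|exact: sqr_ge0|].
  apply: le_trans (indicator_gap _ _ _) _ => //.
  by rewrite lerD2r; apply: ler_wpM2l => //; exact: aA.
rewrite -mulr_sumr big_split/= -!mulr_sumr sum_between// sumr_const card_ord.
have -> : `|(n + N)%:R - (s.+1 * n)%:R| = n%:R * `|N%:R / n%:R - s%:R| :> R.
  rewrite -[X in X * `| _ |](ger0_norm (ltW n0)) -normrM; congr `| _ |.
  by rewrite mulSn natrD natrD natrM; field; rewrite lt0r_neq0.
rewrite -(mulr_natr A M) le_eqVlt; apply/orP; left; apply/eqP.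
by move: (`|_|) (M%:R : R) => u v; field; rewrite lt0r_neq0.
Qed.

End Linear.

End Comparison.

(** * Limits along sample-size sequences *)

Section Regime.
Context {R : realType}.
Variables (N n : nat -> nat) (s : nat).
Hypotheses (s1 : (1 < s)%N) (noo : ((n k)%:R : R) @[k --> \oo] --> +oo)
  (Ns : ((N k)%:R / (n k)%:R : R) @[k --> \oo] --> (s%:R : R)).

Lemma regime_ge K : \forall k \near \oo, (K <= n k)%N.
Proof.
move/cvgryPge: noo => /(_ K%:R); apply: filterS => k; by rewrite ler_nat.
Qed.

Lemma regime_inv : ((n k)%:R^-1 : R) @[k --> \oo] --> (0 : R).
Proof.
apply/cvgrPdist_le => e e0; near=> k; rewrite sub0r normrN ger0_norm ?invr_ge0//.
have h : e^-1 <= (n k)%:R by near: k; move/cvgryPge: noo => /(_ e^-1).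
rewrite -[leRHS]invrK lef_pV2 ?posrE ?invr_gt0//.
by apply: lt_le_trans h; rewrite invr_gt0.
Unshelve. all: by end_near. Qed.

Lemma regime_le : \forall k \near \oo, (n k <= N k)%N.
Proof.
move/cvgrPdist_le: Ns => /(_ 1 ltr01) h; have h1 := regime_ge 1.
near=> k; have n0 : 0 < (n k)%:R :> R by rewrite ltr0n; near: k.
have : `|s%:R - (N k)%:R / (n k)%:R| <= 1 :> R by near: k.
rewrite ler_norml => /andP[_ h2]; rewrite -(ler_nat R).
have s2 : 2 <= s%:R :> R by rewrite ler_nat.
have : 1 <= (N k)%:R / (n k)%:R :> R by lra.
by rewrite ler_pdivlMr// mul1r.
Unshelve. all: by end_near. Qed.

Let s0 : s%:R != 0 :> R. Proof. by rewrite pnatr_eq0 -lt0n ltnW. Qed.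

Let inv1 : ((1 - (n k)%:R^-1)^-1 : R) @[k --> \oo] --> (1 : R).
Proof.
rewrite -[X in _ --> X]invr1; apply: cvgV; first exact: oner_neq0.
by rewrite -[X in _ --> X](subr0 1); apply: cvgB; [exact: cvg_cst|exact: regime_inv].
Qed.

Let invu : ((((N k)%:R / (n k)%:R)^-1) : R) @[k --> \oo] --> (s%:R^-1 : R).
Proof. by apply: cvgV. Qed.

Lemma al1_cvg t : al1 (R := R) s (N k) (n k) t @[k --> \oo] --> (1 : R).
Proof.
case: t; first exact: cvg_cst.
have -> : (fun k => al1 (R := R) s (N k) (n k) false) = (fun k => s%:R * ((N k)%:R / (n k)%:R)^-1).
  by apply/funext => k; rewrite /al1 invf_div mulrA.
by rewrite -[X in _ --> X](mulfV s0); apply: cvgM; [exact: cvg_cst|].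
Qed.

Lemma al2_cvg t t' : al2 (R := R) s (N k) (n k) t t' @[k --> \oo] --> (1 : R).
Proof.
have n1 := regime_ge 1.
have mixed : (s%:R * (n k)%:R / (N k)%:R : R) @[k --> \oo] --> (1 : R) := al1_cvg false.
case: t; case: t' => //=.
  apply: cvg_trans inv1; apply: near_eq_cvg; near=> k.
  have n0 : (n k)%:R != 0 :> R by rewrite pnatr_eq0 -lt0n; near: k.
  rewrite /al2 (_ : 1 - (n k)%:R^-1 = ((n k)%:R - 1) / (n k)%:R); last by field.
  by rewrite invf_div invfM expr2 mulrA mulfK.
have lim : (s%:R ^+ 2 * (((N k)%:R / (n k)%:R)^-1 * ((N k)%:R / (n k)%:R - (n k)%:R^-1)^-1) : R) @[k --> \oo] --> (1 : R).
  rewrite -[X in _ --> X](_ : s%:R ^+ 2 * (s%:R^-1 * (s%:R - 0)^-1) = 1); last by rewrite subr0; field.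
  apply: cvgM; [exact: cvg_cst|apply: cvgM => //].
  by apply: cvgV; [rewrite subr0|apply: cvgB => //; exact: regime_inv].
apply: cvg_trans lim; apply: near_eq_cvg; near=> k.
have n0 : (n k)%:R != 0 :> R by rewrite pnatr_eq0 -lt0n; near: k.
rewrite /al2 (_ : (N k)%:R / (n k)%:R - (n k)%:R^-1 = ((N k)%:R - 1) / (n k)%:R); last by field.
by rewrite !invf_div invfM; ring.
Unshelve. all: by end_near. Qed.

Lemma total_cvg : ((n k + N k + s.+1 * n k)%:R / (n k)%:R : R) @[k --> \oo] --> (1 + s%:R + s.+1%:R : R).
Proof.
have n1 := regime_ge 1.
have lim : (1 + (N k)%:R / (n k)%:R + s.+1%:R : R) @[k --> \oo] --> (1 + s%:R + s.+1%:R : R).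
  by apply: cvgD; [apply: cvgD => //; exact: cvg_cst|exact: cvg_cst].
apply: cvg_trans lim; apply: near_eq_cvg; near=> k.
have n0 : (n k)%:R != 0 :> R by rewrite pnatr_eq0 -lt0n; near: k.
rewrite (natrD _ (n k + N k)%N) (natrD _ (n k)) natrM; move: (s.+1%:R : R) => a; by field.
Unshelve. all: by end_near. Qed.

Lemma ratio_dist_cvg : (`|(N k)%:R / (n k)%:R - s%:R| : R) @[k --> \oo] --> (0 : R).
Proof.
rewrite -[X in _ --> X](@normr0 _ R); apply: cvg_norm.
by rewrite -[X in _ --> X](subrr s%:R); apply: cvgB => //; exact: cvg_cst.
Qed.

(** Passing from [m] to [m + 1] multiplies the ratio by [(N - m) / (s n - m)], which tends to 1. *)
Lemma binomial_ratio m : ('C(N k, m)%:R / 'C(s * n k, m)%:R : R) @[k --> \oo] --> (1 : R).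
Proof.
elim: m => [|m ih].
  under eq_fun do rewrite !bin0 divr1; exact: cvg_cst.
have hn := regime_ge (m.+1); have hN := regime_le.
have sinv : s%:R * s%:R^-1 = 1 :> R by rewrite mulfV.
have lim : ('C(N k, m)%:R / 'C(s * n k, m)%:R * (((N k)%:R / (n k)%:R - m%:R * (n k)%:R^-1) / (s%:R - m%:R * (n k)%:R^-1)) : R)
    @[k --> \oo] --> (1 : R).
  rewrite -[X in _ --> X](_ : 1 * ((s%:R - m%:R * 0) / (s%:R - m%:R * 0)) = 1); last first.
    by rewrite mulr0 subr0 sinv mulr1.
  have mv : (m%:R * (n k)%:R^-1 : R) @[k --> \oo] --> (m%:R * 0 : R).
    by apply: cvgM; [exact: cvg_cst|exact: regime_inv].
  apply: cvgM => //; apply: cvgM; first by apply: cvgB.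
  by apply: cvgV; [rewrite mulr0 subr0|apply: cvgB => //; exact: cvg_cst].
apply: cvg_trans lim; apply: near_eq_cvg; near=> k.
have nk : (m < n k)%N by near: k.
have nN : (n k <= N k)%N by near: k.
have mN : (m < N k)%N by apply: leq_trans nN.
have msn : (m < s * n k)%N by apply: leq_trans nk _; rewrite leq_pmull// ltnW.
have n0 : (n k)%:R != 0 :> R by rewrite pnatr_eq0 -lt0n (leq_trans _ nk).
have e a : (m <= a)%N -> 'C(a, m.+1)%:R = (a%:R - m%:R) * 'C(a, m)%:R / m.+1%:R :> R.
  move=> ma; have m0 : m.+1%:R != 0 :> R by rewrite pnatr_eq0.
  apply: (mulfI m0); rewrite -natrM mul_bin_left natrM natrB// [RHS]mulrC divfK//.
have b0 : 'C(s * n k, m)%:R != 0 :> R by rewrite pnatr_eq0 -lt0n bin_gt0 ltnW.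
have sm : s%:R * (n k)%:R - m%:R != 0 :> R by rewrite -(natrM R s (n k)) -(natrB _ (ltnW msn)) pnatr_eq0 -lt0n subn_gt0.
rewrite (e _ (ltnW mN)) (e _ (ltnW msn)) natrM.
have m0 : m.+1%:R != 0 :> R by rewrite pnatr_eq0.
move: b0 m0 sm; move: ('C(s * n k, m)%:R : R) (m.+1%:R : R) ('C(N k, m)%:R : R) => b c a b0 c0 sm.
have e2 : s%:R - m%:R * (n k)%:R^-1 = (s%:R * (n k)%:R - m%:R) / (n k)%:R :> R by field.
rewrite e2; field; rewrite n0 b0 sm c0//.
Unshelve. all: by end_near. Qed.

End Regime.

(** * Slutsky's lemma in mean square *)

Section Slutsky.
Context {R : realType} {d : measure_display} {T : measurableType d}.
Variables (Q : probability T R) (X Y : nat -> T -> R) (C : R).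
Hypotheses (lX : forall k, L2 Q (X k)) (lY : forall k, L2 Q (Y k))
  (YC : \forall k \near \oo, Ex Q (fun w => Y k w ^+ 2) <= C)
  (XY : Ex Q (fun w => (X k w - Y k w) ^+ 2) @[k --> \oo] --> 0).

Lemma slutsky f (l : R) : cb f -> Ex Q (fun w => f (Y k w)) @[k --> \oo] --> l ->
  Ex Q (fun w => f (X k w)) @[k --> \oo] --> l.
Proof.
move=> cf fl; apply/cvgrPdist_le => e e0.
have e4 : 0 < e / 4 by rewrite divr_gt0.
(* A common second moment bound for [Y k] and, once [X k] is within distance 1 in mean square, for
   [X k] too. *)
pose C' := 2 * `|C| + 2.
have C'0 : 0 <= C' by rewrite addr_ge0// mulr_ge0.
have [g [g1 [g2 [M [tc hg]]]]] := TC_dense cf C'0 e4.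
have M0 := TC_ge0 tc.
have M1 : 0 < M + 1 by rewrite ltr_wpDl.
(* The bound 1 serves the second moment of [X k]; the other one makes [4 * M] times the square root
   of [e1] at most [e / 4]. *)
pose e1 := Num.min 1 ((e / (16 * (M + 1))) ^+ 2).
have e10 : 0 < e1 by rewrite lt_min ltr01 exprn_gt0// divr_gt0// mulr_gt0.
move/cvgrPdist_le: XY => /(_ e1 e10) XYe.
move/cvgrPdist_le: fl => /(_ (e / 4) e4) fle.
near=> k.
have h1 : Ex Q (fun w => Y k w ^+ 2) <= C by near: k.
have h2 : Ex Q (fun w => (X k w - Y k w) ^+ 2) <= e1.
  have : `|0 - Ex Q (fun w => (X k w - Y k w) ^+ 2)| <= e1 by near: k.
  by rewrite sub0r normrN ger0_norm//; exact: Ex_sqr_ge0.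
have h3 : `|l - Ex Q (fun w => f (Y k w))| <= e / 4 by near: k.
have lD := L2B (lX k) (lY k).
have YC' : Ex Q (fun w => Y k w ^+ 2) <= C'.
  by apply: (le_trans h1); rewrite /C'; have := ler_norm C; have := normr_ge0 C; lra.
have XC' : Ex Q (fun w => X k w ^+ 2) <= C'.
  rewrite (_ : Ex Q _ = Ex Q (fun w => ((X k w - Y k w) + Y k w) ^+ 2)); last first.
    by apply: Ex_eq => w; rewrite subrK.
  apply: le_trans (Ex_sqrD_le lD (lY k)) _.
  have : e1 <= 1 by rewrite ge_min lexx.
  by rewrite /C'; have := ler_norm C; lra.
have a1 := hg _ _ Q (X k) (lX k) XC'; have a2 := hg _ _ Q (Y k) (lY k) YC'.
have lg (Z : T -> R) : L2 Q Z -> L1 Q (fun w => g (Z w)).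
  by move=> lZ; apply: L1_eq (L1_TC Q 0 tc (L2_meas lZ)) => x; rewrite add0r.
have a3 : `|Ex Q (fun w => g (X k w)) - Ex Q (fun w => g (Y k w))| <= e / 4.
  rewrite -ExB; [|exact: lg..].
  apply: le_trans (Ex_abs (L1B (lg _ (lX k)) (lg _ (lY k)))) _.
  apply: (@le_trans _ _ (Ex Q (fun x => 4 * M * `|X k x - Y k x|))).
    apply: Ex_le; [exact: (L1_norm (L1B (lg _ (lX k)) (lg _ (lY k))))|exact/L1Z/L1_norm/L2_L1|].
    move=> x; have := TC_lip (Y k x) (X k x - Y k x) tc.
    by rewrite addrCA subrr addr0.
  rewrite ExZ; last exact/L1_norm/L2_L1.
  apply: (@le_trans _ _ (4 * M * (e / (16 * (M + 1))))).
    apply: ler_wpM2l; first exact: mulr_ge0.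
    apply: le_trans (Ex_norm_le_sqrt lD) _.
    have p0 : 0 <= e / (16 * (M + 1)) by rewrite divr_ge0 ?mulr_ge0 ?(ltW M1)// ltW.
    rewrite -[leRHS](ger0_norm p0) -sqrtr_sqr ler_sqrt ?sqr_ge0//.
    by apply: (le_trans h2); rewrite ge_min lexx orbT.
  have -> : 4 * M * (e / (16 * (M + 1))) = e / 4 * (M / (M + 1)) by field; rewrite lt0r_neq0.
  rewrite ler_piMr ?divr_ge0 ?(ltW e0)// ler_pdivrMr// mul1r; lra.
move: a1 a2 a3 h3; rewrite !ler_norml => /andP[? ?] /andP[? ?] /andP[? ?] /andP[? ?].
by apply/andP; split; lra.
Unshelve. all: by end_near. Qed.

End Slutsky.

Section UStatisticLimit.
Context {R : realType} {d : measure_display} {E : measurableType d}.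
Variables (mu : probability E R) (Q : probability (seqspace E (nat + nat)%type) R).
Hypotheses (iQ : iid_law mu Q).
Local Notation T := (seqspace E (nat + nat)%type).
Variables (m0 m1 : nat) (H : T -> R).
Hypotheses (m00 : (0 < m0)%N) (m10 : (0 < m1)%N) (lH : L2 Q H) (dH : dep (S0 m0 m1) H).
Variables (N n : nat -> nat) (s : nat).
Hypotheses (s1 : (1 < s)%N) (noo : ((n k)%:R : R) @[k --> \oo] --> +oo)
  (Ns : ((N k)%:R / (n k)%:R : R) @[k --> \oo] --> (s%:R : R)).
Variables (c : nat) (a : nat -> R).
Hypothesis (aE : forall k, a k ^+ 2 = (n k)%:R ^+ c).
Hypothesis (H0 : forall S, (#|trace m0 m1 S| < c)%N -> {ae Q, forall x, PS Q S H x = 0}).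

(** [a k ^+ 2] is [n^c], one power of [n] less than what [Uavg_degen_bound] gains with [q] of order
    [n]. *)
Lemma remainder_cvg : Ex Q (fun x => (a k * Uavg (N k) (n k) (fun y => H y - @lead _ _ _ Q m0 m1 c H y) x) ^+ 2)
  @[k --> \oo] --> (0 : R).
Proof.
pose F y := H y - @lead _ _ _ Q m0 m1 c H y.
have lF : L2 Q F := L2_remainder iQ m0 m1 c lH.
pose m := (m0 + m1)%N; have m_gt0 : (0 < m)%N by rewrite addn_gt0 m00.
pose K : R := 'C(m, c.+1)%:R * (2 * m%:R) ^+ c.+1 * Ex Q (fun x => F x ^+ 2).
have lim : (K * (n k)%:R^-1 : R) @[k --> \oo] --> (0 : R).
  rewrite -[X in _ --> X](mulr0 K); apply: cvgM; [exact: cvg_cst|exact: regime_inv].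
have nm := regime_ge noo m; have nN := regime_le s1 noo Ns.
apply: (squeeze_cvgr _ (cvg_cst 0) lim); near=> k.
rewrite Ex_sqr_ge0/=.
have mk : (m <= n k)%N by near: k.
have nk : (n k <= N k)%N by near: k.
(* The largest block length for which the blocks of all [m0 + m1] arguments fit into [n k] indices;
   it satisfies [n k <= 2 * m * q]. *)
pose q := (n k %/ m)%N.
have q0 : (0 < q)%N by rewrite divn_gt0.
have qm : (q * m <= n k)%N by exact: leq_trunc_div.
have qN : (q * m0 <= N k)%N by apply: leq_trans nk; apply: leq_trans qm; rewrite leq_mul2l leq_addr orbT.
have qn : (q * m1 <= n k)%N by apply: leq_trans qm; rewrite leq_mul2l leq_addl orbT.
have h := Uavg_degen_bound iQ q0 qN qn lF (dep_remainder Q c dH) (degen_remainder iQ lH dH H0).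
have n0 : 0 < (n k)%:R :> R by rewrite ltr0n (leq_trans m_gt0).
have q0' : 0 < q%:R :> R by rewrite ltr0n.
have nq : (n k)%:R <= 2 * m%:R * q%:R :> R.
  rewrite -!natrM ler_nat (divn_eq (n k) m) -/q.
  have h1 : (n k %% m < m)%N by rewrite ltn_mod.
  have h2 : (m <= q * m)%N by rewrite leq_pmull.
  by rewrite -mulnA mul2n -addnn (mulnC m) leq_add2l (leq_trans (ltnW h1)).
rewrite (_ : Ex Q _ = (n k)%:R ^+ c * Ex Q (fun x => Uavg (N k) (n k) F x ^+ 2)); last first.
  rewrite -aE -ExZ; last exact: L2_sqr (L2_Uavg iQ (N k) (n k) lF).
  by apply: Ex_eq => x; rewrite exprMn.
have nc0 : 0 <= (n k)%:R ^+ c :> R by rewrite exprn_ge0.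
apply: le_trans (ler_wpM2l nc0 h) _; rewrite /K.
have EF0 : 0 <= Ex Q (fun x => F x ^+ 2) by exact: Ex_sqr_ge0.
rewrite [leLHS]mulrA [leRHS]mulrAC; apply: ler_wpM2r => //.
rewrite mulrCA -[leRHS]mulrA; apply: ler_wpM2l => //.
rewrite ler_pdivrMr ?exprn_gt0// mulrAC -exprMn ler_pdivlMr// -exprSr.
by rewrite lerXn2r ?nnegrE// ?mulr_ge0.
Unshelve. all: by end_near. Qed.

Variables (Y : nat -> T -> R) (C : R).
Hypotheses (lY : forall k, L2 Q (Y k)) (YC : \forall k \near \oo, Ex Q (fun w => Y k w ^+ 2) <= C)
  (leadY : Ex Q (fun x => (a k * Uavg (N k) (n k) (@lead _ _ _ Q m0 m1 c H) x - Y k x) ^+ 2) @[k --> \oo] --> (0 : R)).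

Let r k : R := 'C(N k, m0)%:R / 'C(s * n k, m0)%:R.
Let X k x := r k * (a k * Uavg (N k) (n k) H x).

Lemma L2_scaled k : L2 Q (X k).
Proof. exact: (L2Z _ (L2Z _ (L2_Uavg iQ (N k) (n k) lH))). Qed.

(** [X - Y] consists of the Hoeffding remainder, the error of the leading term and [(r - 1) Y]; the
    last vanishes because the second moment of [Y] stays bounded. *)
Lemma scaled_cvg : Ex Q (fun x => (X k x - Y k x) ^+ 2) @[k --> \oo] --> (0 : R).
Proof.
pose F y := H y - @lead _ _ _ Q m0 m1 c H y.
have lF : L2 Q F := L2_remainder iQ m0 m1 c lH.
have lL : L2 Q (@lead _ _ _ Q m0 m1 c H) := L2_lead iQ m0 m1 c lH.
pose D1 k x := a k * Uavg (N k) (n k) F x.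
pose D2 k x := a k * Uavg (N k) (n k) (@lead _ _ _ Q m0 m1 c H) x - Y k x.
have lD1 k : L2 Q (D1 k) by exact: (L2Z _ (L2_Uavg iQ (N k) (n k) lF)).
have lD2 k : L2 Q (D2 k) by exact: (L2B (L2Z _ (L2_Uavg iQ (N k) (n k) lL)) (lY k)).
have rc : r k @[k --> \oo] --> (1 : R) := binomial_ratio s1 noo Ns m0.
have XE k x : X k x - Y k x = r k * (D1 k x + D2 k x) + (r k - 1) * Y k x.
  rewrite /X /D1 /D2 (Uavg_eq (N k) (n k) (F := H) (G := fun y => F y + @lead _ _ _ Q m0 m1 c H y)).
    by rewrite UavgD; ring.
  by move=> y; rewrite subrK.
have lim : (2 * (r k ^+ 2 * (2 * Ex Q (fun x => D1 k x ^+ 2) + 2 * Ex Q (fun x => D2 k x ^+ 2))) +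
   2 * ((r k - 1) ^+ 2 * C) : R) @[k --> \oo] --> (0 : R).
  rewrite -[X in _ --> X](_ : 2 * (1 ^+ 2 * (2 * 0 + 2 * 0)) + 2 * ((1 - 1) ^+ 2 * C) = 0); last first.
    by rewrite subrr expr0n/= !(mulr0, mul0r) !addr0 mulr0 mulr0.
  apply: cvgD.
    apply: cvgM; [exact: cvg_cst|apply: cvgM].
      by rewrite !expr2; under eq_fun do rewrite expr2; apply: cvgM.
    by apply: cvgD; apply: cvgM => //; [exact: cvg_cst|exact: remainder_cvg|exact: cvg_cst].
  apply: cvgM; [exact: cvg_cst|apply: cvgM; last exact: cvg_cst].
  have h1 : r k - 1 @[k --> \oo] --> (1 - 1 : R) by apply: cvgB => //; exact: cvg_cst.
  by rewrite !expr2; under eq_fun do rewrite expr2; apply: cvgM.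
apply: (squeeze_cvgr _ (cvg_cst 0) lim); near=> k.
rewrite Ex_sqr_ge0/=.
rewrite (_ : Ex Q _ = Ex Q (fun x => (r k * (D1 k x + D2 k x) + (r k - 1) * Y k x) ^+ 2)); last first.
  by apply: Ex_eq => x; rewrite XE.
have l12 := L2D (lD1 k) (lD2 k).
apply: le_trans (Ex_sqrD_le (L2Z _ l12) (L2Z _ (lY k))) _.
have eZ (b : R) (Z : T -> R) : L2 Q Z -> Ex Q (fun x => (b * Z x) ^+ 2) = b ^+ 2 * Ex Q (fun x => Z x ^+ 2).
  by move=> lZ; rewrite -ExZ; [apply: Ex_eq => x; rewrite exprMn|exact: L2_sqr].
rewrite (eZ (r k) _ l12) (eZ (r k - 1) _ (lY k)); apply: lerD; apply: ler_wpM2l => //; apply: ler_wpM2l; rewrite ?sqr_ge0//.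
  exact: Ex_sqrD_le.
by near: k.
Unshelve. all: by end_near. Qed.

Lemma scaled_weak f (l : R) : cb f -> Ex Q (fun w => f (Y k w)) @[k --> \oo] --> l ->
  Ex Q (fun w => f (X k w)) @[k --> \oo] --> l.
Proof. by move=> cf; apply: (slutsky L2_scaled lY YC scaled_cvg cf). Qed.

End UStatisticLimit.

(** * Gaussian limit of the linear form *)

Section LinearLimit.
Context {R : realType} {d : measure_display} {E : measurableType d}.
Variables (mu : probability E R) (Q1 : probability (seqspace E nat) R).
Hypothesis iQ1 : iid_law mu Q1.
Local Notation T1 := (seqspace E nat).
Variables (s : nat) (wl : bool -> E -> R) (V : bool -> R).
Hypotheses (lw : forall t, L2 mu (wl t)) (w0 : forall t, Ex mu (wl t) = 0)
  (VE : forall t, Ex mu (fun z => wl t z ^+ 2) = V t).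

Definition linear_form n (y : T1) : R := (Num.sqrt n%:R)^-1 * \sum_(q < s.+1 * n) wl (q < n)%N (y q).
Local Notation linf := linear_form.

Let V0 t : 0 <= V t. Proof. by rewrite -VE; exact: Ex_sqr_ge0. Qed.

Let sumbool (F : bool -> R) n : \sum_(q < s.+1 * n) F (q < n)%N = n%:R * F true + (s * n)%:R * F false.
Proof.
rewrite mulSn big_split_ord/=; congr (_ + _).
  rewrite (eq_bigr (fun=> F true)) => [|i _]; last by rewrite ltn_ord.
  by rewrite sumr_const card_ord -[LHS]mulr_natl.
rewrite (eq_bigr (fun=> F false)) => [|i _]; last by rewrite ltnNge leq_addr.
by rewrite sumr_const card_ord -[LHS]mulr_natl.
Qed.

Lemma L2_linf n : L2 Q1 (linf n).
Proof. by apply: L2Z; apply: L2_sum => q _; exact: (L2_mp (mpres_coord iQ1 q) (lw _)). Qed.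

Lemma Ex_linf_sqr n : (0 < n)%N -> Ex Q1 (fun y => linf n y ^+ 2) = V true + s%:R * V false.
Proof.
move=> n0; have n0' : 0 < n%:R :> R by rewrite ltr0n.
have h := Ex_linear_sqr iQ1 (fun=> (Num.sqrt n%:R)^-1) (s.+1 * n) (v := fun q => wl (q < n)%N) (fun q => lw _) (fun q => w0 _).
rewrite (_ : Ex Q1 _ = Ex Q1 (fun y => (\sum_(q < s.+1 * n) (Num.sqrt n%:R)^-1 * wl (q < n)%N (y q)) ^+ 2)); last first.
  by apply: Ex_eq => y; rewrite /linear_form mulr_sumr.
rewrite h (eq_bigr (fun q : 'I_(s.+1 * n) => (Num.sqrt n%:R)^-1 ^+ 2 * V (q < n)%N)) => [|q _]; last by rewrite VE.
rewrite (sumbool (fun t => (Num.sqrt n%:R)^-1 ^+ 2 * V t)) exprVn sqr_sqrtr ?(ltW n0')// natrM.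
by field; rewrite lt0r_neq0.
Qed.

Let sm t n : R := n%:R * Ex mu (fun z => rho ((Num.sqrt n%:R)^-1 * wl t z)).

(** Lindeberg's condition expressed with [rho]: truncation at [B] leaves a tail of small second
    moment, and the bulk costs [2 B V / sqrt n]. *)
Let small t (e : R) : 0 < e -> \forall n \near \oo, sm t n <= e.
Proof.
move=> e0; have e8 : 0 < e / 8 by rewrite divr_gt0.
have [B B0 hB] := trunc_L2_cvg (lw t) e8.
near=> n; have n0 : 0 < n%:R :> R.
  by rewrite ltr0n; near: n; exists 1%N.
have r0 : 0 < Num.sqrt n%:R :> R by rewrite sqrtr_gt0.
have nb : (4 * B * V t / e) ^+ 2 <= n%:R by near: n; exact: nbhs_infty_ger.
have rb : 4 * B * V t / e <= Num.sqrt n%:R.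
  have p0 : 0 <= 4 * B * V t / e by rewrite divr_ge0 ?(ltW e0)// mulr_ge0// mulr_ge0// ltW.
  by rewrite -[leLHS](ger0_norm p0) -sqrtr_sqr ler_sqrt// ltW.
have lt := L2_trunc (lw t) (ltW B0).
have lr : L1 mu (fun z => rho ((Num.sqrt n%:R)^-1 * wl t z)).
  exact: (L1_rho (L2Z (Num.sqrt n%:R)^-1 (lw t))).
rewrite /sm -ExZ//.
apply: (@le_trans _ _ (Ex mu (fun z => (2 * B) * (Num.sqrt n%:R)^-1 * wl t z ^+ 2 + 4 * (wl t z - trunc B (wl t z)) ^+ 2))).
  apply: Ex_le; [exact: L1Z|by apply: L1D; apply: L1Z; exact: L2_sqr|move=> z].
  have := @rho_scale R (wl t z) (2 * B) (Num.sqrt n%:R) (mulr_gt0 (ltr0Sn _ 1) B0) r0.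
  rewrite sqr_sqrtr ?(ltW n0)// (mulrC (wl t z)) (_ : 2 * B / 2 = B)//.
  by rewrite mulrAC divff ?mul1r.
rewrite (ExD (L1Z _ (L2_sqr (lw t))) (L1Z _ (L2_sqr lt))) (ExZ _ (L2_sqr (lw t))) (ExZ _ (L2_sqr lt)) VE.
have h1 : 2 * B * (Num.sqrt n%:R)^-1 * V t <= e / 2.
  rewrite mulrAC ler_pdivrMr// -ler_pdivrMl ?divr_gt0//.
  by apply: le_trans rb; rewrite le_eqVlt; apply/orP; left; apply/eqP; field; rewrite lt0r_neq0.
lra.
Unshelve. all: by end_near. Qed.

Lemma linf_TC M f f1 f2 : TC M f f1 f2 ->
  Ex Q1 (fun y => f (linf n y)) @[n --> \oo] --> gav (Num.sqrt (V true + s%:R * V false)) f 0.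
Proof.
move=> tc; have M0 := TC_ge0 tc; apply/cvgrPdist_le => e e0.
(* The terms [9 * sig i ^+ 3] of [lindeberg_gauss] add up to [K / sqrt n]. *)
pose K : R := 9 * (Num.sqrt (V true) ^+ 3 + s%:R * Num.sqrt (V false) ^+ 3).
have K0 : 0 <= K by rewrite mulr_ge0// addr_ge0 ?mulr_ge0// exprn_ge0// sqrtr_ge0.
pose e' := e / (M + 1) / (4 * s.+1%:R).
have M1 : 0 < M + 1 by rewrite ltr_wpDl.
have e'0 : 0 < e' by rewrite !divr_gt0// mulr_gt0.
have [nt _ ht] := small true e'0; have [nf _ hf] := small false e'0.
near=> n.
have n0 : (0 < n)%N by near: n; exists 1%N.
have n0' : 0 < n%:R :> R by rewrite ltr0n.
have r0 : 0 < Num.sqrt n%:R :> R by rewrite sqrtr_gt0.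
have bt : sm true n <= e' by apply: ht; near: n; exact: nbhs_infty_ge.
have bf : sm false n <= e' by apply: hf; near: n; exact: nbhs_infty_ge.
have nK : (4 * K * (M + 1) / e) ^+ 2 <= n%:R by near: n; exact: nbhs_infty_ger.
have rK : K / Num.sqrt n%:R <= e / (M + 1) / 4.
  have p0 : 0 <= 4 * K * (M + 1) / e by rewrite divr_ge0 ?(ltW e0)// mulr_ge0// ?mulr_ge0// ltW.
  have h : 4 * K * (M + 1) / e <= Num.sqrt n%:R by rewrite -[leLHS](ger0_norm p0) -sqrtr_sqr ler_sqrt// ltW.
  rewrite ler_pdivrMr// -ler_pdivrMl ?divr_gt0//.
  by apply: le_trans h; rewrite le_eqVlt; apply/orP; left; apply/eqP; field; rewrite !lt0r_neq0.
pose v (q : nat) z := (Num.sqrt n%:R)^-1 * wl (q < n)%N z.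
pose sg (q : nat) : R := (Num.sqrt n%:R)^-1 * Num.sqrt (V (q < n)%N).
have sg0 q : 0 <= sg q by rewrite mulr_ge0 ?invr_ge0 ?sqrtr_ge0// ltW.
have sgE q : sg q ^+ 2 = n%:R^-1 * V (q < n)%N.
  by rewrite /sg exprMn exprVn !sqr_sqrtr// ltW.
have vsg q : Ex mu (fun z => v q z ^+ 2) = sg q ^+ 2.
  rewrite sgE -VE -ExZ; last exact: L2_sqr (lw _).
  by apply: Ex_eq => z; rewrite /v exprMn exprVn sqr_sqrtr// ltW.
have lv q : L2 mu (v q) by exact: (L2Z _ (lw _)).
have v0 q : Ex mu (v q) = 0 by rewrite ExZ ?w0 ?mulr0//; exact: L2_L1 (lw _).
have := lindeberg_gauss iQ1 lv v0 sg0 vsg (s.+1 * n) tc.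
have -> : \sum_(i < s.+1 * n) sg i ^+ 2 = V true + s%:R * V false.
  rewrite (eq_bigr (fun i : 'I_(s.+1 * n) => n%:R^-1 * V (i < n)%N)) => [|i _]; last exact: sgE.
  by rewrite (sumbool (fun t => n%:R^-1 * V t)) natrM; field; rewrite lt0r_neq0.
rewrite distrC => h.
rewrite (_ : Ex Q1 _ = Ex Q1 (fun y => f (\sum_(i < s.+1 * n) v i (y i)))); last first.
  by apply: Ex_eq => y; rewrite /linear_form mulr_sumr.
apply: (le_trans h).
rewrite (sumbool (fun t => Ex mu (fun z => rho ((Num.sqrt n%:R)^-1 * wl t z)) + 9 * ((Num.sqrt n%:R)^-1 * Num.sqrt (V t)) ^+ 3)).
rewrite (natrM R s n) (exprMn _ _ (Num.sqrt (V true))) (exprMn _ _ (Num.sqrt (V false))).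
have r3 : n%:R * (Num.sqrt n%:R)^-1 ^+ 3 = (Num.sqrt n%:R)^-1 :> R.
  rewrite -{1}(sqr_sqrtr (ltW n0')); field; exact: lt0r_neq0.
apply: (@le_trans _ _ (M * (s.+1%:R * e' + K / Num.sqrt n%:R))).
  apply: ler_wpM2l => //.
  have s0'' : 0 <= s%:R :> R by [].
  have bf' := ler_wpM2l s0'' bf; rewrite /sm in bt bf'.
  move: bt bf'; rewrite -natr1 /K.
  set z1 := Ex mu _; set z2 := Ex mu _; set i3 := (Num.sqrt n%:R)^-1 ^+ 3 => b1 b2.
  rewrite (_ : _ + _ = n%:R * z1 + s%:R * (n%:R * z2) +
    9 * (Num.sqrt (V true) ^+ 3 + s%:R * Num.sqrt (V false) ^+ 3) * (n%:R * i3)); last by ring.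
  rewrite r3 lerD2r -subr_ge0.
  rewrite (_ : _ - _ = (e' - n%:R * z1) + (s%:R * e' - s%:R * (n%:R * z2))); last by ring.
  by rewrite addr_ge0// subr_ge0.
have -> : s.+1%:R * e' = e / (M + 1) / 4.
  have sp : s.+1%:R != 0 :> R by rewrite pnatr_eq0.
  rewrite /e'; move: sp; move: (s.+1%:R : R) => S sp; field; rewrite sp lt0r_neq0//.
have eM : 0 <= e / (M + 1) / 4 by rewrite !divr_ge0// ltW.
apply: (@le_trans _ _ (M * (e / (M + 1) / 4 + e / (M + 1) / 4))).
  by apply: ler_wpM2l => //; rewrite lerD2l.
have -> : M * (e / (M + 1) / 4 + e / (M + 1) / 4) = e / 2 * (M / (M + 1)) by field; rewrite lt0r_neq0.
have : e / 2 * (M / (M + 1)) <= e / 2.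
  by rewrite ler_piMr ?divr_ge0 ?(ltW e0)// ler_pdivrMr// mul1r; lra.
lra.
Unshelve. all: by end_near. Qed.

Lemma linf_weak f : 0 < V true + s%:R * V false -> cb f ->
  Ex Q1 (fun y => f (linf n y)) @[n --> \oo] --> Ex (normal_prob 0 (Num.sqrt (V true + s%:R * V false))) f.
Proof.
set W := V true + _ => W0 cf; apply/cvgrPdist_le => e e0.
have sW : Num.sqrt W != 0 by rewrite sqrtr_eq0 -ltNge.
have e4 : 0 < e / 4 by rewrite divr_gt0.
have [g [g1 [g2 [M [tc hg]]]]] := TC_dense cf (ltW W0) e4.
have := linf_TC tc; rewrite -/W (gavE _ sW) => /cvgrPdist_le/(_ (e / 4) e4) hl.
have lid : L2 (gauss (Num.sqrt W)) (fun y : measurableTypeR R => y).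
  by split; [exact: measurable_id|apply: L1_gauss_sqr; rewrite sqrtr_gt0].
have idW : Ex (gauss (Num.sqrt W)) (fun y : measurableTypeR R => y ^+ 2) <= W.
  by rewrite Ex_gauss_sqr ?sqrtr_gt0// sqr_sqrtr// ltW.
have hG := hg _ _ (gauss (Num.sqrt W)) (fun y => y) lid idW.
near=> n.
have n0 : (0 < n)%N by near: n; exists 1%N.
have := hg _ _ Q1 (linf n) (L2_linf n); rewrite Ex_linf_sqr// lexx => /(_ isT).
have : `|Ex (gauss (Num.sqrt W)) (fun y : measurableTypeR R => g (0 + y)) - Ex Q1 (fun y => g (linf n y))| <= e / 4 by near: n; exact: hl.
move: hG; rewrite (_ : Ex _ (fun y : measurableTypeR R => g (0 + y)) = Ex (gauss (Num.sqrt W)) g); last first.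
  by apply: Ex_eq => y; rewrite add0r.
rewrite -[Ex (gauss _) (fun y => f y)]/(Ex (gauss (Num.sqrt W)) f) -[Ex (gauss _) (fun y => g y)]/(Ex (gauss (Num.sqrt W)) g).
rewrite /gauss !ler_norml.
move=> /andP[? ?] /andP[? ?] /andP[? ?].
by apply/andP; split; lra.
Unshelve. all: by end_near. Qed.

End LinearLimit.

Lemma le_sum_bool (R : realType) (F : bool -> R) : (forall t, 0 <= F t) -> forall t, F t <= F true + F false.
Proof. by move=> F0 []; rewrite ?lerDl ?lerDr. Qed.

(** * Limit theorems for the two-sample U-statistic *)

Section Limits.
Context {R : realType} {d : measure_display} {E : measurableType d}.
Variables (mu : probability E R) (Q : probability (seqspace E (nat + nat)%type) R).
Variable (Q1 : probability (seqspace E nat) R).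
Hypotheses (iQ : iid_law mu Q) (iQ1 : iid_law mu Q1).
Local Notation T := (seqspace E (nat + nat)%type).
Local Notation T1 := (seqspace E nat).
Let MM : probability (E * E)%type R := (mu \x mu)%E.
Variables (m0 m1 : nat) (H : T -> R).
Hypotheses (m00 : (0 < m0)%N) (m10 : (0 < m1)%N) (lH : L2 Q H) (dH : dep (S0 m0 m1) H)
  (symH : forall (a : 'S_m0 * 'S_m1) (x : T), H (x \o rp a : T) = H x).
Variable s : nat.
Hypothesis s1 : (1 < s)%N.
Hypothesis EH : Ex Q H = 0.

Let s0 : (0 < s)%N. Proof. exact: ltnW. Qed.
Let s0' : s%:R != 0 :> R. Proof. by rewrite pnatr_eq0 -lt0n. Qed.

Lemma trace0_PS S : #|trace m0 m1 S| = 0%N -> forall x, PS Q S H x = 0.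
Proof.
move=> /cards0_eq S0E x; rewrite (PS_dep Q S dH) PS0// => i.
apply/negP => /andP[Si /existsP[p /eqP pi]].
have : p \in trace m0 m1 S by rewrite inE pi.
by rewrite S0E inE.
Qed.

Lemma trace1_PS S p : trace m0 m1 S = [set p]%SET -> forall x, PS Q S H x = PS Q (sel1 (cpos p)) H x.
Proof.
move=> SE x; rewrite (PS_dep Q S dH); apply: PS_eqS => i; rewrite /sel1/=.
apply/andP/eqP => [[Si /existsP[p' /eqP p'i]]|->].
  by have : p' \in trace m0 m1 S by [rewrite inE p'i]; rewrite SE inE => /eqP <-.
split; last by apply/existsP; exists p.
by have : p \in trace m0 m1 S by [rewrite SE inE]; rewrite inE.
Qed.

Section Sequence.
Variables (N n : nat -> nat).
Hypotheses (noo : ((n k)%:R : R) @[k --> \oo] --> +oo)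
  (Ns : ((N k)%:R / (n k)%:R : R) @[k --> \oo] --> (s%:R : R)).

Let noo' : n k @[k --> \oo] --> \oo.
Proof. by apply/cvgnyPge => K; exact: (regime_ge noo). Qed.

Let large : \forall k \near \oo, [/\ (m0 <= N k)%N, (m1 <= n k)%N & (0 < n k)%N].
Proof.
near=> k; have h1 : (m0 + m1 <= n k)%N by near: k; exact: (regime_ge noo).
have h2 : (n k <= N k)%N by near: k; exact: (regime_le s1 noo Ns).
have h3 : (m0 <= n k)%N by apply: leq_trans h1; exact: leq_addr.
split; [exact: leq_trans h2|by apply: leq_trans h1; exact: leq_addl|exact: leq_trans h3].
Unshelve. all: by end_near. Qed.

Lemma U_gaussian_limit (V : R) f : cb f ->
  V = (m1 ^ 2)%:R * Ex mu (fun z => G1 Q H (inr 0%N) z ^+ 2) + (m0 ^ 2)%:R * Ex mu (fun z => G1 Q H (inl 0%N) z ^+ 2) / s%:R ->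
  0 < V ->
  Ex Q (fun x => f ('C(N k, m0)%:R / 'C(s * n k, m0)%:R * (Num.sqrt (n k)%:R * Uavg (N k) (n k) H x)))
    @[k --> \oo] --> Ex (normal_prob 0 (Num.sqrt V)) f.
Proof.
move=> cf VE V0; pose w := wl Q m0 m1 H s; pose W t := Ex mu (fun z => w t z ^+ 2).
have lw t : L2 mu (w t) by exact: (L2_wl iQ).
have w0 t : Ex mu (w t) = 0 by exact: (Ex_wl iQ).
have WE : W true + s%:R * W false = V.
  rewrite /W /w /wl VE (_ : Ex mu _ = m1%:R ^+ 2 * Ex mu (fun z => G1 Q H (inr 0%N) z ^+ 2)); last first.
    by rewrite -ExZ; [apply: Ex_eq => z; rewrite exprMn|exact: L2_sqr (L2_G1 iQ lH _)].
  rewrite (_ : Ex mu (fun z => (m0%:R / _ * _) ^+ 2) = (m0%:R / s%:R) ^+ 2 * Ex mu (fun z => G1 Q H (inl 0%N) z ^+ 2)); last first.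
    by rewrite -ExZ; [apply: Ex_eq => z; rewrite exprMn|exact: L2_sqr (L2_G1 iQ lH _)].
  by rewrite !natrX; move: (Ex _ _) (Ex _ _) => u v; field.
pose Y k (x : T) := linear_form s w (n k) (x \o pin (n k)).
have lY k : L2 Q (Y k) by exact: (L2_mp (mpres_pin iQ iQ1 (n k)) (L2_linf iQ1 s lw (n k))).
have YE k g : measurable_fun setT g -> Ex Q (fun x => g (Y k x)) = Ex Q1 (fun y => g (linear_form s w (n k) y)).
  move=> mg; rewrite [RHS](Ex_mp (mpres_pin iQ iQ1 (n k)))//.
  exact: (measurableT_comp mg (L2_meas (L2_linf iQ1 s lw (n k)))).
have YC : \forall k \near \oo, Ex Q (fun x => Y k x ^+ 2) <= V.
  near=> k; have [_ _ n0] : [/\ (m0 <= N k)%N, (m1 <= n k)%N & (0 < n k)%N] by near: k; exact: large.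
  rewrite (YE k (fun y => y ^+ 2)); last by apply: measurable_funX.
  by rewrite (Ex_linf_sqr iQ1 s lw w0 (fun t => erefl (W t)) n0) WE.
have leadY : Ex Q (fun x => (Num.sqrt (n k)%:R * Uavg (N k) (n k) (@lead _ _ _ Q m0 m1 1 H) x - Y k x) ^+ 2) @[k --> \oo] --> (0 : R).
  pose WW := W true + W false.
  have WW0 : forall t, W t <= WW by apply: le_sum_bool => t; exact: Ex_sqr_ge0.
  have lim : (WW * (2 * (\sum_t (al1 s (N k) (n k) t - 1) ^+ 2) * ((n k + N k + s.+1 * n k)%:R / (n k)%:R) +
     2 * `|(N k)%:R / (n k)%:R - s%:R|) : R) @[k --> \oo] --> (0 : R).
    rewrite -[X in _ --> X](_ : WW * (2 * ((1 - 1) ^+ 2 + (1 - 1) ^+ 2) * (1 + s%:R + s.+1%:R) + 2 * 0) = 0); last first.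
      by rewrite subrr expr0n/= !(mulr0, addr0) mul0r mulr0.
    apply: cvgM; [exact: cvg_cst|apply: cvgD; last first].
      by apply: cvgM; [exact: cvg_cst|exact: ratio_dist_cvg].
    apply: cvgM; last exact: total_cvg.
    apply: cvgM; [exact: cvg_cst|].
    under eq_fun do rewrite big_bool.
    have h t : (al1 s (N k) (n k) t - 1) ^+ 2 @[k --> \oo] --> ((1 - 1) ^+ 2 : R).
      rewrite expr2; under eq_fun do rewrite expr2.
      by apply: cvgM; apply: cvgB; (try exact: cvg_cst); exact: al1_cvg.
    exact: (cvgD (h true) (h false)).
  apply: (squeeze_cvgr _ (cvg_cst 0) lim); near=> k; rewrite Ex_sqr_ge0/=.
  have [mN mn n0] : [/\ (m0 <= N k)%N, (m1 <= n k)%N & (0 < n k)%N] by near: k; exact: large.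
  exact: (lead1_linf_dist iQ iQ1 m10 lH symH s0 EH mN mn (fun t => WW0 t)).
have aE k : Num.sqrt (n k)%:R ^+ 2 = (n k)%:R ^+ 1 :> R by rewrite sqr_sqrtr.
apply: (@scaled_weak _ _ _ _ _ iQ _ _ _ m00 lH dH _ _ _ s1 noo Ns 1%N _ aE _ Y V lY YC leadY f _ cf).
  by move=> S; rewrite ltnS leqn0 => /eqP S0E; apply: aeW; exact: trace0_PS.
rewrite (_ : (fun k => Ex Q (fun w => f (Y k w))) = (fun k => Ex Q1 (fun y => f (linear_form s w (n k) y)))); last first.
  by apply/funext => k; apply: YE; exact: cb_meas.
have := @linf_weak _ _ _ _ _ iQ1 s w W lw w0 (fun t => erefl (W t)) f.
by rewrite WE => /(_ V0 cf) h; exact: (cvg_comp _ _ noo' h).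
Unshelve. all: by end_near. Qed.

End Sequence.

Section Degenerate.
Hypotheses (E0 : Ex mu (fun z => G1 Q H (inl 0%N) z ^+ 2) = 0)
  (E1 : Ex mu (fun z => G1 Q H (inr 0%N) z ^+ 2) = 0).

(** At a coordinate that the kernel does not read, the projection is the mean, which is 0; at the
    others symmetry reduces to the two order-one kernels, whose second moments vanish. *)
Lemma sel1_PS0 a : {ae Q, forall x, PS Q (sel1 a) H x = 0}.
Proof.
have z (b : nat + nat) : Ex mu (fun z => G1 Q H b z ^+ 2) = 0 -> {ae mu, forall z, G1 Q H b z = 0}.
  exact: (Ex_sqr0_ae (L2_G1 iQ lH b)).
have [/existsP[p /eqP <-]|h] := boolP (S0 m0 m1 a); last first.
  apply: aeW => x; rewrite (PS_dep Q _ dH) PS0// => i; rewrite /sel1/=.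
  by apply/negP => /andP[/eqP -> ]; exact/negP.
case: p => k.
  apply: (ae_imp (ae_mp (mpres_coord iQ (inl (val k))) (z _ E0))) => x hx.
  by rewrite (PS_l iQ lH symH).
apply: (ae_imp (ae_mp (mpres_coord iQ (inr (val k))) (z _ E1))) => x hx.
by rewrite (PS_r iQ lH symH).
Qed.

Let H0 S : (#|trace m0 m1 S| < 2)%N -> {ae Q, forall x, PS Q S H x = 0}.
Proof.
rewrite ltnS leq_eqVlt ltnS leqn0 => /orP[/cards1P[p Sp]|/eqP S0E].
  by apply: (ae_imp (sel1_PS0 (cpos p))) => x hx; rewrite (trace1_PS Sp).
by apply: aeW; exact: trace0_PS.
Qed.

Let w := wq Q m0 m1 H s.
Let lw t t' : L2 MM (w t t'). Proof. exact: (L2_wq iQ). Qed.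
Let wsym t t' y z : w t t' (y, z) = w t' t (z, y). Proof. exact: (wq_sym iQ). Qed.
Let wdeg t t' : degen mu (w t t'). Proof. exact: (degen_wq iQ m0 m1 lH s sel1_PS0). Qed.

Lemma U_chaos_limit (N n : nat -> nat) : ((n k)%:R : R) @[k --> \oo] --> +oo ->
  ((N k)%:R / (n k)%:R : R) @[k --> \oo] --> (s%:R : R) -> forall f (l : R), cb f ->
  Ex Q1 (fun y => f (chaos s w j.+1 y)) @[j --> \oo] --> l ->
  Ex Q (fun x => f ('C(N k, m0)%:R / 'C(s * n k, m0)%:R * ((n k)%:R * Uavg (N k) (n k) H x)))
    @[k --> \oo] --> l.
Proof.
move=> noo Ns f l cf fl.
(* The chaos is indexed by [j.+1] to keep its size positive, hence the shift by one. *)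
have noo' : (n k).-1 @[k --> \oo] --> \oo.
  apply/cvgnyPge => K; have := regime_ge noo K.+1; apply: filterS => k h.
  by rewrite -ltnS prednK// (leq_trans _ h).
have large : \forall k \near \oo, [/\ (m0 <= N k)%N, (m1 <= n k)%N & (0 < n k)%N].
  near=> k; have h1 : (m0 + m1 <= n k)%N by near: k; exact: (regime_ge noo).
  have h2 : (n k <= N k)%N by near: k; exact: (regime_le s1 noo Ns).
  have h3 : (m0 <= n k)%N by apply: leq_trans h1; exact: leq_addr.
  split; [exact: leq_trans h2|by apply: leq_trans h1; exact: leq_addl|exact: leq_trans h3].
pose W : R := \sum_t \sum_t' Ex MM (fun z => w t t' z ^+ 2).
have wW t t' : Ex MM (fun z => w t t' z ^+ 2) <= W.
  have sq t1 t2 : 0 <= Ex MM (fun z => w t1 t2 z ^+ 2) by exact: Ex_sqr_ge0.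
  rewrite /W big_bool; apply: le_trans (le_sum_bool (F := fun t => \sum_t' Ex MM (fun z => w t t' z ^+ 2)) _ t).
    rewrite big_bool; exact: (le_sum_bool (F := fun t' => Ex MM (fun z => w t t' z ^+ 2)) (sq t) t').
  by move=> t1; apply: sumr_ge0.
pose Y k (x : T) := chaos s w (n k) (x \o pin (n k)).
have lY k : L2 Q (Y k) by exact: (L2_mp (mpres_pin iQ iQ1 (n k)) (L2_chaos iQ1 s lw (n k))).
have YE k g : measurable_fun setT g -> Ex Q (fun x => g (Y k x)) = Ex Q1 (fun y => g (chaos s w (n k) y)).
  move=> mg; rewrite [RHS](Ex_mp (mpres_pin iQ iQ1 (n k)))//.
  exact: (measurableT_comp mg (L2_meas (L2_chaos iQ1 s lw (n k)))).
have YC : \forall k \near \oo, Ex Q (fun x => Y k x ^+ 2) <= s.+1%:R ^+ 2 * W.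
  near=> k; have [_ _ n0] : [/\ (m0 <= N k)%N, (m1 <= n k)%N & (0 < n k)%N] by near: k; exact: large.
  rewrite (YE k (fun y => y ^+ 2)); last by apply: measurable_funX.
  exact: (Ex_chaos_sqr_le iQ1 s lw wdeg n0 wW).
have leadY : Ex Q (fun x => ((n k)%:R * Uavg (N k) (n k) (@lead _ _ _ Q m0 m1 2 H) x - Y k x) ^+ 2) @[k --> \oo] --> (0 : R).
  have lim : (W * ((n k + N k + s.+1 * n k)%:R / (n k)%:R) *
     (2 * (\sum_t \sum_t' (al2 s (N k) (n k) t t' - 1) ^+ 2) * ((n k + N k + s.+1 * n k)%:R / (n k)%:R) +
     2 * `|(N k)%:R / (n k)%:R - s%:R|) : R) @[k --> \oo] --> (0 : R).
    pose z : R := (1 - 1) ^+ 2.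
    rewrite -[X in _ --> X](_ : W * (1 + s%:R + s.+1%:R) * (2 * ((z + z) + (z + z)) * (1 + s%:R + s.+1%:R) + 2 * 0) = 0); last first.
      by rewrite /z subrr expr0n/= !(mulr0, addr0) mul0r mulr0.
    apply: cvgM; first by apply: cvgM; [exact: cvg_cst|exact: total_cvg].
    apply: cvgD; last by apply: cvgM; [exact: cvg_cst|exact: ratio_dist_cvg].
    apply: cvgM; last exact: total_cvg.
    apply: cvgM; [exact: cvg_cst|].
    under eq_fun do rewrite !big_bool.
    have h t t' : (al2 s (N k) (n k) t t' - 1) ^+ 2 @[k --> \oo] --> z.
      rewrite /z expr2; under eq_fun do rewrite expr2.
      by apply: cvgM; apply: cvgB; (try exact: cvg_cst); exact: al2_cvg.
    exact: (cvgD (cvgD (h true true) (h true false)) (cvgD (h false true) (h false false))).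
  apply: (squeeze_cvgr _ (cvg_cst 0) lim); near=> k; rewrite Ex_sqr_ge0/=.
  have [mN mn n0] : [/\ (m0 <= N k)%N, (m1 <= n k)%N & (0 < n k)%N] by near: k; exact: large.
  exact: (lead2_chaos_dist iQ iQ1 m00 m10 lH symH s0 sel1_PS0 mN mn wW).
have aE k : (n k)%:R ^+ 2 = (n k)%:R ^+ 2 :> R by [].
apply: (@scaled_weak _ _ _ _ _ iQ _ _ _ m00 lH dH _ _ _ s1 noo Ns 2%N _ aE H0 Y _ lY YC leadY f _ cf).
have h := cvg_comp _ _ noo' fl; apply: cvg_trans h; apply: near_eq_cvg; near=> k.
have [_ _ n0] : [/\ (m0 <= N k)%N, (m1 <= n k)%N & (0 < n k)%N] by near: k; exact: large.
by rewrite (YE k f (cb_meas cf)) /= prednK.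
Unshelve. all: by end_near. Qed.

Lemma chaos_limit_law (V : R) :
  V = Ex MM (fun z => w true true z ^+ 2) / 2 + s%:R * Ex MM (fun z => w true false z ^+ 2) +
      s%:R ^+ 2 / 2 * Ex MM (fun z => w false false z ^+ 2) ->
  exists nu : probability (measurableTypeR R) R,
  [/\ L2 nu (fun x => x), Ex nu (fun x => x) = 0, Ex nu (fun x => x ^+ 2) = V,
      V != 0 -> forall c : R, (nu [set c] < 1)%E &
      forall f, cb f -> Ex Q1 (fun y => f (chaos s w j.+1 y)) @[j --> \oo] --> Ex nu f].
Proof.
move=> VE; pose Z j := chaos s w j.+1.
have lZ j : L2 Q1 (Z j) by exact: (L2_chaos iQ1 s lw).
have Z0 j : Ex Q1 (Z j) = 0 by exact: (Ex_chaos iQ1 s lw wdeg).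
have ZV : Ex Q1 (fun y => Z j y ^+ 2) @[j --> \oo] --> V.
  have iv : ((j.+1%:R)^-1 : R) @[j --> \oo] --> (0 : R) by exact: cvg_harmonic.
  rewrite (_ : (fun j => Ex Q1 (fun y => Z j y ^+ 2)) = (fun j : nat => (1 - (j.+1%:R)^-1) / 2 * Ex MM (fun z => w true true z ^+ 2) +
    s%:R * Ex MM (fun z => w true false z ^+ 2) + s%:R * (s%:R - (j.+1%:R)^-1) / 2 * Ex MM (fun z => w false false z ^+ 2))); last first.
    by apply/funext => j; exact: (Ex_chaos_sqr iQ1 s lw wdeg (ltn0Sn j)).
  rewrite -[X in _ --> X](_ : (1 - 0) / 2 * Ex MM (fun z => w true true z ^+ 2) +
    s%:R * Ex MM (fun z => w true false z ^+ 2) + s%:R * (s%:R - 0) / 2 * Ex MM (fun z => w false false z ^+ 2) = V); last first.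
    rewrite VE; move: (Ex MM (fun z => w true true z ^+ 2)) => u.
    move: (Ex MM (fun z => w true false z ^+ 2)) => u'.
    move: (Ex MM (fun z => w false false z ^+ 2)) => u''; by field.
  apply: cvgD; first apply: cvgD; last 2 first.
  - exact: cvg_cst.
  - apply: cvgM; last exact: cvg_cst.
    apply: cvgM; last exact: cvg_cst.
    by apply: cvgM; [exact: cvg_cst|apply: cvgB => //; exact: cvg_cst].
  - apply: cvgM; last exact: cvg_cst.
    apply: cvgM; last exact: cvg_cst.
    by apply: cvgB => //; exact: cvg_cst.
have Zui (e : R) : 0 < e -> exists2 A, 0 < A & forall j, Ex Q1 (fun y => Z j y ^+ 2 - Num.min (Z j y ^+ 2) A) <= e.
  move=> e0; have [A A0 hA] := chaos_ui iQ1 s lw wsym wdeg e0.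
  by exists A => // j; exact: hA.
pose W : R := \sum_t \sum_t' Ex MM (fun z => w t t' z ^+ 2).
have wW t t' : Ex MM (fun z => w t t' z ^+ 2) <= W.
  have sq t1 t2 : 0 <= Ex MM (fun z => w t1 t2 z ^+ 2) by exact: Ex_sqr_ge0.
  rewrite /W big_bool; apply: le_trans (le_sum_bool (F := fun t => \sum_t' Ex MM (fun z => w t t' z ^+ 2)) _ t).
    rewrite big_bool; exact: (le_sum_bool (F := fun t' => Ex MM (fun z => w t t' z ^+ 2)) (sq t) t').
  by move=> t1; apply: sumr_ge0.
have ZC j : Ex Q1 (fun y => Z j y ^+ 2) <= s.+1%:R ^+ 2 * W.
  exact: (Ex_chaos_sqr_le iQ1 s lw wdeg (ltn0Sn j) wW).
have Zc M f f1 f2 (e : R) : TC M f f1 f2 -> 0 < e -> exists n0, forall n n', (n0 <= n)%N -> (n0 <= n')%N ->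
    `|Ex Q1 (fun y => f (Z n y)) - Ex Q1 (fun y => f (Z n' y))| <= e.
  move=> tc e0; have [n0 hn] := chaos_cauchy iQ1 s lw wsym wdeg tc e0.
  exists n0 => n n' h h'; apply: hn => //; exact: leqW.
have [nu hnu] := weak_limit_exists lZ ZC Zc.
exists nu; split.
- exact: (weak_limit_L2 lZ ZV Zui hnu).
- exact: (weak_limit_mean lZ Z0 ZV Zui hnu).
- exact: (weak_limit_sqr lZ ZV Zui hnu).
- exact: (weak_limit_nondeg lZ Z0 ZV Zui hnu).
- exact: hnu.
Qed.

End Degenerate.
End Limits.

(** * Random subsampling *)

Section BernoulliWeights.
Context {R : realType}.

(** The probability that independent selections with probability [t] choose exactly [D]. *)
Definition bweight (n : nat) (t : R) (D : {set 'I_n}) : R := \prod_i (if i \in D then t else 1 - t).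

(** The expectation of a product over independent selections, as distributivity of a product over
    sums; total mass and covariances are special cases. *)
Lemma sum_bweight_prod n (t : R) (y : 'I_n -> bool -> R) :
  \sum_(D : {set 'I_n}) bweight t D * \prod_i y i (i \in D) =
  \prod_i (t * y i true + (1 - t) * y i false).
Proof.
rewrite bigA_distr; apply: eq_bigr => D _; rewrite -big_split/=.
by apply: eq_bigr => i _; case: (i \in D).
Qed.

Lemma sum_bweight n (t : R) : \sum_(D : {set 'I_n}) bweight t D = 1.
Proof.
transitivity (\sum_(D : {set 'I_n}) bweight t D * \prod_(i < n) 1).
  by apply: eq_bigr => D _; rewrite big1_eq mulr1.
rewrite (sum_bweight_prod t (fun _ _ => 1)) big1// => i _; ring.
Qed.

Lemma bweight_ge0 n (t : R) (D : {set 'I_n}) : 0 <= t <= 1 -> 0 <= bweight t D.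
Proof. by move=> /andP[t0 t1]; apply: prodr_ge0 => i _; case: ifP => _ //; rewrite subr_ge0. Qed.

(** The binomial variance: the centred selection indicators are uncorrelated, each with variance
    [t * (1 - t)]. *)
Lemma sum_bweight_sqr n (t : R) :
  \sum_(D : {set 'I_n}) bweight t D * (#|D|%:R - n%:R * t) ^+ 2 = n%:R * (t * (1 - t)).
Proof.
pose z (b : bool) : R := b%:R - t.
have zE (D : {set 'I_n}) : #|D|%:R - n%:R * t = \sum_i z (i \in D).
  rewrite big_split/= sumr_const card_ord mulNrn mulr_natl; congr (_ - _).
  by rewrite -sum1_card natr_sum big_mkcond/=; apply: eq_bigr => i _; case: (i \in D).
have zz (i j : 'I_n) : \sum_(D : {set 'I_n}) bweight t D * (z (i \in D) * z (j \in D)) =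
    (t * (1 - t)) *+ (i == j).
  pose y (k : 'I_n) (b : bool) : R := (if k == i then z b else 1) * (if k == j then z b else 1).
  transitivity (\sum_(D : {set 'I_n}) bweight t D * \prod_k y k (k \in D)).
    apply: eq_bigr => D _; congr (_ * _); rewrite big_split/=.
    by rewrite -!big_mkcond/= !big_pred1_eq.
  rewrite sum_bweight_prod (bigD1 i)//= /y eqxx /z.
  case: eqVneq => [<-|ij]; last first.
    by rewrite mulr0n [X in X * _](_ : _ = 0) ?mul0r//=; ring.
  rewrite mulr1n big1 => [|k ki]; last by rewrite (negbTE ki); ring.
  rewrite [_ *+ true]mulr1n [false%:R]mulr0n; ring.
transitivity (\sum_i \sum_j \sum_(D : {set 'I_n}) bweight t D * (z (i \in D) * z (j \in D))).
  under [RHS]eq_bigr => i _ do rewrite exchange_big/=.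
  rewrite exchange_big/=; apply: eq_bigr => D _; rewrite zE expr2 big_distrlr/= mulr_sumr.
  by apply: eq_bigr => i _; rewrite mulr_sumr.
under eq_bigr => i _.
  under eq_bigr => j _ do rewrite zz.
  rewrite (bigD1 i)//= eqxx big1 ?addr0; last by move=> j ji; rewrite eq_sym (negbTE ji).
  over.
by rewrite sumr_const card_ord mulr1n mulr_natl.
Qed.

(* the window [r = n ^ (-1/4)] tends to zero although [n r ^ 2] is unbounded *)
Lemma bweight_limit (s : nat) (n0 n : nat -> nat) (a : nat -> nat -> R) (M l : R) :
  (forall k, s * n k <= n0 k)%N -> (0 < s)%N -> ((n k)%:R : R) @[k --> \oo] --> +oo ->
  (forall N k, `|a N k| <= M) ->
  (forall N : nat -> nat, ((N k)%:R / (n k)%:R : R) @[k --> \oo] --> (s%:R : R) ->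
     a (N k) k @[k --> \oo] --> l) ->
  \sum_(D : {set 'I_(n0 k)}) bweight ((s * n k)%:R / (n0 k)%:R) D * a #|D| k @[k --> \oo] --> l.
Proof.
move=> sn0 s0 noo aM al.
pose r k : R := (Num.sqrt (Num.sqrt (n k)%:R))^-1.
have sq0 : (Num.sqrt (n k)%:R : R)^-1 @[k --> \oo] --> (0 : R).
  apply/cvgrPdist_le => e e0; near=> k; rewrite sub0r normrN.
  have h : (e^-1) ^+ 2 < (n k)%:R :> R by near: k; move/cvgryPgt: noo; apply.
  have e1 : e^-1 < Num.sqrt (n k)%:R.
    by rewrite -[ltLHS]ger0_norm ?invr_ge0 ?ltW// -sqrtr_sqr ltr_sqrt// (le_lt_trans _ h)// sqr_ge0.
  have p : 0 < Num.sqrt (n k)%:R :> R by apply: lt_trans e1; rewrite invr_gt0.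
  rewrite ger0_norm ?invr_ge0 1?ltW// -[ltRHS]invrK ltf_pV2 ?posrE ?invr_gt0//.
have r0 : r k @[k --> \oo] --> (0 : R).
  have -> : r = fun k => Num.sqrt (Num.sqrt (n k)%:R : R)^-1.
    by apply/funext => k; rewrite /r sqrtrV.
  rewrite -[X in _ --> X](sqrtr0 R).
  by apply: (cvg_comp _ _ sq0); exact: sqrt_continuous.
have r_ge0 k : 0 <= r k by rewrite invr_ge0 sqrtr_ge0.
pose win k (N : nat) := `|N%:R / (n k)%:R - s%:R| <= r k.
(* The size in the window at which [a] is farthest from [l]. The hypothesis applies to this
   deterministic sequence, and by maximality its conclusion is uniform over the window. The default
   0 is for [n k = 0], where the window is empty; otherwise [s * n k] lies in it. *)
pose N k : nat := if (0 < n k)%N then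
  [arg max_(i > (inord (s * n k) : 'I_(n0 k).+1) | win k i) `|a i k - l|]%O : nat else 0%N.
have Nwin k : (0 < n k)%N -> win k (N k) /\ forall i, (i <= n0 k)%N -> win k i ->
    `|a i k - l| <= `|a (N k) k - l|.
  move=> nk; rewrite /N nk; case: arg_maxP => [|i wi imax].
    rewrite /win inordK ?ltnS// natrM mulfK ?pnatr_eq0 -?lt0n//.
    by rewrite subrr normr0.
  split=> // j jn wj; have := imax (inord j); rewrite inordK ?ltnS//; exact.
have npos : \forall k \near \oo, (0 < n k)%N.
  by move/cvgryPgt: noo => /(_ 0); apply: filterS => k; rewrite ltr0n.
have Ns : ((N k)%:R / (n k)%:R : R) @[k --> \oo] --> (s%:R : R).
  apply/cvgrPdist_le => e e0; near=> k; rewrite distrC.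
  have nk : (0 < n k)%N by near: k.
  apply: le_trans (Nwin k nk).1 _; rewrite -[leLHS]ger0_norm// -normrN -[X in `|X|]sub0r.
  by near: k; move/cvgrPdist_le: r0; apply.
have aN := al N Ns.
apply/cvgrPdist_le => e e0.
have bnd : `|a (N k) k - l| + (M + `|l|) * (s%:R * (Num.sqrt (n k)%:R : R)^-1) @[k --> \oo] --> (0 : R).
  rewrite -[X in _ --> X](_ : `|l - l| + (M + `|l|) * (s%:R * 0) = 0); last first.
    by rewrite subrr normr0 !mulr0 addr0.
  apply: cvgD; first by apply: cvg_norm; apply: cvgB => //; exact: cvg_cst.
  by apply: cvgM; [exact: cvg_cst|apply: cvgM => //; exact: cvg_cst].
near=> k.
have nk : (0 < n k)%N by near: k.
have small : `|0 - (`|a (N k) k - l| + (M + `|l|) * (s%:R * (Num.sqrt (n k)%:R : R)^-1))| <= e.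
  by near: k; move/cvgrPdist_le: bnd; apply.
have n0k : (0 < n0 k)%N by apply: leq_trans (sn0 k); rewrite muln_gt0 s0.
have n0R : 0 < (n0 k)%:R :> R by rewrite ltr0n.
have nR : 0 < (n k)%:R :> R by rewrite ltr0n.
set t := (s * n k)%:R / (n0 k)%:R.
have t01 : 0 <= t <= 1.
  by rewrite /t divr_ge0//= ler_pdivrMr// mul1r ler_nat.
have M0 : 0 <= M by apply: le_trans (aM 0%N k).
have S0 : 0 < Num.sqrt (n k)%:R :> R by rewrite sqrtr_gt0.
have S2 : Num.sqrt (n k)%:R ^+ 2 = (n k)%:R :> R by rewrite sqr_sqrtr// ltW.
have r2 : r k ^+ 2 = (Num.sqrt (n k)%:R)^-1 by rewrite /r exprVn sqr_sqrtr// ltW.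
(* Chebyshev: outside the window the squared deviation exceeds [n^2 r^2], so [B] times it dominates
   the trivial bound [M + |l|]. Its mean is at most [s n], which leaves an error of order
   [n^(-1/2)]. *)
pose B := (M + `|l|) / ((n k)%:R ^+ 2 * r k ^+ 2).
have B0 : 0 <= B by rewrite /B divr_ge0// ?addr_ge0// mulr_ge0// sqr_ge0.
have ptw (D : {set 'I_(n0 k)}) :
    `|l - a #|D| k| <= `|a (N k) k - l| + B * (#|D|%:R - (n0 k)%:R * t) ^+ 2.
  have -> : (n0 k)%:R * t = s%:R * (n k)%:R.
    by rewrite /t mulrC divfK ?gt_eqF// (natrM R s (n k)).
  have Dn : (#|D| <= n0 k)%N by rewrite -[leqRHS]card_ord max_card.
  have [w|w] := boolP (`|#|D|%:R / (n k)%:R - s%:R| <= r k).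
    rewrite distrC; apply: le_trans ((Nwin k nk).2 _ Dn w) _.
    by rewrite lerDl mulr_ge0// sqr_ge0.
  apply: (@le_trans _ _ (M + `|l|)).
    by apply: le_trans (ler_normB _ _) _; rewrite addrC lerD2r aM.
  apply: ler_wpDl => //; rewrite /B mulrAC ler_pdivlMr; last first.
    by rewrite r2 mulr_gt0 ?exprn_gt0// invr_gt0.
  rewrite ler_wpM2l ?addr_ge0//.
  have -> : #|D|%:R - s%:R * (n k)%:R = (n k)%:R * (#|D|%:R / (n k)%:R - s%:R) :> R.
    by rewrite mulrBr mulrCA mulfV ?gt_eqF// mulr1 (mulrC s%:R).
  rewrite exprMn ler_wpM2l ?sqr_ge0// -[leRHS]real_normK ?num_real//.
  by rewrite ler_sqr ?nnegrE// ltW// ltNge.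
have -> : l - \sum_(D : {set 'I_(n0 k)}) bweight t D * a #|D| k =
    \sum_(D : {set 'I_(n0 k)}) bweight t D * (l - a #|D| k).
  under [RHS]eq_bigr => D _ do rewrite mulrBr.
  by rewrite sumrB -mulr_suml sum_bweight mul1r.
apply: le_trans (ler_norm_sum _ _ _) _.
apply: (@le_trans _ _ (\sum_(D : {set 'I_(n0 k)}) (bweight t D * `|a (N k) k - l| +
    B * (bweight t D * (#|D|%:R - (n0 k)%:R * t) ^+ 2)))).
  apply: ler_sum => D _; rewrite normrM ger0_norm ?bweight_ge0// mulrCA -mulrDr.
  by rewrite ler_wpM2l ?bweight_ge0.
rewrite big_split/= -mulr_suml sum_bweight mul1r -mulr_sumr sum_bweight_sqr.
move: small; rewrite sub0r normrN; apply: le_trans; apply: le_trans (ler_norm _).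
rewrite lerD2l /B r2.
have nt : (n0 k)%:R * (t * (1 - t)) <= s%:R * (n k)%:R.
  rewrite mulrA [X in X * _](_ : _ = s%:R * (n k)%:R); last first.
    by rewrite /t mulrC divfK ?gt_eqF// (natrM R s (n k)).
  by rewrite ler_piMr ?mulr_ge0// lerBlDr lerDl; case/andP: t01.
apply: (@le_trans _ _ ((M + `|l|) / ((n k)%:R ^+ 2 * (Num.sqrt (n k)%:R)^-1) * (s%:R * (n k)%:R))).
  by apply: ler_wpM2l => //; rewrite /B r2 in B0.
move: S2 S0; move: (Num.sqrt _) (M + _) => S x <- S0.
by rewrite le_eqVlt; apply/orP; left; apply/eqP; field; rewrite gt_eqF.
Unshelve. all: by end_near. Qed.

End BernoulliWeights.

Section SampleSums.
Context {R : realType} {d : measure_display} {E : measurableType d}.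
Variables (mu : probability E R) (Q : probability (seqspace E (nat + nat)%type) R).
Hypothesis iQ : iid_law mu Q.
Local Notation T := (seqspace E (nat + nat)%type).
Variables (m0 m1 : nat) (h : m0.-tuple E * m1.-tuple E -> R).
Hypothesis hsym : forall (x : m0.-tuple E) (y : m1.-tuple E) (sg : 'S_m0) (tau : 'S_m1),
  h ([tuple tnth x (sg k) | k < m0], [tuple tnth y (tau l) | l < m1]) = h (x, y).

Definition ukernel (x : T) : R := h ([tuple x (inl (val k)) | k < m0], [tuple x (inr (val l)) | l < m1]).

Lemma ukernel_sym (a : 'S_m0 * 'S_m1) (x : T) : ukernel (x \o rp a : T) = ukernel x.
Proof.
rewrite -[RHS](hsym _ _ a.1 a.2); congr (h (_, _)); apply: eq_from_tnth => k.
  by rewrite !tnth_mktuple/= pext_ord.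
by rewrite !tnth_mktuple/= pext_ord.
Qed.

Lemma ukernel_dep : dep (S0 m0 m1) ukernel.
Proof.
move=> x y xy; congr (h (_, _)); apply: eq_from_tnth => k; rewrite !tnth_mktuple; apply: xy.
  exact: (S0_cpos (inl k : pos m0 m1)).
exact: (S0_cpos (inr k : pos m0 m1)).
Qed.

Lemma incr_sum0 (V : nmodType) (m N : nat) (F : {ffun 'I_m -> 'I_N} -> V) : (N < m)%N ->
  \sum_(i : {ffun 'I_m -> 'I_N} | incr_idx i) F i = 0.
Proof.
move=> Nm; rewrite big_pred0// => i; apply/negP => /incr_inj/leq_card.
by rewrite !card_ord leqNgt Nm.
Qed.

Definition term N n (x : T) (i : {ffun 'I_m0 -> 'I_N}) (j : {ffun 'I_m1 -> 'I_n}) : R :=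
  h ([tuple x (inl (val (i k))) | k < m0], [tuple x (inr (val (j l))) | l < m1]).

(** [sum_incr_perm], applied in each sample, turns increasing families into permutations. For
    [N < m0] both sides are 0, by an empty sum and a vanishing binomial. *)
Lemma sum_term N n (x : T) : (m1 <= n)%N ->
  \sum_(i : {ffun 'I_m0 -> 'I_N} | incr_idx i) \sum_(j : {ffun 'I_m1 -> 'I_n} | incr_idx j) term x i j =
  'C(N, m0)%:R * 'C(n, m1)%:R * Uavg N n ukernel x.
Proof.
move=> mn; have [Nm|mN] := ltnP N m0.
  by rewrite incr_sum0// bin_small// !mul0r.
have fact0 M : M`!%:R != 0 :> R by rewrite pnatr_eq0 -lt0n fact_gt0.
have w0 : injective (fun k : 'I_m0 => widen_ord mN k) by move=> k l /(congr1 val)/= /val_inj.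
have w1 : injective (fun k : 'I_m1 => widen_ord mn k) by move=> k l /(congr1 val)/= /val_inj.
apply: (mulfI (fact0 N)); rewrite (sum_incr_perm w0); last first.
  move=> p i; apply: eq_bigr => j _; rewrite /term -[RHS](hsym _ _ p 1%g).
  by congr (h (_, _)); apply: eq_from_tnth => k; rewrite !tnth_mktuple ?ffunE ?perm1.
apply: (mulfI (fact0 n)); rewrite mulrCA mulr_sumr.
under eq_bigr => sg _.
  rewrite (sum_incr_perm w1); last first.
    move=> p j; rewrite /term -[RHS](hsym _ _ 1%g p).
    by congr (h (_, _)); apply: eq_from_tnth => k; rewrite !tnth_mktuple ?ffunE ?perm1.
  over.
rewrite -mulr_sumr pair_big/= /Uavg card_prod !card_Sn natrM.
under [in LHS]eq_bigr => a _.
  rewrite (_ : term _ _ _ = ukernel (x \o rp a)); last first.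
    rewrite /term /ukernel; congr (h (_, _)); apply: eq_from_tnth => k; rewrite !tnth_mktuple ffunE/=.
      by rewrite (pext_ord a.1 (widen_ord mN k)).
    by rewrite (pext_ord a.2 (widen_ord mn k)).
  over.
move: (\sum__ _) (fact0 N) (fact0 n) => z.
move: (N`!%:R) (n`!%:R) ('C(N, m0)%:R) ('C(n, m1)%:R) => u v c c' u0 v0; field.
by rewrite u0 v0.
Qed.

(** The relabelling [a] brings the controls in [D] to the first [#|D|] places. It disappears under
    the expectation because the law is invariant, so only the cardinality of [D] remains. *)
Lemma sum_term_subset (n0 n : nat) (D : {set 'I_n0}) : (0 < m0)%N -> (m1 <= n)%N ->
  exists a : 'S_n0 * 'S_n, forall x : T,
  \sum_(i : {ffun 'I_m0 -> 'I_n0} | incr_idx i && [forall k, i k \in D])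
    \sum_(j : {ffun 'I_m1 -> 'I_n} | incr_idx j) term x i j =
  'C(#|D|, m0)%:R * 'C(n, m1)%:R * Uavg #|D| n ukernel (x \o rp a : T).
Proof.
move=> m00 mn; have Dn : (#|D| <= n0)%N by rewrite -[leqRHS]card_ord max_card.
have [sg h1] := sum_incr_subset Dn m00 (erefl #|D|); exists (sg, 1%g) => x.
rewrite h1 -(sum_term #|D| _ mn); apply: eq_bigr => i _; apply: eq_bigr => j _.
rewrite /term; congr (h (_, _)); apply: eq_from_tnth => k; rewrite !tnth_mktuple/= ?pext1//.
by rewrite ffunE -(pext_ord sg).
Qed.

Hypothesis mh : measurable_fun setT ukernel.

Lemma Ex_sum_term_subset (n0 n : nat) (D : {set 'I_n0}) (g : R -> R) : measurable_fun setT g ->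
  (0 < m0)%N -> (m1 <= n)%N -> L2 Q ukernel ->
  Ex Q (fun x => g (\sum_(i : {ffun 'I_m0 -> 'I_n0} | incr_idx i && [forall k, i k \in D])
    \sum_(j : {ffun 'I_m1 -> 'I_n} | incr_idx j) term x i j)) =
  Ex Q (fun x => g ('C(#|D|, m0)%:R * 'C(n, m1)%:R * Uavg #|D| n ukernel x)).
Proof.
move=> mg m00 mn lH; have [a ha] := sum_term_subset D m00 mn.
rewrite [RHS](Ex_mp (mpres_comp iQ (rpK a))).
  by apply: Ex_eq => x; rewrite ha.
apply: (measurableT_comp mg); apply: measurable_funM => //.
exact: (L2_meas (L2_Uavg iQ #|D| n lH)).
Qed.

End SampleSums.

Lemma law_exists {R : realType} d d' (T : measurableType d) (T' : measurableType d')
    (P : probability T R) (phi : T -> T') : measurable_fun setT phi ->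
  exists Q : probability T' R, mpres P Q phi.
Proof.
move=> mphi; pose f : {mfun T >-> T'} := mfun_Sub (mem_set mphi).
by exists (distribution P f : probability T' R); split.
Qed.

(** * Expectation on an independent event *)

Section IndependentOfEvent.
Context {R : realType} {d d' : measure_display} {Om : measurableType d} {E : measurableType d'}.
Variables (P : probability Om R) (mu : probability E R) (I : eqType)
  (Q : probability (seqspace E I) R) (phi : Om -> seqspace E I) (A : set Om).
Hypotheses (iQ : iid_law mu Q) (mphi : forall i, measurable_fun setT (fun w => phi w i))
  (mA : measurable A)
  (ind : forall J B, uniq J -> (forall i, measurable (B i)) ->
     P (A `&` phi @^-1` box J B) = (P A * Q (box J B))%E).
Local Notation T := (seqspace E I).
Let PQ : probability (Om * T)%type R := (P \x Q)%E.

Lemma Ex_indic : Ex P \1_A = fine (P A).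
Proof. by rewrite /Ex /Rintegral integral_indic// setIT. Qed.

(* Resampling [phi w] off [A] by an independent copy does not change its law, by independence of [phi] and [A]. *)
Let mpres_resample : mpres PQ Q (fun z => if z.1 \in A then phi z.1 else z.2).
Proof.
apply: (mpres_iid _ iQ) => [i|J B uJ mB].
  rewrite (_ : (fun w => _) = fun z : Om * T => if z.1 \in A then phi z.1 i else z.2 i); last first.
    by apply/funext => z; case: ifP.
  apply: measurable_fun_ifT.
  - apply: (measurable_fun_bool true); rewrite setTI (_ : _ @^-1` _ = A `*` setT); first exact: measurableX.
    by apply/seteqP; split => z /=; rewrite ?inE; [move=> h; split => //; exact/set_mem|case=> h _; exact/mem_set].
  - exact: (measurableT_comp (mphi i) measurable_fst).
  - exact: (measurableT_comp (measurable_coord i) measurable_snd).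
rewrite (_ : _ @^-1` _ = ((A `&` phi @^-1` box J B) `*` setT) `|` (~` A `*` box J B)); last first.
  apply/seteqP; split => [[w y]/=|[w y]/=].
    by case: ifPn => [/set_mem Aw h|/negP Aw h]; [left|right; split => // /mem_set].
  by case=> [[[Aw h] _]|[Aw h]]; [rewrite mem_set|rewrite memNset].
have mbox : measurable (box J B : set T) by exact: measurable_box.
have mpb : measurable (phi @^-1` box J B).
  by rewrite -[X in measurable X]setTI; apply: (measurable_seqspace mphi).
rewrite measureU; last 3 first.
- by apply: measurableX => //; exact: measurableI.
- by apply: measurableX => //; exact: measurableC.
- by apply/seteqP; split => // -[w y] [[[Aw _] _] [nAw _]].
rewrite /PQ/= !product_measure1E//; [|exact: measurableC|exact: measurableI].
rewrite [X in (X * _ + _)%E](_ : _ = (P A * Q (box J B))%E); last exact: ind.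
rewrite [X in (_ * X + _)%E](_ : _ = 1%E); last exact: (probability_setT Q).
rewrite mule1 [X in (_ + X * _)%E](_ : _ = (1 - P A)%E); last exact: probability_setC.
rewrite -ge0_muleDl ?measure_ge0//; last by rewrite sube_ge0 ?probability_le1// fin_num_measure.
by rewrite addeC subeK ?fin_num_measure// mul1e iQ.
Qed.

(** The resampled variable has law [Q], whence [E_Q g = E (1_A g(phi)) + (1 - P A) E_Q g], which is
    solved for the middle term. *)
Lemma Ex_indic_mul (g : T -> R) (M : R) : measurable_fun setT g -> (forall x, `|g x| <= M) ->
  Ex P (fun w => \1_A w * g (phi w)) = fine (P A) * Ex Q g.
Proof.
move=> mg gM; have m1 : measurable_fun setT (\1_A : Om -> R) by exact: measurable_indic.
have mgp : measurable_fun setT (fun w => g (phi w)) by exact: (measurableT_comp mg (measurable_seqspace mphi)).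
have l1 : L1 P (fun w => \1_A w * g (phi w)).
  apply: (@L1_bdd _ _ _ _ _ M); first exact: measurable_funM.
  move=> w; rewrite normrM; apply: le_trans (gM (phi w)).
  by rewrite ler_piMl// ger0_norm// indicE; case: (_ \in _).
have lA : L1 P (\1_A : Om -> R).
  by apply: (@L1_bdd _ _ _ _ _ 1) => // w; rewrite indicE; case: (_ \in _); rewrite ?normr1 ?normr0.
have lg : L1 Q g by exact: (L1_bdd Q mg gM).
have : Ex Q g = Ex P (fun w => \1_A w * g (phi w)) + (1 - fine (P A)) * Ex Q g.
  rewrite {1}(Ex_mp mpres_resample mg) Ex_fubini; last exact: (L1_mp mpres_resample lg).
  have -> : (1 - fine (P A)) * Ex Q g = Ex P (fun w => Ex Q g * (1 - \1_A w)).
    rewrite ExZ; last by apply: L1B => //; exact: L1_cst.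
    by rewrite ExB//; [rewrite Ex_cst Ex_indic mulrC|exact: L1_cst].
  rewrite -ExD//; last by apply: L1Z; apply: L1B => //; exact: L1_cst.
  apply: Ex_eq => w /=; rewrite indicE; case: (_ \in _).
    by rewrite Ex_cst mul1r subrr mulr0 addr0.
  by rewrite mul0r add0r subr0 mulr1.
by move=> /eqP; rewrite -subr_eq => /eqP <-; ring.
Qed.

End IndependentOfEvent.

Section Mixture.
Context {R : realType} {d : measure_display} {Om : measurableType d}.
Variables (P : probability Om R) (D : finType) (A : D -> set Om).
Hypotheses (mA : forall D, measurable (A D)) (disj : forall i j w, A i w -> A j w -> i = j)
  (tot : \sum_i fine (P (A i)) = 1).

Let mass w := \sum_i (\1_(A i) w : R).

Let mass01 w : mass w = 0 \/ mass w = 1.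
Proof.
have [[i Ai]|h] := pselect (exists i, A i w).
  right; rewrite /mass (bigD1 i)//= big1 ?addr0 ?indicE ?mem_set// => j ji.
  by rewrite indicE memNset// => /(disj Ai)/esym/eqP; apply/negP.
left; rewrite /mass big1// => i _; rewrite indicE memNset// => Ai; apply: h; by exists i.
Qed.

(** [1 - mass] takes only the values 0 and 1, so it equals its own square, and its expectation is 0
    by [tot]. *)
Let mass_ae : {ae P, forall w, mass w = 1}.
Proof.
have l1 i : L1 P (\1_(A i) : Om -> R).
  apply: (@L1_bdd _ _ _ _ _ 1) => [|w]; first exact: measurable_indic.
  by rewrite indicE; case: (_ \in _); rewrite ?normr1 ?normr0.
have lm : L1 P mass by exact: L1_sum.
have : {ae P, forall w, 1 - mass w = 0}.
  have e w : (1 - mass w) ^+ 2 = 1 - mass w.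
    by case: (mass01 w) => ->; rewrite ?subr0 ?subrr expr2 ?mulr1 ?mulr0.
  have l : L1 P (fun w => 1 - mass w) by apply: L1B => //; exact: L1_cst.
  apply: Ex_sqr0_ae; first by split; [exact: L1_meas l|apply: L1_eq l => w; rewrite e].
  under Ex_eq do rewrite e.
  rewrite ExB//; last exact: L1_cst.
  rewrite Ex_cst Ex_sum// -[X in X - _]tot; apply/eqP; rewrite subr_eq0; apply/eqP.
  by apply: eq_bigr => i _; rewrite Ex_indic.
by move/ae_imp; apply => w /eqP; rewrite subr_eq0 => /eqP.
Qed.

Lemma Ex_mixture (G : Om -> R) (g : D -> Om -> R) (M : R) : measurable_fun setT G ->
  (forall i, measurable_fun setT (g i)) -> (forall i w, `|g i w| <= M) ->
  (forall i w, A i w -> G w = g i w) ->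
  Ex P G = \sum_i Ex P (fun w => \1_(A i) w * g i w).
Proof.
move=> mG mg gM Gg.
have l i : L1 P (fun w => \1_(A i) w * g i w).
  apply: (@L1_bdd _ _ _ _ _ M); first by apply: measurable_funM => //; exact: measurable_indic.
  move=> w; rewrite normrM; apply: le_trans (gM i w).
  by rewrite ler_piMl// ger0_norm// indicE; case: (_ \in _).
rewrite -Ex_sum//; apply: Ex_ae => //; first by apply: L1_meas; apply: L1_sum => i _.
apply: (ae_imp mass_ae) => w m1; rewrite -[LHS]mulr1 -m1 mulr_sumr; apply: eq_bigr => i _.
rewrite indicE; have [/set_mem/Gg ->|] := boolP (w \in A i); first by rewrite mulrC.
by rewrite mulr0 mul0r.
Qed.

End Mixture.

(** * Conditioning on the selected controls *)

Section Subsampling.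
Context {R : realType} {d d' : measure_display} {Om : measurableType d} {E : measurableType d'}.
Variables (P : probability Om R) (X0 X1 : nat -> Om -> E) (delta : nat -> Om -> R).

Definition sample (w : Om) : seqspace E (nat + nat)%type :=
  fun i => match i with inl k => X0 k w | inr l => X1 l w end.

Hypotheses (mX0 : forall i, measurable_fun setT (X0 i)) (mX1 : forall i, measurable_fun setT (X1 i))
  (md : forall i, measurable_fun setT (delta i)) (mu : probability E R)
  (law0 : forall i, mpres P mu (X0 i)) (law1 : forall i, mpres P mu (X1 i))
  (indep : mutually_independent_classes P
     (fun c : (nat + nat) + nat => match c with
       | inl (inl i) => events_of (X0 i)
       | inl (inr j) => events_of (X1 j)
       | inr i => events_of (delta i) end)).

Lemma measurable_sample i : measurable_fun setT (fun w => sample w i).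
Proof. by case: i. Qed.

Let mpres_sample i : mpres P mu (fun w => sample w i).
Proof. by case: i. Qed.

Let joint (J : seq (nat + nat)) (K : seq nat) (B : nat + nat -> set E) (C : nat -> set R) :
  uniq J -> uniq K -> (forall i, measurable (B i)) -> (forall i, measurable (C i)) ->
  P ([set w | forall i, i \in K -> C i (delta i w)] `&` sample @^-1` box J B) =
  (\prod_(i <- K) P (delta i @^-1` C i) * \prod_(i <- J) mu (B i))%E.
Proof.
move=> uJ uK mB mC.
pose F (c : (nat + nat) + nat) : set Om := match c with
  | inl i => (fun w => sample w i) @^-1` B i | inr i => delta i @^-1` C i end.
pose L : seq ((nat + nat) + nat) := map inr K ++ map inl J.
have uL : uniq L.
  rewrite cat_uniq !map_inj_uniq ?uJ ?uK ?andbT//=; [|by move=> ? ? []|by move=> ? ? []].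
  by apply/hasPn => _ /mapP[i _ ->]; apply/negP => /mapP[].
have EL i : i \in L -> match i with
       | inl (inl i) => events_of (X0 i)
       | inl (inr j) => events_of (X1 j)
       | inr i => events_of (delta i) end (F i).
  by case: i => [[i|i]|i] _ /=; [exists (B (inl i))|exists (B (inr i))|exists (C i)] => //=; exact: mB.
have := indep uL EL; rewrite !big_cat !big_map/=.
rewrite (_ : P _ = P ([set w | forall i, i \in K -> C i (delta i w)] `&` sample @^-1` box J B)).
  move=> ->; congr (_ * _)%E; apply: eq_bigr => i _.
  by case: (mpres_sample i) => _ h; exact: (h (B i) (mB i)).
congr (P (_ `&` _)).
  by rewrite -bigcap_seq; apply/seteqP; split => w /= h i; exact: h.
by rewrite -bigcap_seq; apply/seteqP; split => w /= h i; exact: h.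
Qed.

Lemma sample_box J B : uniq J -> (forall i, measurable (B i)) ->
  P (sample @^-1` box J B) = (\prod_(i <- J) mu (B i))%E.
Proof.
move=> uJ mB; have := joint uJ (isT : uniq [::]) mB (fun=> measurableT).
by rewrite big_nil mul1e => <-; congr (P _); apply/seteqP; split => w //= [].
Qed.

Variables (Q : probability (seqspace E (nat + nat)%type) R).
Hypothesis (iQ : iid_law mu Q).

Lemma mpres_sample_law : mpres P Q sample.
Proof. by apply: (mpres_iid measurable_sample iQ); exact: sample_box. Qed.

Variables (n0 : nat) (t : R).
Hypotheses (d1 : forall i, P (delta i @^-1` [set 1]) = t%:E)
  (d0 : forall i, P (delta i @^-1` [set 0]) = (1 - t)%:E).

(** The indicators take values in 0 and 1 only almost surely, so these events exhaust [Omega] up to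
    a null set; [Ex_mixture] is stated accordingly. *)
Definition selected (D : {set 'I_n0}) : set Om := [set w | forall i : 'I_n0, delta i w = (i \in D)%:R].

Let selected_box (D : {set 'I_n0}) J B : uniq J -> (forall i, measurable (B i)) ->
  P (selected D `&` sample @^-1` box J B) = ((bweight t D)%:E * \prod_(i <- J) mu (B i))%E.
Proof.
move=> uJ mB; pose C (i : nat) : set R := [set ((i \in map val (enum D)))%:R].
have CE (i : 'I_n0) : C i = [set (i \in D)%:R].
  by rewrite /C mem_map ?mem_enum//; exact: val_inj.
have mC i : measurable (C i) by exact: measurable_set1.
have := joint uJ (iota_uniq 0 n0) mB mC.
rewrite (_ : [set w | _] = selected D); last first.
  apply/seteqP; split => w /= h i; last by rewrite mem_iota add0n => /= ik; have := h (Ordinal ik); rewrite -[i]/(val (Ordinal ik)) CE.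
  by have := h i; rewrite CE; apply; rewrite mem_iota/= add0n.
move=> ->; congr (_ * _)%E.
rewrite /bweight -prodEFin.
have -> : iota 0 n0 = index_iota 0 n0 by rewrite /index_iota subn0.
rewrite big_mkord; apply: eq_bigr => i _; rewrite CE.
by case: (i \in D); [exact: d1|exact: d0].
Qed.

Let measurable_selected D : measurable (selected D).
Proof.
rewrite (_ : selected D = \bigcap_(i in [set: 'I_n0]) (delta i @^-1` [set (i \in D)%:R])).
  apply: fin_bigcap_measurable => // i _; rewrite -[X in measurable X]setTI; exact: md.
by apply/seteqP; split => w h i; [move=> _|]; exact: h.
Qed.

Let selected_prob D : P (selected D) = (bweight t D)%:E.
Proof.
have := selected_box D (isT : uniq [::]) (fun=> measurableT); rewrite big_nil mule1 => <-.
by rewrite boxT preimage_setT setIT.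
Qed.

Lemma Ex_subsample (G : Om -> R) (g : {set 'I_n0} -> seqspace E (nat + nat)%type -> R) (M : R) :
  measurable_fun setT G -> (forall D, measurable_fun setT (g D)) ->
  (forall D x, `|g D x| <= M) -> (forall D w, selected D w -> G w = g D (sample w)) ->
  Ex P G = \sum_(D : {set 'I_n0}) bweight t D * Ex Q (g D).
Proof.
move=> mG mg gM Gg; have ms := measurable_seqspace measurable_sample.
rewrite (@Ex_mixture _ _ _ P _ selected measurable_selected _ _ G (fun D w => g D (sample w)) M) //.
- apply: eq_bigr => D _; rewrite (Ex_indic_mul iQ measurable_sample (measurable_selected D) _ (mg D) (gM D)) ?selected_prob//.
  by move=> J B uJ mB; rewrite selected_box// iQ// selected_prob.
- move=> D D' w h h'; apply/setP => i; have := h i; rewrite h' => /eqP.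
  by rewrite eqr_nat; case: (i \in D); case: (i \in D').
- by under eq_bigr do rewrite selected_prob/=; exact: sum_bweight.
- by move=> D; exact: (measurableT_comp (mg D) ms).
Qed.

End Subsampling.

(** * The subsampled statistic *)

Lemma measurable_sum_cond {R : realType} d (T : measurableType d) (I : Type) (s : seq I) (A : pred I)
    (F : I -> T -> R) : (forall i, measurable_fun setT (F i)) ->
  measurable_fun setT (fun x => \sum_(i <- s | A i) F i x).
Proof.
move=> mF; under eq_fun do rewrite big_mkcond.
by apply: measurable_sum => i; case: (A i).
Qed.

(** * The statistic under the null hypothesis *)

Section NullModel.
Context {R : realType} {d : measure_display} {Omega : measurableType d}.
Variables (P : probability Omega R) (p m0 m1 s : nat).
Local Notation E := (p.-tuple R).
Local Notation T := (seqspace E (nat + nat)%type).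
Variables (h : m0.-tuple E * m1.-tuple E -> R) (X0 X1 : nat -> Omega -> E)
  (n0 n1 : nat -> nat) (delta : nat -> nat -> Omega -> R).
Hypotheses (m00 : (0 < m0)%N) (m10 : (0 < m1)%N) (s1 : (1 < s)%N)
  (mh : measurable_fun setT h)
  (hsym : forall (x : m0.-tuple E) (y : m1.-tuple E) (sg : 'S_m0) (tau : 'S_m1),
    h ([tuple tnth x (sg k) | k < m0], [tuple tnth y (tau l) | l < m1]) = h (x, y))
  (mX0 : forall i, measurable_fun setT (X0 i)) (mX1 : forall i, measurable_fun setT (X1 i))
  (sn0 : forall k, (s * n1 k <= n0 k)%N)
  (md : forall k i, measurable_fun setT (delta k i))
  (dlaw : forall k i, P (delta k i @^-1` [set 1]) = ((s * n1 k)%:R / (n0 k)%:R)%:E /\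
               P (delta k i @^-1` [set 0]) = (1 - (s * n1 k)%:R / (n0 k)%:R)%:E)
  (indep : forall k, mutually_independent_classes P
     (fun c : (nat + nat) + nat => match c with
       | inl (inl i) => events_of (X0 i)
       | inl (inr j) => events_of (X1 j)
       | inr i => events_of (delta k i) end))
  (noo : ((n1 k)%:R : R) @[k --> \oo] --> +oo).
Variables (mu : probability E R) (Q : probability T R).
Hypotheses (law0 : forall i, mpres P mu (X0 i)) (law1 : forall i, mpres P mu (X1 i))
  (iQ : iid_law mu Q).
Local Notation Y := (sample X0 X1).
Local Notation H := (@ukernel R _ E m0 m1 h).

Lemma measurable_term d' (S : measurableType d') (f : 'I_m0 -> S -> E) (g : 'I_m1 -> S -> E) :
  (forall k, measurable_fun setT (f k)) -> (forall l, measurable_fun setT (g l)) ->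
  measurable_fun setT (fun x => h ([tuple f k x | k < m0], [tuple g l x | l < m1])).
Proof.
move=> mf mg; apply: (measurableT_comp mh); apply: measurable_fun_pair.
  apply/measurable_fun_tnthP => i; rewrite (_ : _ \o _ = f i)//.
  by apply/funext => x /=; rewrite tnth_mktuple.
apply/measurable_fun_tnthP => i; rewrite (_ : _ \o _ = g i)//.
by apply/funext => x /=; rewrite tnth_mktuple.
Qed.

Lemma measurable_ukernel : measurable_fun setT (H : T -> R).
Proof. by apply: measurable_term => i; exact: measurable_coord. Qed.

Let mpY : mpres P Q Y.

Proof. exact: (mpres_sample_law mX0 mX1 law0 law1 (@indep 0%N) iQ). Qed.

Definition upto a b (i : nat + nat) : bool := match i with inl k => (k < a)%N | inr l => (l < b)%N end.

(** The integration variable in [h_cond] plays the role of a second copy of the sample, spliced with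
    the observed values on the coordinates in [upto a b]. *)
Lemma h_condE a b w : h_cond P h X0 X1 a b (first_tuple m0 X0 w) (first_tuple m1 X1 w) =
  PS Q (upto a b) H (Y w).
Proof.
rewrite /PS (Ex_mp mpY); last first.
  exact: (measurableT_comp measurable_ukernel (measurable_mixr iQ _ _)).
rewrite /h_cond unlock /Ex /Rintegral; congr (fine (integral _ _ _)); apply/funext => w'.
congr (_%:E); rewrite /ukernel; congr (h (_, _)); apply: eq_from_tnth => k.
  by rewrite !tnth_mktuple.
by rewrite !tnth_mktuple.
Qed.

Hypotheses (Eh : ('E_P[fun w => h (first_tuple m0 X0 w, first_tuple m1 X1 w)] = 0)%E)
  (Eh2 : ('E_P[(fun w => h (first_tuple m0 X0 w, first_tuple m1 X1 w) ^+ 2)%R] < +oo)%E).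

Lemma Ex_ukernel : Ex Q H = 0.
Proof.
by rewrite (Ex_mp mpY measurable_ukernel) /Ex /Rintegral; move: Eh; rewrite unlock => ->.
Qed.

Lemma L2_ukernel : L2 Q H.
Proof.
have mHY : measurable_fun setT (fun w => H (Y w)) := meas_mp mpY measurable_ukernel.
apply: (mp_L2 mpY measurable_ukernel); split => //; apply/integrableP; split.
  by apply/measurable_EFinP; exact: measurable_sqr.
move: Eh2; rewrite unlock; apply: le_lt_trans; apply: ge0_le_integral => //.
- by do 2 apply: measurableT_comp => //; exact: measurable_sqr.
- by apply/measurable_EFinP; exact: measurable_sqr.
- by move=> w _ /=; rewrite lee_fin ger0_norm ?sqr_ge0.
Qed.

(** The projection has the mean of the kernel, which is 0, so its variance is its second moment. *)
Lemma xiE a b : xi P h X0 X1 a b = Ex Q (fun x => PS Q (upto a b) H x ^+ 2).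
Proof.
have lPS := PS_L2 iQ (upto a b) L2_ukernel; have mPS := L2_meas lPS.
rewrite /xi /variance unlock; under [fun w => h_cond _ _ _ _ _ _ _ _]eq_fun do rewrite h_condE.
have e0 : fine ('E_P[fun w => PS Q (upto a b) H (Y w)])%E = 0.
  transitivity (Ex P (fun w => PS Q (upto a b) H (Y w))); first by rewrite unlock.
  by rewrite -(Ex_mp mpY mPS) (Ex_PS iQ _ (L2_L1 L2_ukernel)) Ex_ukernel.
rewrite e0 (Ex_mp mpY (measurable_sqr mPS)) unlock /Ex /Rintegral.
congr (fine (integral _ _ _)); apply/funext => w; congr (_%:E) => /=.
transitivity ((PS Q (upto a b) H (Y w) - 0) * (PS Q (upto a b) H (Y w) - 0)); first by [].
by rewrite subr0 expr2.
Qed.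

Let lH := L2_ukernel.

Lemma xi01E : xi P h X0 X1 0 1 = Ex mu (fun z => G1 Q H (inr 0%N) z ^+ 2).
Proof.
rewrite xiE (Ex_G1_sqr iQ lH); apply: Ex_eq => x; congr (_ ^+ 2); apply: PS_eqS => -[k|l] //=.
by rewrite /sel1 ltnS leqn0.
Qed.

Lemma xi10E : xi P h X0 X1 1 0 = Ex mu (fun z => G1 Q H (inl 0%N) z ^+ 2).
Proof.
rewrite xiE (Ex_G1_sqr iQ lH); apply: Ex_eq => x; congr (_ ^+ 2); apply: PS_eqS => -[k|l] //=.
by rewrite /sel1 ltnS leqn0.
Qed.

Lemma xi02E : xi P h X0 X1 0 2 = Ex (mu \x mu)%E (fun z => G2 Q H (inr 0%N) (inr 1%N) z ^+ 2).
Proof.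
have ab : inr 0%N != inr 1%N :> nat + nat by [].
rewrite xiE (Ex_G2_sqr iQ lH ab); apply: Ex_eq => x; congr (_ ^+ 2).
by apply: PS_eqS; case=> [k|[|[|l]]].
Qed.

Lemma xi20E : xi P h X0 X1 2 0 = Ex (mu \x mu)%E (fun z => G2 Q H (inl 0%N) (inl 1%N) z ^+ 2).
Proof.
have ab : inl 0%N != inl 1%N :> nat + nat by [].
rewrite xiE (Ex_G2_sqr iQ lH ab); apply: Ex_eq => x; congr (_ ^+ 2).
by apply: PS_eqS; case=> [[|[|k]]|l].
Qed.

Lemma xi11E : xi P h X0 X1 1 1 = Ex (mu \x mu)%E (fun z => G2 Q H (inr 0%N) (inl 0%N) z ^+ 2).
Proof.
have ab : inr 0%N != inl 0%N :> nat + nat by [].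
rewrite xiE (Ex_G2_sqr iQ lH ab); apply: Ex_eq => x; congr (_ ^+ 2).
by apply: PS_eqS; case=> [[|k]|[|l]].
Qed.

Lemma xi_ge0 a b : 0 <= xi P h X0 X1 a b.
Proof. by rewrite xiE; exact: Ex_sqr_ge0. Qed.

(* [h_{a,b}] does not depend on indices beyond [m0], [m1] *)
Lemma xi_min a b a' b' : minn a m0 = minn a' m0 -> minn b m1 = minn b' m1 ->
  xi P h X0 X1 a b = xi P h X0 X1 a' b'.
Proof.
move=> aa bb; rewrite !xiE; apply: Ex_eq => x; congr (_ ^+ 2).
rewrite (PS_dep Q (upto a b) (@ukernel_dep _ _ _ _ _ h)) (PS_dep Q (upto a' b') (@ukernel_dep _ _ _ _ _ h)).
apply: PS_eqS => i; rewrite /=.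
case/boolP: (S0 m0 m1 i) => [/existsP[[k|l] /eqP <-]|]; rewrite ?andbF//= !andbT.
  by have := ltn_ord k; move: (val k) => u um; rewrite -[LHS]andbT -[RHS]andbT -{1 2}um -!leq_min aa.
by have := ltn_ord l; move: (val l) => u um; rewrite -[LHS]andbT -[RHS]andbT -{1 2}um -!leq_min bb.
Qed.

Lemma T_S_selected k (D : {set 'I_(n0 k)}) w : selected (delta k) D w ->
  T_S h X0 X1 s (n0 k) (n1 k) (delta k) w =
  ('C(s * n1 k, m0)%:R)^-1 * ('C(n1 k, m1)%:R)^-1 *
  \sum_(i : {ffun 'I_m0 -> 'I_(n0 k)} | incr_idx i && [forall k, i k \in D])
    \sum_(j : {ffun 'I_m1 -> 'I_(n1 k)} | incr_idx j) term h (Y w) i j.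
Proof.
move=> sel; rewrite /T_S; congr (_ * _); rewrite big_mkcondr/=; apply: eq_bigr => i _.
have -> : \prod_(k0 < m0) delta k (i k0) w = [forall k0, i k0 \in D]%:R.
  under eq_bigr do rewrite sel; case: forallP => [iD|iD].
    by rewrite big1// => k0 _; rewrite iD.
  apply/eqP; have /existsP[k0 hk] : [exists k0, i k0 \notin D].
    by rewrite -negb_forall; apply/forallP.
  by rewrite (bigD1 k0)//= (negbTE hk) mul0r.
by case: ifP => _; [apply: eq_bigr => j _; rewrite mul1r|rewrite big1// => j _; rewrite mul0r].
Qed.

Lemma measurable_T_S k : measurable_fun setT (T_S h X0 X1 s (n0 k) (n1 k) (delta k)).
Proof.
apply: measurable_funM => //; apply: measurable_sum_cond => i; apply: measurable_sum_cond => j.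
by apply: measurable_funM; [apply: measurable_prod => l _; exact: md|exact: measurable_term].
Qed.

Lemma T_S_cvg (c : nat -> R) (f : R -> R) (l : R) : cb f ->
  (forall N : nat -> nat, ((N k)%:R / (n1 k)%:R : R) @[k --> \oo] --> (s%:R : R) ->
    Ex Q (fun x => f ('C(N k, m0)%:R / 'C(s * n1 k, m0)%:R * (c k * Uavg (N k) (n1 k) H x)))
      @[k --> \oo] --> l) ->
  Ex P (fun w => f (c k * T_S h X0 X1 s (n0 k) (n1 k) (delta k) w)) @[k --> \oo] --> l.
Proof.
move=> cf hN; have mf := cb_meas cf; have [_ [M fM]] := cf.
pose a N k := Ex Q (fun x => f ('C(N, m0)%:R / 'C(s * n1 k, m0)%:R * (c k * Uavg N (n1 k) H x))).
have mU N k : measurable_fun setT (Uavg N (n1 k) H : T -> R) := L2_meas (L2_Uavg iQ N (n1 k) lH).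
have aM N k : `|a N k| <= M.
  apply: Ex_le_bdd => //; apply: (L1_bdd Q _ (fun=> fM _)).
  by apply: (measurableT_comp mf); do 2 apply: measurable_funM => //.
have := bweight_limit sn0 (ltnW s1) noo aM hN; apply: cvg_trans; apply: near_eq_cvg; near=> k.
(* The mixture identity is needed only eventually, when there are enough cases for ['C(n1 k, m1)] to
   be nonzero. *)
have m1n : (m1 <= n1 k)%N by near: k; move/cvgryPge: noo => /(_ m1%:R); apply: filterS => k; rewrite ler_nat.
pose z : R := ('C(s * n1 k, m0)%:R)^-1 * ('C(n1 k, m1)%:R)^-1.
pose g (D : {set 'I_(n0 k)}) (x : T) := f (c k * (z *
  \sum_(i : {ffun 'I_m0 -> 'I_(n0 k)} | incr_idx i && [forall k, i k \in D])
    \sum_(j : {ffun 'I_m1 -> 'I_(n1 k)} | incr_idx j) term h x i j)).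
rewrite (Ex_subsample mX0 mX1 (md k) law0 law1 (@indep k) iQ (fun i => (dlaw k i).1) (fun i => (dlaw k i).2)
  (g := g) (M := M)).
- apply: eq_bigr => D _; congr (_ * _).
  have mfz : measurable_fun setT (fun y => f (c k * (z * y))).
    by apply: (measurableT_comp mf); do 2 apply: measurable_funM => //.
  rewrite /g (Ex_sum_term_subset iQ hsym D mfz m00 m1n lH); apply: Ex_eq => x; congr f.
  rewrite /z; have C0 : 'C(n1 k, m1)%:R != 0 :> R by rewrite pnatr_eq0 -lt0n bin_gt0.
  rewrite mulrCA; move: ('C(s * n1 k, m0)%:R^-1 : R) ('C(n1 k, m1)%:R : R) ('C(#|D|, m0)%:R : R) (c k) C0.
  by move: (Uavg _ _ _ _) => U u v v' c' v0; field.
- by apply: (measurableT_comp mf); apply: measurable_funM => //; exact: measurable_T_S.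
- move=> D; apply: (measurableT_comp mf); do 2 apply: measurable_funM => //.
  apply: measurable_sum_cond => i; apply: measurable_sum_cond => j; apply: measurable_term => q; exact: measurable_coord.
- by move=> D x; exact: fM.
- by move=> D w sel; rewrite /g (T_S_selected sel).
Unshelve. all: by end_near. Qed.

Lemma T_S_cvg_in_distribution (c : nat -> R) (nu : probability (measurableTypeR R) R) :
  (forall f, cb f -> Ex P (fun w => f (c k * T_S h X0 X1 s (n0 k) (n1 k) (delta k) w)) @[k --> \oo] --> Ex nu f) ->
  cvg_in_distribution P (fun k w => c k * T_S h X0 X1 s (n0 k) (n1 k) (delta k) w) nu.
Proof.
move=> hc f ff fM; have cf : cb f by split.
have mf := cb_meas cf; have [M bM] := fM.
have lf k : L1 P (fun w => f (c k * T_S h X0 X1 s (n0 k) (n1 k) (delta k) w)).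
  apply: (L1_bdd P _ (fun=> bM _)); apply: (measurableT_comp mf).
  by apply: measurable_funM => //; exact: measurable_T_S.
rewrite (Ex_EFin (L1_bdd nu mf bM)).
rewrite (_ : (fun k => _) = fun k => (Ex P (fun w => f (c k * T_S h X0 X1 s (n0 k) (n1 k) (delta k) w)))%:E).
  by apply: cvg_EFin; [exact: nearW|exact: hc].
by apply/funext => k; rewrite unlock/= -(Ex_EFin (lf k)).
Qed.

(** The image of [Q] under restriction to the left coordinates, that is, the law of the controls
    alone. *)
Let Q1_ex : exists Q1 : probability (seqspace E nat) R, iid_law mu Q1.
Proof.
have mpi : measurable_fun setT (fun x : T => x \o inl : seqspace E nat).
  by apply: measurable_seqspace => i; exact: measurable_coord.
have [Q1 [_ hQ1]] := law_exists Q mpi; exists Q1 => J B uJ mB.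
apply: etrans (esym (hQ1 _ (measurable_box uJ mB))) _.
pose B' (i : nat + nat) := match i with inl k => B k | inr _ => setT end.
rewrite (_ : _ @^-1` _ = box (map inl J) B').
  rewrite iQ; first by rewrite big_map.
    by rewrite map_inj_uniq// => ? ? [].
  by case=> [k|k] //=; exact: mB.
apply/seteqP; split => x /= hx i; first by move=> /mapP[k kJ ->]; exact: hx.
by move=> iJ; apply: (hx (inl i)); rewrite map_f.
Qed.

Lemma gaussian_limit : 0 < xi P h X0 X1 0 1 \/ 0 < xi P h X0 X1 1 0 ->
  cvg_in_distribution P
     (fun k w => Num.sqrt (n1 k)%:R * T_S h X0 X1 s (n0 k) (n1 k) (delta k) w)
     (normal_prob 0 (Num.sqrt ((m1 ^ 2)%:R * xi P h X0 X1 0 1 +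
                               (m0 ^ 2)%:R * xi P h X0 X1 1 0 / s%:R))).
Proof.
move=> xi0; have [Q1 iQ1] := Q1_ex; apply: T_S_cvg_in_distribution => f cf; apply: T_S_cvg => // N Ns.
apply: (U_gaussian_limit iQ iQ1 m00 m10 lH (ukernel_dep h) (ukernel_sym hsym) s1 Ex_ukernel noo Ns cf).
  by rewrite xi01E xi10E.
have s0 : 0 < s%:R :> R by rewrite ltr0n ltnW.
have sq m : (0 < m)%N -> 0 < (m ^ 2)%:R :> R by move=> mm; rewrite ltr0n expn_gt0 mm.
case: xi0 => x0.
  by rewrite ltr_pwDl ?mulr_gt0 ?sq// divr_ge0 ?mulr_ge0 ?xi_ge0// ltW.
by rewrite ltr_pwDr ?divr_gt0 ?mulr_gt0 ?sq// mulr_ge0 ?xi_ge0.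
Qed.

Lemma degenerate_limit : xi P h X0 X1 1 0 = 0 -> xi P h X0 X1 0 1 = 0 ->
   (0 < xi P h X0 X1 0 2 \/ 0 < xi P h X0 X1 2 0 \/ 0 < xi P h X0 X1 1 1) ->
   exists nu : probability (measurableTypeR R) R,
     (forall c : R, nu [set c] < 1)%E /\
     nu.-integrable setT (fun x => x%:E) /\
     (\int[nu]_x x%:E = 0)%E /\
     (\int[nu]_x (x ^+ 2)%:E =
        ((m1 ^ 2 * (m1 - 1) ^ 2)%:R * xi P h X0 X1 0 2 / 2
         + (m1 ^ 2 * m0 ^ 2)%:R * xi P h X0 X1 1 1 / s%:R
         + (m0 ^ 2 * (m0 - 1) ^ 2)%:R * xi P h X0 X1 2 0 / (2 * s%:R ^+ 2))%:E)%E /\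
     cvg_in_distribution P
       (fun k w => (n1 k)%:R * T_S h X0 X1 s (n0 k) (n1 k) (delta k) w) nu.
Proof.
move=> x10 x01 xpos; pose V : R := (m1 ^ 2 * (m1 - 1) ^ 2)%:R * xi P h X0 X1 0 2 / 2
  + (m1 ^ 2 * m0 ^ 2)%:R * xi P h X0 X1 1 1 / s%:R
  + (m0 ^ 2 * (m0 - 1) ^ 2)%:R * xi P h X0 X1 2 0 / (2 * s%:R ^+ 2).
have [Q1 iQ1] := Q1_ex.
have s0 : 0 < s%:R :> R by rewrite ltr0n ltnW.
have E0 : Ex mu (fun z => G1 Q H (inl 0%N) z ^+ 2) = 0 by rewrite -xi10E.
have E1 : Ex mu (fun z => G1 Q H (inr 0%N) z ^+ 2) = 0 by rewrite -xi01E.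
have l2 a b : a != b -> L1 (mu \x mu)%E (fun z => G2 Q H a b z ^+ 2).
  by move=> ab; exact: (L2_sqr (L2_G2 iQ lH ab)).
have natB m : (0 < m)%N -> (m - 1)%:R = m%:R - 1 :> R by move=> mm; rewrite natrB.
have VE : V = Ex (mu \x mu)%E (fun z => wq Q m0 m1 H s true true z ^+ 2) / 2 +
      s%:R * Ex (mu \x mu)%E (fun z => wq Q m0 m1 H s true false z ^+ 2) +
      s%:R ^+ 2 / 2 * Ex (mu \x mu)%E (fun z => wq Q m0 m1 H s false false z ^+ 2).
  have -> : Ex (mu \x mu)%E (fun z => wq Q m0 m1 H s true true z ^+ 2) = (m1%:R * (m1%:R - 1)) ^+ 2 * xi P h X0 X1 0 2.
    by rewrite xi02E -ExZ; [apply: Ex_eq => z; rewrite /wq exprMn|exact: l2].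
  have -> : Ex (mu \x mu)%E (fun z => wq Q m0 m1 H s true false z ^+ 2) = (m0%:R * m1%:R / s%:R) ^+ 2 * xi P h X0 X1 1 1.
    by rewrite xi11E -ExZ; [apply: Ex_eq => z; rewrite /wq exprMn|exact: l2].
  have -> : Ex (mu \x mu)%E (fun z => wq Q m0 m1 H s false false z ^+ 2) =
      (m0%:R * (m0%:R - 1) / s%:R ^+ 2) ^+ 2 * xi P h X0 X1 2 0.
    by rewrite xi20E -ExZ; [apply: Ex_eq => z; rewrite /wq exprMn|exact: l2].
  rewrite /V.
  rewrite (natrM R (m1 ^ 2) ((m1 - 1) ^ 2)) (natrM R (m1 ^ 2) (m0 ^ 2)) (natrM R (m0 ^ 2) ((m0 - 1) ^ 2)).
  rewrite !natrX !natB//; move: (xi P _ _ _ _ _) (xi P _ _ _ _ _) (xi P _ _ _ _ _) => u v w.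
  move: (m0%:R) (m1%:R) (s%:R) s0 => a b c c0; field; by rewrite gt_eqF.
have V0 : V != 0.
  have sq m : (0 < m)%N -> 0 < (m ^ 2)%:R :> R by move=> mm; rewrite ltr0n expn_gt0 mm.
  have t1 : 0 <= (m1 ^ 2 * (m1 - 1) ^ 2)%:R * xi P h X0 X1 0 2 / 2 by rewrite divr_ge0 ?mulr_ge0 ?xi_ge0.
  have t2 : 0 <= (m1 ^ 2 * m0 ^ 2)%:R * xi P h X0 X1 1 1 / s%:R by rewrite divr_ge0 ?mulr_ge0 ?xi_ge0.
  have t3 : 0 <= (m0 ^ 2 * (m0 - 1) ^ 2)%:R * xi P h X0 X1 2 0 / (2 * s%:R ^+ 2).
    by rewrite divr_ge0 ?mulr_ge0 ?xi_ge0// sqr_ge0.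
  have big m : (m != 1)%N -> (0 < m)%N -> 0 < (m ^ 2 * (m - 1) ^ 2)%:R :> R.
    by case: m => [|[|m]]// _ _; rewrite ltr0n muln_gt0 !expn_gt0 subn_gt0.
  rewrite gt_eqF// /V; case: xpos => [x|[x|x]].
  (* With a single case argument [xi 0 2] would coincide with [xi 0 1], which is 0; hence
     [(m1 - 1) ^ 2] is positive and the variance does not vanish. *)
  - have m1' : (m1 != 1)%N.
      by apply/eqP => m1E; move: x; rewrite (@xi_min 0 2 0 1) ?m1E// x01 ltxx.
    by rewrite -addrA ltr_pwDl ?addr_ge0// divr_gt0// mulr_gt0// big.
  - have m0' : (m0 != 1)%N.
      by apply/eqP => m0E; move: x; rewrite (@xi_min 2 0 1 0) ?m0E// x10 ltxx.
    by rewrite ltr_pwDr ?addr_ge0// divr_gt0 ?mulr_gt0 ?big ?exprn_gt0.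
  - rewrite ltr_pwDl// ltr_pwDr// divr_gt0// mulr_gt0//.
    by rewrite ltr0n muln_gt0 !expn_gt0 m00 m10.
have [nu [l2nu Enu E2nu nd lim]] := chaos_limit_law iQ iQ1 m00 m10 lH (ukernel_dep h) (ukernel_sym hsym) Ex_ukernel E0 E1 VE.
exists nu; split; first exact: nd V0.
split; first exact: (L2_L1 l2nu).
split; first by rewrite (Ex_EFin (L2_L1 l2nu)) Enu.
split; first by rewrite (Ex_EFin (L2_sqr l2nu)) E2nu.
apply: T_S_cvg_in_distribution => f cf; apply: T_S_cvg => // N Ns.
exact: (U_chaos_limit iQ iQ1 m00 m10 lH (ukernel_dep h) (ukernel_sym hsym) s1 Ex_ukernel E0 E1 noo Ns cf (lim f cf)).
Qed.

End NullModel.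

Theorem theorem3 (R : realType) (d : measure_display) (Omega : measurableType d)
  (P : probability Omega R) (p m0 m1 s : nat)
  (h : m0.-tuple (p.-tuple R) * m1.-tuple (p.-tuple R) -> R)
  (X0 X1 : nat -> Omega -> p.-tuple R)
  (n0 n1 : nat -> nat) (delta : nat -> nat -> Omega -> R) :
  (1 <= m0)%N -> (1 <= m1)%N -> (2 <= s)%N ->
  (* the kernel: measurable, symmetric in each group, mean zero, finite second moment *)
  measurable_fun setT h ->
  (forall (x : m0.-tuple (p.-tuple R)) (y : m1.-tuple (p.-tuple R))
          (sg : 'S_m0) (tau : 'S_m1),
      h ([tuple tnth x (sg k) | k < m0], [tuple tnth y (tau l) | l < m1]) = h (x, y)) ->
  ('E_P[fun w => h (first_tuple m0 X0 w, first_tuple m1 X1 w)] = 0)%E ->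
  ('E_P[(fun w => h (first_tuple m0 X0 w, first_tuple m1 X1 w) ^+ 2)%R] < +oo)%E ->
  (* observations: measurable, and (null hypothesis) all with the same law *)
  (forall i, measurable_fun setT (X0 i)) -> (forall j, measurable_fun setT (X1 j)) ->
  (forall i (B : set (p.-tuple R)), measurable B ->
      P (X0 i @^-1` B) = P (X0 0%N @^-1` B) /\ P (X1 i @^-1` B) = P (X0 0%N @^-1` B)) ->
  (* subsampling indicators: Bernoulli(s n1 / n0) *)
  (forall k, (s * n1 k <= n0 k)%N) ->
  (forall k i, measurable_fun setT (delta k i)) ->
  (forall k i, P (delta k i @^-1` [set 1]) = ((s * n1 k)%:R / (n0 k)%:R)%:E /\
               P (delta k i @^-1` [set 0]) = (1 - (s * n1 k)%:R / (n0 k)%:R)%:E) ->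
  (* for each k, the X^(0)'s, X^(1)'s and delta's are mutually independent *)
  (forall k, mutually_independent_classes P
     (fun c : (nat + nat) + nat => match c with
       | inl (inl i) => events_of (X0 i)
       | inl (inr j) => events_of (X1 j)
       | inr i => events_of (delta k i) end)) ->
  (* asymptotic regime: n1 -> oo, n1 / n -> 0 with n = n0 + n1 *)
  (((n1 k)%:R : R) @[k --> \oo] --> +oo) ->
  ((n1 k)%:R / (n0 k + n1 k)%:R @[k --> \oo] --> (0 : R)) ->
  (* part (1) *)
  ((0 < xi P h X0 X1 0 1 \/ 0 < xi P h X0 X1 1 0) ->
   ('E_P[(fun w => h_cond P h X0 X1 1 0 (first_tuple m0 X0 w) (first_tuple m1 X1 w) ^+ 4)%R]
      < +oo)%E ->
   cvg_in_distribution P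
     (fun k w => Num.sqrt (n1 k)%:R * T_S h X0 X1 s (n0 k) (n1 k) (delta k) w)
     (normal_prob 0 (Num.sqrt ((m1 ^ 2)%:R * xi P h X0 X1 0 1 +
                               (m0 ^ 2)%:R * xi P h X0 X1 1 0 / s%:R))))
  /\
  (* part (2) *)
  (xi P h X0 X1 1 0 = 0 -> xi P h X0 X1 0 1 = 0 ->
   (0 < xi P h X0 X1 0 2 \/ 0 < xi P h X0 X1 2 0 \/ 0 < xi P h X0 X1 1 1) ->
   exists nu : probability (measurableTypeR R) R,
     (forall c : R, nu [set c] < 1)%E /\
     nu.-integrable setT (fun x => x%:E) /\
     (\int[nu]_x x%:E = 0)%E /\
     (\int[nu]_x (x ^+ 2)%:E =
        ((m1 ^ 2 * (m1 - 1) ^ 2)%:R * xi P h X0 X1 0 2 / 2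
         + (m1 ^ 2 * m0 ^ 2)%:R * xi P h X0 X1 1 1 / s%:R
         + (m0 ^ 2 * (m0 - 1) ^ 2)%:R * xi P h X0 X1 2 0 / (2 * s%:R ^+ 2))%:E)%E /\
     cvg_in_distribution P
       (fun k w => (n1 k)%:R * T_S h X0 X1 s (n0 k) (n1 k) (delta k) w) nu).
Proof.
move=> m00 m10 s1 mh hsym Eh Eh2 mX0 mX1 law sn0 md dlaw indep noo _.
(* By the null hypothesis the law of the first control is the common law of all controls and
   cases. *)
have [mu hmu] := law_exists P (mX0 0%N); have [_ mu0] := hmu.
have law0 i : mpres P mu (X0 i) by split => // B mB; rewrite (law i B mB).1 mu0.
have law1 i : mpres P mu (X1 i) by split => // B mB; rewrite (law i B mB).2 mu0.
have mY := measurable_seqspace (measurable_sample mX0 mX1).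
have [Q [_ hQ]] := law_exists P mY.
have iQ : iid_law mu Q.
  move=> J B uJ mB; apply: etrans (esym (hQ _ (measurable_box uJ mB))) _.
  exact: (sample_box law0 law1 (indep 0%N)).
split=> [xi0 _|x10 x01 xpos].
  exact: (gaussian_limit m00 m10 s1 mh hsym mX0 mX1 sn0 md dlaw indep noo law0 law1 iQ Eh Eh2 xi0).
exact: (degenerate_limit m00 m10 s1 mh hsym mX0 mX1 sn0 md dlaw indep noo law0 law1 iQ Eh Eh2 x10 x01 xpos).
Qed.
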